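(* Let $0<\varepsilon\ll1$, and let $\Omega$ and $\Omega_0$ be bounded Lipschitz domains in $\mathbb{R}^d$ with $\overline\Omega\subset\Omega_0$ and $\mathrm{dist}(x,\Omega)\sim10\varepsilon$ for $x\in\partial\Omega_0$. Suppose $\omega$ satisfies the geometric hypotheses stated in the context, and $\Omega_\varepsilon=\Omega\cap(\varepsilon\omega)$. Let $\delta(x)=\mathrm{dist}(x,\partial\Omega_0)$. Then there exists an extension operator $$\Lambda_\varepsilon:H^1(\Omega_\varepsilon,\Gamma_\varepsilon;\mathbb{R}^d)\to H_0^1(\Omega_0;\mathbb{R}^d)$$ such that $\Lambda_\varepsilon(w)=w$ a.e. on $\Omega_\varepsilon$, with the trace of $\Lambda_\varepsilon(w)$ vanishing on $\partial\Omega_0$. Moreover, for $-1<\beta<1$, $$\int_{\Omega_0}|\nabla\Lambda_\varepsilon(w)|^2\delta^\beta dx\le C\int_{\Omega_\varepsilon}|\nabla w|^2\delta^\beta dx,$$ where $C$ depends on $d$, $\mathfrak{g}^\omega$ and the characters of $\Omega$ and $\omega$, but is independent of $\varepsilon$ and $r_0$.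
   Context: $d\ge2$; $Y=[-1/2,1/2)^d$; ''$0<\varepsilon\ll1$'' means $0<\varepsilon\le\varepsilon_0$ for a sufficiently small $\varepsilon_0\in(0,1)$. Geometric hypotheses on $\omega$: $\omega\subset\mathbb{R}^d$ is an unbounded Lipschitz domain with 1-periodic structure ($\omega+z=\omega$ for $z\in\mathbb{Z}^d$); $\omega$ is connected; $\omega\cap Y$ is a Lipschitz domain; $\mathbb{R}^d\setminus\omega=\bigcup_{k\ge1}H_k$ with each $H_k$ connected and bounded, and there is a constant $\mathfrak{g}^\omega$ with $0<\mathfrak{g}^\omega\le\inf_{i\ne j}\mathrm{dist}(H_i,H_j)$. $\varepsilon\omega=\{x:x/\varepsilon\in\omega\}$, $\Gamma_\varepsilon=\partial\Omega_\varepsilon\cap\partial\Omega$; $H^1(\Omega_\varepsilon,\Gamma_\varepsilon;\mathbb{R}^d)$ is the closure in $H^1(\Omega_\varepsilon;\mathbb{R}^d)$ of smooth vector-valued functions vanishing on $\Gamma_\varepsilon$. $\mathrm{dist}(x,\Omega)\sim10\varepsilon$ means it is bounded above and below by fixed positive multiples of $10\varepsilon$, independent of $\varepsilon$. $r_0$ is the diameter of $\Omega$; the ''character'' of a domain is the Lipschitz bound of the functions whose graphs locally describe its boundary.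
   Formalization: C may depend, besides the Lipschitz bound of ω, on the radius of the balls in which ∂ω is a Lipschitz graph; with the bound alone the claim fails (annular holes with a gap of width η→0). The smallness threshold ε0 for ε may depend on ω and Ω. *)

(* Defs.v *)
From HB Require Import structures.
From mathcomp Require Import all_boot all_order all_algebra.
From mathcomp Require Import all_classical all_reals all_analysis.

Set Implicit Arguments.
Unset Strict Implicit.
Unset Printing Implicit Defensive.

Import Order.TTheory GRing.Theory Num.Theory.
Import numFieldNormedType.Exports.

Local Open Scope classical_set_scope.
Local Open Scope ring_scope.

(* The sigma-algebra generated by the coordinates, i.e. the Borel one. *)
Section measurable_rV.
Context {R : realType} {n : nat}.

Let coor (i : 'I_n) (x : 'rV[R]_n) : R := x 0 i.

Let rV_set0 : g_sigma_preimage coor set0.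
Proof. exact: sigma_algebra0. Qed.

Let rV_setC A : g_sigma_preimage coor A -> g_sigma_preimage coor (~` A).
Proof. exact: sigma_algebraC. Qed.

Let rV_bigcup (F : (set 'rV[R]_n)^nat) :
  (forall i, g_sigma_preimage coor (F i)) ->
  g_sigma_preimage coor (\bigcup_i (F i)).
Proof. exact: sigma_algebra_bigcup. Qed.

HB.instance Definition _ := @isMeasurable.Build default_measure_display
  'rV[R]_n (g_sigma_preimage coor) rV_set0 rV_setC rV_bigcup.

Lemma measurable_coor (i : 'I_n) :
  measurable_fun [set: 'rV[R]_n] (fun x => x 0 i).
Proof.
move=> _ Y mY; rewrite setTI; apply: sub_sigma_algebra => /=.
rewrite -bigcup_seq/=; exists i => /=; first by rewrite mem_index_enum.
by exists Y => //; rewrite setTI.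
Qed.

Lemma measurable_fun_rV d (T : measurableType d) (f : T -> 'rV[R]_n) :
  (forall i, measurable_fun [set: T] (fun x => f x 0 i)) ->
  measurable_fun [set: T] f.
Proof.
move=> mf; suff H : g_sigma_preimage (fun i => coor i \o f) `<=` measurable.
  move=> _ A mA; apply: H; rewrite g_sigma_preimage_comp; by exists A.
apply: smallest_sub; first exact: sigma_algebra_measurable.
rewrite -bigcup_seq; apply: bigcup_sub => i Ii A [B mB <-]; exact: mf.
Qed.

End measurable_rV.

Section lebesgue_rV.
Context (R : realType).

Definition rV_cons n (p : measurableTypeR R * 'rV[R]_n) : 'rV[R]_n.+1 :=
  row_mx (p.1 : R)%:M p.2.

Definition rV_uncons n (x : 'rV[R]_n.+1) : measurableTypeR R * 'rV[R]_n :=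
  (lsubmx (x : 'rV_(1 + n)) 0 0, rsubmx (x : 'rV_(1 + n))).

Lemma rV_consK n : cancel (@rV_cons n) (@rV_uncons n).
Proof.
by case=> a x; rewrite /rV_uncons /rV_cons row_mxKl row_mxKr mxE eqxx mulr1n.
Qed.

Lemma measurable_rV_cons n : measurable_fun setT (@rV_cons n).
Proof.
apply: measurable_fun_rV => i.
case: (@split_ordP 1 n i) => j ->.
- rewrite (_ : (fun _ => _) = fst); first exact: measurable_fst.
  apply/funext => p; apply: (etrans (row_mxEl (p.1 : R)%:M p.2 0 j)).
  by rewrite mxE !ord1 eqxx mulr1n.
- rewrite (_ : (fun _ => _) = (fun x : 'rV[R]_n => x 0 j) \o snd).
    exact: (measurableT_comp (measurable_coor j) measurable_snd).
  by apply/funext => p; exact: (row_mxEr (p.1 : R)%:M p.2 0 j).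
Qed.

Lemma measurable_rV_uncons n : measurable_fun setT (@rV_uncons n).
Proof.
apply/measurable_fun_pairP; split.
- rewrite (_ : _ \o _ = fun x : 'rV[R]_n.+1 => (x : 'rV_(1 + n)) 0 (lshift n 0)).
    exact: measurable_coor.
  by apply/funext => x; rewrite /= mxE.
- apply: measurable_fun_rV => i.
  rewrite (_ : (fun _ => _) = fun x : 'rV[R]_n.+1 => (x : 'rV_(1 + n)) 0 (rshift 1 i)).
    exact: measurable_coor.
  by apply/funext => x; rewrite /= mxE.
Qed.

Section lebesgue_cons.
Variables (n : nat) (m : {sigma_finite_measure set 'rV[R]_n -> \bar R}).

Definition lebesgue_cons : set 'rV[R]_n.+1 -> \bar R :=
  pushforward (@lebesgue_measure R \x m)%E (@rV_cons n).

Let mu0 : lebesgue_cons set0 = 0%E.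
Proof. by rewrite /lebesgue_cons /pushforward preimage_set0 measure0. Qed.

Let mu_ge0 A : (0 <= lebesgue_cons A)%E.
Proof. by rewrite /lebesgue_cons /pushforward measure_ge0. Qed.

Let mu_sigma_additive : semi_sigma_additive lebesgue_cons.
Proof.
move=> F mF tF mUF; rewrite /lebesgue_cons /pushforward preimage_bigcup.
apply: measure_semi_sigma_additive.
- by move=> k; rewrite -[X in measurable X]setTI; exact: measurable_rV_cons.
- apply/trivIsetP => i j _ _ ij; rewrite -preimage_setI.
  by move/trivIsetP : tF => -> //; rewrite preimage_set0.
- rewrite -preimage_bigcup -[X in measurable X]setTI.
  exact: measurable_rV_cons.
Qed.

HB.instance Definition _ := isMeasure.Build _ _ _ lebesgue_cons
  mu0 mu_ge0 mu_sigma_additive.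

Let lebesgue_cons_sigma_finite : sigma_finite setT lebesgue_cons.
Proof.
have /sigma_finiteP[F [FT ndF Foo]] := sigma_finiteT (@lebesgue_measure R).
have /sigma_finiteP[G [GT ndG Goo]] := sigma_finiteT m.
exists (fun k => @rV_uncons n @^-1` (F k `*` G k)).
  rewrite -preimage_bigcup (_ : \bigcup_k _ = setT) ?preimage_setT//.
  apply/seteqP; split=> // -[a x] _.
  have [i _ Fi] : (\bigcup_k F k) a by rewrite -FT.
  have [j _ Gj] : (\bigcup_k G k) x by rewrite -GT.
  exists (maxn i j) => //; split => /=.
  - by move: Fi; exact/subsetPset/ndF/leq_maxl.
  - by move: Gj; exact/subsetPset/ndG/leq_maxr.
move=> k; have [mF Fk] := Foo k; have [mG Gk] := Goo k; split.
  by rewrite -[X in measurable X]setTI; apply: measurable_rV_uncons => //;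
    exact: measurableX.
rewrite /lebesgue_cons /pushforward -comp_preimage.
rewrite (_ : _ \o _ = id); last by apply/funext => p; exact: rV_consK.
by rewrite preimage_id product_measure1E// lte_mul_pinfty// ge0_fin_numE.
Qed.

HB.instance Definition _ := Measure_isSigmaFinite.Build _ _ _ lebesgue_cons
  lebesgue_cons_sigma_finite.

End lebesgue_cons.

Fixpoint lebesgue_rV n : {sigma_finite_measure set 'rV[R]_n -> \bar R} :=
  match n with
  | 0 => \d_(0 : 'rV[R]_0)
  | n.+1 => lebesgue_cons (lebesgue_rV n)
  end.

End lebesgue_rV.

(* The library norm of 'rV[R]_d is the sup norm, hence the definitions below
   (the topology is the same). *)
Section euclid.
Context (R : realType) (d : nat).
Implicit Types (A B U : set 'rV[R]_d) (x y : 'rV[R]_d).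

Definition dot x y : R := \sum_i x 0 i * y 0 i.

(* Squared Euclidean (Frobenius) norm of a vector or matrix. *)
Definition sqn m n (M : 'M[R]_(m, n)) : R := \sum_i \sum_j M i j ^+ 2.

Definition enorm x : R := Num.sqrt (sqn x).

Definition eball x (r : R) : set 'rV[R]_d := [set y | enorm (y - x) < r].

Definition pt_dist x A : R := inf [set enorm (x - y) | y in A].

(* dist(A, B), equal to +oo if A or B is empty. *)
Definition set_dist A B : \bar R :=
  ereal_inf [set (enorm (p.1 - p.2))%:E | p in A `*` B].

Definition bnd A : set 'rV[R]_d := closure A `\` A°.

(* In B(x0, r), U is the part of R^d above the graph of a function psi defined
   on the hyperplane orthogonal to the unit vector nu, with Lipschitz bound L;
   the values of psi off this hyperplane play no role. *)
Definition lipschitz_graph_at (r L : R) U x0 : Prop :=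
  exists nu (psi : 'rV[R]_d -> R),
  [/\ enorm nu = 1,
      forall y z, dot y nu = 0 -> dot z nu = 0 ->
        `|psi y - psi z| <= L * enorm (y - z)
    & forall x, eball x0 r x ->
        (U x <-> psi (x - dot x nu *: nu) < dot x nu)].

(* Lipschitz domain whose character is bounded by L, the local graphs being
   available in all balls of radius r centered on the boundary. *)
Definition lipschitz_domain (r L : R) U : Prop :=
  [/\ open U, connected U, U !=set0
    & forall x0, bnd U x0 -> lipschitz_graph_at r L U x0].

Definition bounded_lipschitz_domain (L : R) U : Prop :=
  bounded_set U /\ exists2 r : R, 0 < r & lipschitz_domain r L U.

Definition scale_set (e : R) A : set 'rV[R]_d := [set x | A (e^-1 *: x)].

Definition periodic_set A : Prop :=
  forall z : 'rV[int]_d, [set x + map_mx intr z | x in A] = A.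

Definition unit_cell : set 'rV[R]_d :=
  [set x | forall i, - 2^-1 <= x 0 i < 2^-1].

(* As Y is half-open, the Lipschitz domain meant by "omega `&` Y" is its
   interior. *)
Definition perforated_structure (r L g : R) (omega : set 'rV[R]_d) : Prop :=
  [/\ lipschitz_domain r L omega, ~ bounded_set omega, periodic_set omega,
      exists r' L' : R, 0 < r' /\
        lipschitz_domain r' L' (omega `&` unit_cell)°
    & exists H : nat -> set 'rV[R]_d,
        [/\ ~` omega = \bigcup_k H k,
            forall k, connected (H k) /\ bounded_set (H k)
          & (g%:E <= ereal_inf [set set_dist (H p.1) (H p.2)
                               | p in [set p : nat * nat | p.1 != p.2]])%E]].

End euclid.

Section sobolev.
Context (R : realType) (d : nat).
Local Notation Rd := 'rV[R]_d.
Local Notation mu := (@lebesgue_rV R d).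
Implicit Types (U G : set Rd) (f : Rd -> R) (w : Rd -> Rd).

Definition partial (j : 'I_d) f : Rd -> R := fun x => 'D_(delta_mx 0 j) f x.

(* C^oo on R^d: all iterated partial derivatives are differentiable. *)
Definition smooth f : Prop :=
  forall (s : seq 'I_d) (x : Rd), differentiable (foldr partial f s) x.

Definition smooth_vec w : Prop := forall i, smooth (fun x => w x 0 i).

(* C^oo_c(U) *)
Definition test_fun U f : Prop :=
  let supp := closure [set x | f x != 0] in
  [/\ smooth f, compact supp & supp `<=` U].

(* The classical gradient, with entries (i, j) |-> partial_j w_i. *)
Definition grad w (x : Rd) : 'M[R]_d :=
  \matrix_(i, j) partial j (fun y => w y 0 i) x.

Definition L2 U m n (F : Rd -> 'M[R]_(m, n)) : Prop :=
  (forall i j, measurable_fun U (fun x => F x i j)) /\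
  (\int[mu]_(x in U) (sqn (F x))%:E < +oo)%E.

Definition weak_grad U w (Dw : Rd -> 'M[R]_d) : Prop :=
  forall f, test_fun U f -> forall i j,
    \int[mu]_(x in U) (w x 0 i * partial j f x)
    = - \int[mu]_(x in U) (Dw x i j * f x).

(* w belongs to H^1(U; R^d) and its weak gradient is Dw. *)
Definition H1 U w (Dw : Rd -> 'M[R]_d) : Prop :=
  [/\ L2 U w, L2 U Dw & weak_grad U w Dw].

(* Closure in H^1(U; R^d) of a set P of smooth vector fields on R^d. *)
Definition H1_closure U (P : set (Rd -> Rd)) : set (Rd -> Rd) :=
  [set w | exists2 Dw, H1 U w Dw &
    forall e : R, 0 < e -> exists phi, [/\ P phi, H1 U phi (grad phi)
      & (\int[mu]_(x in U) (sqn (phi x - w x))%:E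
         + \int[mu]_(x in U) (sqn (grad phi x - Dw x))%:E <= e%:E)%E]].

Definition H1_vanishing U G : set (Rd -> Rd) :=
  H1_closure U [set phi | smooth_vec phi /\ forall x, G x -> phi x = 0].

Definition H1_0 U : set (Rd -> Rd) :=
  H1_closure U [set phi | forall i, test_fun U (fun x => phi x 0 i)].

(* N has (d-1)-dimensional Hausdorff measure zero. *)
Definition surface_negligible (N : set Rd) : Prop :=
  forall e : R, 0 < e -> exists (c : nat -> Rd) (r : nat -> R),
  [/\ forall k, 0 < r k, N `<=` \bigcup_k eball (c k) (r k)
    & (\sum_(0 <= k <oo) (r k ^+ d.-1)%:E <= e%:E)%E].

(* t is the trace of w on the boundary of U: at almost every boundary point x
   for the surface measure, the mean of |w - t(x)| over U `&` B(x, r) tends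
   to 0 with r. *)
Definition has_trace U w (t : Rd -> Rd) : Prop :=
  exists2 N, surface_negligible N & forall x, bnd U x -> ~ N x ->
    (fun r : R => (\int[mu]_(y in U `&` eball x r) enorm (w y - t x))
                  / fine (mu (U `&` eball x r))) @ 0^'+ --> (0 : R).

Definition ae_eq_on U w w' : Prop := {ae mu, forall x, U x -> w x = w' x}.

(* Lam induces a linear operator from X to Y, where X and Y are regarded as
   spaces of classes of functions equal a.e. on U and on V respectively. *)
Definition linear_operator U (X : set (Rd -> Rd)) V (Y : set (Rd -> Rd))
    (Lam : (Rd -> Rd) -> (Rd -> Rd)) : Prop :=
  [/\ forall w, X w -> Y (Lam w),
      forall w w', X w -> X w' -> ae_eq_on U w w' ->
        ae_eq_on V (Lam w) (Lam w')
    & forall (a : R) w w', X w -> X w' ->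
        ae_eq_on V (Lam (fun x => a *: w x + w' x))
                   (fun x => a *: Lam w x + Lam w' x)].

End sobolev.

(* Main.v *)
(* Let W = eps omega, U = Omega `&` W, and let f be a component of w, extended by 0
   outside U. For x outside W let s(x) = sg W l x be a quarter of min(dist(x, W), l),
   with l of order eps. For z outside W take A(z) to be the mean of f over the points
   of W at distance less than K s(z) from z and at depth more than c s(z) in W, if z is
   at distance less than t = O(eps) from Omega, and A(z) = 0 otherwise. The extension
   is f on W and, outside W, the mollification of A with the variable radius s.
   A Lipschitz domain has a cone property, which gives points deep in W near any
   x outside W, and chains of balls in W between two such points; by periodicity and
   connectedness the number of balls is bounded uniformly. Poincare's inequality along
   the chains, started on a ball outside Omega (where f = 0) when A is cut off near x,
   bounds |D ext(x)|^2 by C s(x)^-d times the integral of |D f|^2 over the points of W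
   near x at depth comparable to s(x). Since these points are at distance at most
   C s(x) from x, Tonelli's theorem gives the global bound, even with weights which are
   comparable at such pairs of points; the weight delta^beta is, because delta is at
   least of order eps wherever the extension does not vanish.
   The bounds rest on a translation estimate for f, which holds for smooth w vanishing
   on Gamma_eps and passes to L^2 limits. For such a w the extension is Lipschitz off
   the null set bnd W `|` bnd U and is supported in Omega0, so that mollifying it gives
   test functions; the general case follows by density. *)

Require Import Defs.
From HB Require Import structures.
From mathcomp Require Import all_boot all_order all_algebra.
From mathcomp Require Import all_classical all_reals all_analysis.
From mathcomp Require Import measurable_realfun zify ring lra.

Set Implicit Arguments.
Unset Strict Implicit.
Unset Printing Implicit Defensive.

Import Order.TTheory GRing.Theory Num.Theory.
Import numFieldNormedType.Exports.

Local Open Scope classical_set_scope.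
Local Open Scope ring_scope.


(** * The Borel sets and the Lebesgue measure of R^d *)

Section rV_topology.
Context {R : realType} {n : nat}.
Implicit Types (x y : 'rV[R]_n) (e : R).

(** The constant may depend neither on [eps] nor on Omega beyond its character. So no reflection,
    partition of unity or extension theorem on a reference cell is used: omega enters only through a
    cone condition of known aperture and radius, its periodicity and its connectedness, Omega only
    through the aperture of its cones, while the radius of these last cones only decides how small
    [eps] has to be. The main obstacle is a hole that meets the boundary of Omega. Extending [f] by
    0 is harmless there because a segment inside [W] can meet the boundary of [U] only on that of
    Omega, where the smooth fields [w] vanish; and the cut-off of [A] takes place at distance [t]
    from Omega precisely so that a ball in [W] but outside Omega is available near it. The sup norm
    is used throughout, since its balls are cubes of explicit measure, and is compared with the
    Euclidean norm where the statement uses the latter. As the statement concerns every weak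
    gradient of [w] and of its extension, uniqueness of weak gradients is proved too. *)

Lemma coord_le_norm x i : `|x 0 i| <= `|x|.
Proof.
rewrite /Num.norm /= mx_normrE.
exact: (le_bigmax_cond _ (fun ij => `|x ij.1 ij.2|) (j := (0, i))).
Qed.

Lemma rV_norm_le x e : 0 <= e -> (forall i, `|x 0 i| <= e) -> `|x| <= e.
Proof.
move=> e0 H; rewrite /Num.norm /= mx_normrE; apply: bigmax_le => //= -[i j] _ /=.
by rewrite ord1.
Qed.

Lemma rV_norm_lt x e : 0 < e -> (forall i, `|x 0 i| < e) -> `|x| < e.
Proof.
move=> e0 H; rewrite /Num.norm /= mx_normrE; apply: bigmax_lt => //= -[i j] _ /=.
by rewrite ord1.
Qed.

Lemma measurable_rV_ball x e : measurable (ball x e).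
Proof.
have [e0|e0] := ltP 0 e; last first.
  rewrite (_ : ball x e = set0); first exact: measurable0.
  by apply/seteqP; split => // y [/lt_le_trans/(_ e0)]; rewrite ltxx.
have -> : ball x e = \bigcap_(i in [set: 'I_n])
    ((fun y : 'rV[R]_n => y 0 i) @^-1` (ball (x 0 i) e)).
  apply/seteqP; split => [y [_ H] i _|y H]; first exact: H.
  by split => // i j; rewrite ord1; exact: H.
apply: fin_bigcap_measurable => // i _; rewrite -[X in measurable X]setTI.
apply: measurable_coor => //; by apply: open_measurable; exact: ball_open.
Qed.

(** Second countability: [O] is the union of the balls with rational centre and radius [k.+1%:R^-1]
    that it contains, and a ball of the sup norm is a finite intersection of coordinate strips. *)
Lemma open_measurable_rV (O : set 'rV[R]_n) : open O -> measurable O.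
Proof.
move=> oO.
pose B (p : 'rV[rat]_n * nat) := ball (map_mx ratr p.1 : 'rV[R]_n) p.2.+1%:R^-1.
have -> : O = \bigcup_p (if `[< B p `<=` O >] then B p else set0).
  apply/seteqP; split => [x Ox|x [p _]]; last by case: asboolP => // pO /pO.
  have [e /= e0 eO] : exists2 e : R, 0 < e & ball x e `<=` O.
    by apply/nbhs_ballP; exact: open_nbhs_nbhs.
  have [k ke] : exists k : nat, k.+1%:R^-1 < e / 2.
    exists (Num.trunc (e / 2)^-1); rewrite invf_plt ?posrE ?divr_gt0//.
    exact: Num.Theory.truncnS_gt.
  have k0 : (0 : R) < k.+1%:R^-1 by rewrite invr_gt0.
  have qP i : {q : rat | x 0 i - k.+1%:R^-1 < ratr q < x 0 i + k.+1%:R^-1}.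
    apply: cid; have [|q] := @rat_in_itvoo R (x 0 i - k.+1%:R^-1) (x 0 i + k.+1%:R^-1).
      by move: k0; set r := _^-1 => ?; lra.
    by rewrite in_itv; exists q.
  have Hb : ball x k.+1%:R^-1 (map_mx ratr (\row_i sval (qP i)) : 'rV[R]_n).
    split => // i j; rewrite ord1 !mxE; case: (qP j) => q /= /andP[q1 q2].
    by rewrite /ball /= ltr_distlC q1 q2.
  exists (\row_i sval (qP i), k) => //; case: asboolP => [_|[]]; first exact: ball_sym.
  move=> y /= By; apply: eO; have := ball_triangle Hb By.
  by apply: le_ball; move: ke; set r := _^-1 => ?; lra.
apply: countable_bigcupT_measurable => // p.
by case: asboolP => // _; exact: measurable_rV_ball.
Qed.

End rV_topology.

Section rV_measure.
Context {R : realType}.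
Local Notation mu n := (lebesgue_rV R n).

Lemma continuous_measurable_rV n (U : set 'rV[R]_n) (f : 'rV[R]_n -> R) :
  open U -> (forall x, U x -> {for x, continuous f}) -> measurable_fun U f.
Proof.
move=> oU cf; apply: (measurability _ (RGenOpens.measurableE R)).
move=> _ [_ [a [b ->] <-]]; apply: open_measurable_rV; rewrite openE => x [Ux fx].
have h1 : nbhs x U by apply: open_nbhs_nbhs.
have h2 : nbhs x (f @^-1` `]a, b[%classic).
  by apply: cf => //; apply: open_nbhs_nbhs; split => //; exact: interval_open.
exact: filterI.
Qed.

Lemma lebesgue_measure_translation (a : R) (A : set R) : measurable A ->
  pushforward (@lebesgue_measure R) ((fun x => x + a) : _ -> measurableTypeR R) A =
  lebesgue_measure A.
Proof.
move=> mA.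
have ma : measurable_fun setT ((fun x => x + a) : measurableTypeR R -> measurableTypeR R).
  by apply: measurable_funD.
pose mix := isMeasurableFun.Build _ _ _ _ _ ma.
pose f : {mfun measurableTypeR R >-> measurableTypeR R} := HB.pack (fun x : R => x + a) mix.
apply/esym/(@lebesgue_measure_unique _ (pushforward lebesgue_measure f)) => //= _ [[b c]] _ <-.
rewrite /pushforward.
rewrite (_ : _ @^-1` _ = `](b - a), (c - a)]%classic); last first.
  by apply/seteqP; split => x /=; rewrite !in_itv /= => /andP[? ?]; apply/andP; split; lra.
rewrite !lebesgue_measure_itv/= !lte_fin ltrD2r.
by case: ifP => // _; rewrite -!EFinB; congr EFin; lra.
Qed.

Lemma integral_translation (a : R) (f : R -> \bar R) :
  measurable_fun setT f -> (forall x, 0 <= f x)%E ->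
  (\int[lebesgue_measure]_x f (x + a)%R = \int[lebesgue_measure]_x f x)%E.
Proof.
move=> mf f0.
have ma : measurable_fun setT ((fun x => x + a) : measurableTypeR R -> measurableTypeR R).
  by apply: measurable_funD.
pose mix := isMeasurableFun.Build _ _ _ _ _ ma.
pose g : {mfun measurableTypeR R >-> measurableTypeR R} := HB.pack (fun x : R => x + a) mix.
transitivity (\int[pushforward lebesgue_measure g]_x f x)%E.
  by rewrite ge0_integral_pushforward.
by apply: eq_measure_integral => A mA _; exact: lebesgue_measure_translation.
Qed.

Lemma integral_rV_cons n (f : 'rV[R]_n.+1 -> \bar R) :
  measurable_fun setT f -> (forall x, 0 <= f x)%E ->
  (\int[mu n.+1]_x f x =
   \int[lebesgue_measure]_a \int[mu n]_x f (rV_cons (a, x)))%E.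
Proof.
move=> mf f0.
transitivity (\int[pushforward (lebesgue_measure \x mu n) (@rV_cons R n)]_x f x)%E.
  by [].
rewrite ge0_integral_pushforward//; last exact: measurable_rV_cons.
rewrite preimage_setT fubini_tonelli1//; last by move=> x /=.
by apply: measurableT_comp => //; exact: measurable_rV_cons.
Qed.

Lemma rV_consl n (p : measurableTypeR R * 'rV[R]_n) :
  rV_cons p 0 (lshift n (0 : 'I_1)) = p.1.
Proof. by rewrite /rV_cons (row_mxEl (p.1 : R)%:M p.2 0 0) mxE eqxx mulr1n. Qed.

Lemma rV_consr n (p : measurableTypeR R * 'rV[R]_n) j :
  rV_cons p 0 (rshift 1 j) = p.2 0 j.
Proof. exact: (row_mxEr (p.1 : R)%:M p.2 0 j). Qed.

Lemma rV_consD n (p : R * 'rV[R]_n) (v : 'rV[R]_n.+1) :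
  rV_cons p + v = rV_cons ((p.1 + (rV_uncons v).1, p.2 + (rV_uncons v).2) : measurableTypeR R * _).
Proof.
apply/rowP => i; rewrite !mxE; case: (@split_ordP 1 n i) => j -> /=.
  by rewrite !mxE !ord1 eqxx !mulr1n.
by rewrite !mxE.
Qed.

(** Induction on the dimension: Tonelli's theorem separates the first coordinate, translated on the
    line, from the others, translated by the induction hypothesis. *)
Lemma integral_rV_translation n (v : 'rV[R]_n) (f : 'rV[R]_n -> \bar R) :
  measurable_fun setT f -> (forall x, 0 <= f x)%E ->
  (\int[mu n]_x f (x + v)%R = \int[mu n]_x f x)%E.
Proof.
elim: n v f => [|n IH] v f mf f0.
  by apply: eq_integral => x _; congr f; apply/rowP => -[].
have mfv : measurable_fun setT (fun x : 'rV[R]_n.+1 => f (x + v)).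
  apply: measurableT_comp => //; apply: measurable_fun_rV => i.
  under eq_fun do rewrite mxE.
  by apply: measurable_funD => //; exact: measurable_coor.
rewrite (integral_rV_cons mfv (fun x => f0 (x + v))) (integral_rV_cons mf f0).
have mfc : measurable_fun setT (fun p => f (rV_cons p)).
  by apply: measurableT_comp => //; exact: measurable_rV_cons.
transitivity (\int[lebesgue_measure]_a \int[mu n]_x
    f (rV_cons ((a + (rV_uncons v).1)%R, x)))%E.
  apply: eq_integral => a _.
  rewrite -[RHS](IH (rV_uncons v).2)//.
    by apply: eq_integral => x _; rewrite rV_consD.
  exact: (measurableT_comp mfc (pair1_measurable _)).
rewrite (integral_translation _ (f := fun a => \int[mu n]_x f (rV_cons (a, x)))%E)//.
  exact: (measurable_fun_fubini_tonelli_F (fun p => f (rV_cons p))).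
by move=> a; apply: integral_ge0.
Qed.

(** Balls of the sup norm are products of intervals, hence the exact value, on which all the
    comparisons of volumes rest. *)
Lemma lebesgue_rV_ball n (x : 'rV[R]_n) (r : R) : 0 < r ->
  mu n (ball x r) = ((r *+ 2) ^+ n)%:E.
Proof.
move=> r0; elim: n x => [|n IH] x.
  rewrite /= /dirac indicE mem_set// -ball_normE /=.
  by rewrite (_ : x - 0 = 0) ?normr0//; apply/rowP => -[].
transitivity ((lebesgue_measure \x mu n)%E (@rV_cons R n @^-1` (ball x r))) => //.
rewrite (_ : _ @^-1` _ = ball (rV_uncons x).1 r `*` ball (rV_uncons x).2 r); last first.
  apply/seteqP; split => [[a y] /= [_ H]|[a y] /= [H1 [_ H2]]]; split => //=.
  - by have := H 0 (lshift n (0 : 'I_1)); rewrite rV_consl mxE.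
  - by split => // i j; have := H 0 (rshift 1 j : 'I_n.+1); rewrite rV_consr mxE ord1.
  - move=> i j; rewrite ord1; case: (@split_ordP 1 n j) => k ->.
      by rewrite ord1 rV_consl; move: H1; rewrite mxE.
    by rewrite rV_consr; have := H2 0 k; rewrite mxE.
rewrite product_measure1E; [|exact: measurable_ball|exact: measurable_rV_ball].
rewrite [X in (X * _)%E](_ : _ = (r *+ 2)%:E); last exact: (lebesgue_measure_ball _ (ltW r0)).
by rewrite IH -EFinM -exprS.
Qed.

Lemma measurable_rVD d (T : measurableType d) n (f g : T -> 'rV[R]_n) :
  measurable_fun setT f -> measurable_fun setT g ->
  measurable_fun setT (fun x => f x + g x).
Proof.
move=> mf mg; apply: measurable_fun_rV => i; under eq_fun do rewrite mxE.
by apply: measurable_funD; apply: (measurableT_comp (measurable_coor i)).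
Qed.

Lemma measurable_rVZ d (T : measurableType d) n (f : T -> R) (g : T -> 'rV[R]_n) :
  measurable_fun setT f -> measurable_fun setT g ->
  measurable_fun setT (fun x => f x *: g x).
Proof.
move=> mf mg; apply: measurable_fun_rV => i; under eq_fun do rewrite mxE.
by apply: measurable_funM => //; apply: (measurableT_comp (measurable_coor i)).
Qed.

Lemma measurable_rVN d (T : measurableType d) n (g : T -> 'rV[R]_n) :
  measurable_fun setT g -> measurable_fun setT (fun x => - g x).
Proof.
move=> mg; under eq_fun do rewrite -scaleN1r.
by apply: measurable_rVZ.
Qed.

Lemma measurable_rV_norm d (T : measurableType d) n (g : T -> 'rV[R]_n) :
  measurable_fun setT g -> measurable_fun setT (fun x => `|g x|).
Proof.
move=> mg; apply: (measurableT_comp (f := fun y : 'rV[R]_n => `|y|)) => //.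
by apply: continuous_measurable_rV => // [|x _]; [exact: openT|exact: norm_continuous].
Qed.

Lemma integral_rV_translation_set n (v : 'rV[R]_n) (A : set 'rV[R]_n)
    (f : 'rV[R]_n -> \bar R) :
  measurable A -> measurable_fun setT f -> (forall x, 0 <= f x)%E ->
  (\int[mu n]_(x in A) f (x + v)%R = \int[mu n]_(x in [set y | A (y - v)%R]) f x)%E.
Proof.
move=> mA mf f0; pose B := [set y | A (y - v)].
have mB : measurable B.
  rewrite -[B]setTI; apply: (measurable_rVD (g := fun=> - v)) => //.
rewrite integral_mkcond [RHS]integral_mkcond.
rewrite -[RHS](@integral_rV_translation _ v).
- apply: eq_integral => x _; rewrite !patchE.
  suff -> : (x + v \in B) = (x \in A) by [].
  by apply/idP/idP; rewrite !inE /B /= addrK.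
- exact/(measurable_restrictT f mB)/measurable_funTS.
- by move=> x; apply: erestrict_ge0.
Qed.

End rV_measure.

(** * Calculus and smooth bump functions *)

Section rV_calculus.
Context {R : realType} {n : nat}.
Implicit Types (f g : 'rV[R]_n -> R) (x h v : 'rV[R]_n).

Definition rV_lin (c : 'I_n -> R) h : R := \sum_j h 0 j * c j.

Let rV_lin_is_linear c : linear (rV_lin c).
Proof.
move=> a x y; rewrite /rV_lin scaler_sumr -big_split; apply: eq_bigr => j _ /=.
by rewrite !mxE mulrDl -mulrA.
Qed.

HB.instance Definition _ c := GRing.isLinear.Build R 'rV[R]_n R *%R (rV_lin c)
  (rV_lin_is_linear c).

Lemma rV_lin_le c (B : R) h : (forall j, `|c j| <= B) ->
  `|rV_lin c h| <= n%:R * B * `|h|.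
Proof.
move=> cB; apply: le_trans (ler_norm_sum _ _ _) _.
apply: (@le_trans _ _ (\sum_(j < n) B * `|h|)).
  apply: ler_sum => j _; rewrite normrM mulrC.
  by apply: ler_pM => //; exact: coord_le_norm.
by rewrite sumr_const card_ord -[leLHS]mulr_natl mulrA.
Qed.

Lemma rV_lin_continuous c : continuous (rV_lin c).
Proof.
move=> x s /= /nbhs_ballP[e /= e0 es]; pose K := n%:R * \sum_j `|c j|.
have K0 : 0 <= K by rewrite mulr_ge0// sumr_ge0.
apply/nbhs_ballP; exists (e / (K + 1)) => [/=|y]; first by rewrite divr_gt0//; lra.
rewrite -[in X in X -> _]ball_normE /= ltr_pdivlMr; last by lra.
move=> xy; apply: es; rewrite -ball_normE /= -linearB.
apply: le_lt_trans xy; apply: le_trans (rV_lin_le (B := \sum_j `|c j|) _ _) _ => [j|].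
  by rewrite (bigD1 j)//= lerDl sumr_ge0.
by rewrite mulrDr mulr1 [leRHS]addrC mulrC lerDr.
Qed.

(** A quadratic bound on the remainder is what differentiation under the integral sign yields; it
    gives differentiability and identifies the differential at once. *)
Lemma differentiable_quadratic f x (c : 'I_n -> R) (rho B : R) : 0 < rho -> 0 <= B ->
  (forall h, `|h| < rho -> `|f (x + h) - f x - rV_lin c h| <= B * `|h| ^+ 2) ->
  differentiable f x /\ 'd f x = rV_lin c :> (_ -> _).
Proof.
move=> r0 B0 H.
have key (e : R) : 0 < e ->
    \forall h \near (0 : 'rV[R]_n), `|f (h + x) - (f x + rV_lin c h)| <= e * `|h|.
  move=> e0; near=> h.
  have hr : `|h| < Num.min rho (e / (B + 1)).
    near: h; apply/nbhs_ballP; exists (Num.min rho (e / (B + 1))).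
      by rewrite /= lt_min r0 divr_gt0//; lra.
    by move=> y; rewrite -ball_normE /= sub0r normrN.
  move: hr; rewrite lt_min => /andP[h1 h2].
  rewrite opprD addrA [h + x]addrC.
  apply: le_trans (H h h1) _; rewrite expr2 mulrA; apply: ler_pM => //.
    by rewrite mulr_ge0.
  apply: (@le_trans _ _ (B * (e / (B + 1)))); first by rewrite ler_wpM2l// ltW.
  rewrite mulrA ler_pdivrMr; last by lra.
  by nra.
have dfE : 'd f x = rV_lin c :> ('rV[R]_n -> R).
  apply: diff_unique; first exact: rV_lin_continuous.
  by apply/eqaddoP => e e0; exact: key.
split => //; apply/diff_locallyP; rewrite dfE; split; first exact: rV_lin_continuous.
by apply/eqaddoP => e e0; exact: key.
Unshelve. all: by end_near. Qed.

Lemma delta_mx_linE c j : rV_lin c (delta_mx 0 j) = c j.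
Proof.
rewrite /rV_lin (bigD1 j)//= big1 ?addr0 => [|i ij].
  by rewrite mxE !eqxx mul1r.
by rewrite mxE (negbTE ij) andbF mul0r.
Qed.

Lemma partial_quadratic f x (c : 'I_n -> R) (rho B : R) : 0 < rho -> 0 <= B ->
  (forall h, `|h| < rho -> `|f (x + h) - f x - rV_lin c h| <= B * `|h| ^+ 2) ->
  forall j, partial j f x = c j.
Proof.
move=> r0 B0 H j; have [df dE] := differentiable_quadratic r0 B0 H.
by rewrite /partial deriveE// dE delta_mx_linE.
Qed.

Lemma derive_rV_lin f x v : differentiable f x ->
  'D_v f x = rV_lin (fun j => partial j f x) v.
Proof.
move=> df; rewrite deriveE// {1}[v]row_sum_delta linear_sum.
apply: eq_bigr => j _; rewrite linearZ /= /partial deriveE//.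
Qed.

Lemma is_derive_line f x v (t : R) : differentiable f (x + t *: v) ->
  is_derive t 1 (fun s => f (x + s *: v)) (rV_lin (fun j => partial j f (x + t *: v)) v).
Proof.
move=> df; rewrite -derive_rV_lin//.
pose F (s : R) : R := f (x + s *: v).
have E : (fun h : R => h^-1 *: ((F \o shift t) (h *: (1 : R)) - F t)) =
  (fun h : R => h^-1 *: ((f \o shift (x + t *: v)) (h *: v) - f (x + t *: v))).
  apply/funext => h /=; congr (_ *: (_ - _)).
  by rewrite /F [h *: 1]mulr1 scalerDl addrCA.
have dv : derivable f (x + t *: v) v by exact: diff_derivable.
apply: DeriveDef; first by rewrite /derivable -/F E.
by rewrite /derive -/F E.
Qed.

Lemma rV_MVT f x v : (forall t, 0 <= t <= 1 -> differentiable f (x + t *: v)) ->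
  exists2 t, 0 <= t <= 1 &
    f (x + v) - f x = rV_lin (fun j => partial j f (x + t *: v)) v.
Proof.
move=> df; pose F (t : R) := f (x + t *: v).
have [|t|t t01 E] := @MVT_segment R F (fun t => rV_lin (fun j => partial j f (x + t *: v)) v) 0 1 ler01.
- move=> t /[!in_itv]/= /andP[t0 t1]; apply: is_derive_line.
  by apply: df; rewrite !ltW.
- apply: derivable_within_continuous => s /[!in_itv]/= s01.
  by have [] := is_derive_line (df _ s01).
exists t; first by move: t01; rewrite in_itv.
by move: E; rewrite /F scale1r scale0r addr0 subr0 mulr1.
Qed.

Lemma rV_lipschitz_le f x v (B : R) :
  (forall t, 0 <= t <= 1 -> differentiable f (x + t *: v)) ->
  (forall t j, 0 <= t <= 1 -> `|partial j f (x + t *: v)| <= B) ->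
  `|f (x + v) - f x| <= n%:R * B * `|v|.
Proof. by move=> /rV_MVT[t t01 ->] pB; apply: rV_lin_le => j; exact: pB. Qed.

(** The mean value theorem is applied to [f], then to each partial derivative between [x] and the
    intermediate point, so that no integral form of Taylor's formula is involved. *)
Lemma quadratic_remainder f (B : R) :
  (forall x, differentiable f x) -> (forall j x, differentiable (partial j f) x) ->
  (forall i j x, `|partial i (partial j f) x| <= B) ->
  forall x h, `|f (x + h) - f x - rV_lin (fun j => partial j f x) h| <=
    n%:R * (n%:R * B) * `|h| ^+ 2.
Proof.
move=> df d2f B2 x h.
have [t /andP[t0 t1] ->] := rV_MVT (fun t _ => df (x + t *: h)).
have -> : rV_lin (fun j => partial j f (x + t *: h)) h - rV_lin (fun j => partial j f x) h
  = rV_lin (fun j => partial j f (x + t *: h) - partial j f x) h.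
  by rewrite /rV_lin -sumrB; apply: eq_bigr => j _; rewrite mulrBr.
apply: le_trans (rV_lin_le (B := n%:R * B * `|h|) _ _) _; last first.
  by rewrite expr2 !mulrA.
move=> j; apply: le_trans (rV_lipschitz_le (B := B) _ _) _ => //.
rewrite normrZ ger0_norm//.
have B0 : 0 <= n%:R * B.
  by rewrite mulr_ge0// (le_trans _ (B2 j j x)).
rewrite ler_wpM2l// -[leRHS]mul1r.
by rewrite ler_wpM2r.
Qed.

Lemma near0_partial f x (P : set 'rV[R]_n) j : open P -> P x ->
  (forall y, P y -> f y = 0) -> partial j f x = 0.
Proof.
move=> oP Px f0; rewrite /partial -(derive_cst (0 : R) x (delta_mx 0 j)).
apply: near_eq_derive; have : nbhs x P by apply: open_nbhs_nbhs.
by apply: filterS => y /f0.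
Qed.

End rV_calculus.

Section smooth_functions.
Context {R : realType} {d : nat}.
Implicit Types (f g : 'rV[R]_d -> R).

(** Bounding the number of derivatives turns stability properties of smooth functions, such as that
    of products, into inductions on [k]. *)
Definition Cn k f := forall s, (size s <= k)%N -> forall x,
  differentiable (foldr (@partial R d) f s) x.

(** The derivative split off is the innermost one, that is the last of the sequence folded over,
    whence [rcons]. *)
Lemma CnS k f : Cn k.+1 f <-> (forall x, differentiable f x) /\ forall j, Cn k (partial j f).
Proof.
split=> [H|[H1 H2] s]; first split.
- by move=> x; exact: (H [::]).
- by move=> j s sk x; have := H (rcons s j); rewrite foldr_rcons size_rcons; apply.
- case/lastP: s => [_ x|s j]; first exact: H1.
  by rewrite size_rcons ltnS foldr_rcons => sk; exact: H2.
Qed.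

Lemma Cn0 f : Cn 0 f <-> forall x, differentiable f x.
Proof.
split=> [H x|H [|//] _]; [exact: (H [::])|exact: H].
Qed.

Lemma CnW k f : Cn k.+1 f -> Cn k f.
Proof. by move=> H s sk; apply: H; apply: leq_trans sk _. Qed.

Lemma Cn_smooth f : (forall k, Cn k f) <-> smooth f.
Proof. by split=> [H s x|H k s _ x]; [exact: (H (size s))|exact: H]. Qed.

Lemma partialD f g j : (forall x, differentiable f x) -> (forall x, differentiable g x) ->
  partial j (f + g) = partial j f + partial j g.
Proof.
move=> df dg; apply/funext => x; rewrite /partial deriveD//; exact: diff_derivable.
Qed.

Lemma partialM f g j : (forall x, differentiable f x) -> (forall x, differentiable g x) ->
  partial j (f * g) = f * partial j g + g * partial j f.
Proof.
move=> df dg; apply/funext => x; rewrite /partial deriveM//; exact: diff_derivable.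
Qed.

Lemma CnD k f g : Cn k f -> Cn k g -> Cn k (f + g).
Proof.
elim: k f g => [|k IH] f g.
  by rewrite !Cn0 => df dg x; exact: differentiableD.
rewrite !CnS => -[df f1] [dg g1]; split; first by move=> x; exact: differentiableD.
by move=> j; rewrite partialD//; exact: IH.
Qed.

Lemma CnM k f g : Cn k f -> Cn k g -> Cn k (f * g).
Proof.
elim: k f g => [|k IH] f g.
  by rewrite !Cn0 => df dg x; exact: differentiableM.
move=> cf cg; move: (cf) (cg); rewrite !CnS => -[df f1] [dg g1].
split; first by move=> x; exact: differentiableM.
by move=> j; rewrite partialM//; apply: CnD; apply: IH => //; exact: CnW.
Qed.

Lemma partial_cst (c : R) j : partial j (cst c : 'rV[R]_d -> R) = cst 0.
Proof. by apply/funext => x; rewrite /partial derive_cst. Qed.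

Lemma Cn_cst k (c : R) : Cn k (cst c).
Proof.
elim: k c => [|k IH] c; first by rewrite Cn0 => x; exact: differentiable_cst.
by rewrite CnS; split => [x|j]; [exact: differentiable_cst|rewrite partial_cst].
Qed.

Lemma Cn_prod k (I : Type) (r : seq I) (F : I -> 'rV[R]_d -> R) :
  (forall i, Cn k (F i)) -> Cn k (\prod_(i <- r) F i).
Proof.
move=> cF; elim/big_ind: _ => [|f g|i _]; [exact: Cn_cst|exact: CnM|exact: cF].
Qed.

Lemma partial_comp1 (F : R -> R) (l : 'rV[R]_d -> R) x j :
  derivable F (l x) 1 -> differentiable l x ->
  partial j (F \o l) x = 'D_1 F (l x) * partial j l x.
Proof.
move=> /derivable1_diffP dF dl.
rewrite /partial deriveE; last exact: differentiable_comp.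
rewrite diff_comp// [LHS]/=.
have -> : 'D_(delta_mx 0 j) l x = 'd l x (delta_mx 0 j) by rewrite -deriveE.
have -> : 'D_1 F (l x) = 'd F (l x) (1 : R) by rewrite -deriveE.
set u := 'd l x _; transitivity ('d F (l x) (u *: (1 : R))); first by rewrite [u *: 1]mulr1.
by rewrite linearZ mulrC.
Qed.

End smooth_functions.

Section bump.
Context {R : realType}.

(* Zero for y <= 0; the family is stable under differentiation. *)
Definition fexp (p : {poly R}) (y : R) : R :=
  if 0 < y then p.[y^-1] * expR (- y^-1) else 0.

(** Each monomial is controlled by one term of the exponential series: the power of degree i of [t]
    is at most i! times [expR t]. *)
Lemma horner_expR_bounded (p : {poly R}) :
  exists2 C : R, 0 <= C & forall t, 0 <= t -> `|p.[t]| * expR (- t) <= C.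
Proof.
exists (\sum_(i < size p) `|p`_i| * i`!%:R).
  by apply: sumr_ge0 => i _; rewrite mulr_ge0.
move=> t t0; rewrite horner_coef.
apply: le_trans (_ : (\sum_(i < size p) `|p`_i| * t ^+ i) * expR (- t) <= _).
  rewrite ler_wpM2r ?expR_ge0//; apply: le_trans (ler_norm_sum _ _ _) _.
  by apply: ler_sum => i _; rewrite normrM [`|t ^+ i|]ger0_norm ?exprn_ge0.
rewrite mulr_suml; apply: ler_sum => i _; rewrite -mulrA ler_wpM2l//.
rewrite expRN ler_pdivrMr ?expR_gt0//.
case: (nat_of_ord i) => [|k]; first by rewrite expr0 fact0 mul1r -expR0 ler_expR.
have := expR_ge1Dxn k t0; have f0 : (0 : R) < (k.+1)`!%:R by rewrite ltr0n fact_gt0.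
rewrite -ler_pdivrMl// mulrC; lra.
Qed.

Lemma fexp_le_sqr (p : {poly R}) :
  exists2 C : R, 0 <= C & forall h, `|fexp p h| <= C * h ^+ 2.
Proof.
(* At [t = h^-1] the additional factor [t ^+ 2] provides the [h ^+ 2] of the bound. *)
have [C C0 H] := horner_expR_bounded (p * 'X^2).
exists C => // h; rewrite /fexp; case: ifPn => [h0|_]; last first.
  by rewrite normr0 mulr_ge0// sqr_ge0.
rewrite -ler_pdivrMr ?exprn_gt0// normrM [`|expR _|]ger0_norm ?expR_ge0//.
have := H h^-1; rewrite invr_ge0 ltW// => /(_ isT).
rewrite hornerM hornerXn normrM [`|h^-1 ^+ 2|]ger0_norm ?sqr_ge0// exprVn.
by rewrite mulrAC.
Qed.

(** With [t = y^-1], the derivative of [p(t) exp(-t)] in [y] is [t^2 (p - p')(t) exp(-t)], again of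
    the same form. At 0 the quadratic bound makes the difference quotient tend to 0. *)
Lemma is_derive_fexp (p : {poly R}) (y : R) :
  is_derive y 1 (fexp p) (fexp ('X^2 * (p - p^`())) y).
Proof.
have [y0|y0|<-] := ltgtP 0 y.
- have E : is_derive y 1 (fun z => p.[z^-1] * expR (- z^-1))
      (fexp ('X^2 * (p - p^`())) y).
    have yn0 : y != 0 by rewrite gt_eqF.
    have dV : is_derive y (1 : R) (fun z : R => z^-1) (- y ^- 2).
      by have := @is_deriveV _ id y 1 1 yn0 (is_derive_id _ _); rewrite [_ *: 1]mulr1.
    have dP : is_derive y (1 : R) (fun z : R => p.[z^-1]) (p^`().[y^-1] * - y ^- 2).
      exact: is_derive1_comp.
    have dN : is_derive y (1 : R) (fun z : R => - z^-1) (y ^- 2).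
      by have := is_deriveN dV; rewrite opprK.
    have dE : is_derive y (1 : R) (fun z : R => expR (- z^-1)) (expR (- y^-1) * y ^- 2).
      exact: is_derive1_comp.
    have dM := is_deriveM dP dE.
    apply: (is_derive_eq dM).
    rewrite /fexp y0 hornerM hornerXn hornerD hornerN /GRing.scale /=.
    rewrite exprVn; ring.
  apply: near_eq_is_derive E; near=> z.
  have z0 : 0 < z by near: z; exact: lt_nbhsr.
  by rewrite /fexp z0.
- rewrite {2}/fexp ltNge (ltW y0) /=.
  apply: (@near_eq_is_derive _ _ _ (cst 0)) => //; near=> z.
  have z0 : z < 0 by near: z; exact: lt_nbhsl.
  by rewrite /fexp ltNge (ltW z0).
- have [C C0 H] := fexp_le_sqr p.
  have F0 q : fexp q 0 = 0 by rewrite /fexp ltxx.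
  rewrite F0.
  have E : h^-1 *: ((fexp p \o shift 0) (h *: (1 : R)) - fexp p 0) @[h --> 0^'] --> (0 : R).
    apply/cvgrPdist_le => e e0; near=> h.
    rewrite /= F0 sub0r normrN addr0 subr0 [h *: 1]mulr1 normrM.
    have hn0 : h != 0 by near: h; exact: nbhs_dnbhs_neq.
    rewrite normfV ler_pdivrMl ?normr_gt0//; apply: le_trans (H h) _.
    rewrite -[h ^+ 2]ger0_norm ?sqr_ge0// normrX expr2 mulrA.
    rewrite [leRHS]mulrC ler_wpM2r//.
    have : `|h| < e / (C + 1).
      near: h; apply: dnbhs0_lt; rewrite divr_gt0//; lra.
    by rewrite ltr_pdivlMr; [nra|lra].
  by apply: DeriveDef; [apply/cvg_ex; exists 0|exact: cvg_lim].
Unshelve. all: by end_near. Qed.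

Lemma Cn_fexp d k (p : {poly R}) (a c : R) (i : 'I_d) :
  Cn k (fun x : 'rV[R]_d => fexp p (a + c * x 0 i)).
Proof.
pose l (x : 'rV[R]_d) : R := a + c * x 0 i.
have lE x h : l (x + h) - l x - rV_lin (fun j => c * (j == i)%:R) h = 0.
  rewrite /rV_lin (bigD1 i)//= big1 => [|j /negbTE ->]; last by rewrite !mulr0.
  by rewrite /l eqxx !mxE /=; ring.
have H x h : `|h| < 1 -> `|l (x + h) - l x - rV_lin (fun j => c * (j == i)%:R) h| <= 0 * `|h| ^+ 2.
  by move=> _; rewrite lE normr0 mul0r.
have dl x : differentiable l x.
  by have [] := differentiable_quadratic ltr01 (lexx 0) (H x).
have pl j x : partial j l x = c * (j == i)%:R.
  exact: (partial_quadratic ltr01 (lexx 0) (H x)).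
have dF q y : derivable (fexp q) y 1 by have [] := is_derive_fexp q y.
have dc q x : differentiable (fexp q \o l) x.
  by apply: differentiable_comp => //; apply/derivable1_diffP.
suff : forall q, Cn k (fexp q \o l) by exact.
elim: k => [|k IH] q; first by rewrite Cn0.
rewrite CnS; split => // j.
(* The inner derivative is a constant, which is absorbed into the polynomial, so that the induction
   hypothesis on [k] applies. *)
suff -> : partial j (fexp q \o l) =
    fexp ('X^2 * (q - q^`()) * (c * (j == i)%:R)%:P) \o l by [].
apply/funext => x; rewrite partial_comp1//.
have [_ ->] := is_derive_fexp q (l x); rewrite pl /= /fexp.
by case: ifP => // _; rewrite ?mul0r// !hornerM hornerC; ring.
Qed.

(** The product over the coordinates of [f (1 + x_i) * f (1 - x_i)], with [f y = exp(-1/y)] for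
    [y > 0] and 0 otherwise, is positive exactly on the open unit cube, which is the unit ball of
    the sup norm. *)
Lemma bump_exists d : exists eta : 'rV[R]_d -> R,
  [/\ smooth eta, forall x, 0 <= eta x, forall x, 1 <= `|x| -> eta x = 0,
      exists2 c, 0 < c & forall x, `|x| <= 2^-1 -> c <= eta x
    & forall x, eta (- x) = eta x].
Proof.
pose f := fexp 1.
have fE y : f y = if 0 < y then expR (- y^-1) else 0 by rewrite /f /fexp hornerC mul1r.
have f0 y : 0 <= f y by rewrite fE; case: ifP => // _; exact: expR_ge0.
pose eta (x : 'rV[R]_d) := \prod_i (f (1 + 1 * x 0 i) * f (1 + -1 * x 0 i)).
exists eta; split.
- apply/Cn_smooth => k.
  suff -> : eta = \prod_i ((fun x : 'rV[R]_d => f (1 + 1 * x 0 i)) *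
      (fun x => f (1 + -1 * x 0 i))).
    by apply: Cn_prod => i; apply: CnM; exact: Cn_fexp.
  by apply/funext => x; rewrite fct_prodE.
- by move=> x; apply: prodr_ge0 => i _; rewrite mulr_ge0.
- move=> x x1; have [/forallP H|/forallPn[i]] := boolP [forall i, `|x 0 i| < 1].
    by have := rV_norm_lt ltr01 H; rewrite ltNge x1.
  rewrite -leNgt ler_normr => /orP[] xi; rewrite /eta (bigD1 i)//= !fE.
    rewrite [X in _ * X * _]ifF ?mulr0 ?mul0r//; apply/negbTE; rewrite -leNgt; lra.
  rewrite [X in X * _ * _]ifF ?mul0r//; apply/negbTE; rewrite -leNgt; lra.
(* For [|x_i| <= 1/2] both arguments of [f] are at least 1/2, where [f >= expR (-2)]. *)
- exists (\prod_(i < d) (expR (-2) * expR (-2))).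
    by apply: prodr_gt0 => i _; rewrite mulr_gt0 ?expR_gt0.
  move=> x x1; apply: ler_prod => i _; rewrite mulr_ge0 ?expR_ge0//=.
  have fl y : 2^-1 <= y -> expR (-2) <= f y.
    move=> hy; have y0 : 0 < y by lra.
    rewrite fE y0 ler_expR lerN2 -[leRHS]invrK lef_pV2 ?posrE//; lra.
  have := le_trans (coord_le_norm x i) x1; rewrite ler_norml => /andP[h1 h2].
  by apply: ler_pM; rewrite ?expR_ge0//; apply: fl; lra.
- move=> x; apply: eq_bigr => i _; rewrite mxE mulrC; congr (f _ * f _); ring.
Qed.

End bump.

(** * Differentiation of kernels of variable radius *)

Lemma measurable_inv (R : realType) : measurable_fun setT (fun y : R => y^-1).
Proof.
rewrite -(setUv [set (0 : R)]); apply/measurable_funU => //; first exact: measurableC.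
split; first exact: measurable_fun_set1.
apply: open_continuous_measurable_fun; first exact/closed_openC/closed_eq.
by move=> y /set_mem/eqP y0; exact: inv_continuous.
Qed.

Section integral_tools.
Context {R : realType} {n : nat}.
Local Notation mu := (lebesgue_rV R n).
Implicit Types (f g : 'rV[R]_n -> R) (x v : 'rV[R]_n).

Lemma le_integral_supp f x (r M : R) : 0 < r -> measurable_fun setT f ->
  (forall z, ball x r z -> `|f z| <= M) -> (forall z, ~ ball x r z -> f z = 0) ->
  (\int[mu]_z `|f z|%:E <= (M * (r *+ 2) ^+ n)%:E)%E.
Proof.
move=> r0 mf fM f0.
have mB := measurable_rV_ball x r.
have M0 : 0 <= M by apply: le_trans (fM x _) => //; exact: ballxx.
apply: (@le_trans _ _ (\int[mu]_z (M%:E * (\1_(ball x r) z)%:E))%E).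
  apply: ge0_le_integral => //.
  - by apply/measurable_EFinP; exact: measurableT_comp.
  - by apply/measurable_EFinP; apply: measurable_funM => //; exact: measurable_indic.
  move=> z _; rewrite -EFinM lee_fin indicE.
  have [zB|zB] := pselect (ball x r z); first by rewrite (mem_set zB) mulr1 fM.
  by rewrite f0// normr0 mulr_ge0.
rewrite ge0_integralZl//; last by apply/measurable_EFinP; exact: measurable_indic.
rewrite integral_indic// setIT [X in (_ * X)%E](_ : _ = ((r *+ 2) ^+ n)%:E) -?EFinM//.
exact: lebesgue_rV_ball.
Qed.

Lemma integrable_supp f x (r M : R) : 0 < r -> measurable_fun setT f ->
  (forall z, ball x r z -> `|f z| <= M) -> (forall z, ~ ball x r z -> f z = 0) ->
  mu.-integrable setT (EFin \o f).
Proof.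
move=> r0 mf fM f0; apply/integrableP; split; first exact/measurable_EFinP.
exact: (le_lt_trans (le_integral_supp r0 mf fM f0) (ltry _)).
Qed.

Lemma normr_Rintegral_supp f x (r M : R) : 0 < r -> measurable_fun setT f ->
  (forall z, ball x r z -> `|f z| <= M) -> (forall z, ~ ball x r z -> f z = 0) ->
  `|\int[mu]_z f z| <= M * (r *+ 2) ^+ n.
Proof.
move=> r0 mf fM f0; rewrite -lee_fin EFin_normr_Rintegral//; last exact: integrable_supp fM f0.
apply: le_trans (le_abse_integral _ _ _) _ => //; first exact/measurable_EFinP.
exact: (le_integral_supp r0 mf fM f0).
Qed.

Lemma Rintegral_translation v f : measurable_fun setT f ->
  \int[mu]_x f (x + v) = \int[mu]_x f x.
Proof.
move=> mf; rewrite /Rintegral; congr fine; rewrite integralE [RHS]integralE.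
have m1 := measurable_funepos ((measurable_EFinP _ _).2 mf).
have m2 := measurable_funeneg ((measurable_EFinP _ _).2 mf).
rewrite -(integral_rV_translation v m1)// -(integral_rV_translation v m2)//.
congr (_ - _)%E; apply: eq_integral => x _.
  exact: (congr1 (fun h => h x) (funepos_comp (EFin \o f) (fun x : 'rV[R]_n => x + v))).
exact: (congr1 (fun h => h x) (funeneg_comp (EFin \o f) (fun x : 'rV[R]_n => x + v))).
Qed.

Lemma integrable_translation v f : mu.-integrable setT (EFin \o f) ->
  mu.-integrable setT (EFin \o (fun x => f (x + v))).
Proof.
move=> /integrableP[/measurable_EFinP mf foo]; apply/integrableP; split.
  apply/measurable_EFinP; apply: measurableT_comp => //.
  exact: measurable_rVD.
rewrite (integral_rV_translation v (f := fun x => `|(f x)%:E|%E))//.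
by apply: measurableT_comp => //; exact/measurable_EFinP.
Qed.

Lemma Rdominated_cvg (F : nat -> 'rV[R]_n -> R) f g :
  (forall k, measurable_fun setT (F k)) -> measurable_fun setT f ->
  {ae mu, forall x, F ^~ x @ \oo --> f x} ->
  mu.-integrable setT (EFin \o g) -> {ae mu, forall x k, `|F k x| <= g x} ->
  (fun k => \int[mu]_x F k x) @ \oo --> \int[mu]_x f x.
Proof.
move=> mF mf Ff ig Fg.
have [||||H1 _ H3] := @dominated_convergence _ _ _ mu setT measurableT
    (fun k => EFin \o F k) (EFin \o f) (EFin \o g) _ _ _ ig _.
- by move=> k; exact/measurable_EFinP.
- exact/measurable_EFinP.
- by apply: filterS Ff => x Fx _; apply: cvg_EFin => //; exact: nearW.
- by apply: filterS Fg => x Fx k _; rewrite lee_fin.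
apply: fine_cvg; rewrite fineK//; exact: integrable_fin_num.
Qed.

Lemma dominated_cvg_sqr (F : nat -> 'rV[R]_n -> R) f x (r M : R) : 0 < r ->
  (forall k, measurable_fun setT (F k)) -> measurable_fun setT f ->
  {ae mu, forall z, F ^~ z @ \oo --> f z} ->
  {ae mu, forall z k, `|F k z - f z| <= M} ->
  (forall z k, ~ ball x r z -> F k z - f z = 0) ->
  (fun k => \int[mu]_z ((F k z - f z) ^+ 2)%:E)%E @ \oo --> 0%E.
Proof.
move=> r0 mF mf Ff FM F0.
have [|||||_ _ H3] := @dominated_convergence _ _ _ mu setT measurableT
    (fun k => EFin \o (fun z => (F k z - f z) ^+ 2)) (cst 0%E)
    (EFin \o (fun z => M ^+ 2 * \1_(ball x r) z)) _ _ _ _ _.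
- by move=> k; apply/measurable_EFinP; apply: measurable_funX; exact: measurable_funB.
- exact: measurable_cst.
- apply: filterS Ff => z Fz _; apply: cvg_EFin; first by exact: nearW.
  rewrite /comp /= -[X in _ --> X](expr0n R 2) -[X in X ^+ _](subrr (f z)) expr2.
  under eq_fun do rewrite expr2.
  by apply: cvgM; apply: cvgB => //; exact: cvg_cst.
- apply: (@integrable_supp _ x r (M ^+ 2)) => //.
  + by apply: measurable_funM => //; apply: measurable_indic; exact: measurable_rV_ball.
  + by move=> z zB; rewrite indicE mem_set// mulr1 ger0_norm ?sqr_ge0.
  + by move=> z zB; rewrite indicE memNset// mulr0.
- apply: filterS FM => z Fz k _; rewrite lee_fin /= ger0_norm ?sqr_ge0// indicE.
  have [zB|zB] := pselect (ball x r z); last by rewrite F0// expr0n mulr_ge0// sqr_ge0.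
  rewrite (mem_set zB) mulr1 -[leLHS]ger0_norm ?sqr_ge0// normrX.
  by rewrite lerXn2r ?nnegrE// (le_trans _ (Fz k)).
by move: H3; rewrite integral0.
Qed.

End integral_tools.

Section parametric_kernel.
Context {R : realType} {n : nat}.
Local Notation mu := (lebesgue_rV R n).
Implicit Types (psi A s : 'rV[R]_n -> R) (x v : 'rV[R]_n).

(** Vanishing is required on an open set only, so that it passes to the partial derivatives. *)
Definition bump psi := smooth psi /\ forall x, 1 < `|x| -> psi x = 0.

Lemma open_norm_gt1 : open [set x : 'rV[R]_n | 1 < `|x|].
Proof.
apply: (@open_comp _ _ (fun x : 'rV[R]_n => `|x|) [set y | 1 < y]); last exact: open_gt.
by move=> x _; exact: norm_continuous.
Qed.

Lemma bump_partial psi j : bump psi -> bump (partial j psi).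
Proof.
move=> [sp p0]; split; first by move=> s x; rewrite -foldr_rcons; exact: sp.
move=> x x1; exact: (near0_partial _ open_norm_gt1).
Qed.

Lemma bump_continuous psi : bump psi -> continuous psi.
Proof.
by move=> [sp _] x; apply: differentiable_continuous; exact: (sp [::]).
Qed.

Lemma bump_measurable psi : bump psi -> measurable_fun setT psi.
Proof.
move=> bp; apply: continuous_measurable_rV => [|x _]; first exact: openT.
exact: bump_continuous.
Qed.

Lemma continuous_bounded_ball psi x (r : R) : continuous psi ->
  exists B : R, forall z, `|z - x| <= r -> `|psi z| <= B.
Proof.
move=> cp; pose K := [set z : 'rV[R]_n | `|z - x| <= r].
have cK : compact K.
  apply: bounded_closed_compact.
    exists (r + `|x|); split; first exact: num_real.
    move=> y ry z /= zx; have := ler_normD (z - x) x; rewrite subrK => /le_trans; apply.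
    by apply: le_trans (ltW ry); rewrite lerD2r.
  apply: (@closed_comp _ _ (fun z : 'rV[R]_n => `|z - x|) [set y | y <= r]); last exact: closed_le.
  move=> z _; apply: continuous_comp; last exact: norm_continuous.
  by apply: continuousB => //; exact: cst_continuous.
have [M [_ HM]] : bounded_set (psi @` K).
  by apply: compact_bounded; apply: continuous_compact => //; exact: continuous_subspaceT.
exists (M + 1) => z zx; apply: (HM (M + 1)); [clear; lra|by exists z].
Qed.

Lemma bump_bounded psi : bump psi -> exists2 B : R, 0 <= B & forall x, `|psi x| <= B.
Proof.
move=> bp; have [B HB] := continuous_bounded_ball 0 1 (bump_continuous bp).
exists `|B| => // x; have [x1|x1] := leP `|x| 1.
  by apply: le_trans (ler_norm _); apply: HB; rewrite subr0.
by rewrite bp.2// normr0.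
Qed.

(** The radius is taken at the integration variable [z] and not at [x]: differentiation in [x] then
    falls on [psi] alone, [s] and [A] need not be differentiable, and each derivative raises the
    exponent [e] by one. *)
Definition Kint psi e s A x : R :=
  \int[mu]_z (psi ((s z)^-1 *: (x - z)) * (s z)^-1 ^+ e * A z).

Section local.
Variables (psi s A : 'rV[R]_n -> R) (e : nat) (x0 : 'rV[R]_n) (rho r s0 M : R).
Hypotheses (bp : bump psi) (e0 : (0 < e)%N) (rho0 : 0 < rho) (r0 : 0 < r)
  (s00 : 0 < s0) (ms : measurable_fun setT s) (mA : measurable_fun setT A).
Hypothesis far : forall h z, `|h| < rho -> ~ ball x0 r z ->
  s z = 0 \/ 1 < `|(s z)^-1 *: (x0 + h - z)|.
Hypothesis near_s : forall z, ball x0 r z -> s0 <= s z.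
Hypothesis near_A : forall z, ball x0 r z -> `|A z| <= M.

Let k (p : 'rV[R]_n -> R) m x z := p ((s z)^-1 *: (x - z)) * (s z)^-1 ^+ m * A z.

Let M0 : 0 <= M.
Proof. by apply: le_trans (near_A (ballxx _ r0)). Qed.

Let mk p m x : bump p -> measurable_fun setT (k p m x).
Proof.
move=> bp'; have mV : measurable_fun setT (fun z => (s z)^-1).
  exact: (measurableT_comp (f := fun y : R => y^-1) (@measurable_inv R) ms).
apply: measurable_funM => //; apply: measurable_funM; last exact: measurable_funX.
apply: (measurableT_comp (bump_measurable bp')).
apply: measurable_rVZ => //; apply: measurable_rVD => //; exact: measurable_rVN.
Qed.

Let k_far p m h z : bump p -> (0 < m)%N -> `|h| < rho -> ~ ball x0 r z -> k p m (x0 + h) z = 0.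
Proof.
move=> [_ p0] m0 hr zB; rewrite /k; have [->|/p0 ->] := far hr zB; last by rewrite !mul0r.
(* Where [s z = 0] the inverse is 0 by convention, and so is its power as the exponent is
   positive. *)
by rewrite invr0 expr0n; case: m m0 => // m _; rewrite mulr0 mul0r.
Qed.

Let sV z : ball x0 r z -> 0 <= (s z)^-1 <= s0^-1.
Proof.
move=> zB; have sz := near_s zB; have sz0 := lt_le_trans s00 sz.
by rewrite invr_ge0 ltW//= lef_pV2 ?posrE.
Qed.

Let ik p m h : bump p -> (0 < m)%N -> `|h| < rho ->
  mu.-integrable setT (EFin \o k p m (x0 + h)).
Proof.
move=> bp' m0 hr; have [B B0 pB] := bump_bounded bp'.
apply: (@integrable_supp _ _ _ x0 r (B * s0^-1 ^+ m * M)) => //.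
- exact: mk.
- move=> z zB; have /andP[h1 h2] := sV zB; rewrite /k !normrM.
  apply: ler_pM => //; last exact: near_A.
  apply: ler_pM => //; rewrite normrX ger0_norm// lerXn2r ?nnegrE//.
  by rewrite invr_ge0 ltW.
- by move=> z; exact: k_far.
Qed.

(** Differentiation under the integral sign: the second order remainder of [psi] is integrated over
    [ball x0 r], outside which every kernel involved vanishes for all [|h| < rho]. *)
Lemma Kint_remainder : exists2 B : R, 0 <= B & forall h, `|h| < rho ->
  `|Kint psi e s A (x0 + h) - Kint psi e s A x0 -
    rV_lin (fun j => Kint (partial j psi) e.+1 s A x0) h| <= B * `|h| ^+ 2.
Proof.
have bp2 i j : bump (partial i (partial j psi)) by do 2 apply: bump_partial.
have [B B0 pB] : exists2 B : R, 0 <= B & forall i j x, `|partial i (partial j psi) x| <= B.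
  have H (p : 'I_n * 'I_n) : {B : R | 0 <= B & forall x, `|partial p.1 (partial p.2 psi) x| <= B}.
    exact/cid2/bump_bounded.
  exists (\sum_p s2val (H p)); first by apply: sumr_ge0 => p _; case: (H p).
  move=> i j x; rewrite (bigD1 (i, j))//=; case: (H (i, j)) => /= b b0 Hb.
  by apply: ler_wpDr (Hb x); apply: sumr_ge0 => p _; case: (H p).
pose C := n%:R * (n%:R * B) * s0^-1 ^+ 2 * s0^-1 ^+ e * M.
exists (C * (r *+ 2) ^+ n).
  by rewrite !(mulr_ge0, exprn_ge0)// ?invr_ge0 ?mulrn_wge0// ltW.
move=> h hr.
have h0 : `|0 : 'rV[R]_n| < rho by rewrite normr0.
pose q z := k psi e (x0 + h) z - k psi e x0 z - \sum_j h 0 j * k (partial j psi) e.+1 x0 z.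
have ik0 p m : bump p -> (0 < m)%N -> mu.-integrable setT (EFin \o k p m x0).
  by move=> bp' m0; have := ik bp' m0 h0; rewrite addr0.
have -> : Kint psi e s A (x0 + h) - Kint psi e s A x0 -
    rV_lin (fun j => Kint (partial j psi) e.+1 s A x0) h = \int[mu]_z q z.
  rewrite /q RintegralB//; last first.
  - rewrite (_ : _ \o _ = fun z => \sum_j (h 0 j * k (partial j psi) e.+1 x0 z)%:E)%E; last first.
      by apply/funext => z /=; rewrite sumEFin.
    apply: integrable_sum => // j _; apply: (@integrableZl _ _ _ _ _ _ _ (EFin \o k (partial j psi) e.+1 x0)) => //.
    by apply: ik0 => //; exact: bump_partial.
  - apply: (@integrableB _ _ _ _ _ _ (EFin \o k psi e (x0 + h)) (EFin \o k psi e x0)) => //; first exact: ik.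
    exact: ik0.
  rewrite RintegralB//; [|exact: ik|exact: ik0].
  congr (_ - _ - _); rewrite /rV_lin /Rintegral.
  under [in RHS]eq_integral do rewrite -sumEFin.
  rewrite integral_sum//; last first.
    move=> j; apply: (@integrableZl _ _ _ _ _ _ _ (EFin \o k (partial j psi) e.+1 x0)) => //.
    by apply: ik0 => //; exact: bump_partial.
  rewrite -sum_fine; last first.
    move=> j _; apply: integrable_fin_num => //.
    apply: (@integrableZl _ _ _ _ _ _ _ (EFin \o k (partial j psi) e.+1 x0)) => //.
    by apply: ik0 => //; exact: bump_partial.
  apply: eq_bigr => j _; rewrite -RintegralZl//.
  by apply: ik0 => //; exact: bump_partial.
have mq : measurable_fun setT q.
  apply: measurable_funB; first by apply: measurable_funB; exact: mk.
  rewrite (_ : (fun z => _) = \sum_j (fun z => h 0 j * k (partial j psi) e.+1 x0 z)); last first.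
    by apply/funext => z; rewrite fct_sumE.
  elim/big_ind: _ => [|f g mf mg|j _]; [exact: measurable_cst|exact: measurable_funD|].
  by apply: measurable_funM => //; apply: mk; exact: bump_partial.
rewrite mulrAC; apply: (@normr_Rintegral_supp _ _ _ x0) => // z zB; last first.
  rewrite /q k_far// -[x0 in k psi e x0 z]addr0 k_far// big1 ?subr0// => j _.
  by rewrite -[x0]addr0 k_far ?mulr0//; exact: bump_partial.
have /andP[V0 V1] := sV zB.
(* The factor [(s z)^-1] of the increment accounts for the exponent [e.+1] in the kernels of the
   partial derivatives. *)
have -> : q z = (psi ((s z)^-1 *: (x0 - z) + (s z)^-1 *: h) - psi ((s z)^-1 *: (x0 - z)) -
    rV_lin (fun j => partial j psi ((s z)^-1 *: (x0 - z))) ((s z)^-1 *: h)) * (s z)^-1 ^+ e * A z.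
  rewrite /q /k -scalerDr [x0 + h - z]addrAC.
  have E3 (a b c e1 a1 : R) : (a - b - c) * e1 * a1 = a * e1 * a1 - b * e1 * a1 - c * e1 * a1.
    by ring.
  rewrite E3; congr (_ - _).
  rewrite linearZ /= /rV_lin mulr_sumr !mulr_suml; apply: eq_bigr => j _.
  by rewrite exprS; ring.
rewrite !normrM; apply: (@le_trans _ _ (n%:R * (n%:R * B) * `|(s z)^-1 *: h| ^+ 2 * s0^-1 ^+ e * M)).
  apply: ler_pM => //.
  - apply: ler_pM => //; first by apply: quadratic_remainder => // [x|j x];
      [exact: (bp.1 [::])|exact: ((bump_partial j bp).1 [::])].
    by rewrite normrX ger0_norm// lerXn2r ?nnegrE// invr_ge0 ltW.
  - exact: near_A.
have E0 : 0 <= s0^-1 ^+ e by rewrite exprn_ge0// invr_ge0 ltW.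
have hh : `|(s z)^-1 *: h| ^+ 2 <= s0^-1 ^+ 2 * `|h| ^+ 2.
  rewrite normrZ exprMn ger0_norm// ler_wpM2r ?exprn_ge0// lerXn2r ?nnegrE//.
  by rewrite invr_ge0 ltW.
rewrite (_ : C * `|h| ^+ 2 =
  n%:R * (n%:R * B) * (s0^-1 ^+ 2 * `|h| ^+ 2) * s0^-1 ^+ e * M); last by rewrite /C; ring.
by rewrite ler_wpM2r// ler_wpM2r// ler_wpM2l// !mulr_ge0.
Qed.

Lemma differentiable_Kint : differentiable (Kint psi e s A) x0.
Proof.
have [B B0 H] := Kint_remainder.
by have [] := differentiable_quadratic rho0 B0 H.
Qed.

Lemma partial_Kint j : partial j (Kint psi e s A) x0 = Kint (partial j psi) e.+1 s A x0.
Proof. by have [B B0 H] := Kint_remainder; rewrite (partial_quadratic rho0 B0 H). Qed.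

End local.
End parametric_kernel.

(** * Weak derivatives and mollification *)

Section weak_derivative.
Context {R : realType} {n : nat}.
Local Notation mu := (lebesgue_rV R n).
Implicit Types (u f G : 'rV[R]_n -> R) (x v : 'rV[R]_n) (N : set 'rV[R]_n).

Definition lip_off N (M : R) u :=
  forall x y, ~ N x -> ~ N y -> `|u x - u y| <= M * `|x - y|.

Lemma null_translation N v : measurable N -> mu N = 0%E ->
  measurable [set x | N (x + v)] /\ mu [set x | N (x + v)] = 0%E.
Proof.
move=> mN N0; have mN' : measurable [set x | N (x + v)].
  by rewrite -[X in measurable X]setTI; apply: (measurable_rVD (g := fun=> v)).
split=> //; have := integral_indic mu measurableT mN'.
rewrite setIT => <-; rewrite -[RHS]N0 -[in RHS](setIT N) -(integral_indic mu measurableT mN).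
rewrite -(integral_rV_translation v (f := fun x => (\1_N x)%:E))//.
by apply/measurable_EFinP; exact: measurable_indic.
Qed.

Lemma derive_seq f x v (t : nat -> R) : (forall k, t k != 0) -> t @ \oo --> (0 : R) ->
  derivable f x v -> (fun k => (t k)^-1 * (f (x + t k *: v) - f x)) @ \oo --> 'D_v f x.
Proof.
move=> tn0 t0 dv.
have t0' : t @ \oo --> (0 : R)^'.
  move=> P P0; have H : \forall k \near \oo, (t k != 0 -> P (t k)) by exact: (t0 _ P0).
  suff : \forall k \near \oo, P (t k) by [].
  by apply: filterS H => k; apply; exact: tn0.
have := cvg_comp _ _ t0' dv; apply: cvg_trans.
by apply: near_eq_cvg; apply: nearW => k /=; rewrite [x + _]addrC.
Qed.

Lemma norm_delta_mx_le j : `|delta_mx 0 j : 'rV[R]_n| <= 1.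
Proof.
apply: rV_norm_le => // i; rewrite mxE eqxx /=.
by case: (i == j); rewrite ?normr1// normr0.
Qed.

(** Discrete integration by parts: a translation moves the difference quotient from [f] to [u], and
    dominated convergence is applied on both sides, the quotients of [u] being bounded by the
    Lipschitz constant off a null set. *)
Lemma weak_derivative_lip u f G fj N x0 (r M Mu Bf : R) j :
  measurable N -> mu N = 0%E -> measurable_fun setT u -> measurable_fun setT f ->
  measurable_fun setT G -> measurable_fun setT fj -> 0 < r ->
  (forall x, ~ ball x0 r x -> u x = 0) -> (forall x, `|u x| <= Mu) -> lip_off N M u ->
  (forall x, ~ N x -> derivable u x (delta_mx 0 j) /\ 'D_(delta_mx 0 j) u x = G x) ->
  (forall x, `|f x| <= Bf) -> (forall x y, `|f x - f y| <= Bf * `|x - y|) ->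
  (forall x, derivable f x (delta_mx 0 j) /\ 'D_(delta_mx 0 j) f x = fj x) ->
  \int[mu]_x (u x * fj x) = - \int[mu]_x (G x * f x).
Proof.
move=> mN N0 mu_ mf mG mfj r0 u0 uM uL uG fB fL fj'.
pose e : 'rV[R]_n := delta_mx 0 j; pose t (k : nat) : R := k.+1%:R^-1.
have e1 : `|e| <= 1 := norm_delta_mx_le j.
have tk0 k : 0 < t k by rewrite invr_gt0.
have tk1 k : t k <= 1 by rewrite invf_le1// ler1n.
have t0 : t @ \oo --> (0 : R) by exact: cvg_harmonic.
have Mu0 : 0 <= Mu := le_trans (normr_ge0 _) (uM 0).
have Bf0 : 0 <= Bf := le_trans (normr_ge0 _) (fB 0).
have mtr (g : 'rV[R]_n -> R) v : measurable_fun setT g -> measurable_fun setT (fun x : 'rV[R]_n => g (x + v)).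
  by move=> mg; apply: measurableT_comp => //; exact: measurable_rVD.
pose F1 k x := u x * ((t k)^-1 * (f (x + t k *: e) - f x)).
pose F2 k x := (t k)^-1 * (u x - u (x - t k *: e)) * f x.
have mF1 k : measurable_fun setT (F1 k).
  apply: measurable_funM => //; apply: measurable_funM => //.
  by apply: measurable_funB => //; exact: mtr.
have mF2 k : measurable_fun setT (F2 k).
  apply: measurable_funM => //; apply: measurable_funM => //.
  by apply: measurable_funB => //; exact: mtr.
have iu (g : 'rV[R]_n -> R) (B : R) : measurable_fun setT g -> (forall x, `|g x| <= B) ->
    mu.-integrable setT (EFin \o (fun x => u x * g x)).
  move=> mg gB; apply: (@integrable_supp _ _ _ x0 r (Mu * B)) => //.
  - exact: measurable_funM.
  - by move=> z _; rewrite normrM ler_pM.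
  - by move=> z /u0 ->; rewrite mul0r.
have E12 k : \int[mu]_x F1 k x = - \int[mu]_x F2 k x.
  pose a := \int[mu]_x (u x * f x); pose b := \int[mu]_x (u x * f (x + t k *: e)).
  have i1 := iu f Bf mf fB.
  have i2 : mu.-integrable setT (EFin \o (fun x => u x * f (x + t k *: e))).
    by apply: (iu _ Bf) => //; exact: mtr.
  have -> : \int[mu]_x F1 k x = (t k)^-1 * (b - a).
    rewrite -RintegralB// -RintegralZl//; last first.
      exact: (integrableB measurableT i2 i1).
    by apply: eq_Rintegral => x _; rewrite /F1; ring.
  have bE : b = \int[mu]_x (u (x - t k *: e) * f x).
    rewrite /b -(Rintegral_translation (- (t k *: e))).
      by apply: eq_Rintegral => x _; rewrite subrK.
    by apply: measurable_funM => //; exact: mtr.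
  have i3 : mu.-integrable setT (EFin \o (fun x => u (x - t k *: e) * f x)).
    have := integrable_translation (- (t k *: e)) i2.
    by apply: eq_integrable => // x _ /=; rewrite subrK.
  have -> : \int[mu]_x F2 k x = (t k)^-1 * (a - b).
    rewrite bE -RintegralB// -RintegralZl//; last first.
      exact: (integrableB measurableT i1 i3).
    by apply: eq_Rintegral => x _; rewrite /F2; ring.
  by rewrite -mulrN opprB.
have c1 : (fun k => \int[mu]_x F1 k x) @ \oo --> \int[mu]_x (u x * fj x).
  apply: (@Rdominated_cvg _ _ F1 _ (fun x => Mu * Bf * \1_(ball x0 r) x)) => //.
  - exact: measurable_funM.
  - apply: aeW => x; apply: cvgM; first exact: cvg_cst.
    have [d1 <-] := fj' x; apply: derive_seq => // k; by rewrite gt_eqF.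
  - apply: (@integrable_supp _ _ _ x0 r (Mu * Bf)) => //.
    + by apply: measurable_funM => //; apply: measurable_indic; exact: measurable_rV_ball.
    + by move=> z zB; rewrite indicE mem_set// mulr1 ger0_norm ?mulr_ge0.
    + by move=> z zB; rewrite indicE memNset// mulr0.
  - apply: aeW => x k; rewrite indicE.
    have [xB|xB] := pselect (ball x0 r x); last first.
      by rewrite /F1 u0// mul0r normr0 mulr_ge0// mulr_ge0.
    rewrite (mem_set xB) mulr1 normrM ler_pM// normrM gtr0_norm ?invr_gt0//.
    rewrite ler_pdivrMl//; apply: le_trans (fL _ _) _.
    rewrite addrAC subrr add0r normrZ gtr0_norm// mulrC ler_wpM2r//.
    by rewrite ler_piMr// ltW.
have c2 : (fun k => \int[mu]_x F2 k x) @ \oo --> \int[mu]_x (G x * f x).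
  (* The Lipschitz bound needs both ends [x] and [x - t k *: e] off [N], for every [k]. *)
  pose N' := N `|` \bigcup_k [set x | N (x - t k *: e)].
  have nN' : mu.-negligible N'.
    apply: negligibleU; first by exists N; split.
    apply: negligible_bigcup => k; exists [set x | N (x - t k *: e)].
    by have [] := null_translation (- (t k *: e)) mN N0; split.
  have aeN' (P : 'rV[R]_n -> Prop) : (forall x, ~ N' x -> P x) -> {ae mu, forall x, P x}.
    by move=> H; apply: negligibleS nN' => x /= nP; apply: contrapT => /H.
  (* As [t k <= 1], off the ball of radius [r + 1] both [u] and its translate vanish. *)
  apply: (@Rdominated_cvg _ _ F2 _ (fun x => M * Bf * \1_(ball x0 (r + 1)) x)) => //.
  - exact: measurable_funM.
  - apply: aeN' => x nN; apply: cvgM; last exact: cvg_cst.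
    have [d1 <-] : derivable u x e /\ 'D_e u x = G x.
      by apply: uG => xN; apply: nN; left.
    have Nt0 k : - t k != 0 by rewrite oppr_eq0 gt_eqF.
    have Nt : (fun k => - t k) @ \oo --> (0 : R).
      by rewrite -[X in _ --> X]oppr0; exact: cvgN.
    have := derive_seq Nt0 Nt d1; apply: cvg_trans.
    by apply: near_eq_cvg; apply: nearW => k /=; rewrite invrN scaleNr; ring.
  - apply: (@integrable_supp _ _ _ x0 (r + 1) `|M * Bf|) => //; first lra.
    + by apply: measurable_funM => //; apply: measurable_indic; exact: measurable_rV_ball.
    + by move=> z zB; rewrite indicE mem_set// mulr1.
    + by move=> z zB; rewrite indicE memNset// mulr0.
  - apply: aeN' => x nN k; rewrite indicE.
    have nNx : ~ N x by move=> xN; apply: nN; left.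
    have nNk : ~ N (x - t k *: e) by move=> xN; apply: nN; right; exists k.
    have kx : `|x - (x - t k *: e)| <= t k.
      rewrite opprB addrC subrK normrZ gtr0_norm// -[leRHS]mulr1; by rewrite ler_wpM2l// ltW.
    have [xB|xB] := pselect (ball x0 (r + 1) x); last first.
      rewrite /F2 !u0 ?subrr ?mulr0 ?mul0r ?normr0 ?memNset ?mulr0//.
        rewrite -ball_normE /= => h; apply: xB; rewrite -ball_normE /=.
        apply: le_lt_trans (ler_distD (x - t k *: e) _ _) _.
        rewrite ltr_leD// [`|x - t k *: e - x|]distrC; exact: le_trans kx (tk1 k).
      by move=> h; apply: xB; apply: le_ball h; rewrite lerDl.
    rewrite (mem_set xB) mulr1 normrM ler_pM// normrM gtr0_norm ?invr_gt0//.
    rewrite ler_pdivrMl//; apply: le_trans (uL _ _ nNx nNk) _.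
    have M0 : 0 <= M * `|x - (x - t k *: e)| by apply: le_trans (uL _ _ nNx nNk).
    (* The sign of [M] is not assumed; a negative [M] would force the two points to coincide,
       against [t k > 0]. *)
    rewrite mulrC; have [M0'|M0'] := leP 0 M; first exact: ler_wpM2r.
    move: M0; rewrite nmulr_rge0// => h.
    have /normr0_eq0/eqP : `|x - (x - t k *: e)| = 0 by apply/eqP; rewrite eq_le h normr_ge0.
    rewrite opprB addrC subrK => /eqP E.
    have : t k *: e = 0 by [].
    move=> /eqP; rewrite scaler_eq0 gt_eqF//= => /eqP /matrixP/(_ 0 j).
    by rewrite /e !mxE !eqxx => /eqP; rewrite oner_eq0.
have c1' : (fun k => \int[mu]_x F1 k x) @ \oo --> - \int[mu]_x (G x * f x).
  by under eq_fun do rewrite E12; exact: cvgN.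
exact: (cvg_unique _ c1 c1').
Qed.


Section mollifier.
Variable eta : 'rV[R]_n -> R.
Hypotheses (n0 : (0 < n)%N) (beta : bump eta) (eta0 : forall x, 0 <= eta x)
  (etapos : exists2 c, 0 < c & forall x, `|x| <= 2^-1 -> c <= eta x).

(** The integral of [eta] is not prescribed; mollification divides by this mass, which is the same
    at every point by [mollmassE]. *)
Definition mollmass (s : R) := Kint eta n (cst s) (cst 1) 0.

Definition moll (s : R) u x := (mollmass s)^-1 * Kint eta n (cst s) u x.

Let ker s x z := eta (s^-1 *: (x - z)) * s^-1 ^+ n.

Let ker_ge0 s x z : 0 < s -> 0 <= ker s x z.
Proof. by move=> s0; rewrite mulr_ge0// exprn_ge0// invr_ge0 ltW. Qed.

Let ker_far s x z : 0 < s -> s < `|x - z| -> ker s x z = 0.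
Proof.
move=> s0 xz; rewrite /ker beta.2 ?mul0r// normrZ gtr0_norm ?invr_gt0//.
by rewrite ltr_pdivlMl// mulr1.
Qed.

Let mker s x : measurable_fun setT (ker s x).
Proof.
apply: measurable_funM => //; apply: (measurableT_comp (bump_measurable beta)).
apply: measurable_rVZ => //; apply: measurable_rVD => //; exact: measurable_rVN.
Qed.

Let iker s x u (M : R) : 0 < s -> measurable_fun setT u -> (forall z, `|u z| <= M) ->
  mu.-integrable setT (EFin \o (fun z => ker s x z * u z)).
Proof.
move=> s0 mu_ uM; have [B B0 pB] := bump_bounded beta.
apply: (@integrable_supp _ _ _ x (s + s) (B * s^-1 ^+ n * M)) => //; first lra.
- exact: measurable_funM.
- move=> z _; rewrite !normrM !ler_pM// ger0_norm// exprn_ge0// invr_ge0 ltW//.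
- move=> z; rewrite -ball_normE /= => /negP; rewrite -leNgt => h.
  by rewrite ker_far ?mul0r//; lra.
Qed.

Lemma mollmassE s x : Kint eta n (cst s) (cst 1) x = mollmass s.
Proof.
rewrite /mollmass /Kint -(Rintegral_translation x); last first.
  apply: measurable_funM => //; exact: mker.
by apply: eq_Rintegral => z _ /=; rewrite sub0r opprD addrCA subrr addr0.
Qed.

Lemma mollmass_gt0 s : 0 < s -> 0 < mollmass s.
Proof.
move=> s0; have [c c0 Hc] := etapos.
have mB : measurable (ball (0 : 'rV[R]_n) (s / 2)) by exact: measurable_rV_ball.
have iB : mu.-integrable setT (EFin \o \1_(ball (0 : 'rV[R]_n) (s / 2))).
  apply: (@integrable_supp _ _ _ 0 (s / 2) 1) => //; first lra.
  - by move=> z zB; rewrite indicE mem_set// normr1.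
  - by move=> z zB; rewrite indicE memNset.
apply: (@lt_le_trans _ _ (\int[mu]_z (c * s^-1 ^+ n * \1_(ball (0 : 'rV[R]_n) (s / 2)) z))).
  rewrite RintegralZl//.
  rewrite /Rintegral integral_indic// setIT.
  rewrite [X in fine X](_ : _ = ((s / 2 *+ 2) ^+ n)%:E); last by apply: lebesgue_rV_ball; lra.
  by rewrite /= !mulr_gt0// exprn_gt0// ?invr_gt0// mulrn_wgt0//; lra.
apply: le_Rintegral => //.
- exact: (@integrableZl _ _ _ _ _ measurableT (c * s^-1 ^+ n) _ iB).
- by apply: (@iker s 0 (cst 1) 1) => // z; rewrite normr1.
move=> z _; rewrite indicE mulr1 /=.
have [zB|zB] := pselect (ball (0 : 'rV[R]_n) (s / 2) z); last first.
  by rewrite (memNset zB) mulr0; apply: (ker_ge0 0 z s0).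
rewrite (mem_set zB) mulr1 ler_wpM2r//; first by rewrite exprn_ge0// invr_ge0 ltW.
apply: Hc; rewrite sub0r normrZ normrN gtr0_norm ?invr_gt0// ler_pdivrMl//.
by move: zB; rewrite -ball_normE /= sub0r normrN => /ltW.
Qed.

(** A weighted mean of values within [M] of [a] is within [M] of [a]. Uniform bounds, convergence
    and exact reproduction of constants by mollification are all instances. *)
Lemma moll_avg s u x (a M Mu : R) N : 0 < s -> measurable_fun setT u ->
  measurable N -> mu N = 0%E -> (forall z, `|u z| <= Mu) -> 0 <= M ->
  (forall z, ~ N z -> `|z - x| <= s -> `|u z - a| <= M) -> `|moll s u x - a| <= M.
Proof.
move=> s0 mu_ mN N0 uM M0 H.
(* Giving the value [a] on the null set [N] makes the bound hold everywhere without changing the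
   integral. *)
pose u' z := u z * \1_(~` N) z + a * \1_N z.
have u'N z : N z -> u' z = a.
  by move=> zN; rewrite /u' !indicE (mem_set zN) memNset ?mulr0 ?add0r ?mulr1//; exact.
have u'nN z : ~ N z -> u' z = u z.
  by move=> zN; rewrite /u' !indicE (memNset zN) mem_set// mulr0 addr0 mulr1.
have mu' : measurable_fun setT u'.
  by apply: measurable_funD; apply: measurable_funM => //; apply: measurable_indic => //; exact: measurableC.
have u'M z : `|u' z| <= `|a| + Mu.
  have [zN|zN] := pselect (N z); first by rewrite u'N// lerDl (le_trans _ (uM z)).
  by rewrite u'nN//; apply: le_trans (uM z) _; rewrite lerDr.
have E : Kint eta n (cst s) u x = Kint eta n (cst s) u' x.
  rewrite /Kint /Rintegral; congr fine; apply: ae_eq_integral => //.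
  - by apply/measurable_EFinP; apply: measurable_funM => //; exact: mker.
  - by apply/measurable_EFinP; apply: measurable_funM => //; exact: mker.
  - exists N; split => // z /= nz; apply: contrapT => zN; apply: nz => _.
    by rewrite u'nN.
have c0 := mollmass_gt0 s0.
have i1 := iker x s0 mu' u'M.
have i2 : mu.-integrable setT (EFin \o (fun z => ker s x z * a)).
  by apply: (@iker s x (cst a) `|a|).
rewrite /moll E -[X in _ - X](mulKf (lt0r_neq0 c0)) -mulrBr normrM gtr0_norm ?invr_gt0//.
rewrite ler_pdivrMl// -{1}(mollmassE s x).
have -> : Kint eta n (cst s) (cst 1) x * a = \int[mu]_z (ker s x z * a).
  rewrite mulrC -RintegralZl//; last by apply: (@iker s x (cst 1) 1) => // z; rewrite normr1.
  by apply: eq_Rintegral => z _; rewrite /ker /= mulr1 mulrC.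
rewrite -RintegralB//; apply: le_trans (le_normr_Rintegral _ _) _ => //.
  exact: (integrableB measurableT i1 i2).
rewrite -(mollmassE s x) mulrC -RintegralZl//; last by apply: (@iker s x (cst 1) 1) => // z; rewrite normr1.
apply: le_Rintegral => //.
- exact: (integrable_norm (integrableB measurableT i1 i2)).
- have := @integrableZl _ _ _ _ _ measurableT M _ (@iker s x (cst 1) 1 s0 (measurable_cst _) _).
  by apply => z; rewrite normr1.
move=> z _; rewrite -mulrBr normrM ger0_norm ?ker_ge0// /= mulr1 mulrC.
have [xz|xz] := ltP s `|x - z|; first by rewrite -/(ker s x z) ker_far// !mulr0.
rewrite ler_wpM2r ?ker_ge0//.
have [zN|zN] := pselect (N z); first by rewrite u'N// subrr normr0.
by rewrite u'nN//; apply: H => //; rewrite distrC.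
Qed.

Lemma moll_supp s u x : 0 < s -> (forall z, `|z - x| <= s -> u z = 0) -> moll s u x = 0.
Proof.
move=> s0 u0; rewrite /moll [Kint _ _ _ _ _](_ : _ = 0) ?mulr0//.
rewrite /Kint (@eq_Rintegral _ _ _ mu setT (cst 0)); first by rewrite Rintegral_cst ?mul0r.
move=> z _ /=; have [xz|xz] := ltP s `|x - z|.
  by rewrite -/(ker s x z) ker_far// mul0r.
by rewrite u0 ?mulr0// distrC.
Qed.

Let Kint_local p e s u (Mu : R) x : bump p -> (0 < e)%N -> 0 < s ->
  measurable_fun setT u -> (forall z, `|u z| <= Mu) ->
  differentiable (Kint p e (cst s) u) x /\
  forall j, partial j (Kint p e (cst s) u) x = Kint (partial j p) e.+1 (cst s) u x.
Proof.
move=> bp e0 s0 mu_ uM.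
have far h z : `|h| < s -> ~ ball x (s *+ 3) z ->
    cst s z = 0 \/ 1 < `|(cst s z)^-1 *: (x + h - z)|.
  rewrite -ball_normE /= => hs /negP; rewrite -leNgt => xz; right.
  rewrite normrZ gtr0_norm ?invr_gt0// ltr_pdivlMl// mulr1.
  have := ler_distD (x + h) x z; rewrite opprD addNKr normrN.
  move: (`|x + h - z|) => A; move: xz; rewrite !mulrS mulr0n; lra.
have s3 : 0 < s *+ 3 by rewrite mulrn_wgt0.
split; first by apply: (@differentiable_Kint _ _ p (cst s) u e x s (s *+ 3) s Mu).
by move=> j; apply: (@partial_Kint _ _ p (cst s) u e x s (s *+ 3) s Mu).
Qed.

Lemma smooth_Kint s u (Mu : R) : 0 < s -> measurable_fun setT u ->
  (forall z, `|u z| <= Mu) -> smooth (Kint eta n (cst s) u).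
Proof.
move=> s0 mu_ uM.
have bfold l : bump (foldr (@partial R n) eta l).
  by elim: l => [|j l IH] //=; exact: bump_partial.
suff E l : foldr (@partial R n) (Kint eta n (cst s) u) l =
    Kint (foldr (@partial R n) eta l) (size l + n)%N (cst s) u.
  move=> l x; rewrite E; have e0 : (0 < size l + n)%N by rewrite addn_gt0 n0 orbT.
  by have [] := Kint_local x (bfold l) e0 s0 mu_ uM.
elim: l => [|j l IH] //=; rewrite IH; apply/funext => x.
have e0 : (0 < size l + n)%N by rewrite addn_gt0 n0 orbT.
by have [_ ->] := Kint_local x (bfold l) e0 s0 mu_ uM.
Qed.

End mollifier.

End weak_derivative.

Section mollification.
Context {R : realType} {n : nat}.
Local Notation mu := (lebesgue_rV R n).
Implicit Types (u f G : 'rV[R]_n -> R) (x v : 'rV[R]_n) (N : set 'rV[R]_n).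
Variable eta : 'rV[R]_n -> R.
Hypotheses (n0 : (0 < n)%N) (beta : bump eta) (eta0 : forall x, 0 <= eta x)
  (etapos : exists2 c, 0 < c & forall x, `|x| <= 2^-1 -> c <= eta x).
Local Notation moll := (moll eta).

Lemma smoothZ (c : R) f : smooth f -> smooth (fun x => c * f x).
Proof.
move=> /Cn_smooth sf; apply/Cn_smooth => k.
suff -> : (fun x => c * f x) = cst c * f by apply: CnM => //; exact: Cn_cst.
by apply/funext.
Qed.

Lemma smooth_moll s u (Mu : R) : 0 < s -> measurable_fun setT u ->
  (forall z, `|u z| <= Mu) -> smooth (moll s u).
Proof. by move=> s0 mu_ uM; apply: smoothZ; exact: (smooth_Kint _ _ s0 mu_ uM). Qed.

Lemma smooth_continuous f : smooth f -> continuous f.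
Proof. by move=> sf x; apply: differentiable_continuous; exact: (sf [::]). Qed.

Lemma smooth_measurable f : smooth f -> measurable_fun setT f.
Proof.
move=> sf; apply: continuous_measurable_rV => [|x _]; [exact: openT|exact: smooth_continuous].
Qed.

Lemma smooth_partial f j : smooth f -> smooth (partial j f).
Proof. by move=> sf s x; rewrite -foldr_rcons; exact: sf. Qed.

(** The derivative of the kernel in [x] is minus its derivative in [z], so that
    [weak_derivative_lip], with the kernel as the second function, moves it onto [u]. *)
Lemma partial_moll s u G N x0 (r M Mu : R) j x : 0 < s ->
  measurable N -> mu N = 0%E -> measurable_fun setT u -> measurable_fun setT G -> 0 < r ->
  (forall x, ~ ball x0 r x -> u x = 0) -> (forall x, `|u x| <= Mu) -> lip_off N M u ->
  (forall x, ~ N x -> derivable u x (delta_mx 0 j) /\ 'D_(delta_mx 0 j) u x = G x) ->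
  partial j (moll s u) x = moll s G x.
Proof.
move=> s0 mN N0 mu_ mG r0 u0 uM uL uG.
pose p := partial j eta; pose e : 'rV[R]_n := delta_mx 0 j.
have bp : bump p by exact: bump_partial.
pose f z := eta (s^-1 *: (x - z)) * s^-1 ^+ n.
pose fj z := - (p (s^-1 *: (x - z)) * s^-1 ^+ n.+1).
have sV0 : 0 <= s^-1 by rewrite invr_ge0 ltW.
have mxz : measurable_fun setT (fun z : 'rV[R]_n => s^-1 *: (x - z)).
  by apply: measurable_rVZ => //; apply: measurable_rVD => //; exact: measurable_rVN.
have mf : measurable_fun setT f.
  by apply: measurable_funM => //; exact: (measurableT_comp (bump_measurable beta) mxz).
have mfj : measurable_fun setT fj.
  apply: measurableT_comp => //.
  by apply: measurable_funM => //; exact: (measurableT_comp (bump_measurable bp) mxz).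
have [B B0 etaB] := bump_bounded beta.
have [B' B'0 pB] : exists2 B' : R, 0 <= B' & forall i x, `|partial i eta x| <= B'.
  have H i : {b : R | 0 <= b & forall x, `|partial i eta x| <= b}.
    by apply/cid2/bump_bounded; exact: bump_partial.
  exists (\sum_i s2val (H i)); first by apply: sumr_ge0 => i _; case: (H i).
  move=> i y; rewrite (bigD1 i)//=; case: (H i) => /= b b0 Hb.
  by apply: ler_wpDr (Hb y); apply: sumr_ge0 => k _; case: (H k).
pose Bf := Num.max (B * s^-1 ^+ n) (n%:R * B' * s^-1 * s^-1 ^+ n).
have fB z : `|f z| <= Bf.
  rewrite le_max normrM [`|s^-1 ^+ n|]ger0_norm ?exprn_ge0//.
  by rewrite ler_wpM2r ?exprn_ge0.
have fL y z : `|f y - f z| <= Bf * `|y - z|.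
  rewrite /f -mulrBl normrM [`|s^-1 ^+ n|]ger0_norm ?exprn_ge0//.
  apply: (@le_trans _ _ (n%:R * B' * s^-1 * s^-1 ^+ n * `|y - z|)); last first.
    by rewrite ler_wpM2r// /Bf le_max lexx orbT.
  have := @rV_lipschitz_le _ _ eta (s^-1 *: (x - z)) (s^-1 *: (z - y)) B'
    (fun t _ => beta.1 [::] _) (fun t i _ => pB i _).
  rewrite -scalerDr addrA subrK normrZ ger0_norm// [`|z - y|]distrC => h.
  rewrite [leRHS]mulrAC ler_wpM2r ?exprn_ge0//; apply: le_trans h _.
  by rewrite !mulrA.
have fD z : derivable f z e /\ 'D_e f z = fj z.
  have H := @is_derive_line _ _ eta (s^-1 *: (x - z)) (- s^-1 *: e) 0 (beta.1 [::] _).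
  rewrite scale0r addr0 in H.
  have E0 : rV_lin (fun i => partial i eta (s^-1 *: (x - z))) (- s^-1 *: e) =
      - s^-1 * p (s^-1 *: (x - z)).
    by rewrite linearZ /= delta_mx_linE.
  rewrite E0 in H.
  have E : (fun h : R => h^-1 *: ((f \o shift z) (h *: e) - f z)) =
    (fun h : R => s^-1 ^+ n * (h^-1 *: (((fun t : R => eta (s^-1 *: (x - z) + t *: (- s^-1 *: e)))
       \o shift 0) (h *: (1 : R)) - eta (s^-1 *: (x - z) + (0 : R) *: (- s^-1 *: e))))).
    apply/funext => h /=; rewrite scale0r !addr0 [h *: 1]mulr1 /f -mulrBl.
    have -> : s^-1 *: (x - (h *: e + z)) = s^-1 *: (x - z) + h *: (- s^-1 *: e).
      by rewrite scalerA mulrN mulrC scaleNr -scalerA -scalerBr opprD addrA addrAC.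
    by rewrite /GRing.scale /=; ring.
  have [Hd HD] := H.
  have c : (fun h : R => h^-1 *: ((f \o shift z) (h *: e) - f z)) h @[h --> 0^'] --> fj z.
    rewrite E /fj; have -> : - (p (s^-1 *: (x - z)) * s^-1 ^+ n.+1) =
      s^-1 ^+ n * (- s^-1 * p (s^-1 *: (x - z))) by rewrite exprS; ring.
    apply: cvgM; first exact: cvg_cst.
    by rewrite -HD; exact: Hd.
  by split; [apply/cvg_ex; exists (fj z)|exact: cvg_lim].
have W := weak_derivative_lip mN N0 mu_ mf mG mfj r0 u0 uM uL uG fB fL fD.
have -> : partial j (moll s u) x = (mollmass eta s)^-1 * Kint p n.+1 (cst s) u x.
  have far h z : `|h| < s -> ~ ball x (s *+ 3) z ->
      cst s z = 0 \/ 1 < `|(cst s z)^-1 *: (x + h - z)|.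
    rewrite -ball_normE /= => hs /negP; rewrite -leNgt => xz; right.
    rewrite normrZ gtr0_norm ?invr_gt0// ltr_pdivlMl// mulr1.
    have := ler_distD (x + h) x z; rewrite opprD addNKr normrN.
    move: (`|x + h - z|) => A; move: xz; rewrite !mulrS mulr0n; lra.
  have s3 : 0 < s *+ 3 by rewrite mulrn_wgt0.
  have dK : differentiable (Kint eta n (cst s) u) x.
    by apply: (@differentiable_Kint _ _ eta (cst s) u n x s (s *+ 3) s Mu).
  rewrite -(@partial_Kint _ _ eta (cst s) u n x s (s *+ 3) s Mu)//.
  have -> : moll s u = (mollmass eta s)^-1 *: Kint eta n (cst s) u by [].
  by rewrite /partial deriveZ//; exact: diff_derivable.
rewrite /moll; congr (_ * _).
have -> : Kint p n.+1 (cst s) u x = - \int[mu]_z (u z * fj z).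
  have ip : mu.-integrable setT (EFin \o (fun z => u z * fj z)).
    have [Bp _ HBp] := bump_bounded bp.
    apply: (@integrable_supp _ _ _ x0 r (Mu * (Bp * s^-1 ^+ n.+1))) => //.
    - exact: measurable_funM.
    - move=> z _; rewrite normrM ler_pM// normrN normrM ler_pM//.
      by rewrite ger0_norm ?exprn_ge0.
    - by move=> z /u0 ->; rewrite mul0r.
  rewrite -mulN1r -RintegralZl//; apply: eq_Rintegral => z _ /=; rewrite /fj; ring.
rewrite W opprK; apply: eq_Rintegral => z _; exact: mulrC.
Qed.

(** Off [N], [u] is Lipschitz and the [G j] are continuous, so the mollifications converge almost
    everywhere; they are bounded and supported in a fixed ball, and dominated convergence gives L^2
    convergence. The bound [s <= rho] will keep the supports inside the outer domain. *)
Lemma moll_approx u (G : 'I_n -> 'rV[R]_n -> R) N x0 (r M : R) (e rho : R) :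
  0 < e -> 0 < rho ->
  measurable N -> mu N = 0%E -> measurable_fun setT u ->
  (forall j, measurable_fun setT (G j)) -> 0 < r ->
  (forall x, ~ ball x0 r x -> u x = 0) -> (forall x, `|u x| <= M) -> lip_off N M u ->
  (forall j x, ~ N x -> derivable u x (delta_mx 0 j) /\ 'D_(delta_mx 0 j) u x = G j x) ->
  (forall j x, `|G j x| <= M) -> (forall j x, ~ ball x0 r x -> G j x = 0) ->
  (forall j x, ~ N x -> {for x, continuous (G j)}) ->
  exists s, [/\ 0 < s, s <= rho,
    (\int[mu]_x ((moll s u x - u x) ^+ 2)%:E <= e%:E)%E &
    forall j, (\int[mu]_x ((partial j (moll s u) x - G j x) ^+ 2)%:E <= e%:E)%E].
Proof.
move=> e0 rho0 mN N0 mu_ mG r0 u0 uM uL uG GM G0 cG.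
have M0 : 0 <= M := le_trans (normr_ge0 _) (uM 0).
pose t (k : nat) : R := k.+1%:R^-1.
have tk0 k : 0 < t k by rewrite invr_gt0.
have tk1 k : t k <= 1 by rewrite invf_le1// ler1n.
have t0 : t @ \oo --> (0 : R) by exact: cvg_harmonic.
have aeN (P : 'rV[R]_n -> Prop) : (forall x, ~ N x -> P x) -> {ae mu, forall x, P x}.
  by move=> H; exists N; split => // x /= nP; apply: contrapT => /H.
have far (g : 'rV[R]_n -> R) k z : (forall x, ~ ball x0 r x -> g x = 0) ->
    ~ ball x0 (r + 1) z -> moll (t k) g z - g z = 0.
  move=> g0; rewrite -ball_normE /= => /negP; rewrite -leNgt => zB.
  have tk := tk1 k.
  rewrite moll_supp// ?g0 ?subr0//.
    by rewrite -ball_normE /= => /lt_le_trans/(_ (le_trans _ zB)); rewrite lerDl ler01 ltxx => /(_ isT).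
  move=> y yz; apply: g0; rewrite -ball_normE /= => h.
  have := ler_distD y x0 z; move: yz h zB.
  move: (`|y - z|) (`|x0 - y|) (`|x0 - z|) => a b c; lra.
have key (g : 'rV[R]_n -> R) : measurable_fun setT g -> (forall x, `|g x| <= M) ->
    (forall x, ~ ball x0 r x -> g x = 0) -> (forall x, ~ N x -> forall d : R, 0 < d ->
       exists2 b : R, 0 < b & forall z, ~ N z -> `|z - x| <= b -> `|g z - g x| <= d) ->
    (fun k => \int[mu]_x ((moll (t k) g x - g x) ^+ 2)%:E)%E @ \oo --> 0%E.
  move=> mg gM g0 gc; apply: (@dominated_cvg_sqr _ _ _ _ x0 (r + 1) (M + M)) => //.
  - lra.
  - by move=> k; apply: smooth_measurable; exact: (smooth_moll _ mg gM).
  - apply: aeN => x nNx; apply/cvgrPdist_le => d d0.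
    have [b b0 Hb] := gc x nNx d d0.
    have : \forall k \near \oo, t k < b.
      have /cvgrPdist_lt/(_ b b0) := t0; apply: filterS => k.
      by rewrite sub0r normrN gtr0_norm.
    apply: filterS => k kb; rewrite distrC.
    apply: (moll_avg beta eta0 etapos (tk0 k) mg mN N0 gM (ltW d0)).
    by move=> z nNz zx; apply: Hb => //; apply: le_trans zx (ltW kb).
  - apply: aeN => x nNx k.
    apply: (moll_avg beta eta0 etapos (tk0 k) mg mN N0 gM (addr_ge0 M0 M0)).
    by move=> z _ _; apply: le_trans (ler_normB _ _) _; apply: lerD.
  - by move=> z k; exact: far.
have cu := key u mu_ uM u0.
have cGj j := key (G j) (mG j) (GM j) (G0 j).
have near_lt (F : nat -> \bar R) : F @ \oo --> 0%E -> \forall k \near \oo, (F k <= e%:E)%E.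
  move=> F0; have nb : nbhs (0%E : \bar R) [set y | (y < e%:E)%E].
    by apply: open_nbhs_nbhs; split; [exact: open_ereal_lt_ereal|rewrite /= lte_fin].
  have : \forall k \near \oo, (F k < e%:E)%E by exact: (F0 _ nb).
  by apply: filterS => k /ltW.
have h1 : \forall k \near \oo, (\int[mu]_x ((moll (t k) u x - u x) ^+ 2)%:E <= e%:E)%E.
  apply/near_lt/cu => x nNx d d0; exists (d / (M + 1)) => [|z nNz zx]; first by rewrite divr_gt0//; lra.
  apply: le_trans (uL _ _ nNz nNx) _; apply: le_trans (ler_wpM2l M0 zx) _.
  rewrite mulrA ler_pdivrMr; last lra.
  by rewrite mulrC ler_wpM2l ?ltW//; lra.
have h2 : \forall k \near \oo, forall j, (\int[mu]_x ((moll (t k) (G j) x - G j x) ^+ 2)%:E <= e%:E)%E.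
  apply: filter_forall => j; apply/near_lt/cGj => x nNx d d0.
  have /cvgrPdist_lt/(_ d d0)/nbhs_ballP[b /= b0 Hb] := cG j x nNx.
  exists (b / 2); first lra.
  move=> z nNz zx; rewrite distrC; apply/ltW/Hb; rewrite -ball_normE /= distrC; lra.
have h3 : \forall k \near \oo, t k <= rho.
  have /cvgrPdist_lt/(_ rho rho0) := t0; apply: filterS => k.
  by rewrite sub0r normrN gtr0_norm// => /ltW.
have [k [k1 [k2 k3]]] : exists k, (\int[mu]_x ((moll (t k) u x - u x) ^+ 2)%:E <= e%:E)%E /\
    (forall j, (\int[mu]_x ((moll (t k) (G j) x - G j x) ^+ 2)%:E <= e%:E)%E) /\ t k <= rho.
  have h4 : \forall k \near \oo, (\int[mu]_x ((moll (t k) u x - u x) ^+ 2)%:E <= e%:E)%E /\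
    (forall j, (\int[mu]_x ((moll (t k) (G j) x - G j x) ^+ 2)%:E <= e%:E)%E) /\ t k <= rho.
    by apply: filterS3 h1 h2 h3 => k.
  exact: (@filter_ex _ \oo _ _ h4).
exists (t k); split => // j.
under eq_integral do rewrite (partial_moll _ _ mN N0 mu_ (mG j) r0 u0 uM uL (uG j))//.
exact: k2.
Qed.

End mollification.

(** * Functions orthogonal to all test functions *)

Section uniqueness.
Context {R : realType} {n : nat}.
Local Notation mu := (lebesgue_rV R n).
Implicit Types (u f G h : 'rV[R]_n -> R) (x v : 'rV[R]_n) (O : set 'rV[R]_n).

(** Converse of [open_measurable_rV]: it allows a Dynkin class argument starting from the open
    sets. *)
Lemma sigma_open_rV (A : set 'rV[R]_n) : measurable A -> <<s @open 'rV[R]_n >> A.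
Proof.
move=> mA; move: A mA; apply: smallest_sub; first exact: smallest_sigma_algebra.
rewrite -bigcup_seq => _ [i _ [B mB <-]].
have : <<s @open R >> B.
  have : (@RGenOpens.G R).-sigma.-measurable B by rewrite -RGenOpens.measurableE.
  move: B {mB}; apply: smallest_sub; first exact: smallest_sigma_algebra.
  move=> _ [a [b ->]]; apply: sub_sigma_algebra; exact: interval_open.
rewrite setTI; move: B {mB}.
apply: (@smallest_sub _ _ _ [set B | <<s @open 'rV[R]_n >> ((fun x : 'rV[R]_n => x 0 i) @^-1` B)]).
  split => /=.
  - by rewrite preimage_set0; exact: sigma_algebra0.
  - by move=> A HA; rewrite setTD preimage_setC -setTD; exact: sigma_algebraCD.
  - by move=> F HF; rewrite preimage_bigcup; exact: sigma_algebra_bigcup.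
move=> B oB /=; apply: sub_sigma_algebra; apply: open_comp => // x _.
exact: coord_continuous.
Qed.

(** Dynkin's theorem: open sets are stable under intersection and the sets over which the integral
    vanishes form a Dynkin class, so the integral vanishes over every measurable set. *)
Lemma integral_open_eq0 h : mu.-integrable setT (EFin \o h) ->
  (forall O, open O -> \int[mu]_(x in O) h x = 0) -> {ae mu, forall x, h x = 0}.
Proof.
move=> ih hO.
have mh : measurable_fun setT h by apply/measurable_EFinP; exact: (measurable_int mu ih).
have hA A : measurable A -> (\int[mu]_(x in A) (h x)%:E = 0)%E.
  move=> mA; have iA : mu.-integrable A (EFin \o h) by exact: integrableS ih.
  suff : \int[mu]_(x in A) h x = 0.
    by move=> E; rewrite -[LHS]fineK ?integrable_fin_num// -[fine _]/(\int[mu]_(x in A) h x) E.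
  pose H := [set A : set 'rV[R]_n | measurable A /\ \int[mu]_(x in A) h x = 0].
  suff : H A by case.
  move: A mA {iA}; suff : <<s @open 'rV[R]_n >> `<=` H by move=> HH A /sigma_open_rV/HH.
  rewrite -setI_closed_g_dynkin_g_sigma_algebra; last first.
    by move=> A B oA oB; exact: openI.
  apply: smallest_sub; last by move=> A oA; split; [exact: open_measurable_rV|exact: hO].
  split => /=.
  - by split => //; apply: hO; exact: openT.
  - move=> A [mA A0]; split; first exact: measurableC.
    have := @Rintegral_setU _ _ _ mu A (~` A) h mA (measurableC mA).
    rewrite setUv A0 add0r (hO setT)//; last exact: openT.
    by move=> /(_ ih); rewrite disj_set2E setICr eqxx => /(_ isT).
  - move=> F tF HF; split; first by apply: bigcupT_measurable => k; case: (HF k).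
    rewrite /Rintegral integral_bigcup//; last 2 first.
    + by move=> k; case: (HF k).
    + by apply: integrableS ih => //; apply: bigcupT_measurable => k; case: (HF k).
    rewrite eseries0// => k _ _.
    have [mF F0] := HF k.
    have iF : mu.-integrable (F k) (EFin \o h) by exact: integrableS ih.
    by rewrite -[LHS]fineK ?integrable_fin_num// -[fine _]/(\int[mu]_(x in F k) h x) F0.
have : ae_eq mu setT (EFin \o h) (cst 0%E).
  apply: integral_ae_eq => //.
  by move=> E _ mE; rewrite hA// integral0.
by apply: filterS => x /(_ I) [].
Qed.

Lemma open_indic_approx O : (0 < n)%N -> open O -> exists f : nat -> 'rV[R]_n -> R,
  [/\ forall k, test_fun O (f k), forall k x, `|f k x| <= 1
    & forall x, f ^~ x @ \oo --> (\1_O x : R)].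
Proof.
move=> n0 oO; have [eta [se eta0 eta1 etap _]] := @bump_exists R n.
have be : bump eta by split => // x x1; rewrite eta1// ltW.
pose t (k : nat) : R := k.+1%:R^-1.
have tk0 k : 0 < t k by rewrite invr_gt0.
have t0 : t @ \oo --> (0 : R) by exact: cvg_harmonic.
have nt (d : R) : 0 < d -> \forall k \near \oo, t k < d.
  move=> d0; have /cvgrPdist_lt/(_ d d0) := t0; apply: filterS => k.
  by rewrite sub0r normrN gtr0_norm.
(* Mollifying at radius [t k] uses one [t k] of this distance, passing to the closure of the support
   the other; the margin [e] makes the set open, hence measurable. *)
pose Ok k := [set x : 'rV[R]_n | `|x| < k%:R /\ exists2 e, 0 < e & ball x (t k *+ 2 + e) `<=` O].
have oOk k : open (Ok k).
  rewrite openE => x [xk [e e0 He]]; apply/nbhs_ballP.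
  exists (Num.min (k%:R - `|x|) (e / 2)) => [/=|y]; first by rewrite lt_min subr_gt0 xk; lra.
  rewrite -[in X in X -> _]ball_normE /= lt_min => /andP[xy1 xy2]; split.
    have := ler_normD (y - x) x; rewrite subrK distrC; lra.
  exists (e / 2); first lra.
  move=> z; rewrite -[in X in X -> _]ball_normE /= => yz; apply: He.
  rewrite -ball_normE /=; have := ler_distD y x z; lra.
have uM k x : `|\1_(Ok k) x : R| <= 1.
  by rewrite indicE; case: (_ \in _); rewrite ?normr1// normr0.
have mO k : measurable_fun setT (\1_(Ok k) : 'rV[R]_n -> R).
  by apply: measurable_indic; exact: open_measurable_rV.
have N0 : mu set0 = 0%E by exact: measure0.
have nearOk k x : (exists2 z, Ok k z & `|z - x| <= t k) -> O x /\ ball x (t k) `<=` O.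
  move=> [z [_ [e e0 He]] zx]; have tk := tk0 k; split.
    by apply: He; rewrite -ball_normE /= !mulr2n; lra.
  move=> y; rewrite -[in X in X -> _]ball_normE /= => xy; apply: He.
  rewrite -ball_normE /= !mulr2n; have := ler_distD x z y; lra.
have zero k x : ~ (exists2 z, Ok k z & `|z - x| <= t k) -> moll eta (t k) (\1_(Ok k)) x = 0.
  move=> H; apply: moll_supp => // z zx.
  by rewrite indicE memNset// => Oz; apply: H; exists z.
exists (fun k => moll eta (t k) (\1_(Ok k))); split.
- move=> k; split; first exact: (smooth_moll n0 be (tk0 k) (mO k) (uM k)).
    apply: (@subclosed_compact _ _ [set x : 'rV[R]_n | `|x| <= k%:R + 1]).
    + exact: closed_closure.
    + apply: bounded_closed_compact.
        exists (k%:R + 1); split; first exact: num_real.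
        by move=> M kM x /= /le_trans; apply; exact: ltW.
      apply: (@closed_comp _ _ (fun z : 'rV[R]_n => `|z|) [set y | y <= k%:R + 1]); last exact: closed_le.
      by move=> z _; exact: norm_continuous.
    + rewrite closureE; apply: smallest_sub.
        apply: (@closed_comp _ _ (fun z : 'rV[R]_n => `|z|) [set y | y <= k%:R + 1]); last exact: closed_le.
        by move=> z _; exact: norm_continuous.
      move=> x /= fx; have [[z [zk _] zx]|/zero E] := pselect (exists2 z, Ok k z & `|z - x| <= t k).
        have := ler_normD (x - z) z; rewrite subrK distrC.
        have : t k <= 1 by rewrite invf_le1// ler1n.
        lra.
      by rewrite E eqxx in fx.
  move=> x cx; have [y [/= fy]] := cx _ (nbhsx_ballx x (t k) (tk0 k)).
  move=> xy; have [H|/zero E] := pselect (exists2 z, Ok k z & `|z - y| <= t k); last first.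
    by rewrite E eqxx in fy.
  by have [_] := nearOk _ _ H; apply; exact: ball_sym.
- move=> k x; rewrite -[X in `|X|]subr0.
  apply: (moll_avg be eta0 etap (tk0 k) (mO k) measurable0 N0 (uM k) ler01) => z _ _.
  by rewrite subr0.
- move=> x; have [Ox|nOx] := pselect (O x); last first.
    rewrite indicE memNset//; apply: cvg_near_cst; apply: nearW => k.
    by apply: zero => /nearOk[].
  rewrite indicE mem_set//; apply: cvg_near_cst.
  have [e /= e0 He] : exists2 e : R, 0 < e & ball x e `<=` O.
    by apply/nbhs_ballP; exact: open_nbhs_nbhs.
  have h1 : \forall k \near \oo, t k < e / 8 by apply: nt; lra.
  have h2 : \forall k \near \oo, `|x| + e < k%:R.
    exists (Num.trunc (`|x| + e)).+1 => // k /= kt.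
    by apply: lt_le_trans (truncnS_gt _) _; rewrite ler_nat.
  apply: filterS2 h1 h2 => k k1 k2.
  apply/eqP; rewrite -subr_eq0 -normr_le0.
  apply: (moll_avg be eta0 etap (tk0 k) (mO k) measurable0 N0 (uM k) (lexx 0)) => z _ zx.
  rewrite indicE mem_set ?subrr ?normr0//; split.
    have := ler_normD (z - x) x; rewrite subrK; lra.
  exists (e / 8); first lra.
  move=> y; rewrite -[in X in X -> _]ball_normE /= !mulr2n => zy; apply: He.
  rewrite -ball_normE /=; have := ler_distD z x y; rewrite [`|x - z|]distrC; lra.
Qed.

(* Testing against smooth bounded approximations of the indicators of the open
   subsets of U shows that the integral of h vanishes on every open set. *)
Lemma test_fun_ae_eq0 (U : set 'rV[R]_n) h : (0 < n)%N -> open U ->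
  mu.-integrable U (EFin \o h) ->
  (forall f, test_fun U f -> \int[mu]_(x in U) (h x * f x) = 0) ->
  {ae mu, forall x, U x -> h x = 0}.
Proof.
move=> n0 oU ih H.
have mU := open_measurable_rV oU.
pose g : 'rV[R]_n -> R := h \_ U.
have ig : mu.-integrable setT (EFin \o g).
  move: ih; rewrite integrable_mkcond//; apply: eq_integrable => // x _ /=.
  by rewrite /g restrict_EFin.
have mg : measurable_fun setT g by apply/measurable_EFinP; exact: (measurable_int mu ig).
suff : {ae mu, forall x, g x = 0}.
  by apply: filterS => x; rewrite /g patchE => gx Ux; move: gx; rewrite mem_set.
apply: integral_open_eq0 => // O oO.
have [f [tf f1 fO]] := open_indic_approx n0 (openI oO oU).
have tU k : test_fun U (f k).
  by have [sf cf kf] := tf k; split => // x /kf [].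
have mf k : measurable_fun setT (f k).
  by have [sf _ _] := tf k; exact: smooth_measurable.
have E k : \int[mu]_x (g x * f k x) = 0.
  rewrite -(H _ (tU k)) [RHS]Rintegral_mkcond; apply: eq_Rintegral => x _.
  by rewrite /g !patchE; case: ifP => //; rewrite mul0r.
have c : (fun k => \int[mu]_x (g x * f k x)) @ \oo --> \int[mu]_x (g x * \1_(O `&` U) x).
  apply: (@Rdominated_cvg _ _ _ _ (fun x => `|g x|)) => //.
  - by move=> k; exact: measurable_funM.
  - by apply: measurable_funM => //; apply: measurable_indic; apply: open_measurable_rV; exact: openI.
  - by apply: aeW => x; apply: cvgM => //; exact: cvg_cst.
  - exact: integrable_norm.
  - by apply: aeW => x k; rewrite normrM ler_piMr.
rewrite Rintegral_mkcond.
have -> : \int[mu]_x (g \_ O) x = \int[mu]_x (g x * \1_(O `&` U) x).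
  apply: eq_Rintegral => x _; rewrite /g !patchE indicE in_setI.
  by case: (x \in O); case: (x \in U); rewrite ?mulr1 ?mul0r ?mulr0.
have c0 : (fun k => \int[mu]_x (g x * f k x)) @ \oo --> (0 : R).
  by under eq_fun do rewrite E; exact: cvg_cst.
exact: (cvg_unique _ c c0).
Qed.

End uniqueness.

(** * The cone property *)

Section geometry.
Context {R : realType} {d : nat}.
Implicit Types (A U W : set 'rV[R]_d) (x y z p q b nu : 'rV[R]_d) (r a t : R).

Lemma coord_le_enorm x i : `|x 0 i| <= enorm x.
Proof.
rewrite -sqrtr_sqr /enorm ler_wsqrtr// /sqn big_ord1 (bigD1 i)//= lerDl.
by apply: sumr_ge0 => j _; exact: sqr_ge0.
Qed.

Lemma norm_le_enorm x : `|x| <= enorm x.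
Proof. by apply: rV_norm_le => [|i]; [exact: sqrtr_ge0|exact: coord_le_enorm]. Qed.

Lemma enorm_le_norm x : enorm x <= d%:R * `|x|.
Proof.
rewrite -[leRHS]ger0_norm ?mulr_ge0// -sqrtr_sqr ler_wsqrtr// /sqn big_ord1 exprMn.
apply: (@le_trans _ _ (\sum_(j < d) `|x| ^+ 2)).
  apply: ler_sum => j _; rewrite -[leLHS]ger0_norm ?sqr_ge0// normrX.
  by rewrite lerXn2r ?nnegrE// coord_le_norm.
rewrite sumr_const card_ord -[leLHS]mulr_natl ler_wpM2r ?sqr_ge0//.
case: d => [|k]; first by rewrite expr0n.
by rewrite expr2 ler_peMl// ler1n.
Qed.

Lemma dot_le x nu : enorm nu = 1 -> `|dot x nu| <= d%:R * `|x|.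
Proof.
move=> n1; rewrite /dot; apply: le_trans (ler_norm_sum _ _ _) _.
apply: (@le_trans _ _ (\sum_(j < d) `|x|)); last by rewrite sumr_const card_ord -[leLHS]mulr_natl.
apply: ler_sum => j _; rewrite normrM -[leRHS]mulr1; apply: ler_pM => //.
  exact: coord_le_norm.
by rewrite -n1 coord_le_enorm.
Qed.

Lemma dotD x y nu : dot (x + y) nu = dot x nu + dot y nu.
Proof. by rewrite /dot -big_split; apply: eq_bigr => i _ /=; rewrite mxE mulrDl. Qed.

Lemma dotZ t x nu : dot (t *: x) nu = t * dot x nu.
Proof. by rewrite /dot mulr_sumr; apply: eq_bigr => i _; rewrite mxE mulrA. Qed.

Lemma dot_unit nu : enorm nu = 1 -> dot nu nu = 1.
Proof.
move=> n1; have : enorm nu ^+ 2 = 1 by rewrite n1 expr1n.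
rewrite sqr_sqrtr; last by apply: sumr_ge0 => i _; apply: sumr_ge0 => j _; exact: sqr_ge0.
by rewrite /sqn big_ord1 /dot => <-; apply: eq_bigr => i _; rewrite expr2.
Qed.

(** A coordinate-free form of the Lipschitz graph condition, invariant under scaling: from a point
    of [U], a displacement [t *: nu] with an error at most [a * t] stays in [U]. Read backwards, it
    gives the exterior cones. *)
Definition cone_at a r U b := exists nu, `|nu| <= 1 /\
  forall x y t, ball b r x -> ball b r y -> 0 < t -> `|y - x - t *: nu| <= a * t ->
    U x -> U y.

(** A displacement [t *: nu + e] raises the height over the graph by at least [t - const * |e|],
    which is positive when [|e| <= a * t]. The aperture [a] depends on [L] and [d] only, and is
    chosen before the radius of the graphs is known. *)
Lemma lipschitz_cone L : (0 < d)%N ->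
  exists a, [/\ 0 < a, a < 1 & forall r, 0 < r -> exists2 r', 0 < r' &
    forall U b, lipschitz_graph_at r L U b -> cone_at a r' U b].
Proof.
move=> d0; pose D : R := d%:R; have D1 : 1 <= D by rewrite ler1n.
pose K := `|L|; have K0 : 0 <= K by exact: normr_ge0.
(* |e . nu| <= D |e| and |e - (e . nu) nu|_2 <= D (1 + D) |e| *)
pose a := (2 * (D + K * (D * (1 + D))))^-1.
have aux : 0 < D + K * (D * (1 + D)) by rewrite ltr_wpDr ?(lt_le_trans _ D1)// !mulr_ge0//; lra.
have aux1 : 1 <= D + K * (D * (1 + D)).
  by apply: ler_wpDr => //; rewrite !mulr_ge0//; lra.
have a0 : 0 < a by rewrite invr_gt0; lra.
exists a; split => //; first by rewrite invf_lt1; lra.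
move=> r r0; exists (r / (2 * D)); first by rewrite divr_gt0//; lra.
move=> U b [nu [psi [n1 psiL HU]]].
have dnu := dot_unit n1.
exists nu; split; first by rewrite -n1 norm_le_enorm.
have inb x : ball b (r / (2 * D)) x -> eball b r x.
  rewrite -ball_normE /eball /= => bx; apply: le_lt_trans (enorm_le_norm _) _.
  rewrite -/D distrC mulrC -ltr_pdivlMr; last lra.
  apply: lt_le_trans bx _; rewrite ler_wpM2l// ?ltW//.
  by rewrite ltf_pV2 ?posrE; lra.
move=> x y t /inb bx /inb by_ t0 h /(HU _ bx) ux; apply/(HU _ by_).
pose e := y - x - t *: nu; have yE : y = x + t *: nu + e by apply/rowP => i; rewrite !mxE; ring.
have perp z : dot (z - dot z nu *: nu) nu = 0.
  by rewrite dotD -scaleN1r !dotZ dnu mulr1 mulN1r subrr.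
have he : enorm (y - dot y nu *: nu - (x - dot x nu *: nu)) <= D * (1 + D) * `|e|.
  have -> : y - dot y nu *: nu - (x - dot x nu *: nu) = e - dot e nu *: nu.
    rewrite {1 2}yE !dotD dotZ dnu mulr1 !scalerDl.
    by apply/rowP => i; rewrite !mxE; ring.
  apply: le_trans (enorm_le_norm _) _; rewrite -/D -mulrA ler_wpM2l//.
  apply: le_trans (ler_normB _ _) _; rewrite mulrDl mul1r lerD2l normrZ.
  rewrite -[leRHS]mulr1; apply: ler_pM => //; first exact: dot_le.
  by rewrite -n1 norm_le_enorm.
have h1 := psiL _ _ (perp y) (perp x).
have h2 : `|psi (y - dot y nu *: nu) - psi (x - dot x nu *: nu)| <= K * (D * (1 + D)) * `|e|.
  apply: le_trans h1 _; rewrite -mulrA; apply: le_trans (ler_wpM2r (sqrtr_ge0 _) (ler_norm L)) _.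
  by rewrite ler_wpM2l// -/K.
have h3 := dot_le e n1.
have yd : dot y nu = dot x nu + t + dot e nu by rewrite yE !dotD dotZ dnu mulr1.
have h4 : (D + K * (D * (1 + D))) * `|e| < t.
  apply: (@le_lt_trans _ _ ((D + K * (D * (1 + D))) * (a * t))); first by rewrite ler_wpM2l// ltW.
  have -> : (D + K * (D * (1 + D))) * (a * t) = t / 2.
    by rewrite /a; move: aux; set X := D + _ => aux; field; rewrite gt_eqF.
  lra.
rewrite [X in _ < X]yd; move: h2 h3 h4; rewrite -/D mulrDl !ler_norml => /andP[_ h2] /andP[h3 _] h4.
lra.
Qed.

Lemma bnd_segment U x y : U x -> ~ U y -> exists2 t, 0 <= t <= 1 & bnd U (x + t *: (y - x)).
Proof.
move=> Ux nUy; pose g t := x + t *: (y - x).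
have cg : continuous g.
  by move=> t; apply: cvgD; [exact: cvg_cst|apply: cvgZr_tmp; exact: cvg_id].
pose S := [set t | 0 <= t <= 1 /\ U (g t)].
have S0 : S 0 by split; [rewrite lexx ler01|rewrite /g scale0r addr0].
have supS : has_sup S.
  by split; [exists 0|exists 1 => t [/andP[]]].
pose t0 := sup S.
have t00 : 0 <= t0 by exact: (sup_upper_bound supS S0).
have t01 : t0 <= 1 by apply: ge_sup; [exists 0|move=> t [/andP[]]].
exists t0; first by rewrite t00.
split.
- move=> B /cg/nbhs_ballP[e /= e0 He].
  have [t St] := sup_adherent e0 supS; rewrite -/t0 => te.
  exists (g t); split; first by case: St.
  apply: He; rewrite /ball /= ger0_norm; first lra.
  by rewrite subr_ge0; exact: (sup_upper_bound supS St).
- move=> /cg/nbhs_ballP[e /= e0 He].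
  have [t1|t1] := ltP t0 1; last first.
    apply: nUy; have -> : y = g t0.
      by have -> : t0 = 1; [apply/eqP; rewrite eq_le t01 t1|rewrite /g scale1r addrC subrK].
    by apply: He; exact: ballxx.
  pose t := Num.min 1 (t0 + e / 2).
  have tt : t0 < t by rewrite lt_min t1; lra.
  have : S t.
    split; first by rewrite ge_min lexx andbT le_min ler01; lra.
    apply: He; rewrite /ball /= distrC gtr0_norm ?subr_gt0//.
    have : t <= t0 + e / 2 by rewrite ge_min lexx orbT.
    lra.
  by move=> /(sup_upper_bound supS); rewrite leNgt tt.
Qed.

Lemma bnd_closed U : open U -> closed (bnd U).
Proof.
move=> oU; apply: closedI; first exact: closed_closure.
by apply: open_closedC; exact: open_interior.
Qed.

Lemma bnd_notin U x : open U -> bnd U x -> ~ U x.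
Proof. by move=> /interior_id oU [_]; rewrite oU. Qed.

Lemma bnd_near U x e : bnd U x -> 0 < e -> exists2 y, U y & ball x e y.
Proof. by move=> [cx _] e0; have [y [? ?]] := cx _ (nbhsx_ballx x e e0); exists y. Qed.

(** The boundary point itself may serve as a vertex. Upwards, the strict inequality leaves room to
    replace [b] by a nearby point of [U]; downwards, a point of [U] in the opposite cone would put
    [b] in [U], which is impossible for an open set. *)
Lemma cone_up a r U b : 0 < a -> 0 < r -> bnd U b -> cone_at a r U b ->
  exists nu, [/\ `|nu| <= 1,
    (forall x y t, ball b r x -> ball b r y -> 0 < t -> `|y - x - t *: nu| <= a * t -> U x -> U y),
    (forall y t, ball b r y -> 0 < t -> `|y - b - t *: nu| < a * t -> U y) &
    (open U -> forall y t, ball b r y -> 0 < t -> `|b - y - t *: nu| <= a * t -> ~ U y)].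
Proof.
move=> a0 r0 bb [nu [n1 H]]; exists nu; split => //.
- move=> y t by_ t0 h; pose e := Num.min (a * t - `|y - b - t *: nu|) r.
  have e0 : 0 < e by rewrite lt_min subr_gt0 h r0.
  have [x Ux] := bnd_near bb e0.
  rewrite -ball_normE /= lt_min => /andP[xb1 xb2]; apply: (H x y t) => //.
    by rewrite -ball_normE.
  have -> : y - x - t *: nu = (y - b - t *: nu) + (b - x).
    by apply/rowP => i; rewrite !mxE; ring.
  by apply: le_trans (ler_normD _ _) _; lra.
- move=> oU y t by_ t0 h Uy; apply: (bnd_notin oU bb).
  exact: (H y b t) (ballxx _ r0) _ _ _.
Qed.

End geometry.

(** * Chains of balls *)

Section chains.
Context {T : Type}.
Implicit Types (P : T -> Prop) (S : T -> T -> Prop).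

(** The number of steps is exact; upper bounds are treated by [chain_pad], as the step relations
    used are reflexive. *)
Fixpoint chain P S k p q : Prop :=
  match k with
  | 0 => P p /\ p = q
  | k.+1 => P p /\ exists2 p1, S p p1 & chain P S k p1 q
  end.

Lemma chain_trans P S k l p q s : chain P S k p q -> chain P S l q s ->
  chain P S (k + l) p s.
Proof.
elim: k p => [|k IH] p /=; first by move=> [_ ->].
by move=> [Pp [p1 Sp c1]] c2; split => //; exists p1 => //; exact: IH.
Qed.

Lemma chain_mono P P' S S' k p q : (forall x, P x -> P' x) -> (forall x y, S x y -> S' x y) ->
  chain P S k p q -> chain P' S' k p q.
Proof.
move=> PP SS; elim: k p => [|k IH] p /= [/PP Pp]; first by [].
by move=> [p1 /SS ? /IH ?]; split => //; exists p1.
Qed.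

Lemma chain_start P S k p q : chain P S k p q -> P p.
Proof. by case: k => [|k] []. Qed.

Lemma chain_end P S k p q : chain P S k p q -> P q.
Proof. by elim: k p => [|k IH] p /=; [move=> [? <-]|move=> [_ [p1 _ /IH]]]. Qed.

Lemma chain_pad P S k l p q : (forall x, S x x) -> (k <= l)%N -> chain P S k p q -> chain P S l p q.
Proof.
move=> Sx; elim: l => [|l IH]; first by rewrite leqn0 => /eqP ->.
rewrite leq_eqVlt => /predU1P[-> //|/IH H c].
have Pp := chain_start c.
by split => //; exists p => //; exact: H.
Qed.

End chains.
Arguments chain {T}.

Lemma chain_map (T T' : Type) (P : T -> Prop) (S : T -> T -> Prop) (P' : T' -> Prop) (S' : T' -> T' -> Prop) (f : T -> T') k p q :
  (forall x, P x -> P' (f x)) -> (forall x y, S x y -> S' (f x) (f y)) ->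
  chain P S k p q -> chain P' S' k (f p) (f q).
Proof.
move=> PP SS; elim: k p => [|k IH] p /= [/PP Pp]; first by move=> <-.
by move=> [p1 /SS ? /IH ?]; split => //; exists (f p1).
Qed.


Section segment_chains.
Context {R : realType} {d : nat}.
Implicit Types (p q x y : 'rV[R]_d) (h : R) (P : 'rV[R]_d -> Prop).

Definition step h x y := `|x - y| <= h.

Lemma step_refl h x : 0 <= h -> step h x x.
Proof. by rewrite /step subrr normr0. Qed.

Lemma chain_segment P h k p q : (forall t, 0 <= t <= 1 -> P (p + t *: (q - p))) ->
  `|q - p| <= k%:R * h -> chain P (step h) k p q.
Proof.
move=> HP; case: k => [|k] hk.
  move: hk; rewrite mul0r normr_le0 subr_eq0 => /eqP ->; split => //.
  by have := HP 0; rewrite scale0r addr0 lexx ler01; apply.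
pose M : R := k.+1%:R; have M0 : 0 < M by [].
(* The points are numbered from the end [q], so that the induction on [i] adds steps at the start,
   as in the definition of [chain]. *)
pose x (i : nat) := p + (1 - i%:R / M) *: (q - p).
have Px i : (i <= k.+1)%N -> P (x i).
  move=> ik; apply: HP; rewrite subr_ge0 ler_pdivrMr// mul1r ler_nat ik/= gerBl.
  by rewrite divr_ge0// ltW.
have xE : p = x k.+1 by rewrite /x divff ?gt_eqF// subrr scale0r addr0.
suff H i : (i <= k.+1)%N -> chain P (step h) i (x i) q by rewrite {1}xE; exact: H.
elim: i => [|i IH] ik /=.
  by split; [exact: Px|rewrite /x mul0r subr0 scale1r addrC subrK].
split; first exact: Px.
exists (x i); last by apply: IH; exact: ltnW.
rewrite /step /x opprD addrACA subrr add0r -scalerBl normrZ.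
have -> : 1 - i.+1%:R / M - (1 - i%:R / M) = - M^-1.
  by rewrite -[i.+1%:R]natr1 mulrDl mul1r; ring.
by rewrite normrN gtr0_norm ?invr_gt0// ler_pdivrMl.
Qed.

Lemma chain_refine P P' h h' k m p q : 0 <= h ->
  (forall x y, P x -> `|y - x| <= h -> P' y) -> h <= m%:R * h' ->
  chain P (step h) k p q -> chain P' (step h') (k * m) p q.
Proof.
move=> h0 PP hm; elim: k p => [|k IH] p /=.
  by move=> [Pp <-]; split => //; apply: (PP p p Pp); rewrite subrr normr0.
move=> [Pp [p1 Sp /IH c]]; rewrite mulSn; apply: chain_trans c.
apply: chain_segment; last by rewrite distrC (le_trans Sp).
move=> t /andP[t0 t1]; apply: (PP _ _ Pp).
rewrite addrC addKr normrZ ger0_norm// distrC; apply: le_trans Sp.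
by rewrite ler_piMl.
Qed.

End segment_chains.

(** * Bounding the length of chains by periodicity *)

Section integer_chains.
Context {d : nat}.
Implicit Types (z : 'I_d -> int) (Q : ('I_d -> int) -> Prop).
Variables (n M : nat).
Hypothesis n0 : (0 < n)%N.

(** Two points at distance at most one mesh, each moved by at most one mesh to reach the grid, end
    up within three meshes. *)
Definition istep z z' := forall i, (`|z i - z' i| <= 3)%N.

Let lift (a : {ffun 'I_d -> 'I_n}) : 'I_d -> int := fun i => (a i)%:Z.

Let res z : {ffun 'I_d -> 'I_n} :=
  [ffun i => Ordinal (ltn_pmod `|(z i %% n%:Z)%Z|%N n0)].

Let res_lift z : exists w : 'I_d -> int, z = (fun i => lift (res z) i + n%:Z * w i).
Proof.
exists (fun i => (z i %/ n%:Z)%Z); apply/funext => i; rewrite /lift ffunE /=.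
have zn : (0 <= z i %% n%:Z)%Z by rewrite modz_ge0// -lt0n.
have zl : (z i %% n%:Z < n%:Z)%Z by rewrite ltz_pmod.
rewrite modn_small; last by rewrite -ltz_nat gez0_abs.
by rewrite gez0_abs// addrC mulrC -divz_eq.
Qed.

(* A periodic predicate is determined by its values on one cell, so that there
   are only finitely many cases to bound. *)
Lemma periodic_chain_bound : exists N : nat, forall Q,
  (forall z w, Q (fun i => z i + n%:Z * w i) <-> Q z) ->
  forall z z', (forall i, (`|z' i - z i| <= M)%N) ->
  (exists k, chain Q istep k z z') -> chain Q istep N z z'.
Proof.
pose QT (T : {set {ffun 'I_d -> 'I_n}}) z := res z \in T.
pose z1 (b : {ffun 'I_d -> 'I_(M + M).+1}) : 'I_d -> int := fun i => (b i)%:Z - M%:Z.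
(* One number for each triple made of the residues where the predicate holds, the residue of the
   start, and the displacement to the end shifted by [M]; any value will do when no chain exists. *)
have B (p : {set {ffun 'I_d -> 'I_n}} * {ffun 'I_d -> 'I_n} * {ffun 'I_d -> 'I_(M + M).+1}) :
  {N : nat | (exists k, chain (QT p.1.1) istep k (lift p.1.2) (fun i => lift p.1.2 i + z1 p.2 i)) ->
     chain (QT p.1.1) istep N (lift p.1.2) (fun i => lift p.1.2 i + z1 p.2 i)}.
  apply: cid.
  have [[k Hk]|H] := pselect (exists k, chain (QT p.1.1) istep k (lift p.1.2)
      (fun i => lift p.1.2 i + z1 p.2 i)); first by exists k.
  by exists 0%N.
exists (\max_p sval (B p))%N => Q perQ z z' zz' [k ck].
have [w zw] := res_lift z.
pose T := [set a | `[< Q (lift a) >]]%SET.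
have QE y : Q y <-> QT T y.
  have [v yv] := res_lift y.
  rewrite /QT inE; split; first by rewrite {1}yv perQ => H; exact/asboolP.
  by move/asboolP; rewrite {2}yv perQ.
pose b : {ffun 'I_d -> 'I_(M + M).+1} := [ffun i => inord (absz (z' i - z i + M%:Z))].
have bE i : z1 b i = z' i - z i.
  have := zz' i; rewrite /z1 ffunE => h.
  by rewrite inordK; lia.
pose tr (s : int) (y : 'I_d -> int) : 'I_d -> int := fun i => y i + n%:Z * (s * w i).
have Str s x y : istep x y -> istep (tr s x) (tr s y).
  by move=> h i; rewrite /tr opprD addrACA subrr addr0.
have Ptr s x : Q x -> Q (tr s x) by move=> h; exact/perQ.
have ea : tr (-1) z = lift (res z).
  by apply/funext => i; rewrite /tr {1}zw mulN1r mulrN addrK.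
have eb : tr (-1) z' = fun i => lift (res z) i + z1 b i.
  by apply/funext => i; rewrite bE -ea /tr; ring.
have tr1K y : tr 1 (tr (-1) y) = y by apply/funext => i; rewrite /tr; ring.
pose N1 := sval (B (T, res z, b)).
have H : (exists k, chain (QT T) istep k (lift (res z)) (fun i => lift (res z) i + z1 b i)) ->
    chain (QT T) istep N1 (lift (res z)) (fun i => lift (res z) i + z1 b i).
  exact: svalP (B (T, res z, b)).
have N1le : (N1 <= \max_p sval (B p))%N by exact: (leq_bigmax (T, res z, b)).
clearbody N1; rewrite -eb -ea in H.
have c1 : chain (QT T) istep N1 (tr (-1) z) (tr (-1) z').
  apply: H; exists k; apply: (chain_map _ _ ck) => [x /Ptr/QE //|x y /Str]; exact.
rewrite -[z]tr1K -[z']tr1K; apply: (chain_map (P := QT T) (S := istep)) => [x /QE/Ptr //|x y|].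
  exact: Str.
by apply: chain_pad c1 => // x i; rewrite subrr.
Qed.

End integer_chains.

Section harnack_chains.
Context {R : realType} {d : nat}.
Implicit Types (U W : set 'rV[R]_d) (x y z p q b nu : 'rV[R]_d) (a r t K c D rho h eta : R).

Definition cone_domain a r U := open U /\ forall b, bnd U b -> cone_at a r U b.

Definition deep U (r : R) x := ball x r `<=` U.

Lemma deep_le U r r' x : r <= r' -> deep U r' x -> deep U r x.
Proof. by move=> rr H y xy; apply: H; exact: le_ball xy. Qed.

Lemma deep_near U r e x y : deep U (r + e) x -> `|y - x| <= e -> deep U r y.
Proof.
move=> H yx z; rewrite -ball_normE /= => yz; apply: H; rewrite -ball_normE /=.
have := ler_distD y x z; rewrite [`|x - y|]distrC; lra.
Qed.

Lemma bnd_near_point U x z e : U x -> ~ U z -> `|z - x| <= e ->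
  exists2 b, bnd U b & `|b - x| <= e.
Proof.
move=> Ux Uz zx; have [t /andP[t0 t1] bt] := bnd_segment Ux Uz.
exists (x + t *: (z - x)) => //; rewrite addrC addKr normrZ ger0_norm//.
by apply: le_trans zx; rewrite ler_piMl.
Qed.

Lemma deep_or_bnd U x e : U x -> deep U e x \/ exists2 b, bnd U b & `|b - x| <= e.
Proof.
move=> Ux; have [|] := pselect (deep U e x); first by left.
move=> /existsNP[z /not_implyP[xz Uz]]; right; apply: (bnd_near_point Ux Uz).
by move: xz; rewrite -ball_normE /= distrC => /ltW.
Qed.

Lemma corkscrew a r U b t : 0 < a -> a < 1 -> cone_domain a r U -> bnd U b ->
  0 < t -> t <= r / 2 -> exists2 p, `|p - b| <= t & deep U (a / 2 * t) p.
Proof.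
move=> a0 a1 [oU cU] bb t0 tr.
have r0 : 0 < r by lra.
have [nu [n1 _ H _]] := cone_up a0 r0 bb (cU b bb).
have tn : `|t *: nu| <= t by rewrite normrZ gtr0_norm// -[leRHS]mulr1 ler_wpM2l// ltW.
exists (b + t *: nu); first by rewrite addrC addKr.
move=> y; rewrite -ball_normE /= => yp.
have at0 : 0 < a * t by rewrite mulr_gt0.
have at1 : a * t < t by rewrite -[ltRHS]mul1r ltr_pM2r.
have yp' : `|y - b - t *: nu| < a * t.
  rewrite -addrA -opprD distrC; apply: lt_trans yp _; lra.
apply: (H y t) => //; rewrite -ball_normE /=.
have := ler_normD (y - b - t *: nu) (t *: nu); rewrite subrK [`|b - y|]distrC.
have yp2 : `|y - b - t *: nu| < a / 2 * t by rewrite -addrA -opprD distrC.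
lra.
Qed.

(* Up along nu, then horizontally at that height, and down again. *)
Lemma local_chain a r U b p q (D rho h : R) k : 0 < a -> cone_domain a r U -> bnd U b ->
  0 <= D -> 0 < rho -> `|p - b| <= D -> `|q - b| <= D -> deep U rho p -> deep U rho q ->
  3 * D + 2 * rho + (2 * D + rho) / a < r -> 2 * D <= k%:R * h -> (2 * D + rho) / a <= k%:R * h ->
  chain (deep U rho) (step h) (k + (k + k)) p q.
Proof.
move=> a0 [oU cU] bb D0 rho0 pb qb dp dq hr kD kT.
(* At this height the cone with vertex [p] has radius [a * T = 2 * D + rho], enough to contain the
   [rho]-balls around the whole horizontal segment from above [p] to above [q]. *)
pose T := (2 * D + rho) / a; have T0 : 0 < T by rewrite divr_gt0//; lra.
have r0 : 0 < r by move: hr; rewrite -/T; lra.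
have [nu [n1 H _ _]] := cone_up a0 r0 bb (cU b bb).
have tn t : 0 <= t -> `|t *: nu| <= t.
  by move=> t0; rewrite normrZ ger0_norm// -[leRHS]mulr1 ler_wpM2l.
have up s : `|s - b| <= D -> deep U rho s -> forall t, 0 <= t <= T -> deep U rho (s + t *: nu).
  move=> sb ds t /andP[t0 tT]; have [->|tn0] := eqVneq t 0; first by rewrite scale0r addr0.
  move=> y; rewrite -ball_normE /= => ys.
  have t0' : 0 < t by rewrite lt_def tn0.
  have hy : `|s - (y - t *: nu)| < rho.
    by rewrite (_ : s - (y - t *: nu) = s + t *: nu - y)//; apply/rowP => i; rewrite !mxE; ring.
  apply: (H (y - t *: nu) y t) => //.
  - rewrite -ball_normE /=.
    have := ler_distD s b (y - t *: nu); rewrite [`|b - s|]distrC.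
    have : 0 <= T by exact: ltW.
    move: hr; rewrite -/T; lra.
  - rewrite -ball_normE /=.
    have h1 := ler_distD s b y; have h2 := ler_distD (s + t *: nu) s y; have h3 := tn t t0.
    move: h1 h2; rewrite [`|b - s|]distrC opprD addNKr normrN.
    move: hr; rewrite -/T; clear -D0 rho0 sb tT ys h3; lra.
  - by rewrite opprB addrCA subrr addr0 subrr normr0 mulr_ge0// ltW.
  - by apply: ds; rewrite -ball_normE.
have pq : `|q - p| <= 2 * D.
  have := ler_distD b q p; rewrite [`|b - p|]distrC; lra.
have vert s : `|s - b| <= D -> deep U rho s -> chain (deep U rho) (step h) k s (s + T *: nu).
  move=> sb ds; apply: chain_segment; last by rewrite addrC addKr (le_trans (tn T (ltW T0))).
  move=> t /andP[t0 t1]; rewrite [s + _ - s]addrC addKr scalerA; apply: up => //.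
  by rewrite mulr_ge0 ?(ltW T0)//= ler_piMl// ltW.
have vert' s : `|s - b| <= D -> deep U rho s -> chain (deep U rho) (step h) k (s + T *: nu) s.
  move=> sb ds; apply: chain_segment; last first.
    by rewrite opprD addNKr normrN (le_trans (tn T (ltW T0))).
  move=> t /andP[t0 t1].
  have -> : s + T *: nu + t *: (s - (s + T *: nu)) = s + ((1 - t) * T) *: nu.
    by apply/rowP => i; rewrite !mxE; ring.
  by apply: up => //; rewrite mulr_ge0 ?subr_ge0 ?(ltW T0)//= ler_piMl ?(ltW T0)// gerBl.
apply: chain_trans (vert p pb dp) _; apply: chain_trans _ (vert' q qb dq).
apply: chain_segment; last by rewrite opprD addrACA subrr addr0 (le_trans pq).
move=> t /andP[t0 t1]; rewrite opprD addrACA subrr addr0 => y; rewrite -ball_normE /= => yp.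
have tqp : `|t *: (q - p)| <= 2 * D.
  by rewrite normrZ ger0_norm//; apply: le_trans pq; rewrite ler_piMl.
have hy : `|y - p - T *: nu| <= 2 * D + rho.
  have -> : y - p - T *: nu = t *: (q - p) - (p + T *: nu + t *: (q - p) - y).
    by apply/rowP => i; rewrite !mxE; ring.
  by apply: le_trans (ler_normB _ _) _; rewrite lerD// ltW.
apply: (H p y T) => //.
- rewrite -ball_normE /= distrC; move: hr; rewrite -/T; clear -D0 rho0 pb T0; lra.
- rewrite -ball_normE /= distrC.
  have h1 := ler_normD (y - p - T *: nu) (T *: nu); have h2 := tn T (ltW T0).
  have h3 := ler_distD p y b; move: h1; rewrite subrK; move: hr; rewrite -/T; clear -rho0 pb hy h2 h3; lra.
- by rewrite /T mulrCA divff ?gt_eqF// mulr1.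
- by apply: dp; exact: ballxx.
Qed.

Lemma ler_absz (m : int) (k : nat) : (`|m|%:~R <= k%:R :> R) = (`|m| <= k)%N.
Proof. by rewrite (_ : k%:R = (k%:Z)%:~R)// ler_int -lez_nat abszE. Qed.

Lemma natr_ge (x : R) : exists k : nat, x <= k%:R.
Proof. by exists (Num.trunc x).+1; apply/ltW/truncnS_gt. Qed.

(** Either [p] is so deep that the straight segment works, or [p] and [q] are close to a common
    boundary point and [local_chain] applies. Distances, depths and heights are all proportional to
    [t], so that [N] depends on [eta] but not on [t]. *)
Lemma local_harnack a r K c : 0 < a -> 0 < r -> 0 < K -> 0 < c ->
  exists2 t1, 0 < t1 & forall eta, 0 < eta -> exists N : nat, forall U, cone_domain a r U ->
    forall t p q, 0 < t <= t1 -> deep U (c * t) p -> deep U (c * t) q -> `|q - p| <= K * t ->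
    chain (deep U (c * t)) (step (eta * t)) N p q.
Proof.
move=> a0 r0 K0 c0; pose D := 2 * K + c.
have D0 : 0 < D by rewrite /D; lra.
pose E := 3 * D + 2 * c + (2 * D + c) / a.
have E0 : 0 < E by rewrite /E; have := divr_gt0 (_ : 0 < 2 * D + c) a0; lra.
(* For [t] below this bound the detour of [local_chain], of size at most [E * t], stays in the ball
   where the cone condition holds. *)
exists (r / (2 * E)); first by rewrite divr_gt0//; lra.
move=> eta eta0; have [k kE] := natr_ge (E / eta).
have kE' : E <= k%:R * eta by rewrite -ler_pdivrMr.
exists (k + (k + k))%N => U cU t p q /andP[t0 tt] dp dq pq.
have ct0 : 0 < c * t by rewrite mulr_gt0.
have kEt : E * t <= k%:R * (eta * t) by rewrite mulrA ler_pM2r.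
have e0 : 0 <= eta * t by rewrite mulr_ge0// ltW.
have T0 : 0 < (2 * D + c) / a by rewrite divr_gt0//; lra.
have Up : U p by apply: dp; exact: ballxx.
have [H|[b bb bp]] := deep_or_bnd ((K + c) * t) Up.
  apply: (@chain_pad _ _ _ k) => //; first by move=> x; exact: step_refl.
    by rewrite leq_addr.
  apply: chain_segment; last first.
    apply: le_trans pq _; apply: le_trans kEt; rewrite ler_wpM2r// ?ltW//.
    by rewrite /E /D; move: T0; rewrite /D; lra.
  move=> s /andP[s0 s1]; apply: (@deep_near _ _ (K * t) p); first by rewrite addrC -mulrDl.
  rewrite addrC addKr normrZ ger0_norm//; apply: le_trans pq; by rewrite ler_piMl.
apply: (@local_chain a r U b p q (D * t) (c * t)) => //.
- by rewrite mulr_ge0// ltW.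
- rewrite distrC; apply: le_trans bp _; rewrite ler_wpM2r ?(ltW t0)// /D; lra.
- have := ler_distD p q b; rewrite [`|p - b|]distrC => h; apply: le_trans h _.
  rewrite /D (_ : (2 * K + c) * t = K * t + (K + c) * t); last by ring.
  exact: lerD.
- have -> : 3 * (D * t) + 2 * (c * t) + (2 * (D * t) + c * t) / a = E * t.
    by rewrite /E; field; rewrite gt_eqF.
  apply: (@le_lt_trans _ _ (r / 2)); last lra.
  apply: le_trans (ler_wpM2l (ltW E0) tt) _.
  by rewrite le_eqVlt; apply/orP; left; apply/eqP; field; rewrite gt_eqF.
- by apply: le_trans kEt; rewrite mulrA ler_wpM2r ?(ltW t0)// /E; lra.
- apply: le_trans kEt; have -> : (2 * (D * t) + c * t) / a = (2 * D + c) / a * t.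
    by field; rewrite gt_eqF.
  by rewrite ler_wpM2r ?(ltW t0)// /E; lra.
Qed.

(** The points of [U] having near them a deep point that can be reached from [p] form a set open and
    closed in [U], because every point of [U] has a deep point within [3 * t1]. Connectedness alone
    does not bound the number of steps. *)
Lemma connected_chain a r c h t1 U p q : 0 < a -> a < 1 -> 0 < r -> cone_domain a r U ->
  connected U -> 0 < t1 -> t1 <= r / 2 -> 0 < c -> c <= a / 2 ->
  (exists N : nat, forall p q, deep U (c * t1) p -> deep U (c * t1) q ->
    `|q - p| <= 7 * t1 -> chain (deep U (c * t1)) (step h) N p q) ->
  deep U (c * t1) p -> deep U (c * t1) q ->
  exists k, chain (deep U (c * t1)) (step h) k p q.
Proof.
move=> a0 a1 r0 cU kU t10 t1r c0 ca [N HN] dp dq.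
pose dn x := [set s | `|s - x| <= 3 * t1 /\ deep U (c * t1) s].
have dnN x : U x -> exists s, dn x s.
  move=> Ux; have [H|[b bb bx]] := deep_or_bnd t1 Ux.
    exists x; split; first by rewrite subrr normr0; lra.
    apply: deep_le H; rewrite -[leRHS]mul1r ler_wpM2r ?(ltW t10)//; lra.
  have [s sb ds] := corkscrew a0 a1 cU bb t10 t1r.
  exists s; split; first by have := ler_distD b s x; lra.
  by apply: deep_le ds; rewrite ler_wpM2r// ltW.
pose lk x := exists s, dn x s /\ exists k, chain (deep U (c * t1)) (step h) k p s.
(* The deep points attached to [x] and [x'] are within [3 * t1 + t1 + 3 * t1] of each other, whence
   the constant 7. *)
have lkS x x' : U x -> U x' -> `|x - x'| < t1 -> lk x -> lk x'.
  move=> Ux Ux' xx [s [[sx ds] [k ck]]]; have [s' [s'x ds']] := dnN _ Ux'.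
  exists s'; split; first by split.
  exists (k + N)%N; apply: chain_trans ck (HN _ _ ds ds' _).
  have h1 := ler_distD x' s' s; have h2 := ler_distD x x' s.
  move: h1 h2; rewrite [`|x' - x|]distrC [`|x - s|]distrC; lra.
have Uq : U q by apply: dq; apply: ballxx; exact: mulr_gt0.
have Up : U p by apply: dp; apply: ballxx; exact: mulr_gt0.
pose V := [set x | U x /\ lk x].
have VU : V = U.
  apply: kU.
  - exists p; split => //; exists p; split; first by split=> //; rewrite subrr normr0; lra.
    by exists 0%N.
  - exists V; last by apply/seteqP; split => [x [Ux lx]|x []].
    rewrite openE => x [Ux lx]; have [oU _] := cU.
    have nU : nbhs x U by apply: open_nbhs_nbhs.
    have nB : nbhs x (ball x t1) by exact: nbhsx_ballx.
    apply: (@filterS2 _ (nbhs x) _ _ _ _ _ nU nB) => y Uy xy; split => //.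
    by apply: lkS lx => //; move: xy; rewrite -ball_normE.
  - exists (~` [set x | U x /\ ~ lk x]); last first.
      apply/seteqP; split => [x [Ux lx]|x [Ux] /= H]; first by split => // -[].
      by split => //; apply: contrapT => nl; apply: H.
    apply: open_closedC; rewrite openE => x [Ux lx]; have [oU _] := cU.
    have nU : nbhs x U by apply: open_nbhs_nbhs.
    have nB : nbhs x (ball x t1) by exact: nbhsx_ballx.
    apply: (@filterS2 _ (nbhs x) _ _ _ _ _ nU nB) => y Uy xy; split => // ly.
    apply: lx; apply: lkS ly => //; move: xy; by rewrite -ball_normE /= distrC.
have [_ [s [[sq ds] [k ck]]]] : V q by rewrite VU.
exists (k + N)%N; apply: chain_trans ck (HN _ _ ds dq _).
by rewrite distrC; lra.
Qed.

Lemma periodic_shift U (w : 'rV[int]_d) x : periodic_set U ->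
  U (x + map_mx intr w) <-> U x.
Proof.
move=> pU; split => [|Ux]; last by rewrite -(pU w); exists x.
rewrite -{1}(pU w) => -[y Uy /addIr <-]; exact: Uy.
Qed.

Lemma grid_near (n : nat) x : (0 < n)%N -> exists z : 'I_d -> int,
  `|x - \row_i (n%:R^-1 * (z i)%:~R)| <= n%:R^-1.
Proof.
move=> n0; exists (fun i => Num.floor (n%:R * x 0 i)).
have n0' : (0 : R) < n%:R by rewrite ltr0n.
apply: rV_norm_le => [|i]; first by rewrite invr_ge0 ltW.
rewrite !mxE -{1}[x 0 i](mulKf (lt0r_neq0 n0')) -mulrBr normrM gtr0_norm ?invr_gt0//.
rewrite -[leRHS]mulr1 ler_wpM2l ?invr_ge0 ?(ltW n0')//.
have := floor_le (n%:R * x 0 i); have := floorD1_gt (n%:R * x 0 i).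
rewrite intrD => h1 h2; rewrite ger0_norm ?subr_ge0//; lra.
Qed.

(** A chain of uncontrolled length, given by connectedness, is rounded to a grid of mesh [1 / n].
    Depth at a grid point is a periodic predicate on integer vectors, so that [periodic_chain_bound]
    bounds the length uniformly over all [U] with the same [a] and [r], without a compactness
    argument on the domains. *)
Lemma global_harnack a r K c : 0 < a -> a < 1 -> 0 < r -> 0 < c ->
  exists rho h (N : nat), [/\ 0 < rho, 0 < h & forall U, cone_domain a r U -> connected U ->
    periodic_set U -> forall p q, deep U c p -> deep U c q -> `|q - p| <= K ->
    chain (deep U rho) (step h) N p q /\ 2 * h <= rho].
Proof.
move=> a0 a1 r0 c0.
have [t2 t20 H2] := @local_harnack a r 7 (a / 2) a0 r0 (ltr0Sn _ 6) (divr_gt0 a0 (ltr0Sn _ 1)).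
pose t1 := Num.min t2 (Num.min (r / 2) (2 * c / a)).
have t10 : 0 < t1 by rewrite !lt_min t20 !divr_gt0//=; lra.
have t12 : t1 <= t2 by rewrite /t1 ge_min lexx.
have t1r : t1 <= r / 2 by rewrite /t1 !ge_min lexx orbT.
have t1c : a / 2 * t1 <= c.
  have : t1 <= 2 * c / a by rewrite /t1 !ge_min lexx !orbT.
  rewrite ler_pdivlMr//; lra.
pose rho := a / 4 * t1; have rho0 : 0 < rho by rewrite mulr_gt0//; lra.
have [n1 hn1] := natr_ge (6 / rho).
pose n := n1.+1; have n0 : (0 < n)%N by [].
pose eta : R := n%:R^-1; have n0' : (0 : R) < n%:R by rewrite ltr0n.
have eta0 : 0 < eta by rewrite invr_gt0.
(* The depth [2 * rho] available along the chain survives the rounding, and the new step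
   [h = 3 * eta] satisfies [2 * h <= rho]. *)
have etarho : 6 * eta <= rho.
  rewrite /eta ler_pdivrMr// mulrC -ler_pdivrMr//; apply: le_trans hn1 _.
  by rewrite ler_nat.
have [N2 HN2] := H2 (eta / t1) (divr_gt0 eta0 t10).
have [M hM] := natr_ge (n%:R * (K + 2 * eta)).
have [N HN] := @periodic_chain_bound d n M n0.
(* The two additional steps join [p] and [q] to their grid points. *)
exists rho, (3 * eta), N.+2; split => //; first lra.
move=> U cU kU pU p q dp dq pq; split; last lra.
have ht : eta / t1 * t1 = eta by rewrite divfK// gt_eqF.
have [k ck] : exists k, chain (deep U (a / 2 * t1)) (step eta) k p q.
  apply: (@connected_chain a r (a / 2) eta t1 U) => //.
  - by rewrite divr_gt0.
  - by exists N2 => p' q' dp' dq' pq'; rewrite -[in step _]ht; apply: HN2 => //; rewrite t10.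
  - exact: deep_le t1c dp.
  - exact: deep_le t1c dq.
pose g (z : 'I_d -> int) : 'rV[R]_d := \row_i (eta * (z i)%:~R).
pose s x := sval (cid (grid_near x n0)).
have sE x : `|x - g (s x)| <= eta by exact: svalP (cid (grid_near x n0)).
pose Q (z : 'I_d -> int) := deep U rho (g z).
have QE (z w : 'I_d -> int) : Q (fun i => z i + n%:Z * w i) <-> Q z.
  rewrite /Q; have -> : g (fun i => z i + n%:Z * w i) = g z + map_mx intr (\row_i w i).
    apply/rowP => i; rewrite !mxE intrD intrM mulrDr; congr (_ + _).
    by rewrite mulrA /eta mulVf ?mul1r// gt_eqF.
  have E x y : ball (x + map_mx intr (\row_i w i)) rho (y + map_mx intr (\row_i w i) : 'rV[R]_d)
      <-> ball x rho y.
    by rewrite -ball_normE /= opprD addrACA subrr addr0.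
  split => H y.
    by move=> /E /H /periodic_shift; apply.
  by move=> zy; rewrite -[y](subrK (map_mx intr (\row_i w i))); apply/periodic_shift => //;
    apply: H; apply/E; rewrite subrK.
have r2 : a / 2 * t1 = rho + rho by rewrite /rho; field.
have cQ : chain Q (istep (d := d)) k (s p) (s q).
  apply: (chain_map _ _ ck) => [x dx|x y xy i].
    apply: (deep_near (e := eta)) (_ : `|g (s x) - x| <= eta); last by rewrite distrC.
    by apply: deep_le dx; rewrite r2; clear -eta0 etarho; lra.
  have h1 : `|(g (s x) - g (s y)) 0 i| <= 3 * eta.
    apply: le_trans (coord_le_norm _ _) _.
    have := ler_distD x (g (s x)) (g (s y)); have := ler_distD y x (g (s y)).
    have := sE x; have := sE y; rewrite [`|g (s x) - x|]distrC; move: xy; rewrite /step; clear; lra.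
  move: h1; rewrite !mxE -mulrBr normrM gtr0_norm// mulrC ler_pM2r// -intrB -intr_norm.
  by rewrite ler_absz.
have := HN Q QE (s p) (s q) _ (ex_intro _ k cQ).
have zM i : (`|s q i - s p i| <= M)%N.
  have h1 : `|(g (s q) - g (s p)) 0 i| <= K + 2 * eta.
    apply: le_trans (coord_le_norm _ _) _.
    have := ler_distD q (g (s q)) (g (s p)); have := ler_distD p q (g (s p)).
    have := sE p; have := sE q; rewrite [`|g (s q) - q|]distrC; move: pq; clear; lra.
  move: h1; rewrite !mxE -mulrBr normrM gtr0_norm// -ler_pdivlMl// /eta invrK.
  by move=> /le_trans/(_ hM); rewrite -intrB -intr_norm ler_absz.
move=> /(_ zM) cN.
have gstep x : `|x - g (s x)| <= 3 * eta by apply: le_trans (sE x) _; clear -eta0; lra.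
have rr : rho <= a / 2 * t1 by rewrite r2; clear -eta0 etarho; lra.
split; first by apply: deep_le rr _; exact: deep_le t1c dp.
exists (g (s p)); first exact: gstep.
rewrite -[N.+1]addn1; apply: (@chain_trans _ _ _ N 1 _ (g (s q))).
  apply: (chain_map _ _ cN) => // x y xy.
  rewrite /step; apply: rV_norm_le => [|i]; first lra.
  rewrite !mxE -mulrBr normrM gtr0_norm// mulrC ler_pM2r// -intrB -intr_norm.
  by rewrite ler_absz; exact: xy.
split; first exact: chain_end cN.
exists q; first by rewrite /step distrC; exact: gstep.
by split => //; apply: deep_le rr _; exact: deep_le t1c dq.
Qed.

(** Below [t1] the chain is local; between [t1] and 1 the scale is comparable with the period, and
    the global chain is refined to steps [rho * t]. Half of the depth [3 * rho * t] will contain the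
    balls of [chain_poincare]; the other half keeps these balls away from the complement. *)
Lemma harnack_chain a r K c : 0 < a -> a < 1 -> 0 < r -> 0 < K -> 0 < c ->
  exists rho (N : nat), [/\ 0 < rho, 3 * rho <= c & forall U, cone_domain a r U -> connected U ->
    periodic_set U -> forall t p q, 0 < t <= 1 -> deep U (c * t) p -> deep U (c * t) q ->
    `|q - p| <= K * t -> chain (deep U (3 * rho * t)) (step (rho * t)) N p q].
Proof.
move=> a0 a1 r0 K0 c0.
have [t1 t10 H1] := local_harnack a0 r0 K0 c0.
have [rg [h [Ng [rg0 h0 Hg]]]] := @global_harnack a r K (c * t1) a0 a1 r0 (mulr_gt0 c0 t10).
pose rho := Num.min (c / 3) (rg / 6).
have rho0 : 0 < rho by rewrite lt_min !divr_gt0.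
have rc : rho <= c / 3 by rewrite /rho ge_min lexx.
have rrg : rho <= rg / 6 by rewrite /rho ge_min lexx orbT.
have [N1 HN1] := H1 rho rho0.
have [m hm] := natr_ge (h / (rho * t1)).
exists rho, (N1 + Ng * m)%N; split => //; first lra.
move=> U cU kU pU t p q /andP[t0 tl] dp dq pq.
have rt0 : 0 <= rho * t by rewrite mulr_ge0// ltW.
have srefl x : step (rho * t) x x by exact: step_refl.
have [tt|tt] := leP t t1.
  apply: (@chain_pad _ _ _ N1) => //; first exact: leq_addr.
  apply: chain_mono (HN1 U cU t p q _ dp dq pq) => [x|//|]; last by rewrite t0.
  by apply: deep_le; rewrite ler_wpM2r ?(ltW t0)//; lra.
apply: (@chain_pad _ _ _ (Ng * m)) => //; first exact: leq_addl.
have ct : c * t1 <= c * t by rewrite ler_wpM2l// ltW.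
have [|cg hr] := Hg U cU kU pU p q (deep_le ct dp) (deep_le ct dq).
  by apply: le_trans pq _; rewrite ler_piMr// ltW.
apply: (chain_refine (ltW h0) _ _ cg).
  move=> x y dx yx; apply: (@deep_near _ _ h x) => //; apply: deep_le dx.
  have : 3 * rho * t <= 3 * rho by rewrite ler_piMr//; clear -rho0; lra.
  lra.
rewrite ler_pdivrMr ?mulr_gt0// in hm; apply: le_trans hm _.
by rewrite ler_wpM2l// ler_wpM2l ?(ltW rho0)// ltW.
Qed.

(** An integer translation brings a point [y] of [U] within 1 of [z]. If neither [y] nor [z] is
    deep, the segment from [y] to a point outside [U] near [z] meets the boundary within 1 of [z],
    and a corkscrew point there is within 2 of [z]. *)
Lemma deep_everywhere a r U z : 0 < a -> a < 1 -> 0 < r -> cone_domain a r U -> U !=set0 ->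
  periodic_set U -> exists2 q, `|q - z| <= 2 & deep U (a / 2 * Num.min 1 (r / 2)) q.
Proof.
move=> a0 a1 r0 cU [y0 Uy0] pU; set t := Num.min 1 (r / 2).
have t0 : 0 < t by rewrite lt_min ltr01 divr_gt0.
have t1 : t <= 1 by rewrite /t ge_min lexx.
have tr : t <= r / 2 by rewrite /t ge_min lexx orbT.
pose y := y0 + map_mx intr (\row_i Num.floor (z 0 i - y0 0 i)).
have Uy : U y by apply/periodic_shift.
have yz : `|y - z| <= 1.
  apply: rV_norm_le => // i; rewrite !mxE.
  have := floor_le (z 0 i - y0 0 i); have := floorD1_gt (z 0 i - y0 0 i).
  by rewrite intrD ler_norml => h1 h2; apply/andP; split; lra.
have [H|[b bb byt]] := deep_or_bnd t Uy.
  exists y; first lra.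
  apply: deep_le H; rewrite -[leRHS]mul1r ler_wpM2r ?(ltW t0)//; lra.
have [H|nUz] := pselect (deep U t z).
  exists z; first by rewrite subrr normr0.
  apply: deep_le H; rewrite -[leRHS]mul1r ler_wpM2r ?(ltW t0)//; lra.
have [w zw nUw] : exists2 w, `|w - z| <= t & ~ U w.
  move: nUz => /existsNP[w /not_implyP[zw Uw]]; exists w => //.
  by move: zw; rewrite -ball_normE /= distrC => /ltW.
have [s /andP[s0 s1] bs] := bnd_segment Uy nUw.
set b' := y + _ in bs.
have b'z : `|b' - z| <= 1.
  have -> : b' - z = (1 - s) *: (y - z) + s *: (w - z).
    by apply/rowP => i; rewrite !mxE; ring.
  apply: le_trans (ler_normD _ _) _; rewrite !normrZ !ger0_norm ?subr_ge0//.
  have : (1 - s) * `|y - z| <= (1 - s) * 1 by rewrite ler_wpM2l// subr_ge0.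
  have : s * `|w - z| <= s * 1 by rewrite ler_wpM2l//; lra.
  lra.
have [p pb dp] := corkscrew a0 a1 cU bs t0 tr.
exists p => //; have := ler_distD b' p z; lra.
Qed.

End harnack_chains.

(** * Boundaries and scaling *)

Section boundary_measure.
Context {R : realType} {d : nat}.
Implicit Types (S U : set 'rV[R]_d) (x y b nu v : 'rV[R]_d).
Local Notation mu := (lebesgue_rV R d).

Lemma lebesgue_rV_translate S v : measurable S ->
  measurable [set y : 'rV[R]_d | S (y - v)] /\ mu [set y : 'rV[R]_d | S (y - v)] = mu S.
Proof.
move=> mS.
have m1 : measurable [set y : 'rV[R]_d | S (y - v)].
  rewrite -[X in measurable X]setTI; apply: (measurable_rVD (g := cst (- v))) => //.
split => //.
have e := @integral_rV_translation R d (- v) (fun x : 'rV[R]_d => (\1_S x)%:E) _ _.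
have e1 : (\int[mu]_x (\1_S (x - v))%:E = \int[mu]_x (\1_S x)%:E)%E.
  by apply: e => [|x]; [exact/measurable_EFinP/measurable_indic|rewrite lee_fin].
move: e1; rewrite [RHS]integral_indic// setIT => <-.
rewrite -[X in mu X = _]setIT -integral_indic//.
Qed.

(** Infinitely many disjoint sets of the same measure do not fit in a ball of finite measure unless
    this measure is 0. *)
Lemma disjoint_translates_null S b (r : R) (v : nat -> 'rV[R]_d) : measurable S -> 0 < r ->
  (forall k y, S y -> ball b r (y + v k)) ->
  (forall i j y y', S y -> S y' -> (i < j)%N -> y + v i <> y' + v j) -> mu S = 0%E.
Proof.
move=> mS r0 Sb disj.
pose T (k : nat) : set 'rV[R]_d := [set y : 'rV[R]_d | S (y - v k)].
have mT k : measurable (T k) by have [] := lebesgue_rV_translate (v k) mS.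
have muT k : mu (T k) = mu S by have [_] := lebesgue_rV_translate (v k) mS.
have tT : trivIset setT T.
  apply/trivIsetP => i j _ _; wlog ij : i j / (i < j)%N => [H|_].
    rewrite neq_ltn => /orP[ij|ji]; first by apply: H => //; rewrite ltn_eqF.
    by rewrite setIC; apply: H => //; rewrite ltn_eqF.
  rewrite -subset0 => y [/= yi yj]; apply: (disj i j _ _ yi yj ij).
  by rewrite !subrK.
have le K : ((K%:R)%:E * mu S <= ((r *+ 2) ^+ d)%:E)%E.
  rewrite -(lebesgue_rV_ball b r0).
  apply: (@le_trans _ _ (mu (\big[setU/set0]_(i < K) T i))).
    rewrite measure_bigsetU//.
    rewrite (eq_bigr (fun=> mu S)); last by move=> i _; exact: muT.
    elim: (K) => [|m IH]; first by rewrite big_ord0 mul0e.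
    by rewrite big_ord_recr /= -natr1 EFinD ge0_muleDl// mul1e leeD.
  apply: le_measure; rewrite ?inE//; first exact: bigsetU_measurable.
    exact: measurable_rV_ball.
  rewrite -bigcup_mkord; apply: bigcup_sub => k _ y /= /(Sb k); by rewrite subrK.
have S0 : (0 <= mu S)%E by [].
case: (mu S) S0 le => [s| |]//; last first.
  by move=> _ /(_ 1%N); rewrite mul1e.
rewrite lee_fin => s0 le; congr EFin; apply/eqP; rewrite eq_le s0 andbT leNgt; apply/negP => sp.
pose c := (r *+ 2) ^+ d; have := le (Num.trunc (c / s)).+1; rewrite lee_fin -ler_pdivlMr//.
by rewrite leNgt truncnS_gt.
Qed.

Lemma measurable_bnd U : open U -> measurable (bnd U).
Proof.
move=> oU; rewrite -[bnd U]setCK; apply: measurableC; apply: open_measurable_rV.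
by apply: closed_openC; exact: bnd_closed.
Qed.

(** Moving a boundary point up along [nu] by a small amount leads into [U], so two boundary points
    near [b] never differ by a small positive multiple of [nu]: the translates of this piece of the
    boundary along [nu] are disjoint. *)
Lemma cone_translates_null a r U b : 0 < a -> 0 < r -> cone_domain a r U -> bnd U b ->
  mu (bnd U `&` ball b (r / 4)) = 0%E.
Proof.
move=> a0 r0 [oU cU] bb.
have [nu [n1 H _ _]] := cone_up a0 r0 bb (cU b bb).
pose t k : R := r / 4 * k.+1%:R^-1.
have r4 : 0 < r / 4 by rewrite divr_gt0.
have t0 k : 0 < t k by rewrite mulr_gt0 ?invr_gt0.
have t1 k : t k <= r / 4.
  by rewrite /t ler_piMr ?(ltW r4)// invf_le1// ler1n.
have tn (s : R) : 0 <= s -> `|s *: nu| <= s.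
  by move=> s0; rewrite normrZ ger0_norm// -[leRHS]mulr1 ler_wpM2l.
have up (s : R) y : 0 < s -> s <= r / 4 -> bnd U y -> ball b (r / 4) y -> U (y + s *: nu).
  move=> s0 s1 by_ yb; have e0 : 0 < Num.min (a * s) (r / 4) by rewrite lt_min mulr_gt0.
  have [x Ux] := bnd_near by_ e0; rewrite -ball_normE /= lt_min => /andP[xy1 xy2].
  move: yb; rewrite -ball_normE /= => yb.
  apply: (H x _ s) => //.
  - by rewrite -ball_normE /=; have := ler_distD y b x; lra.
  - rewrite -ball_normE /=; have := ler_distD y b (y + s *: nu).
    by rewrite opprD addNKr normrN; have := tn s (ltW s0); lra.
  - by rewrite addrAC addrK ltW.
have mB : measurable (bnd U `&` ball b (r / 4)).
  by apply: measurableI; [exact: measurable_bnd|exact: measurable_rV_ball].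
apply: (@disjoint_translates_null _ b (r / 2) (fun k => t k *: nu)) => //.
- by rewrite divr_gt0.
- move=> k y [_]; rewrite -ball_normE /= => yb.
  have := ler_distD y b (y + t k *: nu); rewrite opprD addNKr normrN.
  have := tn _ (ltW (t0 k)); have := t1 k; lra.
- move=> i j y y' [by_ yb] [by' yb'] ij e.
  have tij : t j < t i.
    by rewrite /t ltr_pM2l// ltf_pV2 ?posrE// ltr_nat ltnS.
  have : U y'.
    have -> : y' = y + (t i - t j) *: nu.
      by rewrite scalerBl addrA e addrK.
    by apply: up => //; [rewrite subr_gt0|have := t1 i; have := t0 j; lra].
  exact: bnd_notin.
Qed.

Lemma bnd_null a r U : 0 < a -> 0 < r -> cone_domain a r U -> mu (bnd U) = 0%E.
Proof.
move=> a0 r0 cU; have [oU _] := cU.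
(* Then [4 / n <= r / 4], so that a grid ball of radius [2 / n] which meets the boundary at [b] lies
   in [ball b (r / 4)]; there are countably many of them. *)
have [k kr] := natr_ge (16 / r); pose n := k.+1.
have n0 : (0 : R) < n%:R by [].
have nr : 4 * n%:R^-1 <= r / 4.
  have : 16 / r <= n%:R by apply: le_trans kr _; rewrite ler_nat.
  rewrite ler_pdivrMr// => h; rewrite ler_pdivrMr// mulrAC ler_pdivlMr//; lra.
pose g (z : {ffun 'I_d -> int}) : 'rV[R]_d := \row_i (n%:R^-1 * (z i)%:~R).
pose S (k : nat) := if unpickle k is Some z then bnd U `&` ball (g z) (2 * n%:R^-1) else set0.
have m0 : (0 : R) < n%:R^-1 by rewrite invr_gt0.
have -> : bnd U = \bigcup_k S k.
  apply/seteqP; split => [x bx|x [j _]]; last by rewrite /S; case: unpickle => // z [].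
  have [z hz] := @grid_near R d n x isT.
  exists (pickle [ffun i => z i]) => //; rewrite /S pickleK; split => //.
  rewrite -ball_normE /= distrC (le_lt_trans (y := n%:R^-1))//; last lra.
  by move: hz; under eq_mx do rewrite -(ffunE z).
apply/negligibleP; last apply: negligible_bigcup => j.
  by apply: bigcup_measurable => j _; rewrite /S; case: unpickle => // z;
    apply: measurableI; [exact: measurable_bnd|exact: measurable_rV_ball].
rewrite /S; case: unpickle => [z|]; last exact: negligible_set0.
have [[b [bb bz]]|/forallNP H] := pselect (exists b, bnd U b /\ ball (g z) (2 * n%:R^-1) b); last first.
  have -> : bnd U `&` ball (g z) (2 * n%:R^-1) = set0 by apply/seteqP; split => // b /H.
  exact: negligible_set0.
suff h : mu.-negligible (bnd U `&` ball b (r / 4)).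
  apply: negligibleS h.
  move=> x [bx xz]; split => //; move: bz xz; rewrite -!ball_normE /= => bz xz.
  have := ler_distD (g z) b x; rewrite [`|b - g z|]distrC; lra.
apply/negligibleP; last by apply: (cone_translates_null a0 r0 cU bb).
by apply: measurableI; [exact: measurable_bnd|exact: measurable_rV_ball].
Qed.
End boundary_measure.

Section scaling.
Context {R : realType} {d : nat}.
Implicit Types (U : set 'rV[R]_d) (x y z p q b : 'rV[R]_d) (a r e t K c : R).

Lemma ballZ e r x y : 0 < e -> ball (e *: x) (e * r) (e *: y) <-> ball x r y.
Proof.
by move=> e0; rewrite -!ball_normE /= -scalerBr normrZ gtr0_norm// ltr_pM2l.
Qed.

Lemma deepZ e r U x : 0 < e -> deep (scale_set e U) (e * r) (e *: x) <-> deep U r x.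
Proof.
move=> e0; have eN : e != 0 by rewrite gt_eqF.
split => H y.
  by move=> /(ballZ _ _ _ e0)/H; rewrite /scale_set /= scalerK.
rewrite -[y](scalerKV eN) => /(ballZ _ _ _ e0)/H; by rewrite /scale_set /= scalerK.
Qed.

Lemma open_scale e U : open U -> open (scale_set e U).
Proof. by move=> oU; apply: open_comp => // x _; exact: scaler_continuous. Qed.

Lemma bnd_scale e U b : open U -> bnd (scale_set e U) b -> bnd U (e^-1 *: b).
Proof.
move=> oU bb; have nb := bnd_notin (open_scale oU) bb; case: bb => cb _.
split; last by rewrite (_ : U° = U)//; exact/interior_id.
move=> B nB; have [y [Uy By]] := cb _ (@scaler_continuous _ _ e^-1 b _ nB).
by exists (e^-1 *: y).
Qed.

Lemma cone_domain_scale a r e U : 0 < e -> cone_domain a r U ->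
  cone_domain a (e * r) (scale_set e U).
Proof.
move=> e0 [oU cU]; split; first exact: open_scale.
have eN : e != 0 by rewrite gt_eqF.
move=> b /(bnd_scale oU)/cU[nu [n1 H]]; exists nu; split => // x y t bx by_ t0 h.
have inb z : ball b (e * r) z -> ball (e^-1 *: b) r (e^-1 *: z).
  by rewrite -{1}[b](scalerKV eN) -{1}[z](scalerKV eN) => /(ballZ _ _ _ e0).
apply: (H _ _ (e^-1 * t)); [exact: inb|exact: inb|by rewrite mulr_gt0 ?invr_gt0|].
rewrite -scalerA -!scalerBr normrZ gtr0_norm ?invr_gt0// mulrCA ler_wpM2l// invr_ge0.
exact: ltW.
Qed.

Lemma harnack_chain_scale a r K c : 0 < a -> a < 1 -> 0 < r -> 0 < K -> 0 < c ->
  exists rho (N : nat), [/\ 0 < rho, 3 * rho <= c & forall U, cone_domain a r U -> connected U ->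
    periodic_set U -> forall e t p q, 0 < t <= e -> deep (scale_set e U) (c * t) p ->
    deep (scale_set e U) (c * t) q -> `|q - p| <= K * t ->
    chain (deep (scale_set e U) (3 * rho * t)) (step (rho * t)) N p q].
Proof.
move=> a0 a1 r0 K0 c0; have [rho [N [rho0 rc H]]] := @harnack_chain R d a r K c a0 a1 r0 K0 c0.
exists rho, N; split => // U cU kU pU e t p q /andP[t0 te] dp dq pq.
have e0 : 0 < e by exact: lt_le_trans te.
have eN : e != 0 by rewrite gt_eqF.
have tE : t = e * (t / e) by rewrite mulrCA divff// mulr1.
have dE k x : deep (scale_set e U) (k * t) x <-> deep U (k * (t / e)) (e^-1 *: x).
  have := deepZ (k * (t / e)) U (e^-1 *: x) e0.
  by rewrite scalerKV// mulrCA -tE => -[? ?]; split.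
rewrite -[p](scalerKV eN) -[q](scalerKV eN).
apply: (chain_map (P := deep U (3 * rho * (t / e))) (S := step (rho * (t / e))));
  [move=> x|move=> x y|apply: H => //].
- by rewrite dE scalerK.
- rewrite /step -scalerBr normrZ gtr0_norm// => xy.
  by rewrite [in leRHS]tE mulrCA ler_pM2l.
- by rewrite divr_gt0//= ler_pdivrMr ?mul1r.
- exact/dE.
- exact/dE.
- by rewrite -scalerBr normrZ gtr0_norm ?invr_gt0// mulrA [leRHS]mulrC ler_wpM2l// invr_ge0 ltW.
Qed.

Lemma deep_everywhere_scale a r U e z : 0 < a -> a < 1 -> 0 < r -> 0 < e ->
  cone_domain a r U -> U !=set0 -> periodic_set U ->
  exists2 q, `|q - z| <= 2 * e & deep (scale_set e U) (a / 2 * Num.min 1 (r / 2) * e) q.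
Proof.
move=> a0 a1 r0 e0 cU U0 pU; have eN : e != 0 by rewrite gt_eqF.
have [q qz dq] := deep_everywhere (e^-1 *: z) a0 a1 r0 cU U0 pU.
exists (e *: q).
  by rewrite -{1}[z](scalerKV eN) -scalerBr normrZ gtr0_norm// mulrC ler_pM2r.
by rewrite [_ * e]mulrC; apply/deepZ.
Qed.

End scaling.

(** * Translation estimates and Poincare inequalities *)

Section segments.
Context {R : realType}.

(* Integrate the inequality [h'^2 >= 2 m h' - m^2], m being the mean slope. *)
Lemma sqr_increment_le (h h' : R -> R) (a b : R) : a <= b ->
  (forall t : R, is_derive t 1 h (h' t)) -> continuous h' ->
  (((h b - h a) ^+ 2)%:E <=
   (b - a)%:E * \int[lebesgue_measure]_(t in `[a, b]) (h' t ^+ 2)%:E)%E.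
Proof.
rewrite le_eqVlt => /predU1P[->|ab] dh ch.
  by rewrite !subrr expr0n mul0e.
pose m := (h b - h a) / (b - a).
have ba0 : 0 < b - a by rewrite subr_gt0.
pose F t := 2 * m * h t - m ^+ 2 * t.
have dF (t : R) : is_derive t (1 : R) F (2 * m * h' t - m ^+ 2).
  have : is_derive t (1 : R) ((2 * m) *: h - m ^+ 2 *: (@id R)) ((2 * m) *: h' t - m ^+ 2 *: 1).
    by apply: is_deriveB.
  by rewrite [_ *: 1]mulr1.
have cF : continuous (fun t => 2 * m * h' t - m ^+ 2).
  move=> t; apply: (@cvgB _ R^o); last exact: cvg_cst.
  by apply: (@cvgM _ _ _ _ (cst (2 * m)) h'); [exact: cvg_cst|exact: ch].
have Fc : continuous F.
  by move=> t; apply: differentiable_continuous; apply/derivable1_diffP; exact: ex_derive.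
have e : (\int[lebesgue_measure]_(t in `[a, b]) (2 * m * h' t - m ^+ 2)%:E =
    (F b)%:E - (F a)%:E)%E.
  apply: continuous_FTC2 => //.
  - exact: continuous_subspaceT.
  - split=> [t _||]; first exact: ex_derive.
    + exact/cvg_at_right_filter/Fc.
    + exact/cvg_at_left_filter/Fc.
  - by move=> t _; rewrite derive1E derive_val.
have i1 : lebesgue_measure.-integrable `[a, b] (EFin \o (fun t => 2 * m * h' t - m ^+ 2)).
  by apply: continuous_compact_integrable; [exact: segment_compact|exact: continuous_subspaceT].
have i2 : lebesgue_measure.-integrable `[a, b] (EFin \o (fun t => h' t ^+ 2)).
  apply: continuous_compact_integrable; first exact: segment_compact.
  apply: continuous_subspaceT => t.
  by apply: (@continuous_comp _ _ _ h' (fun y => y ^+ 2)); [exact: ch|exact: exprn_continuous].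
have : ((F b)%:E - (F a)%:E <= \int[lebesgue_measure]_(t in `[a, b]) (h' t ^+ 2)%:E)%E.
  rewrite -e; apply: le_integral => // t _; rewrite lee_fin.
  by have := sqr_ge0 (h' t - m); rewrite sqrrB; lra.
rewrite -EFinB.
have -> : F b - F a = (h b - h a) ^+ 2 / (b - a).
  have bN : b - a != 0 by rewrite gt_eqF.
  by rewrite /F /m; field.
have bE : (0 <= (b - a)%:E)%E by rewrite lee_fin ltW.
move=> /(lee_wpmul2l bE); rewrite -[X in (X <= _)%E -> _]EFinM.
by rewrite mulrCA divff ?gt_eqF// mulr1.
Qed.

End segments.

Section exit.
Context {R : realType} {d : nat}.
Implicit Types (U : set 'rV[R]_d) (x y v : 'rV[R]_d) (r s t : R).

(** Unlike in [bnd_segment], the supremum is over the times up to which the whole segment lies in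
    [U]; integration along the segment needs all the earlier points to be in [U]. *)
Lemma first_exit U x v : open U -> U x -> ~ U (x + v) -> exists t : R,
  [/\ 0 < t <= 1, forall s, 0 <= s < t -> U (x + s *: v) & bnd U (x + t *: v)].
Proof.
move=> oU Ux Uy; pose g (t : R) := x + t *: v.
have cg : continuous g.
  by move=> t; apply: cvgD; [exact: cvg_cst|apply: cvgZr_tmp; exact: cvg_id].
pose S := [set t : R | 0 <= t <= 1 /\ forall s, 0 <= s <= t -> U (g s)].
have S0 : S 0.
  split; first by rewrite lexx ler01.
  by move=> s /andP[s0 s1]; rewrite (_ : s = 0) ?/g ?scale0r ?addr0//; apply/eqP; rewrite eq_le s0 s1.
have supS : has_sup S by split; [exists 0|exists 1 => t [/andP[]]].
pose t0 := sup S.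
have t00 : 0 <= t0 by exact: (sup_upper_bound supS S0).
have t01 : t0 <= 1 by apply: ge_sup; [exists 0|move=> t [/andP[]]].
have below s : 0 <= s < t0 -> U (g s).
  move=> /andP[s0 st]; have ts0 : 0 < t0 - s by rewrite subr_gt0.
  have [t [_ St] ts] := sup_adherent ts0 supS.
  by apply: St; rewrite s0/=; move: ts; rewrite -/t0 opprB addrC subrK; exact: ltW.
have nU : ~ U (g t0).
  move=> Ut0; have /cg/nbhs_ballP[e /= e0 He] : nbhs (g t0) U by exact: open_nbhs_nbhs.
  have ball_t t : `|t0 - t| < e -> U (g t) by move=> h; apply: He.
  have [t1|t1] := ltP t0 1; last first.
    by apply: Uy; have : t0 = 1; [apply/eqP; rewrite eq_le t01 t1|rewrite /g => e1; move: Ut0; rewrite /g e1 scale1r].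
  pose t := Num.min 1 (t0 + e / 2).
  have tt : t0 < t by rewrite lt_min t1; lra.
  have te : t <= t0 + e / 2 by rewrite ge_min lexx orbT.
  have : S t.
    split; first by rewrite ge_min lexx andbT le_min ler01; lra.
    move=> s /andP[s0 st]; have [ss|ss] := ltP s t0; first by apply: below; rewrite s0.
    by apply: ball_t; rewrite ler0_norm; lra.
  by move=> /(sup_upper_bound supS); rewrite leNgt tt.
exists t0; split => //.
- rewrite t01 andbT lt_def t00 andbT; apply: contra_notN nU => /eqP ->.
  by rewrite /g scale0r addr0.
- split; last by rewrite (_ : U° = U)//; exact/interior_id.
  move=> B /cg/nbhs_ballP[e /= e0 He].
  have [t St] := sup_adherent e0 supS; rewrite -/t0 => te.
  exists (g t); split; first by case: St => /andP[? ?]; apply; rewrite lexx andbT.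
  apply: He; rewrite /ball /= ger0_norm; first lra.
  by rewrite subr_ge0; exact: (sup_upper_bound supS St).
Qed.

Lemma sqr_sum_le (c : 'I_d -> R) : (\sum_j c j) ^+ 2 <= d%:R * \sum_j c j ^+ 2.
Proof.
have h : \sum_i \sum_j (c i * c j) <= \sum_(i < d) \sum_(j < d) (c i ^+ 2 / 2 + c j ^+ 2 / 2).
  apply: ler_sum => i _; apply: ler_sum => j _.
  by have := sqr_ge0 (c i - c j); rewrite sqrrB; lra.
have e1 : (\sum_j c j) ^+ 2 = \sum_i \sum_j (c i * c j).
  by rewrite expr2 mulr_suml; apply: eq_bigr => i _; rewrite mulr_sumr.
rewrite e1; apply: le_trans h _.
have e2 : \sum_(i < d) \sum_(j < d) (c i ^+ 2 / 2) = d%:R * (\sum_j c j ^+ 2) / 2.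
  rewrite (eq_bigr (fun i => d%:R * (c i ^+ 2 / 2))) => [|i _]; last by rewrite sumr_const card_ord mulr_natl.
  by rewrite -mulr_sumr -mulr_suml mulrA.
have e3 : \sum_(i < d) \sum_(j < d) (c j ^+ 2 / 2) = d%:R * (\sum_j c j ^+ 2) / 2.
  by rewrite exchange_big.
under eq_bigr do rewrite big_split/=.
by rewrite big_split/= e2 e3 -splitr.
Qed.

Lemma rV_lin_sqr_le (c : 'I_d -> R) v : rV_lin c v ^+ 2 <= d%:R * `|v| ^+ 2 * \sum_j c j ^+ 2.
Proof.
apply: le_trans (sqr_sum_le _) _; rewrite -mulrA ler_wpM2l// mulr_sumr.
apply: ler_sum => j _; rewrite exprMn ler_wpM2r ?sqr_ge0//.
by rewrite -real_normK ?num_real// lerXn2r ?nnegrE// coord_le_norm.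
Qed.

End exit.

Section segment_poincare.
Context {R : realType} {d : nat}.
Variables (phi : 'rV[R]_d -> R) (U : set 'rV[R]_d).
Hypotheses (sphi : smooth phi) (oU : open U).
Implicit Types (x y v : 'rV[R]_d) (r s t : R).

Definition zext x := phi x * \1_U x.
Definition zgrad x := (\sum_j partial j phi x ^+ 2) * \1_U x.

Lemma zgrad_ge0 x : 0 <= zgrad x.
Proof. by rewrite mulr_ge0//; apply: sumr_ge0 => j _; exact: sqr_ge0. Qed.

Lemma measurable_zgrad : measurable_fun setT zgrad.
Proof.
apply: measurable_funM; last by apply: measurable_indic; exact: open_measurable_rV.
apply: (@measurable_sum _ _ _ setT _ _ (fun j x => partial j phi x ^+ 2)) => j.
by apply: measurable_funX; apply: smooth_measurable; exact: smooth_partial.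
Qed.

Lemma measurable_line x v : measurable_fun setT (fun t : measurableTypeR R => x + (t : R) *: v).
Proof. by apply: measurable_rVD => //; apply: measurable_rVZ. Qed.

(** The integral on the right is over the whole of [0, 1], which is harmless as [zgrad] is
    nonnegative, so that all the cases of [segment_increment] have the same bound. *)
Lemma inside_increment x v (s t : R) : 0 <= s -> s <= t -> t <= 1 ->
  (forall r, s < r < t -> U (x + r *: v)) ->
  (((phi (x + t *: v) - phi (x + s *: v)) ^+ 2)%:E <= (d%:R * `|v| ^+ 2)%:E *
    \int[lebesgue_measure]_(r in `[0%R, 1%R]) (zgrad (x + r *: v))%:E)%E.
Proof.
move=> s0 st t1 Uin.
have cline : continuous (fun r : R => x + r *: v).
  by move=> r; apply: cvgD; [exact: cvg_cst|apply: cvgZr_tmp; exact: cvg_id].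
pose h' (r : R) := rV_lin (fun j => partial j phi (x + r *: v)) v.
have ch' : continuous h'.
  rewrite /h' /rV_lin; apply: continuous_big => [|j _ r]; first exact: add_continuous.
  apply: (@cvgM _ _ _ _ (cst (v 0 j))); first exact: cvg_cst.
  apply: (@continuous_comp _ _ _ (fun r : R => x + r *: v)); first exact: cline.
  exact/smooth_continuous/smooth_partial.
have dphi y : differentiable phi y by exact: (sphi [::]).
have mz : measurable_fun setT (fun r : measurableTypeR R => zgrad (x + (r : R) *: v)).
  by apply: measurableT_comp => //; [exact: measurable_zgrad|exact: measurable_line].
have := @sqr_increment_le R (fun r => phi (x + r *: v)) h' s t st
  (fun r => is_derive_line (dphi _)) ch'.
have mh : measurable_fun setT (fun r : R => (h' r ^+ 2)%:E).
  by apply/measurable_EFinP; apply: measurable_funX; apply: continuous_measurable_fun.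
move=> /le_trans; apply.
have -> : (\int[lebesgue_measure]_(r in `[s, t]) (h' r ^+ 2)%:E =
    \int[lebesgue_measure]_(r in `]s, t[) (h' r ^+ 2)%:E)%E.
  by apply: integral_itv_bndoo; exact: measurable_funTS.
have c0 : 0 <= d%:R * `|v| ^+ 2 by rewrite mulr_ge0// exprn_ge0.
apply: (@le_trans _ _ (1 * \int[lebesgue_measure]_(r in `]s, t[) (h' r ^+ 2)%:E)%E).
  apply: lee_wpmul2r; last by rewrite lee_fin; lra.
  by apply: integral_ge0 => r _; rewrite lee_fin sqr_ge0.
rewrite mul1e -ge0_integralZl_EFin//; first last.
- exact/measurable_funTS/measurable_EFinP.
- by move=> r _; rewrite lee_fin zgrad_ge0.
apply: (@le_trans _ _ (\int[lebesgue_measure]_(r in `]s, t[)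
    ((d%:R * `|v| ^+ 2)%:E * (zgrad (x + r *: v))%:E))%E).
  apply: ge0_le_integral => //.
  - by move=> r _; rewrite lee_fin sqr_ge0.
  - exact: measurable_funTS.
  - apply/measurable_funTS/measurable_EFinP; exact: measurable_funM.
  - move=> r; rewrite /= in_itv /= => rs; rewrite lee_fin /zgrad indicE mem_set ?mulr1; last exact: Uin.
    exact: rV_lin_sqr_le.
apply: ge0_subset_integral => //.
- by apply/measurable_funTS/measurable_EFinP; exact: measurable_funM.
- by move=> r _; rewrite lee_fin mulr_ge0// zgrad_ge0.
- move=> r; rewrite /= !in_itv/= => /andP[sr rt]; apply/andP; split; lra.
Qed.

(** If the segment leaves [U], then [phi] vanishes where it first exits from each end, so the two
    end values are bounded separately; adding their squares costs the factor 4. *)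
Lemma segment_increment x v :
  (forall t : R, 0 <= t <= 1 -> bnd U (x + t *: v) -> phi (x + t *: v) = 0) ->
  (((zext (x + v) - zext x) ^+ 2)%:E <= (4 * d%:R * `|v| ^+ 2)%:E *
    \int[lebesgue_measure]_(r in `[0%R, 1%R]) (zgrad (x + r *: v))%:E)%E.
Proof.
move=> bv; set J := (X in (_ * X)%E).
have J0 : (0 <= J)%E by apply: integral_ge0 => r _; rewrite lee_fin zgrad_ge0.
set c := d%:R * `|v| ^+ 2; have c0 : 0 <= c by rewrite mulr_ge0// exprn_ge0.
have fin A B k : 0 <= k -> A ^+ 2 <= k * B -> (B%:E <= c%:E * J)%E -> ((A ^+ 2)%:E <= (k * c)%:E * J)%E.
  move=> k0 h1 h2; apply: (@le_trans _ _ (k%:E * B%:E)%E); first by rewrite -EFinM lee_fin.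
  by rewrite EFinM -muleA; apply: lee_wpmul2l; rewrite ?lee_fin.
have out y : ~ U y -> zext y = 0 by move=> Uy; rewrite /zext indicE memNset// mulr0.
have inn y : U y -> zext y = phi y by move=> Uy; rewrite /zext indicE mem_set// mulr1.
have [Hall|] := pselect (forall r, 0 <= r <= 1 -> U (x + r *: v)).
  rewrite -mulrA; apply: (fin _ ((phi (x + 1 *: v) - phi (x + 0 *: v)) ^+ 2)) => //; last first.
    by apply: inside_increment => // r /andP[r0 r1]; apply: Hall; rewrite !ltW.
  have U0 := Hall 0; have U1 := Hall 1; move: U0 U1; rewrite scale0r scale1r addr0 !lexx ler01 => U0 U1.
  rewrite (inn _ (U0 isT)) (inn _ (U1 isT)).
  have := sqr_ge0 (phi (x + v) - phi x); lra.
move=> /existsNP[r0 /not_implyP[/andP[r00 r01] Ur0]].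
have h1 : ((zext x ^+ 2)%:E <= c%:E * J)%E.
  have [Ux|Ux] := pselect (U x); last by rewrite out// expr0n mule_ge0.
  have [t [/andP[t0 t1] Ut bt]] := first_exit oU Ux Ur0.
  have tr : t * r0 <= 1 by rewrite mulr_ile1// ltW.
  have e : x + t *: (r0 *: v) = x + (t * r0) *: v by rewrite scalerA.
  have := @inside_increment x v 0 (t * r0) (lexx _) (mulr_ge0 (ltW t0) r00) tr.
  have tr1 : 0 <= t * r0 <= 1 by rewrite tr mulr_ge0// ltW.
  have := bv _ tr1; rewrite -e => /(_ bt) ->; rewrite scale0r addr0 sub0r sqrrN inn//.
  apply=> r /andP[rr0 rr1].
  have r0p : 0 < r0 by have := lt_trans rr0 rr1; rewrite pmulr_rgt0.
  have -> : r *: v = (r / r0) *: (r0 *: v) by rewrite scalerA divfK// gt_eqF.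
  by apply: Ut; rewrite divr_ge0 ?(ltW rr0)//= ltr_pdivrMr.
have h2 : ((zext (x + v) ^+ 2)%:E <= c%:E * J)%E.
  have [Ux|Ux] := pselect (U (x + v)); last by rewrite out// expr0n mule_ge0.
  have Ur0' : ~ U (x + v + (r0 - 1) *: v).
    have -> // : x + v + (r0 - 1) *: v = x + r0 *: v.
    by apply/rowP => i; rewrite !mxE; ring.
  have [t [/andP[t0 t1] Ut bt]] := first_exit oU Ux Ur0'.
  pose q := t * (1 - r0).
  have q0 : 0 <= q by rewrite mulr_ge0 ?subr_ge0// ltW.
  have q1 : q <= 1 by rewrite mulr_ile1 ?subr_ge0 ?(ltW t0)//; lra.
  have e k : x + v + k *: ((r0 - 1) *: v) = x + (1 - k * (1 - r0)) *: v.
    by apply/rowP => i; rewrite !mxE; ring.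
  have := @inside_increment x v (1 - q) 1.
  rewrite subr_ge0 gerBl => /(_ q1 q0 (lexx _)).
  have tr1 : 0 <= 1 - q <= 1 by apply/andP; split; lra.
  have := bv _ tr1; rewrite -e => /(_ bt) ->; rewrite scale1r subr0 inn//.
  apply=> r /andP[rr0 rr1].
  have r0p : 0 < 1 - r0.
    rewrite lt_def subr_ge0 r01 andbT; apply/negP => /eqP h; move: rr0.
    by rewrite /q h mulr0; lra.
  have -> : r = 1 - (1 - r) / (1 - r0) * (1 - r0) by rewrite divfK ?gt_eqF//; ring.
  rewrite -e; apply: Ut; rewrite divr_ge0 ?(ltW r0p)//=; last lra.
  rewrite ltr_pdivrMr// -/q; lra.
apply: (@le_trans _ _ (2%:E * (zext (x + v) ^+ 2)%:E + 2%:E * (zext x ^+ 2)%:E)%E).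
  rewrite -!EFinM -EFinD lee_fin; have := sqr_ge0 (zext (x + v) + zext x).
  by rewrite sqrrB sqrrD; lra.
have -> : 4 * d%:R * `|v| ^+ 2 = 2 * c + 2 * c by rewrite /c; ring.
rewrite (EFinD (2 * c) (2 * c)) ge0_muleDl ?lee_fin ?mulr_ge0//.
by apply: leeD; rewrite (EFinM 2 c) -muleA; apply: lee_wpmul2l; rewrite ?lee_fin.
Qed.

End segment_poincare.

Section real_integrals.
Context {R : realType} {d : nat}.
Local Notation mu := (lebesgue_rV R d).
Implicit Types (A B : set 'rV[R]_d) (f g : 'rV[R]_d -> R) (p q x v : 'rV[R]_d) (r k m : R).

Lemma le_integral_fin A f g : measurable A -> measurable_fun setT f -> measurable_fun setT g ->
  (forall x, A x -> 0 <= f x) -> (forall x, A x -> f x <= g x) ->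
  (\int[mu]_(x in A) (f x)%:E <= \int[mu]_(x in A) (g x)%:E)%E.
Proof.
move=> mA mf mg f0 fg; apply: ge0_le_integral => //.
- exact/measurable_funTS/measurable_EFinP.
- exact/measurable_funTS/measurable_EFinP.
Qed.

Lemma integral_finD A f g : measurable A -> measurable_fun setT f -> measurable_fun setT g ->
  (forall x, 0 <= f x) -> (forall x, 0 <= g x) ->
  (\int[mu]_(x in A) (f x + g x)%:E =
   \int[mu]_(x in A) (f x)%:E + \int[mu]_(x in A) (g x)%:E)%E.
Proof.
move=> mA mf mg f0 g0; under eq_integral do rewrite EFinD.
rewrite ge0_integralD//; try by move=> x _; rewrite lee_fin.
- exact/measurable_funTS/measurable_EFinP.
- exact/measurable_funTS/measurable_EFinP.
Qed.

Lemma integral_finZ A k f : measurable A -> measurable_fun setT f ->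
  (forall x, 0 <= f x) -> 0 <= k ->
  (\int[mu]_(x in A) (k * f x)%:E = k%:E * \int[mu]_(x in A) (f x)%:E)%E.
Proof.
move=> mA mf f0 k0; under eq_integral do rewrite EFinM.
rewrite ge0_integralZl_EFin//; first by move=> x _; rewrite lee_fin.
exact/measurable_funTS/measurable_EFinP.
Qed.

Lemma integral_fin_ge0 A f : (forall x, 0 <= f x) -> (0 <= \int[mu]_(x in A) (f x)%:E)%E.
Proof. by move=> f0; apply: integral_ge0 => x _; rewrite lee_fin. Qed.

Lemma integral_fin_subset A B f : measurable A -> measurable B -> measurable_fun setT f ->
  (forall x, 0 <= f x) -> A `<=` B ->
  (\int[mu]_(x in A) (f x)%:E <= \int[mu]_(x in B) (f x)%:E)%E.
Proof.
move=> mA mB mf f0 AB; apply: ge0_subset_integral => //; last by move=> x _; rewrite lee_fin.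
exact/measurable_funTS/measurable_EFinP.
Qed.

(* Integrate [h^2 >= 2 c h - c^2], c being the mean of h. *)
Lemma Jensen_sqr A f m : measurable A -> measurable_fun setT f ->
  (0 < mu A)%E -> (mu A < +oo)%E ->
  ((((fine (mu A))^-1 * \int[mu]_(x in A) f x - m) ^+ 2)%:E <=
   ((fine (mu A))^-1)%:E * \int[mu]_(x in A) ((f x - m) ^+ 2)%:E)%E.
Proof.
move=> mA mf A0 Aoo; set a := fine (mu A).
have aE : mu A = a%:E by rewrite /a fineK// ge0_fin_numE// ltW.
have a0 : 0 < a by rewrite -lte_fin -aE.
have [->|Ioo] := eqVneq (\int[mu]_(x in A) ((f x - m) ^+ 2)%:E)%E +oo%E.
  by rewrite gt0_muley ?leey// lte_fin invr_gt0.
have mh : measurable_fun setT (fun x => f x - m) by exact: measurable_funB.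
have mh2 : measurable_fun setT (fun x => (f x - m) ^+ 2) by exact: measurable_funX.
have i2 : mu.-integrable A (EFin \o (fun x => (f x - m) ^+ 2)).
  apply/integrableP; split; first exact/measurable_funTS/measurable_EFinP.
  under eq_integral do rewrite /= ger0_norm ?sqr_ge0//.
  by rewrite ltey.
have i0 k : mu.-integrable A (EFin \o (cst k : 'rV[R]_d -> R)).
  apply/integrableP; split; first exact/measurable_funTS/measurable_EFinP.
  by rewrite (integral_cst mu mA `|k|%:E) lte_mul_pinfty.
have i1 : mu.-integrable A (EFin \o (fun x => f x - m)).
  apply: (le_integrable _ _ _ (integrableD mA (i0 1) i2)) => //.
    exact/measurable_funTS/measurable_EFinP.
  move=> x _ /=; rewrite lee_fin [leRHS]ger0_norm; last by rewrite addr_ge0// sqr_ge0.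
  have := sqr_ge0 (`|f x - m| - 1); rewrite sqrrB real_normK ?num_real//; have := normr_ge0 (f x - m); lra.
have e1 : \int[mu]_(x in A) f x = \int[mu]_(x in A) (f x - m) + m * a.
  have -> : m * a = \int[mu]_(x in A) (cst m x) by rewrite Rintegral_cst.
  rewrite -RintegralD//; by apply: eq_Rintegral => x _; rewrite subrK.
pose H := \int[mu]_(x in A) (f x - m); pose c := a^-1 * H.
have -> : a^-1 * \int[mu]_(x in A) f x - m = c.
  by rewrite e1 mulrDr -/H mulrCA mulVf ?gt_eqF// mulr1 addrK.
have -> : (\int[mu]_(x in A) ((f x - m) ^+ 2)%:E)%E = (\int[mu]_(x in A) ((f x - m) ^+ 2))%:E.
  by rewrite fineK//; apply: integrable_fin_num.
rewrite -EFinM lee_fin mulrC ler_pdivlMr//.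
have i3 : mu.-integrable A (EFin \o (fun x => 2 * c * (f x - m))).
  by have := integrableZl mA (2 * c) i1.
have -> : c ^+ 2 * a = \int[mu]_(x in A) (2 * c * (f x - m) + - c ^+ 2).
  have -> := RintegralD mA i3 (i0 (- c ^+ 2)).
  have -> : \int[mu]_(x in A) (2 * c * (f x - m)) = 2 * c * H by exact: RintegralZl.
  have -> : \int[mu]_(x in A) (cst (- c ^+ 2) x) = - c ^+ 2 * a by rewrite Rintegral_cst.
  rewrite /c.
  by have aN : a != 0 := lt0r_neq0 a0; field.
apply: le_Rintegral => //; first exact: (integrableD mA i3 (i0 _)).
by move=> x _; have := sqr_ge0 (f x - m - c); rewrite sqrrB; lra.
Qed.

End real_integrals.

Section translation_estimates.
Context {R : realType} {d : nat}.
Local Notation mu := (lebesgue_rV R d).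
Implicit Types (A B D W : set 'rV[R]_d) (f g : 'rV[R]_d -> R) (p q x v : 'rV[R]_d) (r k m : R).

(* Here f is a function and g the square of its gradient, possibly multiplied by
   the indicator of a set outside which f is 0. This estimate, unlike those on
   segments, passes to L^2 limits. *)
Definition transl_le W k f g := forall p r v, 0 < r -> ball p (r + `|v|) `<=` W ->
  (\int[mu]_(x in ball p r) ((f (x + v) - f x) ^+ 2)%:E <=
   (k * `|v| ^+ 2)%:E * \int[mu]_(x in ball p (r + `|v|)) (g x)%:E)%E.

Lemma measurable_transl f v : measurable_fun setT f -> measurable_fun setT (fun x => f (x + v)).
Proof. by move=> mf; apply: measurableT_comp => //; apply: (measurable_rVD (g := cst v)). Qed.

Lemma integral_transl_set_le A B f v : measurable A -> measurable B -> measurable_fun setT f ->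
  (forall x, 0 <= f x) -> (forall x, A x -> B (x + v)) ->
  (\int[mu]_(x in A) (f (x + v))%:E <= \int[mu]_(x in B) (f x)%:E)%E.
Proof.
move=> mA mB mf f0 AB.
rewrite (@integral_rV_translation_set _ _ v A (EFin \o f)) //; last first.
  exact/measurable_EFinP.
have mS : measurable [set y : 'rV[R]_d | A (y - v)] by have [] := lebesgue_rV_translate v mA.
apply: integral_fin_subset => // y /= /AB; by rewrite subrK.
Qed.

(** Integrate [segment_increment] over the ball and exchange the integrals: for each time [t] in
    [0, 1] the shifted ball stays in [ball p (r + |v|)], so that no constant is lost. *)
Lemma transl_smooth W U phi : smooth phi -> open U ->
  (forall x, W x -> bnd U x -> phi x = 0) ->
  transl_le W (4 * d%:R) (zext phi U) (zgrad phi U).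
Proof.
move=> sphi oU phi0 p r v r0 BW.
have mz := measurable_zgrad sphi oU.
have mB e : measurable (ball p e) := measurable_rV_ball p e.
have mze : measurable_fun setT (zext phi U).
  apply: measurable_funM; first exact: smooth_measurable.
  by apply: measurable_indic; exact: open_measurable_rV.
pose F (z : 'rV[R]_d * measurableTypeR R) : \bar R := (\1_(ball p r) z.1 * (\1_(`[0%R, 1%R]%classic : set R) z.2 * zgrad phi U (z.1 + (z.2 : R) *: v)))%:E.
have mF : measurable_fun setT F.
  apply/measurable_EFinP; apply: measurable_funM.
    by apply: measurableT_comp => //; apply: measurable_indic.
  apply: measurable_funM.
    by apply: measurableT_comp => //; apply: measurable_indic.
  apply: measurableT_comp => //; apply: measurable_rVD; first exact: measurable_fst.
  by apply: measurable_rVZ => //; exact: measurable_snd.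
have F0 z : (0 <= F z)%E.
  by rewrite lee_fin; apply: mulr_ge0 => //; apply: mulr_ge0 => //; exact: zgrad_ge0.
set c := 4 * d%:R * `|v| ^+ 2; have c0 : 0 <= c by rewrite !mulr_ge0// exprn_ge0.
have E1 x : (\int[lebesgue_measure]_t F (x, t) =
    (\1_(ball p r) x)%:E * \int[lebesgue_measure]_(t in `[0%R, 1%R]) (zgrad phi U (x + (t : R) *: v))%:E)%E.
  rewrite [in RHS]integral_mkcond -ge0_integralZl_EFin//; first last.
  - apply/(measurable_restrictT _ _).1 => //; apply/measurable_funTS/measurable_EFinP.
    by apply: measurableT_comp => //; exact: measurable_line.
  - by move=> t _; apply: erestrict_ge0 => s _; rewrite lee_fin zgrad_ge0.
  apply: eq_integral => t _; rewrite /F /= EFinM; congr (_ * _)%E.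
  by rewrite patchE indicE; case: ifP => _; rewrite ?mul1r ?mul0r.
apply: (@le_trans _ _ (c%:E * \int[mu]_x \int[lebesgue_measure]_t F (x, t))%E).
  rewrite -ge0_integralZl_EFin//; first last.
  - by apply: (measurable_fun_fubini_tonelli_F (m2 := lebesgue_measure)).
  - by move=> x _; apply: integral_ge0.
  rewrite [leLHS]integral_mkcond; apply: ge0_le_integral => //.
  - by move=> x _; apply: erestrict_ge0 => y _; rewrite lee_fin sqr_ge0.
  - apply/(measurable_restrictT _ _).1 => //; apply/measurable_funTS/measurable_EFinP.
    by apply: measurable_funX; apply: measurable_funB => //; exact: measurable_transl.
  - apply: measurable_funeM.
    by apply: (measurable_fun_fubini_tonelli_F (m2 := lebesgue_measure)).
  - move=> x _; rewrite E1 patchE indicE; case: ifPn => [xB|_]; last first.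
      by rewrite mul0e mule0.
    rewrite mul1e; apply: segment_increment => // t /andP[t0 t1]; apply: phi0.
    apply: BW; move: xB; rewrite inE -!ball_normE /= => xB.
    have := ler_distD x p (x + t *: v); rewrite opprD addNKr normrN normrZ ger0_norm//.
    have : t * `|v| <= `|v| by rewrite ler_piMl.
    lra.
apply: lee_wpmul2l; first by rewrite lee_fin.
rewrite fubini_tonelli//.
set K := (X in (_ <= X)%E).
have E2 (t : R) : (\int[mu]_x F (x, t) <= (\1_(`[0%R, 1%R]%classic : set R) t)%:E * K)%E.
  rewrite /F /= indicE; have [t01|] := boolP (t \in _); last first.
    by move=> _; rewrite mul0e; under eq_integral do rewrite mul0r mulr0; rewrite integral0.
  rewrite mul1e; under eq_integral do rewrite mul1r.
  move: t01; rewrite inE /= in_itv /= => /andP[t0 t1].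
  have -> : (\int[mu]_x (\1_(ball p r) x * zgrad phi U (x + t *: v))%:E =
      \int[mu]_(x in ball p r) (zgrad phi U (x + t *: v))%:E)%E.
    rewrite [RHS]integral_mkcond; apply: eq_integral => x _; rewrite patchE indicE.
    by case: ifP => _; rewrite ?mul1r ?mul0r.
  apply: integral_transl_set_le => // x; first exact: zgrad_ge0.
  rewrite -!ball_normE /= => xB.
  have := ler_distD x p (x + t *: v); rewrite opprD addNKr normrN normrZ ger0_norm//.
  have : t * `|v| <= `|v| by rewrite ler_piMl.
  lra.
have K0 : (0 <= K)%E by apply: integral_fin_ge0 => x; exact: zgrad_ge0.
apply: (@le_trans _ _ (\int[lebesgue_measure]_t ((\1_(`[0%R, 1%R]%classic : set R) t)%:E * K))%E).
  apply: ge0_le_integral => //.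
  - by move=> t _; apply: integral_ge0.
  - exact: (measurable_fun_fubini_tonelli_G (m1 := mu)).
  - apply: emeasurable_funM => //; apply/measurable_EFinP; exact: measurable_indic.
under eq_integral do rewrite muleC.
rewrite ge0_integralZl//; last by apply/measurable_EFinP; exact: measurable_indic.
have -> : (\int[lebesgue_measure]_t (\1_(`[0%R, 1%R]%classic : set R) t)%:E = 1)%E.
  rewrite integral_indic// setIT; apply: etrans (lebesgue_measure_itv _) _.
  by rewrite /= lte_fin ltr01 oppr0 adde0.
by rewrite mule1.
Qed.

End translation_estimates.

Section poincare.
Context {R : realType} {d : nat}.
Local Notation mu := (lebesgue_rV R d).
Implicit Types (A B D W : set 'rV[R]_d) (f g h : 'rV[R]_d -> R) (p q x v : 'rV[R]_d) (r k m e : R).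

Lemma integral_transl_T f v : measurable_fun setT f -> (forall x, 0 <= f x) ->
  (\int[mu]_x (f (x + v))%:E = \int[mu]_x (f x)%:E)%E.
Proof.
move=> mf f0; apply: (@integral_rV_translation _ _ v (EFin \o f)) => [|x]; first exact/measurable_EFinP.
by rewrite lee_fin.
Qed.

(** The inequality [g' <= 2 * g + 2 * h] expresses the convergence of the squared gradients.
    Replacing [f] by [f'] costs a factor 2 and replacing [g'] by [g] another, whence [4 * k]; for
    fixed [v] the errors tend to 0 with [e]. *)
Lemma transl_limit W k f g : 0 <= k -> measurable_fun setT f -> measurable_fun setT g ->
  (forall x, 0 <= g x) ->
  (forall e, 0 < e -> exists f' g' h, [/\ measurable_fun setT f', measurable_fun setT g',
     measurable_fun setT h,
     [/\ forall x, 0 <= g' x, forall x, 0 <= h x, forall x, g' x <= 2 * g x + 2 * h x &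
      transl_le W k f' g'] &
     (\int[mu]_x ((f x - f' x) ^+ 2)%:E <= e%:E /\ \int[mu]_x (h x)%:E <= e%:E)%E]) ->
  transl_le W (4 * k) f g.
Proof.
move=> k0 mf mg g0 H p r v r0 BW.
have mB e : measurable (ball p e) := measurable_rV_ball p e.
have v0 : 0 <= k * `|v| ^+ 2 by rewrite mulr_ge0// exprn_ge0.
set I := (X in (_ * X)%E).
suff H2 e : 0 < e -> (\int[mu]_(x in ball p r) ((f (x + v) - f x) ^+ 2)%:E <=
    (4 * k * `|v| ^+ 2)%:E * I + ((4 * (k * `|v| ^+ 2) + 8) * e)%:E)%E.
  apply/lee_addgt0Pr => e e0; pose K := 4 * (k * `|v| ^+ 2) + 8.
  have K0 : 0 < K by rewrite /K; lra.
  have eK : K * (e / K) = e by rewrite mulrCA divff ?mulr1// gt_eqF.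
  by have := H2 (e / K) (divr_gt0 e0 K0); rewrite -/K eK.
move=> e0; have [f' [g' [h [mf' mg' mh [g'0 h0 gh T'] [fe he]]]]] := H e e0.
pose D x := f x - f' x.
have mD : measurable_fun setT D by exact: measurable_funB.
have mD2 : measurable_fun setT (fun x => D x ^+ 2) by exact: measurable_funX.
have mt (F : 'rV[R]_d -> R) : measurable_fun setT F -> measurable_fun setT (fun x => (F (x + v) - F x) ^+ 2).
  by move=> mF; apply: measurable_funX; apply: measurable_funB => //; exact: measurable_transl.
have mDv : measurable_fun setT (fun x => D (x + v) ^+ 2).
  by apply: measurable_funX; exact: measurable_transl.
have D0 x : 0 <= D x ^+ 2 by exact: sqr_ge0.
apply: (@le_trans _ _ (\int[mu]_(x in ball p r)
    (2 * (f' (x + v) - f' x) ^+ 2 + (4 * D (x + v) ^+ 2 + 4 * D x ^+ 2))%:E)%E).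
  apply: le_integral_fin => //; first exact: mt.
  - apply: measurable_funD; first by apply: measurable_funM => //; exact: mt.
    by apply: measurable_funD; apply: measurable_funM.
  - by move=> x _; exact: sqr_ge0.
  - move=> x _; rewrite /D; set a := f (x + v); set b := f x; set a' := f' (x + v); set b' := f' x.
    have := sqr_ge0 ((a' - b') - ((a - a') - (b - b'))); have := sqr_ge0 ((a - a') + (b - b')); nra.
rewrite integral_finD//; first last.
- by move=> x; rewrite addr_ge0// mulr_ge0// sqr_ge0.
- by move=> x; rewrite mulr_ge0// sqr_ge0.
- by apply: measurable_funD; apply: measurable_funM.
- by apply: measurable_funM => //; exact: mt.
rewrite integral_finZ//; [|exact: mt|by move=> x; exact: sqr_ge0].
have eZ c : 0 <= c -> (c * e)%:E = (c%:E * e%:E)%E by rewrite EFinM.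
have hD : (\int[mu]_(x in ball p r) (4 * D (x + v) ^+ 2 + 4 * D x ^+ 2)%:E <= (8 * e)%:E)%E.
  rewrite integral_finD//; try by [move=> x; rewrite mulr_ge0// sqr_ge0|apply: measurable_funM].
  rewrite !integral_finZ//.
  have -> : 8 * e = 4 * e + 4 * e by ring.
  rewrite (EFinD (4 * e)) (EFinM 4 e); apply: leeD; apply: lee_wpmul2l => //; apply: le_trans _ fe.
    rewrite -(@integral_transl_T (fun x => D x ^+ 2) v)//.
    by apply: integral_fin_subset => // x; exact: sqr_ge0.
  exact: integral_fin_subset.
have hg : (\int[mu]_(x in ball p (r + `|v|)) (g' x)%:E <= 2%:E * I + (2 * e)%:E)%E.
  apply: (@le_trans _ _ (\int[mu]_(x in ball p (r + `|v|)) (2 * g x + 2 * h x)%:E)%E).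
    apply: le_integral_fin => //.
    by apply: measurable_funD; apply: measurable_funM.
  rewrite integral_finD//; try by [move=> x; rewrite mulr_ge0|apply: measurable_funM].
  rewrite !integral_finZ// (EFinM 2 e); apply: leeD => //; apply: lee_wpmul2l => //.
  by apply: le_trans he; exact: integral_fin_subset.
apply: (@le_trans _ _ (2%:E * ((k * `|v| ^+ 2)%:E * (2%:E * I + (2 * e)%:E)) + (8 * e)%:E)%E).
  apply: leeD => //; apply: lee_wpmul2l => //; apply: le_trans (T' p r v r0 BW) _.
  by apply: lee_wpmul2l; rewrite ?lee_fin.
have I0 : (0 <= I)%E by exact: integral_fin_ge0.
rewrite ge0_muleDr; [|by rewrite mule_ge0|by rewrite lee_fin; lra].
rewrite ge0_muleDr; first last.
- by rewrite -EFinM lee_fin mulr_ge0//; lra.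
- by rewrite !mule_ge0.
rewrite -addeA !muleA -!EFinM -EFinD.
rewrite (_ : 2 * (k * `|v| ^+ 2) * 2 = 4 * k * `|v| ^+ 2); last by ring.
apply: leeD => //; rewrite lee_fin; have : 0 <= k * `|v| ^+ 2 * e by rewrite mulr_ge0// ltW.
lra.
Qed.

Variables (W D : set 'rV[R]_d) (k : R) (f g : 'rV[R]_d -> R).
Hypotheses (k0 : 0 <= k) (mf : measurable_fun setT f) (mg : measurable_fun setT g)
  (g0 : forall x, 0 <= g x) (mD : measurable D) (T : transl_le W k f g).

Definition sqdev r p m := (\int[mu]_(x in ball p r) ((f x - m) ^+ 2)%:E)%E.

Lemma sqdev_ge0 r p m : (0 <= sqdev r p m)%E.
Proof. by apply: integral_fin_ge0 => x; exact: sqr_ge0. Qed.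

Let mball p r : measurable (ball p r) := measurable_rV_ball p r.

Let msq m : measurable_fun setT (fun x => (f x - m) ^+ 2).
Proof. by apply: measurable_funX; exact: measurable_funB. Qed.

(** One step of the chain is a translation, which gives [sqdev r p m <= X + 2 * sqdev r p1 m] with
    [X] the gradient term; the factor 3 instead of 2 absorbs the repeated [X]. *)
Lemma chain_poincare r m N p q : 0 < r ->
  chain (fun x => ball x (3 * r) `<=` D `&` W) (step (2 * r)) N p q ->
  (sqdev r p m <= (3 ^+ N)%:E * ((8 * k * r ^+ 2)%:E * \int[mu]_(x in D) (g x)%:E + sqdev r q m))%E.
Proof.
move=> r0; set J := (\int[mu]_(x in D) _)%E.
have J0 : (0 <= J)%E by exact: integral_fin_ge0.
have c0 : 0 <= 8 * k * r ^+ 2 by rewrite mulr_ge0 ?sqr_ge0 ?mulr_ge0.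
elim: N p => [|N IH] p /=.
  by move=> [_ ->]; rewrite expr0 mul1e leeDr// mule_ge0.
move=> [Bp [p1 Sp /IH c]]; set X := (_ * J)%E in IH c *; set Y := sqdev r q m in IH c *.
have X0 : (0 <= X)%E by rewrite mule_ge0.
have Y0 : (0 <= Y)%E by exact: sqdev_ge0.
have h1 : (sqdev r p m <= X + 2%:E * sqdev r p1 m)%E.
  pose v := p1 - p; have vr : `|v| <= 2 * r by rewrite distrC.
  have mt : measurable_fun setT (fun x => (f (x + v) - f x) ^+ 2).
    by apply: measurable_funX; apply: measurable_funB => //; exact: measurable_transl.
  have mv : measurable_fun setT (fun x => (f (x + v) - m) ^+ 2).
    by apply: (@measurable_transl _ _ (fun x => (f x - m) ^+ 2)); exact: msq.
  apply: (@le_trans _ _ (\int[mu]_(x in ball p r)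
      (2 * (f (x + v) - f x) ^+ 2 + 2 * (f (x + v) - m) ^+ 2)%:E)%E).
    apply: le_integral_fin => //.
    - by apply: measurable_funD; apply: measurable_funM.
    - by move=> x _; exact: sqr_ge0.
    - by move=> x _; have := sqr_ge0 ((f (x + v) - f x) + (f (x + v) - m)); nra.
  rewrite integral_finD//; try by [move=> x; rewrite mulr_ge0// sqr_ge0|apply: measurable_funM].
  rewrite !integral_finZ//; try by move=> x; exact: sqr_ge0.
  apply: leeD.
    rewrite /X (_ : 8 * k * r ^+ 2 = 2 * (k * (2 * r) ^+ 2)); last by ring.
    rewrite (EFinM 2) -muleA; apply: lee_wpmul2l => //.
    have rB : ball p (r + `|v|) `<=` ball p (3 * r) by apply: le_ball; lra.
    apply: le_trans (T r0 _) _; first by move=> x /rB/Bp[].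
    apply: lee_pmul.
    - by rewrite lee_fin mulr_ge0// exprn_ge0.
    - exact: integral_fin_ge0.
    - by rewrite lee_fin ler_wpM2l// lerXn2r ?nnegrE//; lra.
    - by apply: integral_fin_subset => // x /rB/Bp[].
  have key := @integral_transl_set_le R d (ball p r) (ball p1 r) (fun x => (f x - m) ^+ 2) v
    (mball p r) (mball p1 r) (msq m) (fun x => sqr_ge0 _).
  apply: lee_wpmul2l; first by rewrite lee_fin.
  apply: key => x; rewrite -!ball_normE /=.
  by rewrite (_ : p1 - (x + v) = p - x)//; apply/rowP => i; rewrite !mxE; ring.
apply: le_trans h1 _.
have XY : (0 <= X + Y)%E by rewrite adde_ge0.
apply: (@le_trans _ _ ((X + Y) + 2%:E * ((3 ^+ N)%:E * (X + Y)))%E).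
  by apply: leeD; [rewrite leeDl|apply: lee_wpmul2l].
have N3 : 0 <= 2 * 3 ^+ N :> R by rewrite mulr_ge0 ?exprn_ge0.
apply: (@le_trans _ _ ((1 + 2 * 3 ^+ N)%:E * (X + Y))%E).
  by rewrite (EFinD 1 (2 * 3 ^+ N)) ge0_muleDl ?lee_fin// mul1e (EFinM 2) muleA.
apply: lee_wpmul2r => //; rewrite lee_fin exprS.
have : 1 <= 3 ^+ N :> R by rewrite exprn_ege1//; lra.
lra.
Qed.

(** With [m] the mean over the ball, Jensen's inequality bounds the deviation by a double integral
    of [(f y - f x) ^+ 2]. Substituting [y = x + v] leaves the translation estimate for each
    [|v| < 2 * r]; the set of these [v] has [2 ^+ d] times the measure of the ball. *)
Lemma ball_poincare r q : 0 < r -> ball q (3 * r) `<=` D `&` W -> exists m,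
  (sqdev r q m <= (4 * 2 ^+ d * k * r ^+ 2)%:E * \int[mu]_(x in D) (g x)%:E)%E.
Proof.
move=> r0 BD; pose B : set 'rV[R]_d := ball q r.
have muB : mu B = ((r *+ 2) ^+ d)%:E by exact: lebesgue_rV_ball.
have b0 : 0 < (r *+ 2) ^+ d by rewrite exprn_gt0// mulr2n; lra.
set b := (r *+ 2) ^+ d in muB b0.
have fb : fine (mu B) = b by rewrite muB.
exists (b^-1 * \int[mu]_(x in B) f x); set m := (X in sqdev r q X).
set J := (\int[mu]_(x in D) _)%E; have J0 : (0 <= J)%E by exact: integral_fin_ge0.
have mBB : measurable B by exact: mball.
have jen x : (((f x - m) ^+ 2)%:E <= (b^-1)%:E * \int[mu]_(y in B) ((f y - f x) ^+ 2)%:E)%E.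
  have -> : (f x - m) ^+ 2 = (m - f x) ^+ 2 by rewrite -sqrrN opprB.
  by rewrite /m -fb; apply: Jensen_sqr => //; rewrite -/B muB ?lte_fin// ltry.
pose F (z : 'rV[R]_d * 'rV[R]_d) : \bar R :=
  (\1_B z.1 * (\1_B (z.2 + z.1) * (f (z.2 + z.1) - f z.1) ^+ 2))%:E.
have m2 : measurable_fun setT (fun z : 'rV[R]_d * 'rV[R]_d => z.2 + z.1).
  by apply: measurable_rVD; [exact: measurable_snd|exact: measurable_fst].
have mF : measurable_fun setT F.
  apply/measurable_EFinP; apply: measurable_funM.
    by apply: measurableT_comp => //; apply: measurable_indic.
  apply: measurable_funM.
    by apply: measurableT_comp => //; apply: measurable_indic.
  by apply: measurable_funX; apply: measurable_funB; apply: measurableT_comp.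
have F0 z : (0 <= F z)%E by rewrite lee_fin mulr_ge0// mulr_ge0// sqr_ge0.
have E1 x : B x -> (\int[mu]_(y in B) ((f y - f x) ^+ 2)%:E = \int[mu]_v F (x, v))%E.
  move=> Bx; rewrite integral_mkcond.
  rewrite -[LHS](@integral_rV_translation _ _ x); first last.
  - by move=> y; apply: erestrict_ge0 => z _; rewrite lee_fin sqr_ge0.
  - apply/(measurable_restrictT _ _).1 => //; exact/measurable_funTS/measurable_EFinP.
  apply: eq_integral => v _; rewrite /F /= !indicE (mem_set Bx) mul1r patchE.
  by case: ifP => _; rewrite ?mul1r ?mul0r.
apply: (@le_trans _ _ ((b^-1)%:E * \int[mu]_x \int[mu]_v F (x, v))%E).
  rewrite -ge0_integralZl_EFin//; first last.
  - by rewrite invr_ge0 ltW.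
  - exact: (measurable_fun_fubini_tonelli_F (m2 := mu)).
  - by move=> x _; apply: integral_ge0.
  rewrite /sqdev [leLHS]integral_mkcond; apply: ge0_le_integral => //.
  - by move=> x _; apply: erestrict_ge0 => z _; rewrite lee_fin sqr_ge0.
  - apply/(measurable_restrictT _ _).1 => //; exact/measurable_funTS/measurable_EFinP.
  - by apply: measurable_funeM; exact: (measurable_fun_fubini_tonelli_F (m2 := mu)).
  - move=> x _; rewrite patchE; case: ifPn => [|_]; first by rewrite inE => Bx; rewrite -E1.
    by rewrite mule_ge0 ?lee_fin ?invr_ge0 ?(ltW b0)// integral_ge0.
rewrite fubini_tonelli//.
pose B2 : set 'rV[R]_d := ball 0 (2 * r).
have mB2 : measurable B2 by exact: mball.
have muB2 : mu B2 = ((2 * r *+ 2) ^+ d)%:E by apply: lebesgue_rV_ball; lra.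
have E2 v : (\int[mu]_x F (x, v) <= (\1_B2 v)%:E * ((4 * k * r ^+ 2)%:E * J))%E.
  rewrite indicE; have [vr|] := boolP (v \in _); last first.
    rewrite notin_setE /B2 -ball_normE /= sub0r normrN => vr.
    rewrite mul0e [X in (X <= _)%E](_ : _ = 0)%E//.
    rewrite -[RHS](integral0 mu setT); apply: eq_integral => x _; rewrite /F /= !indicE.
    case: (boolP (x \in B)) => [xB|_]; last by rewrite mul0r.
    case: (boolP (v + x \in B)) => [vB|_]; last by rewrite mul0r mulr0.
    exfalso; apply: vr; move: xB vB; rewrite !inE /B -!ball_normE /= => xB vB.
    have := ler_distD q (v + x) x; rewrite addrK [`|v + x - q|]distrC; lra.
  move: vr; rewrite inE /B2 -ball_normE /= sub0r normrN mul1e => vr.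
  have rB : ball q (r + `|v|) `<=` ball q (3 * r) by apply: le_ball; lra.
  apply: (@le_trans _ _ (\int[mu]_(x in B) ((f (x + v) - f x) ^+ 2)%:E)%E).
    rewrite [leRHS]integral_mkcond; apply: ge0_le_integral => //.
    - by apply: measurableT_comp => //; exact: measurable_pair2.
    - apply/(measurable_restrictT _ _).1 => //; apply/measurable_funTS/measurable_EFinP.
      by apply: measurable_funX; apply: measurable_funB => //; exact: measurable_transl.
    - move=> x _; rewrite /F /= patchE !indicE; case: ifP => _; last by rewrite mul0r.
      rewrite mul1r lee_fin [v + x]addrC; case: (_ \in _); rewrite ?mul1r ?mul0r//.
      exact: sqr_ge0.
  apply: le_trans (T r0 _) _; first by move=> x /rB/BD[].
  apply: lee_pmul.
  - by rewrite lee_fin mulr_ge0// exprn_ge0.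
  - exact: integral_fin_ge0.
  - rewrite lee_fin (_ : 4 * k * r ^+ 2 = k * (2 * r) ^+ 2); last by ring.
    by rewrite ler_wpM2l// lerXn2r ?nnegrE//; lra.
  - by apply: integral_fin_subset => // x /rB/BD[].
have c0 : 0 <= 4 * k * r ^+ 2 by rewrite mulr_ge0 ?sqr_ge0 ?mulr_ge0.
apply: (@le_trans _ _ ((b^-1)%:E * \int[mu]_v ((\1_B2 v)%:E * ((4 * k * r ^+ 2)%:E * J)))%E).
  apply: lee_wpmul2l; first by rewrite lee_fin invr_ge0 ltW.
  apply: ge0_le_integral => //.
  - by move=> t _; apply: integral_ge0.
  - exact: (measurable_fun_fubini_tonelli_G (m1 := mu)).
  - by apply: emeasurable_funM => //; apply/measurable_EFinP; apply: measurable_indic.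
under eq_integral do rewrite muleC.
rewrite ge0_integralZl//; first last.
- by rewrite mule_ge0.
- by apply/measurable_EFinP; apply: measurable_indic.
have -> : (\int[mu]_x (\1_B2 x)%:E = ((2 * r *+ 2) ^+ d)%:E)%E.
  by rewrite integral_indic// setIT; exact: muB2.
have -> : (2 * r) *+ 2 = 2 * (r *+ 2) by rewrite mulrnAr.
rewrite exprMn -/b [X in (_ * X)%E]muleC !muleA -!EFinM; apply: lee_wpmul2r => //.
rewrite lee_fin; have bN := lt0r_neq0 b0; rewrite le_eqVlt; apply/orP; left; apply/eqP.
by field.
Qed.

End poincare.

(** * The extension *)

Section varying_average.
Context {R : realType} {n : nat}.
Local Notation mu := (lebesgue_rV R n).
Implicit Types (psi A : 'rV[R]_n -> R) (x z v h : 'rV[R]_n) (M m r : R) (e : nat).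
Variables (eta : 'rV[R]_n -> R) (s : 'rV[R]_n -> R).
Hypotheses (n0 : (0 < n)%N) (beta : bump eta) (eta0 : forall x, 0 <= eta x)
  (etapos : exists2 c, 0 < c & forall x, `|x| <= 2^-1 -> c <= eta x).
Hypotheses (s0 : forall x, 0 <= s x) (slip : forall x z, `|s x - s z| <= 4^-1 * `|x - z|).

(** Since the radius varies with [z], the mass of the kernel depends on [x]. The quotient reproduces
    constants, so that its derivatives see only the oscillation of [A]. *)
Definition vavg A x := Kint eta n s A x / Kint eta n s (cst 1) x.

Lemma continuous_quarter : continuous s.
Proof.
move=> x B /= /nbhs_ballP[e /= e0 eB]; apply/nbhs_ballP; exists e => // y.
rewrite -ball_normE /= => xy; apply: eB; rewrite -ball_normE /=.
by apply: le_lt_trans (slip _ _) _; have := normr_ge0 (x - y); lra.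
Qed.

Lemma measurable_quarter : measurable_fun setT s.
Proof. by apply: continuous_measurable_rV; [exact: openT|move=> x _; exact: continuous_quarter]. Qed.

Lemma quarter_near x z : ball x (2 * s x) z -> s x / 2 <= s z /\ s z <= 3 / 2 * s x.
Proof.
rewrite -ball_normE /= => xz; have := slip x z; rewrite ler_norml => /andP[h1 h2].
by split; lra.
Qed.

(** If [|x - z| >= 2 * s x] then [s z <= s x + |x - z| / 4 <= 3 / 4 * |x - z|], which is less than
    [|x + h - z|]; this is where the Lipschitz constant 1/4 is used. *)
Lemma quarter_far x h z : 0 < s x -> `|h| < s x / 8 -> ~ ball x (2 * s x) z ->
  s z = 0 \/ 1 < `|(s z)^-1 *: (x + h - z)|.
Proof.
rewrite -ball_normE /= => sx hx /negP; rewrite -leNgt => xz.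
have [->|sz] := eqVneq (s z) 0; [by left|right].
have sz0 : 0 < s z by rewrite lt_def sz s0.
rewrite normrZ gtr0_norm ?invr_gt0// ltr_pdivlMl// mulr1.
have := slip x z; rewrite ler_norml => /andP[h1 h2].
have := ler_normB (x + h - z) h; rewrite addrAC addrK; lra.
Qed.

Lemma quarter_off psi x z : bump psi -> 0 < s x -> ~ ball x (2 * s x) z ->
  psi ((s z)^-1 *: (x - z)) * (s z)^-1 = 0.
Proof.
move=> [_ p0] sx xz; have h : `|0 : 'rV[R]_n| < s x / 8 by rewrite normr0 divr_gt0.
have [->|] := quarter_far sx h xz; first by rewrite invr0 mulr0.
by rewrite addr0 => /p0 ->; rewrite mul0r.
Qed.

Lemma measurable_Kint_ker psi e A x : bump psi -> measurable_fun setT A ->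
  measurable_fun setT (fun z => psi ((s z)^-1 *: (x - z)) * (s z)^-1 ^+ e * A z).
Proof.
move=> bp mA; have ms := measurable_quarter.
have mi : measurable_fun setT (fun z => (s z)^-1).
  by apply: (measurableT_comp (@measurable_inv R)).
apply: measurable_funM => //; apply: measurable_funM; last exact: measurable_funX.
apply: measurableT_comp; first exact: bump_measurable.
by apply: measurable_rVZ => //; apply: measurable_rVD => //; apply: measurable_rVN.
Qed.

Section at_point.
Variables (x0 : 'rV[R]_n).
Hypothesis sx : 0 < s x0.

Lemma Kint_ker_bound psi B e A M z : bump psi -> (forall x, `|psi x| <= B) ->
  ball x0 (2 * s x0) z -> `|A z| <= M ->
  `|psi ((s z)^-1 *: (x0 - z)) * (s z)^-1 ^+ e * A z| <= B * (2 / s x0) ^+ e * M.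
Proof.
move=> bp pB xz AM; have [h1 _] := quarter_near xz.
have sz0 : 0 < s z by apply: lt_le_trans h1; exact: divr_gt0.
rewrite !normrM; apply: ler_pM => //.
apply: ler_pM => //; rewrite normrX lerXn2r ?nnegrE//.
  by rewrite divr_ge0// ltW.
by rewrite gtr0_norm ?invr_gt0// -invf_div lef_pV2 ?posrE// divr_gt0.
Qed.

Lemma Kint_ker_off psi e A z : bump psi -> (0 < e)%N -> ~ ball x0 (2 * s x0) z ->
  psi ((s z)^-1 *: (x0 - z)) * (s z)^-1 ^+ e * A z = 0.
Proof.
by case: e => // e bp _ xz; rewrite exprS mulrA (quarter_off bp)// !mul0r.
Qed.

Lemma integrable_Kint_ker psi e A M : bump psi -> (0 < e)%N -> measurable_fun setT A ->
  (forall z, ball x0 (2 * s x0) z -> `|A z| <= M) ->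
  mu.-integrable setT (EFin \o (fun z => psi ((s z)^-1 *: (x0 - z)) * (s z)^-1 ^+ e * A z)).
Proof.
move=> bp e0 mA AM; have [B B0 pB] := bump_bounded bp.
apply: (@integrable_supp _ _ _ x0 (2 * s x0) (B * (2 / s x0) ^+ e * M)).
- by rewrite mulr_gt0.
- exact: measurable_Kint_ker.
- by move=> z xz; apply: Kint_ker_bound => //; exact: AM.
- by move=> z xz; apply: Kint_ker_off.
Qed.

Lemma Kint_le psi B e A M : bump psi -> (forall x, `|psi x| <= B) -> (0 < e)%N ->
  measurable_fun setT A -> (forall z, ball x0 (2 * s x0) z -> `|A z| <= M) ->
  `|Kint psi e s A x0| <= B * (2 / s x0) ^+ e * M * (4 * s x0) ^+ n.
Proof.
move=> bp pB e0 mA AM; have -> : 4 * s x0 = (2 * s x0) *+ 2 by rewrite mulr2n; ring.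
apply: (@normr_Rintegral_supp _ _ _ x0) => //.
- by rewrite mulr_gt0.
- exact: measurable_Kint_ker.
- by move=> z xz; apply: Kint_ker_bound => //; exact: AM.
- by move=> z xz; apply: Kint_ker_off.
Qed.

Lemma KintB psi e A m M : bump psi -> (0 < e)%N -> measurable_fun setT A ->
  (forall z, ball x0 (2 * s x0) z -> `|A z| <= M) ->
  Kint psi e s (fun z => A z - m) x0 = Kint psi e s A x0 - m * Kint psi e s (cst 1) x0.
Proof.
move=> bp e0 mA AM; have i1 := integrable_Kint_ker bp e0 mA AM.
have i2 : mu.-integrable setT (EFin \o (fun z => psi ((s z)^-1 *: (x0 - z)) * (s z)^-1 ^+ e * (cst 1 : 'rV[R]_n -> R) z)).
  by apply: (@integrable_Kint_ker _ _ _ 1) => // z _; rewrite normr1.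
rewrite /Kint -RintegralZl// -RintegralB//; last first.
  by have := integrableZl measurableT m i2.
by apply: eq_Rintegral => z _ /=; ring.
Qed.

End at_point.

(** On the ball of radius [s x / 4] one has [s x / 2 <= s z <= 3 / 2 * s x], so that the argument of
    [eta] has norm at most 1/2. The powers of [s x] coming from the kernel and from the volume
    cancel. *)
Lemma Kint_mass_le (c : R) x : 0 < c -> (forall x, `|x| <= 2^-1 -> c <= eta x) -> 0 < s x ->
  c * (2 / 3) ^+ n * (2^-1) ^+ n <= Kint eta n s (cst 1) x.
Proof.
move=> c0 Hc sx; pose B : set 'rV[R]_n := ball x (s x / 4).
have sx4 : 0 < s x / 4 by rewrite divr_gt0.
have mB : measurable B by exact: measurable_rV_ball.
have muB : mu B = ((s x / 4 *+ 2) ^+ n)%:E by exact: lebesgue_rV_ball.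
have iB : mu.-integrable setT (EFin \o \1_B).
  apply: (@integrable_supp _ _ _ x (s x / 4) 1) => //.
  - by move=> z zB; rewrite indicE mem_set// normr1.
  - by move=> z zB; rewrite indicE memNset.
pose K := c * (2 / 3 / s x) ^+ n.
have -> : c * (2 / 3) ^+ n * 2^-1 ^+ n = \int[mu]_z (K * \1_B z).
  rewrite RintegralZl//.
  have -> : \int[mu]_z (\1_B z : R) = (s x / 4 *+ 2) ^+ n.
    by rewrite /Rintegral integral_indic// setIT [X in fine X](_ : _ = mu B)// muB.
  rewrite /K -!mulrA -!exprMn; congr (_ * _ ^+ n).
  by have sN := lt0r_neq0 sx; rewrite mulr2n; field.
have iK : mu.-integrable setT (EFin \o (fun z => eta ((s z)^-1 *: (x - z)) * (s z)^-1 ^+ n * (cst 1 : 'rV[R]_n -> R) z)).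
  by apply: (@integrable_Kint_ker _ sx _ _ _ 1) => // z _; rewrite normr1.
apply: le_Rintegral => //; first by have := integrableZl measurableT K iB.
move=> z _ /=; rewrite mulr1.
have [zB|zB] := pselect (B z); last first.
  rewrite indicE memNset// mulr0 mulr_ge0// exprn_ge0// invr_ge0; exact: s0.
rewrite indicE mem_set// mulr1; move: zB; rewrite /B -ball_normE /= => zB.
have xz : ball x (2 * s x) z by rewrite -ball_normE /=; apply: lt_le_trans zB _; lra.
have [h1 h2] := quarter_near xz.
have sz0 : 0 < s z by apply: lt_le_trans h1; exact: divr_gt0.
apply: ler_pM; [exact: ltW|by rewrite exprn_ge0// divr_ge0// ltW| |].
- apply: Hc; rewrite normrZ gtr0_norm ?invr_gt0// ler_pdivrMl//; lra.
- rewrite lerXn2r ?nnegrE ?invr_ge0 ?divr_ge0 ?(ltW sx) ?(ltW sz0)//.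
  rewrite -[2 / 3]invf_div -invfM lef_pV2 ?posrE// ?mulr_gt0//.
Qed.

Lemma Kint_mass : exists2 c, 0 < c & forall x, 0 < s x -> c <= Kint eta n s (cst 1) x.
Proof.
have [c c0 Hc] := etapos; exists (c * (2 / 3) ^+ n * (2^-1) ^+ n).
  by rewrite !mulr_gt0// exprn_gt0.
by move=> x; exact: Kint_mass_le.
Qed.

Lemma differentiable_Kint_vary psi e A M x : bump psi -> (0 < e)%N -> measurable_fun setT A ->
  0 < s x -> (forall z, ball x (2 * s x) z -> `|A z| <= M) ->
  differentiable (Kint psi e s A) x /\
  forall j, partial j (Kint psi e s A) x = Kint (partial j psi) e.+1 s A x.
Proof.
move=> bp e0 mA sx AM.
have h1 : 0 < s x / 8 by rewrite divr_gt0.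
have h2 : 0 < 2 * s x by rewrite mulr_gt0.
have h3 : 0 < s x / 2 by rewrite divr_gt0.
have near z : ball x (2 * s x) z -> s x / 2 <= s z by move=> /quarter_near[].
have far h z : `|h| < s x / 8 -> ~ ball x (2 * s x) z -> s z = 0 \/ 1 < `|(s z)^-1 *: (x + h - z)|.
  exact: quarter_far.
split; first exact: (differentiable_Kint bp e0 h1 h2 h3 measurable_quarter mA far near AM).
by move=> j; exact: (partial_Kint bp e0 h1 h2 h3 measurable_quarter mA far near AM).
Qed.

Lemma differentiable_vavg A M x : measurable_fun setT A ->
  0 < s x -> (forall z, ball x (2 * s x) z -> `|A z| <= M) -> differentiable (vavg A) x.
Proof.
move=> mA sx AM; have [c c0 Hc] := Kint_mass.
have [d1 _] := differentiable_Kint_vary beta n0 mA sx AM.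
have [d2 _] := @differentiable_Kint_vary eta n (cst 1) 1 x beta n0 (measurable_cst _) sx (fun _ _ => eq_ind_r (fun y => y <= 1) (lexx _) (normr1 _)).
apply: (differentiableM d1); apply: differentiableV => //.
by rewrite gt_eqF// (lt_le_trans c0)// Hc.
Qed.

Lemma partial_vavg A M x j : measurable_fun setT A ->
  0 < s x -> (forall z, ball x (2 * s x) z -> `|A z| <= M) ->
  partial j (vavg A) x =
  (Kint (partial j eta) n.+1 s A x * Kint eta n s (cst 1) x -
   Kint eta n s A x * Kint (partial j eta) n.+1 s (cst 1) x) / Kint eta n s (cst 1) x ^+ 2.
Proof.
move=> mA sx AM; have [c c0 Hc] := Kint_mass.
have [d1 p1] := differentiable_Kint_vary beta n0 mA sx AM.
have [d2 p2] := @differentiable_Kint_vary eta n (cst 1) 1 x beta n0 (measurable_cst _) sx (fun _ _ => eq_ind_r (fun y => y <= 1) (lexx _) (normr1 _)).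
have Nx : Kint eta n s (cst 1) x != 0 by rewrite gt_eqF// (lt_le_trans c0)// Hc.
have e1 : partial j (vavg A) x = 'D_(delta_mx 0 j) (Kint eta n s A * (fun y => (Kint eta n s (cst 1) y)^-1)) x by [].
rewrite e1 deriveM; [|exact: diff_derivable|by apply: diff_derivable; exact: differentiableV].
rewrite deriveV//; last exact: diff_derivable.
move: (p1 j) (p2 j); rewrite /partial => -> ->; rewrite /GRing.scale /=.
by field.
Qed.

(** Subtracting [m] from [A] subtracts [m] from the average and does not change its derivatives; in
    the quotient rule every integral of [A] may then be replaced by one of [A - m]. *)
Lemma vavg_bound_le (c B1 : R) A m M x : 0 < c ->
  (forall x, 0 < s x -> c <= Kint eta n s (cst 1) x) ->
  (forall x, `|eta x| <= B1) -> (forall j x, `|partial j eta x| <= B1) ->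
  measurable_fun setT A -> 0 < s x ->
  (forall z, ball x (2 * s x) z -> `|A z - m| <= M) ->
  let D := B1 * 8 ^+ n in let C := D / c + 2 * D / c + 2 * D * D / c ^+ 2 + 1 in
  `|vavg A x - m| <= C * M /\ forall j, `|partial j (vavg A) x| <= C * M / s x.
Proof.
move=> c0 Hc eb pb mA sx AM D C; rewrite {}/C.
have B10 : 0 <= B1 by apply: le_trans (normr_ge0 _) (eb 0).
have D0 : 0 <= D by rewrite mulr_ge0// exprn_ge0.
have M0 : 0 <= M.
  by apply: le_trans (AM x _) => //; apply: ballxx; rewrite mulr_gt0.
have AM' z : ball x (2 * s x) z -> `|A z| <= M + `|m|.
  move=> /AM h; have := ler_normD (A z - m) m; rewrite subrK; lra.
have mB : measurable_fun setT (fun z => A z - m) by exact: measurable_funB.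
set N := Kint eta n s (cst 1) x; have Nc : c <= N by exact: Hc.
have N0 : 0 < N by exact: lt_le_trans Nc.
(* The height of the kernel times the volume of its support: only the powers due to differentiation
   remain. *)
have e8 (e : nat) : (2 / s x) ^+ (n + e) * (4 * s x) ^+ n = 8 ^+ n * (2 / s x) ^+ e.
  rewrite exprD mulrAC -exprMn; congr (_ ^+ _ * _).
  by have sN := lt0r_neq0 sx; field.
have k1 e psi : bump psi -> (forall x, `|psi x| <= B1) ->
    `|Kint psi (n + e) s (fun z => A z - m) x| <= D * M * (2 / s x) ^+ e.
  move=> bp pB; apply: le_trans (@Kint_le x sx psi B1 _ _ M bp pB _ mB AM) _.
    by rewrite addn_gt0 n0.
  by rewrite -mulrA [M * _]mulrC !mulrA -(mulrA B1) e8 /D le_eqVlt; apply/orP; left; apply/eqP; ring.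
have k2 e psi : bump psi -> (forall x, `|psi x| <= B1) ->
    `|Kint psi (n + e) s (cst 1) x| <= D * (2 / s x) ^+ e.
  move=> bp pB; apply: le_trans (@Kint_le x sx psi B1 _ (cst 1) 1 bp pB _ _ _) _ => //.
  - by rewrite addn_gt0 n0.
  - by move=> z _; rewrite normr1.
  by rewrite mulr1 -mulrA e8 /D mulrA.
set Q := Kint eta n s (fun z => A z - m) x.
have QE : Q = Kint eta n s A x - m * N by apply: (KintB sx _ beta n0 mA AM').
have Qle : `|Q| <= D * M.
  by have := k1 0%N eta beta eb; rewrite addn0 expr0 mulr1.
have iN : N^-1 <= c^-1 by rewrite lef_pV2.
have iN0 : 0 <= N^-1 by rewrite invr_ge0 ltW.
have DM0 : 0 <= D * M by rewrite mulr_ge0.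
have c20 : 0 <= c^-1 by rewrite invr_ge0 ltW.
split.
  have -> : vavg A x - m = Q / N.
    by rewrite QE /vavg -/N; have NN := lt0r_neq0 N0; field.
  rewrite normrM [`|N^-1|]ger0_norm//.
  have h : `|Q| / N <= D * M / c by apply: ler_pM.
  apply: le_trans h _; rewrite mulrAC ler_wpM2r//.
  have : 0 <= 2 * D / c by rewrite divr_ge0 ?mulr_ge0// ltW.
  have : 0 <= 2 * D * D / c ^+ 2 by rewrite divr_ge0 ?sqr_ge0 ?mulr_ge0.
  clear -iN0; lra.
move=> j; rewrite (partial_vavg j mA sx AM') -/N.
set P' := Kint (partial j eta) n.+1 s A x; set N' := Kint (partial j eta) n.+1 s (cst 1) x.
set Q' := Kint (partial j eta) n.+1 s (fun z => A z - m) x.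
have Q'E : Q' = P' - m * N' by apply: (KintB sx _ (bump_partial j beta) _ mA AM').
have Q'le : `|Q'| <= D * M * (2 / s x).
  by have := k1 1%N _ (bump_partial j beta) (pb j); rewrite addn1 expr1.
have N'le : `|N'| <= D * (2 / s x).
  by have := k2 1%N _ (bump_partial j beta) (pb j); rewrite addn1 expr1.
have -> : (P' * N - Kint eta n s A x * N') / N ^+ 2 = Q' / N - Q * N' / N ^+ 2.
  by rewrite Q'E QE; have NN := lt0r_neq0 N0; field.
have s20 : 0 <= 2 / s x by rewrite divr_ge0// ltW.
have t1 : `|Q' / N| <= D * M * (2 / s x) / c.
  by rewrite normrM [`|N^-1|]ger0_norm//; apply: ler_pM.
have t2 : `|Q * N' / N ^+ 2| <= D * M * (D * (2 / s x)) / c ^+ 2.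
  rewrite !normrM; apply: ler_pM => //.
    exact: ler_pM.
  by rewrite normrV ?unitfE ?lt0r_neq0 ?exprn_gt0// normrX ger0_norm ?(ltW N0)// lef_pV2 ?posrE ?exprn_gt0// lerXn2r ?nnegrE// ltW.
apply: le_trans (ler_normB _ _) _; apply: le_trans (lerD t1 t2) _.
have -> : D * M * (2 / s x) / c + D * M * (D * (2 / s x)) / c ^+ 2 =
    (2 * D / c + 2 * D * D / c ^+ 2) * (M / s x) by ring.
rewrite -[leRHS]mulrA ler_wpM2r ?divr_ge0 ?(ltW sx)//.
have : 0 <= D / c by rewrite divr_ge0// ltW.
clear -t2; lra.
Qed.

Lemma continuous_partial_vavg A x j : measurable_fun setT A -> 0 < s x ->
  (forall y, 0 < s y -> exists M, forall z, ball y (2 * s y) z -> `|A z| <= M) ->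
  {for x, continuous (partial j (vavg A))}.
Proof.
move=> mA sx locA; have [c c0 Hc] := Kint_mass.
pose G y := (Kint (partial j eta) n.+1 s A y * Kint eta n s (cst 1) y -
   Kint eta n s A y * Kint (partial j eta) n.+1 s (cst 1) y) / Kint eta n s (cst 1) y ^+ 2.
have [M AM] := locA x sx.
have dk psi e A' M' : bump psi -> (0 < e)%N -> measurable_fun setT A' ->
   (forall z, ball x (2 * s x) z -> `|A' z| <= M') -> differentiable (Kint psi e s A') x.
  by move=> bp e0 mA' h; have [] := differentiable_Kint_vary bp e0 mA' sx h.
have one z : ball x (2 * s x) z -> `|(cst 1 : 'rV[R]_n -> R) z| <= 1 by rewrite normr1.
have d1 := dk _ _ _ _ (bump_partial j beta) (ltn0Sn n) mA AM.
have d2 := dk _ _ _ _ beta n0 mA AM.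
have d3 := dk _ _ _ _ (bump_partial j beta) (ltn0Sn n) (measurable_cst _) one.
have d4 := dk _ _ _ _ beta n0 (measurable_cst _) one.
have NN : Kint eta n s (cst 1) x ^+ 2 != 0.
  by rewrite expf_neq0// gt_eqF// (lt_le_trans c0)// Hc.
have dG : differentiable G x.
  apply: (differentiableM (f := fun y => Kint (partial j eta) n.+1 s A y * Kint eta n s (cst 1) y -
   Kint eta n s A y * Kint (partial j eta) n.+1 s (cst 1) y)).
    by apply: differentiableB; apply: differentiableM.
  by apply: differentiableV => //; exact: (differentiableM d4 d4).
have cG := differentiable_continuous dG.
have E : \forall y \near x, G y = partial j (vavg A) y.
  have : nbhs x (s @^-1` [set t | 0 < t]).
    by apply: continuous_quarter; apply: open_nbhs_nbhs; split => //; exact: open_gt.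
  by apply: filterS => y sy; have [M' AM'] := locA y sy; rewrite (partial_vavg j mA sy AM').
have e : G x = partial j (vavg A) x := nbhs_singleton E.
move=> B /= nB; have GB : nbhs x (G @^-1` B) by apply: cG; rewrite e.
by apply: (@filterS2 _ (nbhs x) _ _ _ _ _ E GB) => y /= <-.
Qed.

End varying_average.

(** The constant is chosen before [s] and [A], hence is the same for all domains and all [eps]. *)
Lemma vavg_bound {R : realType} {n : nat} (eta : 'rV[R]_n -> R) : (0 < n)%N -> bump eta ->
  (forall x, 0 <= eta x) -> (exists2 c, 0 < c & forall x, `|x| <= 2^-1 -> c <= eta x) ->
  exists2 C : R, 0 < C & forall s : 'rV[R]_n -> R,
    (forall x, 0 <= s x) -> (forall x z, `|s x - s z| <= 4^-1 * `|x - z|) ->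
    forall (A : 'rV[R]_n -> R) (m M : R) x, measurable_fun setT A -> 0 < s x ->
    (forall z, ball x (2 * s x) z -> `|A z - m| <= M) ->
    `|vavg eta s A x - m| <= C * M /\ forall j, `|partial j (vavg eta s A) x| <= C * M / s x.
Proof.
move=> n0 beta eta0 [c1 c10 Hc1]; pose c := c1 * (2 / 3) ^+ n * (2^-1) ^+ n.
have c0 : 0 < c by rewrite !mulr_gt0// exprn_gt0.
have [B0 B00 HB0] := bump_bounded beta.
have /choice[B HB] : forall j, exists B, 0 <= B /\ forall x, `|partial j eta x| <= B.
  by move=> j; have [B ? ?] := bump_bounded (bump_partial j beta); exists B.
pose B1 := B0 + \sum_j B j.
have B0B1 : B0 <= B1 by rewrite lerDl sumr_ge0// => j _; case: (HB j).
have BB1 j : B j <= B1.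
  rewrite /B1 (bigD1 j)//= addrCA lerDl addr_ge0// sumr_ge0// => k _; by case: (HB k).
have B10 : 0 <= B1 by apply: le_trans B0B1.
pose D := B1 * 8 ^+ n; have D0 : 0 <= D by rewrite mulr_ge0// exprn_ge0.
exists (D / c + 2 * D / c + 2 * D * D / c ^+ 2 + 1).
  by rewrite ltr_wpDl// !addr_ge0// ?divr_ge0 ?mulr_ge0 ?sqr_ge0// ltW.
have etapos : exists2 c, 0 < c & forall x, `|x| <= 2^-1 -> c <= eta x by exists c1.
move=> s s0 slip A m M x mA sx AM; apply: vavg_bound_le => //.
- by move=> y sy; apply: Kint_mass_le.
- by move=> y; exact: le_trans B0B1.
- by move=> j y; apply: le_trans (BB1 j); exact: (HB j).2.
Qed.

(** * The distance to W and the scale of the averages *)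

Section set_distance.
Context {R : realType} {d : nat}.
Implicit Types (A W : set 'rV[R]_d) (x y z p q : 'rV[R]_d) (r c K l : R).

(** The distance in the sup norm, to be compared with the Euclidean [pt_dist] of the statement. *)
Definition sdist A x : R := inf [set `|x - y| | y in A].

Let lb A x : has_lbound [set `|x - y| | y in A].
Proof. by exists 0 => _ [y _ <-]. Qed.

Lemma sdist_le A x y : A y -> sdist A x <= `|x - y|.
Proof. by move=> Ay; apply: ge_inf => //; exists y. Qed.

Lemma sdist_ge A x r : A !=set0 -> (forall y, A y -> r <= `|x - y|) -> r <= sdist A x.
Proof.
move=> [y0 Ay0] H; apply: lb_le_inf; first by exists `|x - y0|; exists y0.
by move=> _ [y Ay <-]; exact: H.
Qed.

(* The infimum of the empty set is 0. *)
Lemma sdist_set0 A x : ~ (A !=set0) -> sdist A x = 0.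
Proof.
move=> A0; have -> : A = set0 by apply/seteqP; split => // y Ay; case: A0; exists y.
by rewrite /sdist image_set0 inf0.
Qed.

Lemma sdist_ge0 A x : 0 <= sdist A x.
Proof.
have [A0|] := pselect (A !=set0); first exact: sdist_ge.
by move=> /sdist_set0 ->.
Qed.

Lemma sdist_lt A x r : A !=set0 -> sdist A x < r -> exists2 y, A y & `|x - y| < r.
Proof.
move=> [y0 Ay0] h; have hi : has_inf [set `|x - y| | y in A].
  by split => //; exists `|x - y0|; exists y0.
have r0 : 0 < r - sdist A x by rewrite subr_gt0.
have [_ [y Ay <-] yr] := inf_adherent r0 hi.
by exists y => //; move: yr; rewrite -/(sdist A x) addrCA subrr addr0.
Qed.

Lemma sdist_lip A x y : `|sdist A x - sdist A y| <= `|x - y|.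
Proof.
have [[y0 Ay0]|A0] := pselect (A !=set0); last first.
  by rewrite !sdist_set0// subrr normr0.
have H u v : sdist A u - sdist A v <= `|u - v|.
  rewrite lerBlDl -lerBlDr; apply: sdist_ge; first by exists y0.
  move=> w Aw; have := sdist_le u Aw; have := ler_distD v u w; lra.
by rewrite ler_norml H andbT lerNl opprB distrC H.
Qed.

Lemma continuous_sdist A : continuous (sdist A).
Proof.
move=> x B /= /nbhs_ballP[e /= e0 eB]; apply/nbhs_ballP; exists e => // y.
rewrite -ball_normE /= => xy; apply: eB; rewrite -ball_normE /=.
exact: le_lt_trans (sdist_lip _ _ _) xy.
Qed.

Lemma measurable_sdist A : measurable_fun setT (sdist A).
Proof. by apply: continuous_measurable_rV; [exact: openT|move=> x _; exact: continuous_sdist]. Qed.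

Lemma sdist_deep W y r : r <= sdist (~` W) y -> deep W r y.
Proof.
move=> h z; rewrite -ball_normE /= => yz; apply: contrapT => Wz.
by have := sdist_le y (Wz : (~` W) z); lra.
Qed.

Lemma deep_sdist W y r : ~` W !=set0 -> deep W r y -> r <= sdist (~` W) y.
Proof.
move=> W0 dy; apply: sdist_ge => // z Wz; rewrite leNgt; apply/negP => yz.
by apply: Wz; apply: dy; rewrite -ball_normE.
Qed.

(* The scale of the averages; the factor 1/4 makes it 1/4-Lipschitz, so that it
   varies by a bounded factor over the ball of center x and radius 2 sg W l x. *)
Definition sg W l x : R := Num.min (sdist W x) l / 4.

Lemma sg_ge0 W l x : 0 <= l -> 0 <= sg W l x.
Proof. by move=> l0; rewrite divr_ge0// le_min sdist_ge0. Qed.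

Lemma sg_le W l x : sg W l x <= l / 4.
Proof. by rewrite ler_pM2r// ge_min lexx orbT. Qed.

Lemma sg_lip W l x y : `|sg W l x - sg W l y| <= 4^-1 * `|x - y|.
Proof.
rewrite /sg -mulrBl normrM [`|4^-1|]gtr0_norm// mulrC ler_pM2l//.
have := sdist_lip W x y; rewrite !ler_norml => /andP[h1 h2].
have := normr_ge0 (x - y).
by case: (leP (sdist W x) l) => a; case: (leP (sdist W y) l) => b n; apply/andP; split; lra.
Qed.

Lemma sg_in W l x : W x -> 0 <= l -> sg W l x = 0.
Proof.
move=> Wx l0; rewrite /sg (_ : sdist W x = 0); first by rewrite min_l// mul0r.
by apply/eqP; rewrite eq_le sdist_ge0 andbT; have := sdist_le x Wx; rewrite subrr normr0.
Qed.

Lemma sg_notin W l x : 0 <= l -> 0 < sg W l x -> ~ W x.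
Proof. by move=> l0 sx Wx; move: sx; rewrite sg_in// ltxx. Qed.

Lemma sg_eq0 W l x : open W -> W !=set0 -> 0 < l -> sg W l x = 0 -> W x \/ bnd W x.
Proof.
move=> oW W0 l0 sx; have [Wx|Wx] := pselect (W x); [by left|right].
split; last by rewrite (_ : W° = W)//; exact/interior_id.
have s0 : sdist W x = 0.
  move: sx => /eqP; rewrite /sg mulf_eq0 invr_eq0 pnatr_eq0 orbF /Num.min.
  by case: ifP => _ /eqP // lE; move: l0; rewrite lE ltxx.
move=> B /nbhs_ballP[e /= e0 eB].
have [y Wy xy] : exists2 y, W y & `|x - y| < e by apply: sdist_lt => //; rewrite s0.
by exists y; split => //; apply: eB; rewrite -ball_normE.
Qed.

Lemma sg_near W l x : W !=set0 -> 0 < sg W l x ->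
  sg W l x = l / 4 \/ exists2 y, W y & `|x - y| < 5 * sg W l x.
Proof.
move=> W0 sx; have [h|h] := leP l (sdist W x).
  by left; rewrite /sg min_r.
right; have e : sg W l x = sdist W x / 4 by rewrite /sg min_l// ltW.
by apply: sdist_lt => //; rewrite {1}(_ : sdist W x = 4 * sg W l x) ?ltr_pM2r ?ltr_nat// e mulrC divfK.
Qed.

Definition Dset W l c K x := [set y | `|y - x| < K * sg W l x /\ c * sg W l x < sdist (~` W) y].

Lemma Dset_deep W l c K x y : Dset W l c K x y -> deep W (c * sg W l x) y.
Proof. by move=> [_ /ltW/sdist_deep]. Qed.

Lemma Dset_ball W l c E x q : ~` W !=set0 -> `|q - x| <= E * sg W l x ->
  deep W (2 * c * sg W l x) q -> ball q (c * sg W l x) `<=` Dset W l c (E + c) x.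
Proof.
move=> W0 qx /(deep_sdist W0) dq y; rewrite -ball_normE /= => qy; split.
  have := ler_distD q y x; rewrite [`|y - q|]distrC; lra.
have := sdist_lip (~` W) q y; rewrite ler_norml => /andP[_ h]; lra.
Qed.

Lemma Dset_sub W l c K c' K' x z : 0 <= c' -> 0 <= K -> sg W l x / 2 <= sg W l z ->
  sg W l z <= 3 / 2 * sg W l x -> `|z - x| <= 2 * sg W l x -> 0 <= sg W l x ->
  2 * c' <= c -> 3 / 2 * K + 2 <= K' -> Dset W l c K z `<=` Dset W l c' K' x.
Proof.
move=> c0 K0 h1 h2 zx sx cc KK y [yz yd]; split.
  have k1 : K * sg W l z <= K * (3 / 2 * sg W l x) by rewrite ler_wpM2l.
  have k2 : (3 / 2 * K + 2) * sg W l x <= K' * sg W l x by rewrite ler_wpM2r.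
  have := ler_distD z y x; lra.
apply: le_lt_trans yd.
have k1 : c' * sg W l x <= c' * (2 * sg W l z) by rewrite ler_wpM2l//; lra.
have k2 : 2 * c' * sg W l z <= c * sg W l z by rewrite ler_wpM2r//; lra.
clear -k1 k2; lra.
Qed.

Lemma measurable_sg W l : measurable_fun setT (sg W l).
Proof.
apply: continuous_measurable_rV; first exact: openT.
by move=> x _; apply: continuous_quarter; exact: sg_lip.
Qed.

Lemma measurable_graph_Dset W l c K :
  measurable [set p : 'rV[R]_d * 'rV[R]_d | Dset W l c K p.1 p.2].
Proof.
have ms : measurable_fun setT (fun p : 'rV[R]_d * 'rV[R]_d => sg W l p.1).
  by apply: measurableT_comp => //; exact: measurable_sg.
have m1 : measurable_fun setT (fun p : 'rV[R]_d * 'rV[R]_d => `|p.2 - p.1| < K * sg W l p.1).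
  apply: measurable_fun_ltr; last exact: measurable_funM.
  apply: measurable_rV_norm; apply: measurable_rVD => //; apply: measurable_rVN.
  exact: measurable_fst.
have m2 : measurable_fun setT (fun p : 'rV[R]_d * 'rV[R]_d => c * sg W l p.1 < sdist (~` W) p.2).
  apply: measurable_fun_ltr; first exact: measurable_funM.
  by apply: measurableT_comp => //; exact: measurable_sdist.
rewrite (_ : [set p | _] = (fun p : 'rV[R]_d * 'rV[R]_d => `|p.2 - p.1| < K * sg W l p.1) @^-1` [set true]
  `&` (fun p : 'rV[R]_d * 'rV[R]_d => c * sg W l p.1 < sdist (~` W) p.2) @^-1` [set true])//.
by apply: measurableI; rewrite -[X in measurable X]setTI; [apply: m1|apply: m2].
Qed.

Lemma measurable_Dset W l c K x : measurable (Dset W l c K x).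
Proof.
have := measurable_xsection x (measurable_graph_Dset W l c K).
by rewrite (_ : xsection _ x = Dset W l c K x)//; apply/seteqP; split => y; rewrite /xsection /= inE.
Qed.

End set_distance.

Section section_integrals.
Context {R : realType} {d : nat}.
Local Notation mu := (lebesgue_rV R d).
Implicit Types (P : set ('rV[R]_d * 'rV[R]_d)) (f : 'rV[R]_d -> R).

Lemma measurable_section_measure P : measurable P ->
  measurable_fun setT (fun x => fine (mu [set y | P (x, y)])).
Proof.
move=> mP; apply: (measurableT_comp (@fine_measurable R setT measurableT)).
have := measurable_fun_xsection mu mP.
rewrite (_ : (fun x => _) = mu \o xsection P)//; apply/funext => x /=; congr (mu _).
by apply/seteqP; split => y; rewrite /xsection /= inE.
Qed.

Lemma measurable_section_integral P f : measurable P -> measurable_fun setT f ->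
  measurable_fun setT (fun x => \int[mu]_(y in [set y | P (x, y)]) f y).
Proof.
move=> mP mf; apply: (measurableT_comp (@fine_measurable R setT measurableT)).
pose F (z : 'rV[R]_d * 'rV[R]_d) : \bar R := (\1_P z * f z.2)%:E.
have mF : measurable_fun setT F.
  apply/measurable_EFinP; apply: measurable_funM; first exact: measurable_indic.
  exact: measurableT_comp.
rewrite (_ : (fun x => _) = fun x => \int[mu]_y (F^\+ (x, y)) - \int[mu]_y (F^\- (x, y)))%E.
  apply: emeasurable_funB; apply: (measurable_fun_fubini_tonelli_F (m2 := mu)) => //.
  - exact: measurable_funepos.
  - exact: measurable_funeneg.
apply/funext => x; rewrite integral_mkcond integralE; congr (_ - _)%E.
- apply: eq_integral => y _; rewrite !funeposE patchE /F indicE /=.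
  rewrite (_ : (y \in _) = ((x, y) \in P)); last by apply/idP/idP; rewrite !inE.
  by case: ifP => _; rewrite ?mul1r ?mul0r.
- apply: eq_integral => y _; rewrite !funenegE patchE /F indicE /=.
  rewrite (_ : (y \in _) = ((x, y) \in P)); last by apply/idP/idP; rewrite !inE.
  by case: ifP => _; rewrite ?mul1r ?mul0r.
Qed.

End section_integrals.

Section covering.
Context {R : realType} {d : nat}.
Local Notation mu := (lebesgue_rV R d).
Implicit Types (V : set 'rV[R]_d) (f : 'rV[R]_d -> R) (p q x y : 'rV[R]_d) (r k : R).

(** Cover [V] by the balls of radius [r / 2] centred on a grid of mesh [r / 4]. One that meets [V]
    at [p] lies in [ball p r], and their number depends on [k] and [d] only. *)
Lemma covering_bound (k : R) : exists M : nat, forall V x r f (B : \bar R), measurable V ->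
  measurable_fun setT f -> (forall y, 0 <= f y) -> 0 < r -> (0 <= B)%E ->
  (forall y, V y -> `|y - x| <= k * r) ->
  (forall p, V p -> (\int[mu]_(y in V `&` ball p r) (f y)%:E <= B)%E) ->
  (\int[mu]_(y in V) (f y)%:E <= M%:R%:E * B)%E.
Proof.
have [m hm] := natr_ge (4 * `|k| + 1).
pose I := {ffun 'I_d -> 'I_(2 * m).+1}; exists #|I| => V x r f B mV mf f0 r0 B0 Vk HV.
pose g (i : I) : 'rV[R]_d := x + \row_j (r / 4 * ((i j)%:R - m%:R)).
pose cell i := V `&` ball (g i) (r / 2).
have mc i : measurable (cell i) by apply: measurableI => //; exact: measurable_rV_ball.
have Bi i : (\int[mu]_(y in cell i) (f y)%:E <= B)%E.
  have [[p [Vp pi]]|H] := pselect (exists p, cell i p).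
    apply: le_trans (HV p Vp); apply: integral_fin_subset => //.
      by apply: measurableI => //; exact: measurable_rV_ball.
    move=> y [Vy yi]; split => //; move: pi yi; rewrite -!ball_normE /= => pi yi.
    have := ler_distD (g i) p y; rewrite [`|p - g i|]distrC; lra.
  have -> : cell i = set0 by apply/seteqP; split => // y yi; case: H; exists y.
  by rewrite integral_set0.
have cov y : V y -> exists i, cell i y.
  move=> Vy; pose t j := 4 / r * (y 0 j - x 0 j) + m%:R.
  have rN := lt0r_neq0 r0.
  have tb j : 0 <= t j /\ t j < (2 * m).+1%:R.
    have h1 : `|(y - x) 0 j| <= k * r by apply: le_trans (coord_le_norm _ _) _; exact: Vk.
    have h2 : `|4 / r * (y 0 j - x 0 j)| <= 4 * `|k|.
      rewrite normrM gtr0_norm ?divr_gt0// mulrAC ler_pdivrMr// -mulrA ler_wpM2l//.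
      move: h1; rewrite !mxE => /le_trans; apply; rewrite ler_wpM2r ?(ltW r0)//; exact: ler_norm.
    rewrite -natr1 natrM; move: h2; rewrite ler_norml /t => /andP[h3 h4].
    have := normr_ge0 k; split; lra.
  have ti j : (Num.trunc (t j) < (2 * m).+1)%N.
    have [h1 h2] := tb j; rewrite -(ltr_nat R); apply: le_lt_trans h2.
    by rewrite truncn_le.
  exists [ffun j => Ordinal (ti j)]; split => //; rewrite -ball_normE /=.
  apply: (@le_lt_trans _ _ (r / 4)); last by rewrite ltr_pM2l// ltf_pV2 ?posrE// ltr_nat.
  apply: rV_norm_le => [|j]; first by rewrite divr_ge0// ltW.
  rewrite !mxE ffunE /=.
  have h1 : (Num.trunc (t j))%:R <= t j by rewrite truncn_le; have [] := tb j.
  have h2 : t j < (Num.trunc (t j)).+1%:R by exact: truncnS_gt.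
  have e : y 0 j - x 0 j = r / 4 * (t j - m%:R).
    by rewrite /t addrK mulrA; field.
  have -> : x 0 j + r / 4 * ((Num.trunc (t j))%:R - m%:R) - y 0 j =
     r / 4 * ((Num.trunc (t j))%:R - t j).
    by rewrite -[y 0 j](subrK (x 0 j)) e; ring.
  rewrite normrM gtr0_norm ?divr_gt0// -[leRHS]mulr1 ler_wpM2l ?divr_ge0 ?(ltW r0)//.
  rewrite -natr1 in h2; rewrite ler_norml; apply/andP; split; lra.
apply: (@le_trans _ _ (\sum_i \int[mu]_(y in cell i) (f y)%:E)%E); last first.
  apply: (@le_trans _ _ (\sum_(i : I) B)%E); first by apply: lee_sum => i _; exact: Bi.
  rewrite big_const; elim: #|I| => [|j IH]; first by rewrite mul0e.
  by rewrite /= -natr1 EFinD ge0_muleDl// mul1e addeC leeD.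
have rl A : measurable A -> (\int[mu]_(y in A) (f y)%:E = \int[mu]_y (\1_A y * f y)%:E)%E.
  move=> mA; rewrite integral_mkcond; apply: eq_integral => y _; rewrite patchE indicE.
  by case: ifP => _; rewrite ?mul1r ?mul0r.
under eq_bigr do rewrite rl//.
rewrite rl// -(ge0_integral_sum mu measurableT (f := fun i y => (\1_(cell i) y * f y)%:E)); first last.
- by move=> i y _; rewrite lee_fin mulr_ge0.
- move=> i; apply/measurable_EFinP; apply: measurable_funM => //; exact: measurable_indic.
apply: ge0_le_integral => //.
- by move=> y _; rewrite lee_fin mulr_ge0.
- by apply/measurable_EFinP; apply: measurable_funM => //; exact: measurable_indic.
- by apply: emeasurable_sum => i; apply/measurable_EFinP; apply: measurable_funM => //.
- move=> y _; rewrite indicE; have [Vy|_] := boolP (y \in V); last first.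
    rewrite mul0r; apply: sume_ge0 => i _; by rewrite lee_fin mulr_ge0.
  have [i ci] := cov y (set_mem Vy); rewrite mul1r (bigD1 i)//= indicE mem_set// mul1r.
  by rewrite leeDl// sume_ge0// => k' _; rewrite lee_fin mulr_ge0.
Qed.

End covering.

(** * Oscillation of the averages *)

Section oscillation.
Context {R : realType} {d : nat}.
Local Notation mu := (lebesgue_rV R d).
Implicit Types (W Z : set 'rV[R]_d) (f g : 'rV[R]_d -> R) (p q x y z : 'rV[R]_d) (r c K E l m : R).

Definition avgZ W l c K Z f x : R :=
  \1_Z x * ((fine (mu (Dset W l c K x)))^-1 * \int[mu]_(y in Dset W l c K x) f y).

Lemma measurable_avgZ W l c K Z f : measurable Z -> measurable_fun setT f ->
  measurable_fun setT (avgZ W l c K Z f).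
Proof.
move=> mZ mf; apply: measurable_funM; first exact: measurable_indic.
have mP := @measurable_graph_Dset R d W l c K.
apply: measurable_funM; last exact: (measurable_section_integral mP mf).
apply: (measurableT_comp (@measurable_inv R)).
exact: (measurable_section_measure mP).
Qed.

Lemma avgZ_out W l c K Z f x : ~ Z x -> avgZ W l c K Z f x = 0.
Proof. by move=> Zx; rewrite /avgZ indicE memNset// mul0r. Qed.

(** Jensen's inequality, the measure of [Dset] being bounded below by that of the ball of radius
    [c * sg W l x] around [q]. *)
Lemma avgZ_sqr_le W l c E Z f x q m : 0 <= l -> 0 < c -> 0 <= E -> 0 < sg W l x ->
  `|q - x| <= E * sg W l x -> deep W (2 * c * sg W l x) q -> measurable_fun setT f -> Z x ->
  (((avgZ W l c (E + c) Z f x - m) ^+ 2)%:E <=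
   ((2 * c * sg W l x)^-1 ^+ d)%:E * \int[mu]_(y in Dset W l c (E + c) x) ((f y - m) ^+ 2)%:E)%E.
Proof.
move=> l0 c0 E0 sx qx dq mf Zx; set D := Dset _ _ _ _ _.
have W0 : ~` W !=set0 by exists x; exact: sg_notin sx.
have mD : measurable D by exact: measurable_Dset.
have cs : 0 < c * sg W l x by rewrite mulr_gt0.
have ks : 0 < (E + c) * sg W l x by rewrite mulr_gt0// ltr_wpDl.
have lo : (((2 * c * sg W l x) ^+ d)%:E <= mu D)%E.
  have -> : 2 * c * sg W l x = (c * sg W l x) *+ 2 by rewrite mulr2n; ring.
  rewrite -(lebesgue_rV_ball q cs); apply: le_measure; rewrite ?inE//; first exact: measurable_rV_ball.
  exact: Dset_ball.
have hi : (mu D < +oo)%E.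
  apply: (@le_lt_trans _ _ (mu (ball x ((E + c) * sg W l x)))).
    apply: le_measure; rewrite ?inE//; first exact: measurable_rV_ball.
    by move=> y []; rewrite -ball_normE /= distrC.
  by rewrite [X in (X < _)%E](lebesgue_rV_ball x ks) ltry.
have c2 : 0 < 2 * c * sg W l x by rewrite -mulrA mulr_gt0.
have D0 : (0 < mu D)%E by apply: lt_le_trans lo; rewrite lte_fin exprn_gt0.
have -> : avgZ W l c (E + c) Z f x = (fine (mu D))^-1 * \int[mu]_(y in D) f y.
  by rewrite /avgZ indicE mem_set// mul1r.
apply: le_trans (Jensen_sqr _ mD mf D0 hi) _.
apply: lee_wpmul2r; first by apply: integral_fin_ge0 => y; exact: sqr_ge0.
have fD : mu D = (fine (mu D))%:E by rewrite fineK// ge0_fin_numE// ltW.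
rewrite lee_fin exprVn lef_pV2 ?posrE ?exprn_gt0//; last by rewrite -lte_fin -fD.
by rewrite -lee_fin -fD.
Qed.

Lemma chain_within (P : 'rV[R]_d -> Prop) (h a : R) N p p0 q : 0 <= h -> `|p - p0| <= a ->
  chain P (step h) N p q -> chain (fun x => P x /\ `|x - p0| <= a + N%:R * h) (step h) N p q.
Proof.
move=> h0; elim: N p a => [|N IH] p a pa /=.
  by move=> [Pp <-]; rewrite mul0r addr0.
move=> [Pp [p1 Sp c]]; split.
  by split => //; apply: le_trans pa _; rewrite lerDl mulr_ge0.
exists p1 => //.
have p1a : `|p1 - p0| <= a + h.
  by have := ler_distD p p1 p0; move: Sp; rewrite /step [`|p1 - p|]distrC; lra.
apply: chain_mono (IH _ _ p1a c) => // x [Px xp]; split => //.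
by apply: le_trans xp _; rewrite -natr1 mulrDl; lra.
Qed.

(** For [z] in the ball, [sg W l z] lies between 1/2 and 3/2 of [sg W l x]. So the points averaged
    at [z] have depth at least [c / 2] and distance at most [3 / 2 * (E + c) + 2] in units of
    [sg W l x]. The other terms of the final radius are the distance [E'] of the reference ball, the
    length [N * rho] of the chains and room for their balls. *)
Lemma oscillation (k c E E' rho : R) (N : nat) : 0 <= k -> 0 < c -> 0 <= E -> E <= E' -> 0 < rho ->
  3 * rho <= c / 2 -> exists2 C, 0 <= C & forall W l f g Z,
  0 < l -> measurable_fun setT f -> measurable_fun setT g -> (forall x, 0 <= g x) ->
  transl_le W k f g ->
  (forall x, 0 < sg W l x -> exists2 q, `|q - x| <= E * sg W l x & deep W (2 * c * sg W l x) q) ->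
  (forall x p q, 0 < sg W l x -> deep W (c / 2 * sg W l x) p -> deep W (c / 2 * sg W l x) q ->
     `|q - p| <= (3 / 2 * (E + c) + 2 + E') * sg W l x ->
     chain (deep W (3 * rho * sg W l x)) (step (rho * sg W l x)) N p q) ->
  (forall x z z', 0 < sg W l x -> ball x (2 * sg W l x) z -> ball x (2 * sg W l x) z' ->
     Z z -> ~ Z z' -> exists q, [/\ `|q - x| <= E' * sg W l x, deep W (c / 2 * sg W l x) q &
       forall y, ball q (rho * sg W l x) y -> f y = 0]) ->
  forall x, 0 < sg W l x -> exists m, forall z, ball x (2 * sg W l x) z ->
    (((avgZ W l c (E + c) Z f z - m) ^+ 2)%:E <=
     (C * sg W l x ^+ 2 * (sg W l x)^-1 ^+ d)%:E *
     \int[mu]_(y in Dset W l (3 / 2 * rho) (3 / 2 * (E + c) + 2 + E' + N%:R * rho + 2 * rho) x) (g y)%:E)%E.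
Proof.
move=> k0 c0 E0 EE' rho0 rc.
have [M HM] := @covering_bound R d ((3 / 2 * (E + c) + 2) * (2 / rho)).
pose C1 := 3 ^+ N * (8 * k + 4 * 2 ^+ d * k) * (rho ^+ 2 / 4).
have C10 : 0 <= C1.
  by rewrite mulr_ge0 ?divr_ge0 ?sqr_ge0// mulr_ge0 ?exprn_ge0// addr_ge0// !mulr_ge0// exprn_ge0.
have ci0 : 0 <= c^-1 by rewrite invr_ge0 ltW.
have CC0 : 0 <= c^-1 ^+ d * (M%:R * C1) by apply: mulr_ge0; [exact: exprn_ge0|exact: mulr_ge0].
exists (c^-1 ^+ d * (M%:R * C1)) => //.
move=> W l f g Z l0 mf mg g0 T HI HC HX x sx; set t := sg W l x in sx *.
set K := E + c; set K3 := (X in Dset W l _ X x); set D := Dset _ _ _ _ _.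
have mD : measurable D by exact: measurable_Dset.
set J := (\int[mu]_(y in D) _)%E; have J0 : (0 <= J)%E by exact: integral_fin_ge0.
(* Then [2 * r] is the step of the chains and [3 * r] half of their depth, so that the balls of
   radius [3 * r] keep the distance [3 / 2 * rho * t] to the complement of [W], as required in
   [D]. *)
pose r := rho * t / 2; have r0 : 0 < r by rewrite divr_gt0// mulr_gt0.
have W0 : ~` W !=set0 by exists x; apply: (sg_notin (ltW l0)) sx.
have tN : 0 <= t by exact: ltW.
have E'0 : 0 <= E' by exact: le_trans EE'.
have rt0 : 0 <= rho * t by rewrite mulr_ge0// ltW.
have Nr0 : 0 <= N%:R * (rho * t) by rewrite mulr_ge0.
have Kt0 : 0 <= (3 / 2 * K + 2) * t by rewrite mulr_ge0// /K; clear -c0 E0; lra.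
have E't0 : 0 <= E' * t by rewrite mulr_ge0.
have inD p a : deep W (3 * rho * t) p -> `|p - x| <= a ->
    a <= (3 / 2 * K + 2) * t + E' * t + N%:R * (rho * t) -> ball p (3 * r) `<=` D `&` W.
  move=> dp pa aK y; rewrite -ball_normE /= => py.
  have r6 : 3 * rho * t = 6 * r by rewrite /r; field.
  split; last by apply: dp; rewrite -ball_normE /=; clear -rt0 py r6; lra.
  split.
    have := ler_distD p y x; rewrite [`|y - p|]distrC -/t.
    have -> : K3 * t = (3 / 2 * K + 2) * t + E' * t + N%:R * (rho * t) + 4 * r.
      by rewrite /K3 /K /r; field.
    clear -rt0 pa aK py r6; lra.
  have h1 := deep_sdist W0 dp; have := sdist_lip (~` W) p y; rewrite ler_norml => /andP[_ h2].
  rewrite -/t; have -> : 3 / 2 * rho * t = 3 * r by rewrite /r; field.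
  clear -py r6 h1 h2; lra.
have main q m : `|q - x| <= E' * t -> deep W (c / 2 * t) q ->
    (sqdev f r q m <= (4 * 2 ^+ d * k * r ^+ 2)%:E * J)%E ->
    forall z, ball x (2 * t) z -> Z z ->
    (((avgZ W l c K Z f z - m) ^+ 2)%:E <= (c^-1 ^+ d * (M%:R * C1) * t ^+ 2 * t^-1 ^+ d)%:E * J)%E.
  move=> qx dq sq z xz Zz.
  have [h1 h2] := quarter_near (sg_lip W l) xz; rewrite -/t in h1 h2.
  have zx : `|z - x| <= 2 * t by move: xz; rewrite -ball_normE /= distrC => /ltW.
  have sz : 0 < sg W l z by clear -sx h1; lra.
  have [q1 q1z dq1] := HI z sz.
  apply: le_trans (avgZ_sqr_le m (ltW l0) c0 E0 sz q1z dq1 mf Zz) _; rewrite -/K.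
  have VK y : Dset W l c K z y -> `|y - x| <= (3 / 2 * K + 2) * t.
    move=> [yz _]; have K0 : 0 <= K by rewrite /K; clear -c0 E0; lra.
    have : K * sg W l z <= K * (3 / 2 * t) by rewrite ler_wpM2l.
    have := ler_distD z y x; clear -zx yz; lra.
  have key : (\int[mu]_(y in Dset W l c K z) ((f y - m) ^+ 2)%:E <= M%:R%:E * ((C1 * t ^+ 2)%:E * J))%E.
    apply: (HM _ x r) => //.
    - exact: measurable_Dset.
    - by apply: measurable_funX; exact: measurable_funB.
    - by move=> y; exact: sqr_ge0.
    - by apply: mule_ge0 => //; rewrite lee_fin; apply: mulr_ge0 => //; exact: sqr_ge0.
    - move=> y /VK; rewrite /r.
      have -> // : (3 / 2 * (E + c) + 2) * (2 / rho) * (rho * t / 2) = (3 / 2 * K + 2) * t.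
      by rewrite /K; field; rewrite gt_eqF.
    - move=> p Vp; apply: (@le_trans _ _ (sqdev f r p m)).
        apply: integral_fin_subset.
        + by apply: measurableI; [exact: measurable_Dset|exact: measurable_rV_ball].
        + exact: measurable_rV_ball.
        + by apply: measurable_funX; exact: measurable_funB.
        + by move=> y; exact: sqr_ge0.
        + by move=> y [].
      have dp : deep W (c / 2 * t) p.
        apply: deep_le (Dset_deep Vp); have : c * (t / 2) <= c * sg W l z by rewrite ler_pM2l.
        clear; lra.
      have px := VK _ Vp.
      have ch : chain (deep W (3 * rho * t)) (step (rho * t)) N p q.
        apply: HC => //; rewrite -/K -/t (mulrDl (3 / 2 * K + 2)).
        have := ler_distD x q p; rewrite [`|x - p|]distrC; clear -qx px; lra.
      have chD : chain (fun y => ball y (3 * r) `<=` D `&` W) (step (2 * r)) N p q.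
        have -> : 2 * r = rho * t by rewrite /r; field.
        apply: chain_mono (chain_within rt0 px ch) => // y [dy yx].
        by apply: inD dy yx _; lra.
      apply: le_trans (chain_poincare k0 mf mg g0 mD T m r0 chD) _.
      apply: (@le_trans _ _ ((3 ^+ N)%:E * ((8 * k * r ^+ 2)%:E * J + (4 * 2 ^+ d * k * r ^+ 2)%:E * J))%E).
        apply: lee_wpmul2l; first by rewrite lee_fin exprn_ge0.
        by apply: leeD.
      rewrite -ge0_muleDl ?lee_fin; first last.
      + by rewrite mulr_ge0 ?sqr_ge0// !mulr_ge0// exprn_ge0.
      + by rewrite mulr_ge0 ?sqr_ge0// mulr_ge0.
      rewrite -EFinD muleA -EFinM; apply: lee_wpmul2r => //.
      by rewrite lee_fin /C1 /r le_eqVlt; apply/orP; left; apply/eqP; field.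
  apply: (@le_trans _ _ (((c * t)^-1 ^+ d)%:E * (M%:R%:E * ((C1 * t ^+ 2)%:E * J)))%E).
    have cz : 0 < 2 * c * sg W l z by rewrite -mulrA mulr_gt0// mulr_gt0.
    have ct : 0 < c * t by rewrite mulr_gt0.
    apply: lee_pmul => //.
    - by rewrite lee_fin exprn_ge0// invr_ge0 ltW.
    - by apply: integral_fin_ge0 => y; exact: sqr_ge0.
    - rewrite lee_fin lerXn2r ?nnegrE ?invr_ge0 ?(ltW cz) ?(ltW ct)// lef_pV2 ?posrE//.
      have : c * (t / 2) <= c * sg W l z by rewrite ler_pM2l.
      clear; lra.
  rewrite !muleA -!EFinM; apply: lee_wpmul2r => //; rewrite lee_fin invfM exprMn.
  by rewrite le_eqVlt; apply/orP; left; apply/eqP; ring.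
have RHS0 : (0 <= (c^-1 ^+ d * (M%:R * C1) * t ^+ 2 * t^-1 ^+ d)%:E * J)%E.
  apply: mule_ge0 => //; rewrite lee_fin; apply: mulr_ge0; last by rewrite exprn_ge0// invr_ge0.
  by apply: mulr_ge0 => //; exact: sqr_ge0.
have [[z1 [xz1 Zz1]]|none] := pselect (exists z, ball x (2 * t) z /\ Z z); last first.
  exists 0 => z xz; rewrite avgZ_out; last by move=> Zz; apply: none; exists z.
  by rewrite subrr expr0n.
(* Some of the averages are 0 by the cut-off, so the reference value has to be 0; the outer ball, on
   which [f = 0], has deviation 0 from it. *)
have [[z2 [xz2 Zz2]]|all] := pselect (exists z, ball x (2 * t) z /\ ~ Z z).
  have [q [qx dq q0]] := HX x z1 z2 sx xz1 xz2 Zz1 Zz2.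
  exists 0 => z xz; have [Zz|Zz] := pselect (Z z); last first.
    by rewrite avgZ_out// subrr expr0n.
  apply: (main q) => //.
  rewrite /sqdev (_ : (\int[mu]_(y in _) _)%E = 0%E).
    by rewrite mule_ge0// lee_fin mulr_ge0 ?sqr_ge0// !mulr_ge0// exprn_ge0.
  rewrite -[RHS](integral0 mu (ball q r)); apply: eq_integral => y; rewrite inE => qy.
  rewrite q0 ?subrr ?expr0n//; apply: le_ball qy; rewrite /r -/t; clear -rt0; lra.
have [q qx dq] := HI x sx; rewrite -/t in qx dq.
have dq' : deep W (c / 2 * t) q by apply: deep_le dq; rewrite ler_wpM2r//; clear -rho0 rc; lra.
have qx' : `|q - x| <= E' * t by apply: le_trans qx _; rewrite ler_wpM2r.
have BD : ball q (3 * r) `<=` D `&` W.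
  apply: (inD q (E' * t)) => //; last lra.
  by apply: deep_le dq'; rewrite ler_wpM2r.
have [m hm] := ball_poincare k0 mf mg g0 mD T r0 BD.
exists m => z xz; apply: (main q) => //.
by apply: contrapT => Zz; apply: all; exists z.
Qed.

End oscillation.

Section tonelli.
Context {R : realType} {d : nat}.
Local Notation mu := (lebesgue_rV R d).
Implicit Types (W : set 'rV[R]_d) (p q h : 'rV[R]_d -> R) (x y z : 'rV[R]_d) (c K l : R).

(** If [D] is the depth of [y], then [D <= |x - y| < K * sg W l x], as [x] is outside [W], and
    [c * sg W l x < D]. So [x] ranges over a ball of radius [K * D / c] around [y], where the
    integrand is at most [(K / D) ^+ d]: the powers of [D] cancel. *)
Lemma Dset_volume W l c K y : 0 < c -> 0 < K -> 0 <= l ->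
  (\int[mu]_x (\1_[set x | 0 < sg W l x /\ Dset W l c K x y] x * (sg W l x)^-1 ^+ d)%:E <=
   ((2 * K ^+ 2 / c) ^+ d)%:E)%E.
Proof.
move=> c0 K0 l0; set S := [set x | _]; set D := sdist (~` W) y.
have [[x1 [sx1 [_ x1D]]]|H] := pselect (exists x, S x); last first.
  rewrite (_ : (\int[mu]_x _)%E = 0%E) ?lee_fin ?exprn_ge0 ?divr_ge0 ?mulr_ge0 ?sqr_ge0 ?ltW//.
  rewrite -[RHS](integral0 mu setT); apply: eq_integral => x _.
  by rewrite indicE memNset ?mul0r// => Sx; apply: H; exists x.
have D0 : 0 < D by apply: lt_trans x1D; rewrite mulr_gt0.
pose r := K * D / c; have r0 : 0 < r by rewrite divr_gt0// mulr_gt0.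
pose B : set 'rV[R]_d := ball y r.
have mB : measurable B by exact: measurable_rV_ball.
have muB : mu B = ((r *+ 2) ^+ d)%:E by exact: lebesgue_rV_ball.
have KD0 : 0 <= (K / D) ^+ d by rewrite exprn_ge0// divr_ge0// ltW.
apply: (@le_trans _ _ (\int[mu]_x ((K / D) ^+ d * \1_B x)%:E)%E); last first.
  rewrite integral_finZ//.
  rewrite integral_indic// setIT [X in (_ * X)%E](_ : _ = mu B)// muB -EFinM lee_fin -exprMn.
  rewrite le_eqVlt; apply/orP; left; apply/eqP; congr (_ ^+ _).
  have DN := lt0r_neq0 D0; have cN := lt0r_neq0 c0; rewrite /r mulr2n; field.
  by rewrite DN cN.
have mS : measurable S.
  rewrite (_ : S = (fun x => 0 < sg W l x) @^-1` [set true] `&` ysection [set p | Dset W l c K p.1 p.2] y); last first.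
    by apply/seteqP; split => x /=; rewrite /ysection /= inE.
  apply: measurableI; last by apply: measurable_ysection; exact: measurable_graph_Dset.
  rewrite -[X in measurable X]setTI; apply: measurable_fun_ltr => //; exact: measurable_sg.
apply: le_integral_fin => //.
- apply: measurable_funM; first exact: measurable_indic.
  by apply: measurable_funX; apply: (measurableT_comp (@measurable_inv R)); exact: measurable_sg.
- by apply: measurable_funM => //; exact: measurable_indic.
- by move=> x _; rewrite mulr_ge0// exprn_ge0// invr_ge0 sg_ge0.
- move=> x _; rewrite indicE; have [Sx|_] := boolP (x \in S); last first.
    by rewrite mul0r mulr_ge0.
  rewrite mul1r; move: Sx; rewrite inE => -[sx [xy xD]].
  have DK : D <= K * sg W l x.
    by apply: le_trans (ltW xy); apply: sdist_le; exact: sg_notin sx.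
  rewrite indicE mem_set ?mulr1; last first.
    rewrite /B -ball_normE /=; apply: lt_le_trans xy _; rewrite /r -mulrA ler_wpM2l ?(ltW K0)//.
    by rewrite ler_pdivlMr// mulrC ltW.
  have i1 : 0 <= (sg W l x)^-1 by rewrite invr_ge0 ltW.
  have i2 : 0 <= K / D by rewrite divr_ge0// ltW.
  rewrite lerXn2r ?nnegrE//.
  by rewrite ler_pdivlMr// ler_pdivrMl// mulrC.
Qed.

Lemma Dset_tonelli W l c K p q h (kap : R) : 0 < c -> 0 < K -> 0 <= l -> 0 <= kap ->
  measurable_fun setT p -> measurable_fun setT q -> measurable_fun setT h ->
  (forall x, 0 <= p x) -> (forall x, 0 <= q x) -> (forall x, 0 <= h x) ->
  (forall x y, 0 < sg W l x -> Dset W l c K x y -> 0 < h y -> p x <= kap * q y) ->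
  (\int[mu]_(x in [set x | (0 < sg W l x)%R]) ((p x * (sg W l x)^-1 ^+ d)%:E *
     \int[mu]_(y in Dset W l c K x) (h y)%:E) <=
   ((2 * K ^+ 2 / c) ^+ d * kap)%:E * \int[mu]_y (q y * h y)%:E)%E.
Proof.
move=> c0 K0 l0 kap0 mp mq mh p0 q0 h0 pq.
have ms : measurable_fun setT (sg W l) by exact: measurable_sg.
have mF0 : measurable [set x | 0 < sg W l x].
  rewrite (_ : [set x | _] = (fun x => 0 < sg W l x) @^-1` [set true])//.
  by rewrite -[X in measurable X]setTI; apply: measurable_fun_ltr.
have mG := @measurable_graph_Dset R d W l c K.
have msi : measurable_fun setT (fun x => (sg W l x)^-1 ^+ d).
  by apply: measurable_funX; exact: (measurableT_comp (@measurable_inv R)).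
have si0 x : 0 <= (sg W l x)^-1 ^+ d by rewrite exprn_ge0// invr_ge0 sg_ge0.
pose a x := \1_[set x | 0 < sg W l x] x * (p x * (sg W l x)^-1 ^+ d).
have ma : measurable_fun setT a.
  by apply: measurable_funM; [exact: measurable_indic|exact: measurable_funM].
have a0 x : 0 <= a x by rewrite mulr_ge0// mulr_ge0.
pose F (z : 'rV[R]_d * 'rV[R]_d) : \bar R :=
  (a z.1 * (\1_[set p | Dset W l c K p.1 p.2] z * h z.2))%:E.
have mF : measurable_fun setT F.
  apply/measurable_EFinP; apply: measurable_funM; first exact: measurableT_comp.
  by apply: measurable_funM; [exact: measurable_indic|exact: measurableT_comp].
have F0 (z : 'rV[R]_d * 'rV[R]_d) : (0 <= F z)%E by rewrite lee_fin mulr_ge0// mulr_ge0.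
have E1 : (\int[mu]_(x in [set x | (0 < sg W l x)%R]) ((p x * (sg W l x)^-1 ^+ d)%:E *
     \int[mu]_(y in Dset W l c K x) (h y)%:E) = \int[mu]_x \int[mu]_y F (x, y))%E.
  rewrite integral_mkcond; apply: eq_integral => x _.
  have -> : (\int[mu]_y F (x, y) = (a x)%:E * \int[mu]_(y in Dset W l c K x) (h y)%:E)%E.
    have mD := measurable_Dset W l c K x.
    rewrite [in RHS]integral_mkcond -ge0_integralZl_EFin//; first last.
    - by apply/(measurable_restrictT _ _).1 => //; apply/measurable_funTS/measurable_EFinP.
    - by move=> y _; apply: erestrict_ge0 => z _; rewrite lee_fin.
    apply: eq_integral => y _; rewrite /F /= EFinM; congr (_ * _)%E; rewrite patchE indicE.
    rewrite (_ : (y \in _) = ((x, y) \in [set p | Dset W l c K p.1 p.2])); last by apply/idP/idP; rewrite !inE.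
    by case: ifP => _; rewrite ?mul1r ?mul0r.
  rewrite patchE /a indicE; case: ifP => _; first by rewrite mul1r.
  by rewrite mul0r mul0e.
rewrite E1 fubini_tonelli//.
set C := (2 * K ^+ 2 / c) ^+ d.
have C0 : 0 <= C by rewrite exprn_ge0// divr_ge0 ?mulr_ge0 ?sqr_ge0// ltW.
rewrite -integral_finZ//; [|exact: measurable_funM|by move=> y; rewrite mulr_ge0|by rewrite mulr_ge0].
apply: ge0_le_integral => //.
- by move=> y _; apply: integral_ge0.
- exact: (measurable_fun_fubini_tonelli_G (m1 := mu)).
- by apply/measurable_EFinP; apply: measurable_funM => //; exact: measurable_funM.
(* The weights are compared only where [h y > 0]; elsewhere both sides are 0. *)
move=> y _; have [hy|hy] := eqVneq (h y) 0.
  rewrite hy !mulr0 /F /=; under eq_integral do rewrite hy !mulr0; by rewrite integral0.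
have hy0 : 0 < h y by rewrite lt_def hy h0.
apply: (@le_trans _ _ (\int[mu]_x (kap * q y * h y * (\1_[set x | (0 < sg W l x)%R /\ Dset W l c K x y] x * (sg W l x)^-1 ^+ d))%:E)%E).
  apply: ge0_le_integral => //.
  - by apply: measurableT_comp => //; exact: measurable_pair2.
  - apply/measurable_EFinP; apply: measurable_funM => //; apply: measurable_funM => //.
    apply: measurable_indic.
    rewrite (_ : [set x | _] = [set x | 0 < sg W l x] `&` ysection [set p | Dset W l c K p.1 p.2] y); last first.
      by apply/seteqP; split => x /=; rewrite /ysection /= inE.
    by apply: measurableI => //; exact: measurable_ysection.
  - move=> x _; rewrite /F /= lee_fin /a !indicE.
    have [sx|sx] := pselect (0 < sg W l x); last first.
      rewrite (memNset (sx : ~ [set x | 0 < sg W l x] x)) !mul0r.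
      by apply: mulr_ge0; [rewrite !mulr_ge0|exact: mulr_ge0].
    have [Dx|Dx] := pselect (Dset W l c K x y); last first.
      rewrite (memNset (Dx : ~ [set p | Dset W l c K p.1 p.2] (x, y))) mul0r mulr0.
      by apply: mulr_ge0; [rewrite !mulr_ge0|exact: mulr_ge0].
    rewrite (mem_set (sx : [set x | 0 < sg W l x] x)) (mem_set (Dx : [set p | Dset W l c K p.1 p.2] (x, y))).
    rewrite (mem_set (conj sx Dx : [set x | 0 < sg W l x /\ Dset W l c K x y] x)) !mul1r.
    rewrite [leLHS](_ : _ = p x * h y * (sg W l x)^-1 ^+ d); last by ring.
    by apply: ler_wpM2r => //; apply: ler_wpM2r => //; exact: pq.
rewrite integral_finZ//; first last.
- by rewrite !mulr_ge0.
- by move=> x; rewrite mulr_ge0.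
- apply: measurable_funM => //; apply: measurable_indic.
  rewrite (_ : [set x | _] = [set x | 0 < sg W l x] `&` ysection [set p | Dset W l c K p.1 p.2] y); last first.
    by apply/seteqP; split => x /=; rewrite /ysection /= inE.
  by apply: measurableI => //; exact: measurable_ysection.
apply: le_trans (lee_wpmul2l _ (Dset_volume W y c0 K0 l0)) _; first by rewrite lee_fin !mulr_ge0.
by rewrite -EFinM lee_fin -/C le_eqVlt; apply/orP; left; apply/eqP; ring.
Qed.

End tonelli.

Section extension.
Context {R : realType} {d : nat}.
Local Notation mu := (lebesgue_rV R d).
Implicit Types (W Om Z : set 'rV[R]_d) (f g : 'rV[R]_d -> R) (p q x y z : 'rV[R]_d)
  (c E K l rho a b : R) (N : nat).

(* c, E : every point outside W sees a ball of radius 2 c sg in W within distance E sg;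
   rho, N : Harnack chains; E' : if some nearby points are outside Z, then such a
   ball exists outside Om too. *)
Definition corkscrews c E W l := forall x, 0 < sg W l x ->
  exists2 q, `|q - x| <= E * sg W l x & deep W (2 * c * sg W l x) q.

Definition chained c K1 rho N W l := forall x p q, 0 < sg W l x ->
  deep W (c / 2 * sg W l x) p -> deep W (c / 2 * sg W l x) q -> `|q - p| <= K1 * sg W l x ->
  chain (deep W (3 * rho * sg W l x)) (step (rho * sg W l x)) N p q.

Definition outer_corkscrews c E' rho W l Om Z := forall x z z', 0 < sg W l x ->
  ball x (2 * sg W l x) z -> ball x (2 * sg W l x) z' -> Z z -> ~ Z z' ->
  exists q, [/\ `|q - x| <= E' * sg W l x, deep W (c / 2 * sg W l x) q &
    forall y, ball q (rho * sg W l x) y -> ~ Om y].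

Lemma sqr_bound a b (J : \bar R) : (0 <= J)%E -> J != +oo%E -> ((a ^+ 2)%:E <= b%:E * J)%E ->
  `|a| <= Num.sqrt (b * fine J).
Proof.
case: J => [j| |]//; rewrite lee_fin => j0 _; rewrite -EFinM lee_fin /= => h.
by rewrite -sqrtr_sqr ler_wsqrtr.
Qed.

Lemma measurable_Dset_integral W l c K f : measurable_fun setT f -> (forall x, 0 <= f x) ->
  measurable_fun setT (fun x => \int[mu]_(y in Dset W l c K x) (f y)%:E)%E.
Proof.
move=> mf f0.
pose F (z : 'rV[R]_d * 'rV[R]_d) : \bar R :=
  (\1_[set p | Dset W l c K p.1 p.2] z * f z.2)%:E.
have mF : measurable_fun setT F.
  apply/measurable_EFinP; apply: measurable_funM; last exact: measurableT_comp.
  by apply: measurable_indic; exact: measurable_graph_Dset.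
have -> : (fun x => \int[mu]_(y in Dset W l c K x) (f y)%:E)%E = (fun x => \int[mu]_y F (x, y))%E.
  apply/funext => x; rewrite integral_mkcond; apply: eq_integral => y _; rewrite patchE /F indicE.
  rewrite (_ : (y \in _) = ((x, y) \in [set p | Dset W l c K p.1 p.2])); last by apply/idP/idP; rewrite !inE.
  by case: ifP => _; rewrite ?mul1r ?mul0r.
by apply: (measurable_fun_fubini_tonelli_F (m2 := mu)) => // z; rewrite lee_fin mulr_ge0.
Qed.

Variables (eta : 'rV[R]_d -> R).
Hypotheses (d0 : (0 < d)%N) (beta : bump eta) (eta0 : forall x, 0 <= eta x)
  (etapos : exists2 c, 0 < c & forall x, `|x| <= 2^-1 -> c <= eta x).

(** For a nonempty open [W] and [l > 0], the test selects the complement of the closure of [W]; on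
    the null set [bnd W] the value is [f x]. *)
Definition ext W l c K Z f x : R :=
  if 0 < sg W l x then vavg eta (sg W l) (avgZ W l c K Z f) x else f x.

Lemma avgZ_value_le W l c E Z f x z : 0 < l -> 0 < c -> 0 <= E -> corkscrews c E W l ->
  measurable_fun setT f -> 0 < sg W l x -> ball x (2 * sg W l x) z ->
  ((avgZ W l c (E + c) Z f z ^+ 2)%:E <= (c^-1 ^+ d * (sg W l x)^-1 ^+ d)%:E *
    \int[mu]_(y in Dset W l (c / 2) (3 / 2 * (E + c) + 2) x) (f y ^+ 2)%:E)%E.
Proof.
move=> l0 c0 E0 HI mf sx xz.
have mf2 : measurable_fun setT (fun y => f y ^+ 2) by exact: measurable_funX.
have [h1 h2] := quarter_near (sg_lip W l) xz.
have zx : `|z - x| <= 2 * sg W l x by move: xz; rewrite -ball_normE /= distrC => /ltW.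
have ci0 : 0 <= c^-1 by rewrite invr_ge0 ltW.
have si0 : 0 <= (sg W l x)^-1 by rewrite invr_ge0 ltW.
have f20 y : 0 <= f y ^+ 2 by exact: sqr_ge0.
have [Zz|Zz] := pselect (Z z); last first.
  rewrite avgZ_out// expr0n mule_ge0 ?lee_fin ?mulr_ge0 ?exprn_ge0//; exact: integral_fin_ge0.
have sz : 0 < sg W l z by lra.
have [q qz dq] := HI z sz.
have := avgZ_sqr_le 0 (ltW l0) c0 E0 sz qz dq mf Zz.
rewrite subr0; under eq_integral do rewrite subr0.
move=> /le_trans; apply; apply: lee_pmul.
- rewrite lee_fin exprn_ge0// invr_ge0; apply: mulr_ge0; [lra|exact: ltW].
- exact: integral_fin_ge0.
- have p1 : 0 < 2 * c * sg W l z by apply: mulr_gt0 => //; lra.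
  have p2 : 0 < c * sg W l x by apply: mulr_gt0.
  rewrite lee_fin -exprMn -invfM lerXn2r ?nnegrE ?invr_ge0 ?(ltW p1) ?(ltW p2)//.
  rewrite lef_pV2 ?posrE//.
  have : c * (sg W l x / 2) <= c * sg W l z by rewrite ler_pM2l.
  lra.
- apply: integral_fin_subset => //; [exact: measurable_Dset|exact: measurable_Dset|].
  apply: Dset_sub => //; [clear -c0 mf2; lra|by rewrite addr_ge0// ltW|exact: ltW|clear -c0 mf2; lra].
Qed.

Lemma ext_value c E : 0 < c -> 0 <= E -> exists2 C, 0 < C & forall W l Z f,
  0 < l -> measurable Z -> corkscrews c E W l -> measurable_fun setT f ->
  forall x, 0 < sg W l x ->
  ((ext W l c (E + c) Z f x ^+ 2)%:E <= (C * (sg W l x)^-1 ^+ d)%:E *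
    \int[mu]_(y in Dset W l (c / 2) (3 / 2 * (E + c) + 2) x) (f y ^+ 2)%:E)%E.
Proof.
move=> c0 E0; have [C C0 HC] := vavg_bound d0 beta eta0 etapos.
have ci0 : 0 < c^-1 ^+ d by rewrite exprn_gt0// invr_gt0.
exists (C ^+ 2 * c^-1 ^+ d); first by rewrite mulr_gt0// exprn_gt0.
move=> W l Z f l0 mZ HI mf x sx; set J := (\int[mu]_(y in _) _)%E.
have J0 : (0 <= J)%E by apply: integral_fin_ge0 => y; exact: sqr_ge0.
have si0 : 0 < (sg W l x)^-1 ^+ d by rewrite exprn_gt0// invr_gt0.
have [Joo|Joo] := eqVneq J +oo%E.
  by rewrite Joo gt0_muley ?leey// lte_fin mulr_gt0// mulr_gt0// exprn_gt0.
have HM z : ball x (2 * sg W l x) z -> `|avgZ W l c (E + c) Z f z - 0| <=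
    Num.sqrt (c^-1 ^+ d * (sg W l x)^-1 ^+ d * fine J).
  by move=> xz; rewrite subr0; apply: sqr_bound => //; exact: avgZ_value_le.
have [h _] := HC _ (fun x => sg_ge0 W x (ltW l0)) (sg_lip W l) _ 0 _ x (measurable_avgZ W l c (E + c) mZ mf) sx HM.
rewrite subr0 in h; rewrite /ext sx -[J]fineK ?ge0_fin_numE ?ltey// -EFinM lee_fin.
have j0 : 0 <= fine J by exact: fine_ge0.
have : `|vavg eta (sg W l) (avgZ W l c (E + c) Z f) x| ^+ 2 <=
    (C * Num.sqrt (c^-1 ^+ d * (sg W l x)^-1 ^+ d * fine J)) ^+ 2.
  by rewrite lerXn2r ?nnegrE ?mulr_ge0 ?sqrtr_ge0 ?(ltW C0).
rewrite real_normK ?num_real// => /le_trans; apply.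
rewrite exprMn sqr_sqrtr; last by apply: mulr_ge0 => //; apply: mulr_ge0; exact: ltW.
by rewrite !mulrA.
Qed.

(** The square of the oscillation carries a factor [sg W l x ^+ 2], which the derivative of the
    averaging kernel, of order [(sg W l x)^-1], cancels exactly. *)
Lemma ext_grad (k c E E' rho : R) N : 0 <= k -> 0 < c -> 0 <= E -> E <= E' -> 0 < rho ->
  3 * rho <= c / 2 -> exists C K3, [/\ 0 < C, 0 < K3 & forall W l Om Z f g,
  0 < l -> measurable Z -> corkscrews c E W l ->
  chained c (3 / 2 * (E + c) + 2 + E') rho N W l -> outer_corkscrews c E' rho W l Om Z ->
  measurable_fun setT f -> measurable_fun setT g -> (forall x, 0 <= g x) ->
  (forall x, ~ Om x -> f x = 0) -> transl_le W k f g ->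
  forall x, 0 < sg W l x -> forall j,
  ((partial j (vavg eta (sg W l) (avgZ W l c (E + c) Z f)) x ^+ 2)%:E <=
    (C * (sg W l x)^-1 ^+ d)%:E * \int[mu]_(y in Dset W l (3 / 2 * rho) K3 x) (g y)%:E)%E].
Proof.
move=> k0 c0 E0 EE' rho0 rc.
have [C1 C10 HC1] := @oscillation R d k c E E' rho N k0 c0 E0 EE' rho0 rc.
have [C2 C20 HC2] := vavg_bound d0 beta eta0 etapos.
set K3 := 3 / 2 * (E + c) + 2 + E' + N%:R * rho + 2 * rho.
have Nr : 0 <= N%:R * rho by rewrite mulr_ge0// ltW.
exists (C2 ^+ 2 * (C1 + 1)), K3; split.
- by rewrite mulr_gt0 ?exprn_gt0//; lra.
- by rewrite /K3; lra.
move=> W l Om Z f g l0 mZ HI HC HX mf mg g0 fOm T x sx j; set J := (\int[mu]_(y in _) _)%E.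
have J0 : (0 <= J)%E by exact: integral_fin_ge0.
have si0 : 0 < (sg W l x)^-1 ^+ d by rewrite exprn_gt0// invr_gt0.
have [Joo|Joo] := eqVneq J +oo%E.
  rewrite Joo gt0_muley ?leey// lte_fin mulr_gt0// mulr_gt0 ?exprn_gt0//; clear -rc C10; lra.
have HX' y z z' : 0 < sg W l y -> ball y (2 * sg W l y) z -> ball y (2 * sg W l y) z' ->
     Z z -> ~ Z z' -> exists q, [/\ `|q - y| <= E' * sg W l y, deep W (c / 2 * sg W l y) q &
       forall y', ball q (rho * sg W l y) y' -> f y' = 0].
  move=> sy yz yz' Zz Zz'; have [q [q1 q2 q3]] := HX y z z' sy yz yz' Zz Zz'.
  by exists q; split => // y' /q3 /fOm.
have [m Hm] := HC1 W l f g Z l0 mf mg g0 T HI HC HX' x sx.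
have HM z : ball x (2 * sg W l x) z -> `|avgZ W l c (E + c) Z f z - m| <=
    Num.sqrt (C1 * sg W l x ^+ 2 * (sg W l x)^-1 ^+ d * fine J).
  by move=> xz; apply: sqr_bound => //; exact: Hm.
have [_ /(_ j) h] := HC2 _ (fun x => sg_ge0 W x (ltW l0)) (sg_lip W l) _ m _ x (measurable_avgZ W l c (E + c) mZ mf) sx HM.
rewrite -[J]fineK ?ge0_fin_numE ?ltey// -EFinM lee_fin.
have j0 : 0 <= fine J by exact: fine_ge0.
set t := sg W l x in sx si0 h HM *; set D := partial _ _ _ in h *; clearbody t D.
have : `|D| ^+ 2 <= (C2 * Num.sqrt (C1 * t ^+ 2 * t^-1 ^+ d * fine J) / t) ^+ 2.
  rewrite lerXn2r ?nnegrE//; apply: divr_ge0; last exact: ltW.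
  by rewrite mulr_ge0 ?sqrtr_ge0// ltW.
rewrite real_normK ?num_real// => /le_trans; apply.
rewrite !exprMn sqr_sqrtr; last first.
  apply: mulr_ge0 => //; apply: mulr_ge0; last exact: ltW.
  by apply: mulr_ge0 => //; exact: sqr_ge0.
have -> : C2 ^+ 2 * (C1 * t ^+ 2 * t^-1 ^+ d * fine J) * t^-1 ^+ 2 =
    C2 ^+ 2 * C1 * t^-1 ^+ d * fine J.
  have e : t ^+ 2 * t^-1 ^+ 2 = 1 by rewrite -exprMn divff ?expr1n ?gt_eqF.
  rewrite -[RHS]mulr1 -e; set X := t^-1 ^+ d; set Y := t^-1 ^+ 2; ring.
rewrite ler_wpM2r// ler_wpM2r ?(ltW si0)// ler_wpM2l ?sqr_ge0//; clear -h; lra.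
Qed.

End extension.

Section extension_integrals.
Context {R : realType} {d : nat}.
Local Notation mu := (lebesgue_rV R d).
Implicit Types (W Om Z : set 'rV[R]_d) (f g p q : 'rV[R]_d -> R) (x y z : 'rV[R]_d)
  (c E K l rho a b k kap : R) (N : nat).

Lemma open_sg W l : open [set x | 0 < sg W l x].
Proof.
have cs := continuous_quarter (sg_lip W l).
rewrite openE => x /= sx.
have nb : nbhs (sg W l x) [set t | 0 < t] by apply: open_nbhs_nbhs; split => //; exact: open_gt.
exact: (cs x _ nb).
Qed.

Lemma measurable_sg_gt0 W l : measurable [set x | 0 < sg W l x].
Proof. by apply: open_measurable_rV; exact: open_sg. Qed.

Lemma Dset_lt W l c K x : mu (Dset W l c K x) != +oo%E.
Proof.
pose r := Num.max 1 (K * sg W l x); have r0 : 0 < r by rewrite lt_max ltr01.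
rewrite -ltey; apply: (@le_lt_trans _ _ (mu (ball x r))).
  apply: le_measure; rewrite ?inE; [exact: measurable_Dset|exact: measurable_rV_ball|].
  by move=> y [yx _]; rewrite -ball_normE /= distrC; apply: lt_le_trans yx _; rewrite le_max lexx orbT.
by rewrite [X in (X < _)%E](lebesgue_rV_ball x r0) ltry.
Qed.

Lemma integrable_Dset W l c K f x : measurable_fun setT f -> (\int[mu]_y (f y ^+ 2)%:E < +oo)%E ->
  mu.-integrable (Dset W l c K x) (EFin \o f).
Proof.
move=> mf foo; have mD := measurable_Dset W l c K x.
have mf2 : measurable_fun setT (fun y => f y ^+ 2) by exact: measurable_funX.
apply/integrableP; split; first exact/measurable_funTS/measurable_EFinP.
apply: (@le_lt_trans _ _ (\int[mu]_(y in Dset W l c K x) (1 + f y ^+ 2)%:E)%E).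
  apply: le_integral_fin => //.
  - exact: measurableT_comp.
  - exact: measurable_funD.
  - move=> y _; have := sqr_ge0 (`|f y| - 1); rewrite sqrrB real_normK ?num_real//.
    have := normr_ge0 (f y); lra.
rewrite integral_finD//; last by move=> y; exact: sqr_ge0.
rewrite lte_add_pinfty//; first by rewrite integral_cst// mul1e ltey Dset_lt.
by apply: le_lt_trans foo; apply: integral_fin_subset => // y; exact: sqr_ge0.
Qed.

Variables (eta : 'rV[R]_d -> R).
Hypotheses (d0 : (0 < d)%N) (beta : bump eta) (eta0 : forall x, 0 <= eta x)
  (etapos : exists2 c, 0 < c & forall x, `|x| <= 2^-1 -> c <= eta x).

Section regularity.
Variables (W Z : set 'rV[R]_d) (l c E : R) (f : 'rV[R]_d -> R).
Hypotheses (l0 : 0 < l) (c0 : 0 < c) (E0 : 0 <= E) (mZ : measurable Z)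
  (HI : corkscrews c E W l) (mf : measurable_fun setT f)
  (foo : (\int[mu]_y (f y ^+ 2)%:E < +oo)%E).
Local Notation A := (avgZ W l c (E + c) Z f).
Local Notation u := (vavg eta (sg W l) A).

Let s0 x : 0 <= sg W l x. Proof. exact/sg_ge0/ltW. Qed.

Lemma avgZ_loc x : 0 < sg W l x -> exists M : R, forall z, ball x (2 * sg W l x) z -> `|A z| <= M.
Proof.
move=> sx; pose J := (\int[mu]_y (f y ^+ 2)%:E)%E.
exists (Num.sqrt (c^-1 ^+ d * (sg W l x)^-1 ^+ d * fine J)) => z xz.
have J0 : (0 <= J)%E by apply: integral_fin_ge0 => y; exact: sqr_ge0.
apply: sqr_bound => //; first by rewrite -ltey.
apply: le_trans (avgZ_value_le Z l0 c0 E0 HI mf sx xz) _.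
apply: lee_wpmul2l.
  by rewrite lee_fin mulr_ge0// exprn_ge0// invr_ge0 ltW.
apply: integral_fin_subset => //; first exact: measurable_Dset.
- exact: measurable_funX.
- by move=> y; exact: sqr_ge0.
Qed.

Lemma differentiable_ext x : 0 < sg W l x -> differentiable u x.
Proof.
move=> sx; have [M HM] := avgZ_loc sx.
exact: (differentiable_vavg d0 beta eta0 etapos s0 (sg_lip W l) (measurable_avgZ W l c (E + c) mZ mf) sx HM).
Qed.

Lemma continuous_partial_ext x j : 0 < sg W l x -> {for x, continuous (partial j u)}.
Proof.
move=> sx; exact: (continuous_partial_vavg d0 beta eta0 etapos s0 (sg_lip W l)
  (measurable_avgZ W l c (E + c) mZ mf) sx avgZ_loc).
Qed.

Lemma measurable_partial_ext j : measurable_fun [set x | 0 < sg W l x] (partial j u).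
Proof.
by apply: continuous_measurable_rV; [exact: open_sg|move=> x; exact: continuous_partial_ext].
Qed.

Lemma measurable_ext : measurable_fun setT (ext eta W l c (E + c) Z f).
Proof.
apply: measurable_fun_if => //.
- by apply: measurable_fun_ltr => //; exact: measurable_sg.
- rewrite setTI (_ : _ @^-1` _ = [set x | 0 < sg W l x])//.
  apply: continuous_measurable_rV; first exact: open_sg.
  by move=> x sx; apply: differentiable_continuous; exact: differentiable_ext.
- exact: measurable_funTS.
Qed.

Lemma ext_off x : 0 < sg W l x -> (forall z, ball x (2 * sg W l x) z -> ~ Z z) ->
  u x = 0 /\ forall j, partial j u x = 0.
Proof.
move=> sx Zx; have [C C0 HC] := vavg_bound d0 beta eta0 etapos.
have HM z : ball x (2 * sg W l x) z -> `|A z - 0| <= 0.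
  by move=> /Zx zZ; rewrite avgZ_out// subr0 normr0.
have [h1 h2] := HC _ s0 (sg_lip W l) _ 0 0 x (measurable_avgZ W l c (E + c) mZ mf) sx HM.
split; first by apply/eqP; rewrite -normr_le0; move: h1; rewrite subr0 mulr0.
by move=> j; apply/eqP; rewrite -normr_le0; move: (h2 j); rewrite mulr0 mul0r.
Qed.

End regularity.

Lemma ext_value_integral c E : 0 < c -> 0 <= E -> exists2 C, 0 < C & forall W l Z f,
  0 < l -> measurable Z -> corkscrews c E W l -> measurable_fun setT f ->
  (\int[mu]_y (f y ^+ 2)%:E < +oo)%E ->
  (\int[mu]_x (ext eta W l c (E + c) Z f x ^+ 2)%:E <= C%:E * \int[mu]_y (f y ^+ 2)%:E)%E.
Proof.
move=> c0 E0; have [C C0 HC] := ext_value d0 beta eta0 etapos c0 E0.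
set K := 3 / 2 * (E + c) + 2 in HC; have K0 : 0 < K by rewrite /K; lra.
have c20 : 0 < c / 2 by rewrite divr_gt0.
pose C' := (2 * K ^+ 2 / (c / 2)) ^+ d * C.
have C'0 : 0 < C' by rewrite mulr_gt0// exprn_gt0// divr_gt0// mulr_gt0// exprn_gt0.
exists (C' + 1); first by rewrite addr_gt0.
move=> W l Z f l0 mZ HI mf foo.
have f20 y : 0 <= f y ^+ 2 by exact: sqr_ge0.
have mf2 : measurable_fun setT (fun y => f y ^+ 2) by exact: measurable_funX.
have mext := measurable_ext l0 c0 E0 mZ HI mf foo.
have mF := measurable_sg_gt0 W l.
have me2 : measurable_fun setT (fun x => ext eta W l c (E + c) Z f x ^+ 2) by exact: measurable_funX.
have I0 : (0 <= \int[mu]_y (f y ^+ 2)%:E)%E by exact: integral_fin_ge0.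
rewrite -(setUv [set x | 0 < sg W l x]) ge0_integral_setU//; first last.
- by apply/disj_setPCl.
- by move=> x _; rewrite lee_fin sqr_ge0.
- by rewrite setUv; exact/measurable_EFinP.
- exact: measurableC.
rewrite setUv EFinD ge0_muleDl ?lee_fin ?(ltW C'0)//; apply: leeD; last first.
  rewrite mul1e; apply: (@le_trans _ _ (\int[mu]_(x in ~` [set x | (0 < sg W l x)%R]) (f x ^+ 2)%:E)%E).
    apply: le_integral_fin => //; first exact: measurableC.
    - by move=> x _; exact: sqr_ge0.
    - by move=> x /negP sx; rewrite /ext (negbTE sx).
  by apply: integral_fin_subset => //; exact: measurableC.
apply: (@le_trans _ _ (\int[mu]_(x in [set x | (0 < sg W l x)%R]) ((C * (sg W l x)^-1 ^+ d)%:E *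
     \int[mu]_(y in Dset W l (c / 2) K x) (f y ^+ 2)%:E))%E).
  apply: ge0_le_integral => //.
  - by move=> x _; rewrite lee_fin sqr_ge0.
  - exact/measurable_funTS/measurable_EFinP.
  - apply: measurable_funTS; apply: emeasurable_funM; last exact: measurable_Dset_integral.
    apply/measurable_EFinP; apply: measurable_funM => //; apply: measurable_funX.
    by apply: (measurableT_comp (@measurable_inv R)); exact: measurable_sg.
  - by move=> x sx; exact: HC.
have := @Dset_tonelli R d W l (c / 2) K (cst C) (cst 1) (fun y => f y ^+ 2) C c20 K0 (ltW l0) (ltW C0).
under [X in (_ <= _ * X)%E]eq_integral do rewrite /= mul1r.
move=> T; apply: T => //.
- by move=> x; exact: ltW.
- by move=> x y _ _ _; rewrite /= mulr1.
Qed.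

Lemma ext_grad_integral (k c E E' rho : R) N : 0 <= k -> 0 < c -> 0 <= E -> E <= E' -> 0 < rho ->
  3 * rho <= c / 2 -> exists C K3, [/\ 0 < C, 0 < K3 & forall W l Om Z f g p q (kap : R),
  0 < l -> measurable Z -> corkscrews c E W l ->
  chained c (3 / 2 * (E + c) + 2 + E') rho N W l -> outer_corkscrews c E' rho W l Om Z ->
  measurable_fun setT f -> measurable_fun setT g -> (forall x, 0 <= g x) ->
  (forall x, ~ Om x -> f x = 0) -> transl_le W k f g -> (\int[mu]_y (f y ^+ 2)%:E < +oo)%E ->
  0 <= kap -> measurable_fun setT p -> measurable_fun setT q -> (forall x, 0 <= p x) ->
  (forall x, 0 <= q x) ->
  (forall x y, 0 < sg W l x -> `|y - x| < K3 * sg W l x -> 0 < g y -> p x <= kap * q y) ->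
  forall j, (\int[mu]_(x in [set x | (0 < sg W l x)%R])
     (p x * partial j (vavg eta (sg W l) (avgZ W l c (E + c) Z f)) x ^+ 2)%:E <=
    (C * kap)%:E * \int[mu]_y (q y * g y)%:E)%E].
Proof.
move=> k0 c0 E0 EE' rho0 rc.
have [C [K3 [C0 K30 HC]]] := @ext_grad R d eta d0 beta eta0 etapos k c E E' rho N k0 c0 E0 EE' rho0 rc.
have c30 : 0 < 3 / 2 * rho by rewrite mulr_gt0// divr_gt0.
exists ((2 * K3 ^+ 2 / (3 / 2 * rho)) ^+ d * C), K3; split => //.
  by rewrite mulr_gt0// exprn_gt0// divr_gt0// mulr_gt0// exprn_gt0.
move=> W l Om Z f g p q kap l0 mZ HI Hch HX mf mg g0 fOm T foo kap0 mp mq p0 q0 pq j.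
have mF := measurable_sg_gt0 W l.
have si0 x : 0 <= (sg W l x)^-1 ^+ d by rewrite exprn_ge0// invr_ge0 sg_ge0// ltW.
apply: (@le_trans _ _ (\int[mu]_(x in [set x | (0 < sg W l x)%R]) ((C * p x * (sg W l x)^-1 ^+ d)%:E *
     \int[mu]_(y in Dset W l (3 / 2 * rho) K3 x) (g y)%:E))%E).
  apply: ge0_le_integral => //.
  - by move=> x _; rewrite lee_fin mulr_ge0// sqr_ge0.
  - apply/measurable_EFinP; apply: measurable_funM; first exact: measurable_funTS.
    by apply: measurable_funX; exact: measurable_partial_ext.
  - apply: measurable_funTS; apply: emeasurable_funM; last exact: measurable_Dset_integral.
    apply/measurable_EFinP; apply: measurable_funM; first exact: measurable_funM.
    apply: measurable_funX.
    by apply: (measurableT_comp (@measurable_inv R)); exact: measurable_sg.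
  - move=> x sx; have := HC W l Om Z f g l0 mZ HI Hch HX mf mg g0 fOm T x sx j.
    have px : (0 <= (p x)%:E)%E by rewrite lee_fin.
    move=> /(lee_wpmul2l px); rewrite -EFinM muleA -EFinM.
    by rewrite (_ : p x * (C * _) = C * p x * (sg W l x)^-1 ^+ d)//; ring.
have := @Dset_tonelli R d W l (3 / 2 * rho) K3 (fun x => C * p x) q g (C * kap) c30 K30 (ltW l0).
rewrite !mulrA; apply => //.
- by rewrite mulr_ge0// ltW.
- exact: measurable_funM.
- by move=> x; rewrite mulr_ge0// ltW.
- by move=> x y sx [xy _] gy; rewrite -mulrA ler_wpM2l ?(ltW C0)// pq.
Qed.

Lemma avgZ_lin W l c K Z f g a x : measurable_fun setT f -> measurable_fun setT g ->
  (\int[mu]_y (f y ^+ 2)%:E < +oo)%E -> (\int[mu]_y (g y ^+ 2)%:E < +oo)%E ->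
  avgZ W l c K Z (fun y => a * f y + g y) x = a * avgZ W l c K Z f x + avgZ W l c K Z g x.
Proof.
move=> mf mg foo goo; have mD := measurable_Dset W l c K x.
have i1 := integrable_Dset W l c K x mf foo; have i2 := integrable_Dset W l c K x mg goo.
have i3 : mu.-integrable (Dset W l c K x) (EFin \o (fun y => a * f y)).
  by have := integrableZl mD a i1.
rewrite /avgZ.
have -> : \int[mu]_(y in Dset W l c K x) (a * f y + g y) =
    a * \int[mu]_(y in Dset W l c K x) f y + \int[mu]_(y in Dset W l c K x) g y.
  by rewrite RintegralD// RintegralZl.
ring.
Qed.

Lemma vavg_lin (s : 'rV[R]_d -> R) (A B : 'rV[R]_d -> R) a x :
  (forall x, 0 <= s x) -> (forall x z, `|s x - s z| <= 4^-1 * `|x - z|) ->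
  measurable_fun setT A -> measurable_fun setT B -> 0 < s x ->
  (exists M : R, forall z, ball x (2 * s x) z -> `|A z| <= M) ->
  (exists M : R, forall z, ball x (2 * s x) z -> `|B z| <= M) ->
  vavg eta s (fun y => a * A y + B y) x = a * vavg eta s A x + vavg eta s B x.
Proof.
move=> s0 slip mA mB sx [MA HA] [MB HB]; rewrite /vavg.
have i1 := integrable_Kint_ker s0 slip sx beta d0 mA HA.
have i2 := integrable_Kint_ker s0 slip sx beta d0 mB HB.
have -> : Kint eta d s (fun y => a * A y + B y) x = a * Kint eta d s A x + Kint eta d s B x.
  rewrite /Kint -RintegralZl// -RintegralD//; last by have := integrableZl measurableT a i1.
  by apply: eq_Rintegral => z _ /=; ring.
by rewrite mulrDl mulrA.
Qed.

Lemma ext_lin W l c E Z f g a x : 0 < l -> 0 < c -> 0 <= E -> measurable Z -> corkscrews c E W l ->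
  measurable_fun setT f -> measurable_fun setT g ->
  (\int[mu]_y (f y ^+ 2)%:E < +oo)%E -> (\int[mu]_y (g y ^+ 2)%:E < +oo)%E ->
  ext eta W l c (E + c) Z (fun y => a * f y + g y) x =
  a * ext eta W l c (E + c) Z f x + ext eta W l c (E + c) Z g x.
Proof.
move=> l0 c0 E0 mZ HI mf mg foo goo; rewrite /ext; case: ifPn => // sx.
have -> : avgZ W l c (E + c) Z (fun y => a * f y + g y) =
    fun z => a * avgZ W l c (E + c) Z f z + avgZ W l c (E + c) Z g z.
  by apply/funext => z; exact: avgZ_lin.
apply: vavg_lin => //.
- by move=> z; rewrite sg_ge0// ltW.
- exact: sg_lip.
- exact: measurable_avgZ.
- exact: measurable_avgZ.
- exact: avgZ_loc.
- exact: avgZ_loc.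
Qed.

Lemma ext_ae W l c K Z f g : measurable_fun setT f -> measurable_fun setT g ->
  {ae mu, forall x, f x = g x} -> {ae mu, forall x, ext eta W l c K Z f x = ext eta W l c K Z g x}.
Proof.
move=> mf mg fg.
have e : avgZ W l c K Z f = avgZ W l c K Z g.
  apply/funext => x; rewrite /avgZ; congr (_ * (_ * _)).
  rewrite /Rintegral; congr fine; apply: ae_eq_integral => //.
  - exact: measurable_Dset.
  - exact/measurable_funTS/measurable_EFinP.
  - exact/measurable_funTS/measurable_EFinP.
  - by apply: filterS fg => y -> .
by apply: filterS fg => x fgx; rewrite /ext e fgx.
Qed.

End extension_integrals.

(** * Geometry of perforated sets *)

Section geometry_of_perforations.
Context {R : realType} {d : nat}.
Implicit Types (om Om W Z : set 'rV[R]_d) (b p q x y z : 'rV[R]_d) (a r c E l lam tau eps : R) (N : nat).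

(** If [sg] is at its cap [lam * eps / 4], a deep point of [W] is within [2 * eps], that is
    [8 / lam] times [sg]. Otherwise [W] has a point within [5 * sg] of [x], the boundary a point
    within another [5 * sg], and a corkscrew point lies at distance [sg] from it: hence 11. *)
Lemma corkscrews_scale a r lam om eps : 0 < a -> a < 1 -> 0 < r -> 0 < lam ->
  lam <= Num.min 1 (r / 2) -> cone_domain a r om -> om !=set0 -> periodic_set om -> 0 < eps ->
  corkscrews (a / 4) (11 + 8 / lam) (scale_set eps om) (lam * eps).
Proof.
move=> a0 a1 r0 lam0; rewrite le_min => /andP[lam1 lamr] com om0 pom eps0.
set W := scale_set eps om; set l := lam * eps.
have l0 : 0 < l by rewrite mulr_gt0.
have W0 : W !=set0.
  by have [y oy] := om0; exists (eps *: y); rewrite /W /scale_set /= scalerK// gt_eqF.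
have cW : cone_domain a (eps * r) W by exact: cone_domain_scale.
have l8 : 0 < 8 / lam by rewrite divr_gt0.
move=> x sx; have a4 : 2 * (a / 4) = a / 2 by field.
have [sl|[w Ww xw]] := sg_near W0 sx.
  have [q qx dq] := deep_everywhere_scale x a0 a1 r0 eps0 com om0 pom.
  exists q.
    apply: le_trans qx _; have -> : 2 * eps = 8 / lam * sg W l x by rewrite sl /l; field; rewrite gt_eqF.
    by rewrite ler_wpM2r ?(ltW sx)//; lra.
  apply: deep_le dq; rewrite a4 sl /l -[leRHS]mulrA ler_wpM2l//; first by rewrite divr_ge0// ltW.
  rewrite mulrAC ler_wpM2r ?(ltW eps0)//.
  have : lam <= Num.min 1 (r / 2) by rewrite le_min lam1.
  by move: lam0; set M := Num.min _ _; lra.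
have Wx : ~ W x by apply: (sg_notin (ltW l0)).
have [b bb bw] := bnd_near_point Ww Wx (ltW xw).
have st : sg W l x <= eps * r / 2.
  apply: le_trans (sg_le W l x) _; rewrite /l.
  have : lam * eps <= r / 2 * eps by rewrite ler_wpM2r// ltW.
  have : 0 < r * eps by rewrite mulr_gt0.
  lra.
have [q qb dq] := corkscrew a0 a1 cW bb sx st.
exists q; last by rewrite a4.
have h1 := ler_distD b q x; have h2 := ler_distD w b x; rewrite [`|w - x|]distrC in h2.
have : 0 < 8 / lam * sg W l x by rewrite mulr_gt0.
lra.
Qed.

(** Two regimes, separated by [kap]. If [sg <= kap * eps], the usual corkscrew ball is so close to
    [z'], itself at distance at least [tau * eps] from [Om], that it misses [Om]. Otherwise [sg] is
    comparable with [eps], and one may go as far as a multiple of [eps]: down the exterior cone of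
    [Om], then to a deep point of [W]. Division by [kap] expresses this distance in units of
    [sg]. *)
Lemma outer_corkscrews_scale a r lam tau aO om Om rO eps (rho : R) : 0 < a -> a < 1 -> 0 < r -> 0 < lam ->
  lam <= Num.min 1 (r / 2) -> 0 < tau -> 0 < aO ->
  let c := a / 4 in let E := 11 + 8 / lam in
  let kap := tau / (2 * (c + E + 2)) in
  let E' := E + (2 + 3 / aO + 2 * lam + 2 * tau) / kap in
  0 < rho -> rho <= c ->
  cone_domain a r om -> om !=set0 -> periodic_set om -> 0 < eps ->
  cone_domain aO rO Om -> Om !=set0 -> (3 / aO + 3) * eps < rO ->
  outer_corkscrews c E' rho (scale_set eps om) (lam * eps) Om [set z | sdist Om z < tau * eps].
Proof.
move=> a0 a1 r0 lam0 lamM tau0 aO0 c E kap E' rho0 rhoc com om0 pom eps0 cO Om0 epsr.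
have HI := corkscrews_scale a0 a1 r0 lam0 lamM com om0 pom eps0.
move: (lamM); rewrite le_min => /andP[lam1 lamr].
set W := scale_set eps om in HI *; set l := lam * eps in HI *.
have l0 : 0 < l by rewrite mulr_gt0.
have c0 : 0 < c by rewrite divr_gt0.
have l8 : 0 < 8 / lam by rewrite divr_gt0.
have E0 : 0 < E by rewrite /E; lra.
have kap0 : 0 < kap by rewrite divr_gt0//; lra.
have aO3 : 0 < 3 / aO by rewrite divr_gt0.
have EE' : E <= E' by rewrite lerDl divr_ge0 ?(ltW kap0)//; lra.
move=> x z z' sx; set t := sg W l x in sx *; rewrite -!ball_normE /= => xz xz' Zz /negP.
rewrite -leNgt => Zz'.
have tl : t <= l / 4 by exact: sg_le.
have rt : rho * t <= c * t by rewrite ler_wpM2r// ltW.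
have [tk|tk] := leP t (kap * eps).
  have [q qx dq] := HI x sx; rewrite -/t -/c -/E in qx dq; exists q; split.
  - by apply: le_trans qx _; rewrite ler_wpM2r// ltW.
  - apply: deep_le dq; rewrite ler_wpM2r ?(ltW sx)//; clear -c0; lra.
  move=> y qy Oy; have := sdist_le z' Oy.
  have h1 := ler_distD x z' y; have h2 := ler_distD q x y.
  rewrite [`|z' - x|]distrC in h1; rewrite [`|x - q|]distrC in h2.
  have : (c + E + 2) * t <= (c + E + 2) * (kap * eps) by rewrite ler_wpM2l//; clear -c0 E0; lra.
  have -> : (c + E + 2) * (kap * eps) = tau * eps / 2.
    by rewrite /kap; field; apply/eqP => h; move: h; clear -c0 E0; lra.
  have : 0 < tau * eps by rewrite mulr_gt0.
  clear -xz' Zz' rt qx qy h1 h2; lra.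
have [w1 Oo zo] := sdist_lt Om0 Zz.
have Oz' : ~ Om z'.
  move=> /(sdist_le z'); rewrite subrr normr0; have : 0 < tau * eps by rewrite mulr_gt0.
  clear -Zz'; lra.
have z'w1 : `|z' - w1| <= (lam + tau) * eps.
  have h1 := ler_distD x z' w1; have h2 := ler_distD z x w1.
  rewrite [`|z' - x|]distrC in h1; rewrite mulrDl; move: tl; rewrite /l; clear -xz xz' zo h1 h2; lra.
have [b bb bo] := bnd_near_point Oo Oz' z'w1.
have rO0 : 0 < rO by apply: le_lt_trans epsr; rewrite mulr_ge0 ?(ltW eps0)//; lra.
have [oO cOb] := cO.
have [nu [n1 _ _ H]] := cone_up aO0 rO0 bb (cOb b bb).
(* The ball of radius [3 * eps = aO * T] around [b - T *: nu] misses [Om]. It has room for the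
   distance [2 * eps] to a deep point of [W] and for the small ball around that point. *)
pose T := 3 * eps / aO; have T0 : 0 < T by rewrite divr_gt0// mulr_gt0.
have aT : aO * T = 3 * eps by rewrite /T mulrC divfK// gt_eqF.
have TE : (3 / aO + 3) * eps = T + 3 * eps by rewrite /T; ring.
have Tn : `|T *: nu| <= T by rewrite normrZ gtr0_norm// -[leRHS]mulr1 ler_wpM2l// ltW.
pose e := b - T *: nu.
have eb : `|e - b| <= T by rewrite /e addrAC subrr add0r normrN.
have out y : `|e - y| <= 3 * eps -> ~ Om y.
  move=> ey; apply: (H oO y T) => //.
    rewrite -ball_normE /=; have := ler_distD e b y; rewrite [`|b - e|]distrC.
    by move: eb ey epsr eps0; rewrite TE; clear; lra.
  by rewrite (_ : b - y - T *: nu = e - y) ?aT// /e addrAC.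
have [q qe dq] := deep_everywhere_scale e a0 a1 r0 eps0 com om0 pom.
have le4 : l / 4 <= eps / 4 by rewrite ler_pM2r// /l ler_piMl// ltW.
exists q; split.
- have h1 := ler_distD e q x; have h2 := ler_distD b e x; have h3 := ler_distD w1 b x.
  have h4 := ler_distD z w1 x; rewrite [`|w1 - z|]distrC [`|z - x|]distrC in h4.
  have : (2 + 3 / aO + 2 * lam + 2 * tau) * eps <= E' * t.
    rewrite /E' (mulrDl E); have Et0 : 0 <= E * t by apply: mulr_ge0; exact: ltW.
    set X := 2 + _ + _ + _; have X0 : 0 <= X by rewrite /X; move: lam0 tau0 (ltW (divr_gt0 (ltr0Sn R 2) aO0)); clear; lra.
    have : X * eps <= X / kap * t.
      by rewrite -mulrA ler_wpM2l// ler_pdivlMl// ltW.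
    by move: Et0; clear; lra.
  have : (2 + 3 / aO + 2 * lam + 2 * tau) * eps = 2 * eps + T + 2 * (lam * eps) + 2 * (tau * eps).
    by rewrite /T; ring.
  move: bo zo tl; rewrite mulrDl /l; clear -sx xz eb qe h1 h2 h3 h4; lra.
- apply: deep_le dq; rewrite /c.
  have h1 : a / 4 / 2 * t <= a / 2 * (l / 4).
    have : a * t <= a * (l / 4) by rewrite ler_pM2l.
    have : 0 < a * (l / 4) by rewrite !mulr_gt0.
    by clear; lra.
  apply: le_trans h1 _; rewrite -[leRHS]mulrA ler_wpM2l ?divr_ge0 ?(ltW a0)// /l.
  rewrite mulrAC ler_wpM2r ?(ltW eps0)//.
  by move: lamM lam0; set M := Num.min _ _; clear; lra.
- move=> y qy; apply: out.
  have h1 := ler_distD q e y; rewrite [`|e - q|]distrC in h1.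
  have : c * t <= t by rewrite ler_piMl ?(ltW sx)// /c; clear -a1; lra.
  clear -sx tl rt qe le4 qy h1; lra.
Qed.

(** The order of the quantifiers matters: the constants precede the domains, the radius [rO] and
    [eps]. *)
Lemma perforation_geometry a r lam tau aO : 0 < a -> a < 1 -> 0 < r -> 0 < lam ->
  lam <= Num.min 1 (r / 2) -> 0 < tau -> 0 < aO ->
  exists c E E' (rho : R) N, [/\ 0 < c, 0 <= E, E <= E', 0 < rho & 3 * rho <= c / 2] /\
  forall om Om rO eps, cone_domain a r om -> connected om -> om !=set0 -> periodic_set om ->
    0 < eps -> cone_domain aO rO Om -> Om !=set0 -> (3 / aO + 3) * eps < rO ->
    [/\ corkscrews c E (scale_set eps om) (lam * eps),
        chained c (3 / 2 * (E + c) + 2 + E') rho N (scale_set eps om) (lam * eps)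
      & outer_corkscrews c E' rho (scale_set eps om) (lam * eps) Om [set z | sdist Om z < tau * eps]].
Proof.
move=> a0 a1 r0 lam0 lamM tau0 aO0.
pose c := a / 4; pose E := 11 + 8 / lam; pose kap := tau / (2 * (c + E + 2)).
pose E' := E + (2 + 3 / aO + 2 * lam + 2 * tau) / kap.
move: (lamM); rewrite le_min => /andP[lam1 _].
have c0 : 0 < c by rewrite divr_gt0.
have l8 : 0 < 8 / lam by rewrite divr_gt0.
have E0 : 0 < E by rewrite /E; lra.
have kap0 : 0 < kap by rewrite divr_gt0//; lra.
have aO3 : 0 < 3 / aO by rewrite divr_gt0.
have EE' : E <= E' by rewrite lerDl divr_ge0 ?(ltW kap0)//; lra.
pose K1 := 3 / 2 * (E + c) + 2 + E'; have K10 : 0 < K1 by rewrite /K1; lra.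
have c2 : 0 < c / 2 by rewrite divr_gt0.
have [rho [N [rho0 rc H]]] := @harnack_chain_scale R d a r K1 (c / 2) a0 a1 r0 K10 c2.
exists c, E, E', rho, N; split; first by split => //; exact: ltW.
move=> om Om rO eps com kom om0 pom eps0 cO Om0 epsr; split.
- exact: (corkscrews_scale a0 a1 r0 lam0 lamM com om0 pom eps0).
- move=> x p q sx dp dq pq; apply: H => //; rewrite sx /=; apply: le_trans (sg_le _ _ _) _.
  have : lam * eps <= eps by rewrite ler_piMl// ltW.
  clear -eps0; lra.
- have rhoc : rho <= c by lra.
  exact: (outer_corkscrews_scale a0 a1 r0 lam0 lamM tau0 aO0 rho0 rhoc com om0 pom eps0 cO Om0 epsr).
Qed.

End geometry_of_perforations.

(** * Extensions of smooth functions *)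

Section zero_extension_lipschitz.
Context {R : realType} {d : nat}.
Variables (phi : 'rV[R]_d -> R) (U : set 'rV[R]_d) (r1 B : R).
Hypotheses (sphi : smooth phi) (oU : open U) (Ur : forall x, U x -> `|x| <= r1)
  (phiB : forall j x, `|x| <= r1 + 1 -> `|partial j phi x| <= B).
Implicit Types (x y v p q : 'rV[R]_d).
Local Notation f := (zext phi U).

Lemma zext_in x : U x -> f x = phi x.
Proof. by move=> Ux; rewrite /zext indicE mem_set// mulr1. Qed.

Lemma zext_out x : ~ U x -> f x = 0.
Proof. by move=> Ux; rewrite /zext indicE memNset// mulr0. Qed.

Lemma convex_lip x v : `|x| <= r1 + 1 -> `|x + v| <= r1 + 1 ->
  `|phi (x + v) - phi x| <= d%:R * B * `|v|.
Proof.
move=> xr vr; apply: rV_lipschitz_le => [t _|t j /andP[t0 t1]]; first exact: (sphi [::]).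
apply: phiB; have -> : x + t *: v = (1 - t) *: x + t *: (x + v).
  by apply/rowP => i; rewrite !mxE; ring.
apply: le_trans (ler_normD _ _) _; rewrite !normrZ !ger0_norm ?subr_ge0//.
have : (1 - t) * `|x| <= (1 - t) * (r1 + 1) by rewrite ler_wpM2l// subr_ge0.
have : t * `|x + v| <= t * (r1 + 1) by rewrite ler_wpM2l.
lra.
Qed.

Lemma bnd_norm_le b : bnd U b -> `|b| <= r1 + 1.
Proof.
move=> bb; have [y Uy] := bnd_near bb (@ltr01 R); rewrite -ball_normE /= => yb.
have := ler_normD (b - y) y; rewrite subrK; have := Ur Uy; lra.
Qed.

Lemma zext_segment_lip x v : 0 <= B ->
  (forall t : R, 0 <= t <= 1 -> bnd U (x + t *: v) -> phi (x + t *: v) = 0) ->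
  `|f (x + v) - f x| <= d%:R * B * `|v|.
Proof.
move=> B0 bv; have c0 : 0 <= d%:R * B by rewrite mulr_ge0.
have le1 y : U y -> `|y| <= r1 + 1 by move=> /Ur; lra.
have exitle y w : U y -> ~ U (y + w) ->
    (forall t : R, 0 <= t <= 1 -> bnd U (y + t *: w) -> phi (y + t *: w) = 0) ->
    `|phi y| <= d%:R * B * `|w|.
  move=> Uy Uw bw; have [t [/andP[t0 t1] _ bt]] := first_exit oU Uy Uw.
  have := convex_lip (le1 _ Uy) (bnd_norm_le bt).
  rewrite bw ?(ltW t0) ?t1// sub0r normrN => /le_trans; apply.
  by rewrite ler_wpM2l// normrZ gtr0_norm// ler_piMl.
have [Ux|Ux] := pselect (U x); have [Uv|Uv] := pselect (U (x + v)).
- by rewrite !zext_in//; apply: convex_lip; exact: le1.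
- by rewrite (zext_out Uv) (zext_in Ux) sub0r normrN; exact: exitle.
- have -> : f (x + v) - f x = phi (x + v) by rewrite (zext_out Ux) subr0 zext_in.
  rewrite -[`|v|]normrN; apply: exitle => //.
    by rewrite addrK.
  move=> t /andP[t0 t1]; have -> : x + v + t *: - v = x + (1 - t) *: v.
    by apply/rowP => i; rewrite !mxE; ring.
  by apply: bv; rewrite subr_ge0 t1 gerBl.
- by rewrite !zext_out// subrr normr0 mulr_ge0.
Qed.

Variables (W : set 'rV[R]_d) (a r : R).
Hypotheses (a0 : 0 < a) (a1 : a < 1) (r0 : 0 < r) (cW : cone_domain a r W) (B0 : 0 <= B)
  (phi0 : forall x, W x -> bnd U x -> phi x = 0).

Lemma zext_step_lip p q (e : R) : deep W e p -> `|q - p| < e ->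
  `|f q - f p| <= d%:R * B * `|q - p|.
Proof.
move=> dp pq; have {1}-> : q = p + (q - p) by rewrite addrC subrK.
apply: zext_segment_lip => // t /andP[t0 t1]; apply: phi0; apply: dp.
rewrite -ball_normE /= opprD addNKr normrN normrZ ger0_norm//.
by apply: le_lt_trans pq; rewrite ler_piMl.
Qed.

Lemma zext_chain_lip p q (e : R) N : 0 < e -> chain (deep W e) (step (e / 2)) N p q ->
  `|f q - f p| <= N%:R * (d%:R * B * (e / 2)).
Proof.
move=> e0; elim: N p => [|N IH] p /=.
  by move=> [_ ->]; rewrite subrr normr0 mul0r.
move=> [dp [p1 Sp /IH h]]; have sp : `|p1 - p| <= e / 2 by rewrite distrC.
have h2 : `|f p1 - f p| <= d%:R * B * (e / 2).
  apply: le_trans (zext_step_lip dp _) _; first by apply: le_lt_trans sp _; lra.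
  by rewrite ler_wpM2l// mulr_ge0.
have := ler_distD (f p1) (f q) (f p); rewrite -natr1 mulrDl mul1r; lra.
Qed.

(* W is locally quasiconvex: near its boundary, go up along the cone, across, and down. *)
Lemma zext_lipschitz : exists2 M, 0 <= M & forall p q, W p -> W q -> `|f q - f p| <= M * `|q - p|.
Proof.
have [oW _] := cW.
have [S S0] := @continuous_bounded_ball R d phi 0 (r1 + 1) (smooth_continuous sphi).
pose S1 := `|S|; have S10 : 0 <= S1 by exact: normr_ge0.
have fS x : `|f x| <= S1.
  have [Ux|Ux] := pselect (U x); last by rewrite zext_out// normr0.
  rewrite zext_in//; apply: le_trans (S0 _ _) (ler_norm S); rewrite subr0.
  by have := Ur Ux; lra.
pose K := 15 + 9 / a; have K0 : 0 < K by rewrite /K; have := divr_gt0 (_ : 0 < 9) a0; lra.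
(* For points at distance [h < t1] the detour, of size at most [K * h], stays in the ball of the
   cone condition; points further apart are treated by the bound [S1] on [f]. *)
pose t1 := r / (2 * K); have t10 : 0 < t1 by rewrite divr_gt0// mulr_gt0.
pose M1 := d%:R * B * (36 / a + 1); have M10 : 0 <= M1.
  by rewrite !mulr_ge0// addr_ge0// divr_ge0// ltW.
have S20 : 0 <= 2 * S1 by exact: mulr_ge0.
have St : 0 <= 2 * S1 / t1 by apply: divr_ge0 => //; exact: ltW.
exists (M1 + 2 * S1 / t1); first exact: addr_ge0.
move=> p q Wp Wq; rewrite mulrDl; set h := `|q - p|; have h0 : 0 <= h by exact: normr_ge0.
have dB0 : 0 <= d%:R * B by rewrite mulr_ge0.
have [ht|ht] := leP t1 h.
  have := ler_normB (f q) (f p); have := fS p; have := fS q.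
  have : 2 * S1 <= 2 * S1 / t1 * h by rewrite mulrAC ler_pdivlMr// ler_wpM2l.
  have : 0 <= M1 * h by exact: mulr_ge0.
  lra.
have S1t : 0 <= 2 * S1 / t1 * h by exact: mulr_ge0.
have M1h0 : 0 <= M1 * h by exact: mulr_ge0.
have [hz|hz] := eqVneq h 0.
  have : q - p == 0 by rewrite -normr_eq0 -/h hz.
  by rewrite subr_eq0 => /eqP ->; rewrite subrr normr0; exact: addr_ge0.
have hp : 0 < h by rewrite lt_def hz.
have M1h : d%:R * B * h <= M1 * h.
  rewrite ler_wpM2r// /M1 ler_peMr// lerDr divr_ge0// ltW//.
have [dp|[b bb bp]] := deep_or_bnd (2 * h) Wp.
  by apply: le_trans (zext_step_lip dp _) _; rewrite -/h; clear -S1t M1h0 hz hp M1h; lra.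
have nearp x : W x -> exists2 e, 0 < e & deep W e x.
  move=> Wx; have /nbhs_ballP[e /= e0 He] : nbhs x W by exact: open_nbhs_nbhs.
  by exists e.
have [ep ep0 dp] := nearp _ Wp; have [eq eq0 dq] := nearp _ Wq.
(* The depths of [p] and [q] may be tiny compared with [h]. The number [k] of steps is then large,
   but only the length [k * rho / 2], at most [X + rho / 2], enters the bound. *)
pose rho := Num.min h (Num.min ep eq); have rho0 : 0 < rho by rewrite !lt_min hp ep0 eq0.
have rhoh : rho <= h by rewrite ge_min lexx.
have dp' : deep W rho p by apply: deep_le dp; rewrite !ge_min lexx !orbT.
have dq' : deep W rho q by apply: deep_le dq; rewrite !ge_min lexx !orbT.
pose D := 3 * h; pose X := 9 * h / a.
have X0 : 0 < X by rewrite divr_gt0// mulr_gt0.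
have Xa : (2 * D + rho) / a <= X by rewrite ler_pM2r ?invr_gt0// /D; clear -hz hp M1h rho0 rhoh X0; lra.
have hX : 9 * h <= X by rewrite ler_pdivlMr// ler_piMr ?mulr_ge0// ltW.
have [k /andP[k1 k2]] : exists k : nat, (2 * X / rho <= k%:R) && (k%:R <= 2 * X / rho + 1).
  exists (Num.trunc (2 * X / rho)).+1.
  have h1 : (Num.trunc (2 * X / rho))%:R <= 2 * X / rho.
    rewrite truncn_le; apply: divr_ge0; last exact: ltW.
    by apply: mulr_ge0 => //; exact: ltW.
  have h2 := truncnS_gt (2 * X / rho).
  by rewrite ltW//= -natr1; clear -rho0 rhoh X0 Xa hX h1 h2; lra.
have Xk : X <= k%:R * (rho / 2).
  move: k1; rewrite ler_pdivrMr//; clear -rho0 rhoh X0 Xa hX k2; lra.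
have kX : k%:R * (rho / 2) <= X + rho / 2.
  have : k%:R * rho <= (2 * X / rho + 1) * rho by rewrite ler_wpM2r// ltW.
  rewrite mulrDl divfK ?gt_eqF//; clear -X0 Xa hX k1 k2 Xk; lra.
have ch : chain (deep W rho) (step (rho / 2)) (k + (k + k)) p q.
  apply: (@local_chain _ _ a r W b p q D rho (rho / 2) k a0 cW bb) => //.
  - by rewrite mulr_ge0.
  - by rewrite distrC; apply: le_trans bp _; rewrite /D; lra.
  - by have := ler_distD p q b; rewrite [`|p - b|]distrC -/h /D; clear -M1h bp Xk kX; lra.
  - apply: (@le_lt_trans _ _ (K * h)).
      have -> : K * h = 15 * h + X by rewrite /K /X; ring.
      by rewrite /D; rewrite /D in Xa; clear -eq0 rho0 rhoh X0 Xa hX k1; lra.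
    apply: (@lt_trans _ _ (K * t1)); first by rewrite ltr_pM2l.
    have -> : K * t1 = r / 2 by rewrite /t1; field; rewrite gt_eqF.
    by rewrite ltr_pdivrMr// ltr_pMr// ltr1n.
  - by apply: le_trans Xk; rewrite /D; lra.
  - exact: le_trans Xk.
apply: le_trans (zext_chain_lip rho0 ch) _.
have -> : (k + (k + k))%:R * (d%:R * B * (rho / 2)) = d%:R * B * (3 * (k%:R * (rho / 2))).
  by rewrite !natrD; ring.
apply: (@le_trans _ _ (M1 * h)); last lra.
rewrite /M1 -[leRHS]mulrA ler_wpM2l//.
have -> : (36 / a + 1) * h = 4 * X + h by rewrite /X; ring.
clear -rho0 rhoh hX k1 kX ch; lra.
Qed.

End zero_extension_lipschitz.

Section mean_bound.
Context {R : realType} {d : nat}.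
Local Notation mu := (lebesgue_rV R d).

Lemma mean_le (D : set 'rV[R]_d) (f : 'rV[R]_d -> R) (m M : R) : measurable D -> measurable_fun setT f ->
  (0 < mu D)%E -> (mu D < +oo)%E -> 0 <= M -> (forall y, D y -> `|f y - m| <= M) ->
  `|(fine (mu D))^-1 * \int[mu]_(y in D) f y - m| <= M.
Proof.
move=> mD mf D0 Doo M0 H.
have a0 : 0 < fine (mu D) by rewrite fine_gt0// D0.
have aE : mu D = (fine (mu D))%:E by rewrite fineK// ge0_fin_numE// ltW.
have := Jensen_sqr m mD mf D0 Doo; set X := _ - m => h.
have h2 : (\int[mu]_(x in D) ((f x - m) ^+ 2)%:E <= (M ^+ 2)%:E * mu D)%E.
  rewrite -(integral_cst mu mD (M ^+ 2)%:E); apply: le_integral_fin => //.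
  - by apply: measurable_funX; exact: measurable_funB.
  - by move=> x _; exact: sqr_ge0.
  - move=> x Dx; rewrite -[leLHS]real_normK ?num_real// lerXn2r ?nnegrE//; exact: H.
have i0 : (0 <= ((fine (mu D))^-1)%:E)%E by rewrite lee_fin invr_ge0 ltW.
have : ((X ^+ 2)%:E <= (M ^+ 2)%:E)%E.
  apply: le_trans h _; apply: le_trans (lee_wpmul2l i0 h2) _.
  by rewrite {2}aE -!EFinM lee_fin mulrCA mulVf ?mulr1// gt_eqF.
rewrite lee_fin -[X ^+ 2]real_normK ?num_real//; rewrite ler_pXn2r ?nnegrE//.
Qed.

End mean_bound.

Section candidate_gradient.
Context {R : realType} {d : nat}.

(** The weak gradient of [ext], written without differentiating [ext] itself, so that it makes sense
    when [f] is only an L^2 limit and [g] its weak gradient. *)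
Definition gext (eta : 'rV[R]_d -> R) W l c K Z f (g : 'I_d -> 'rV[R]_d -> R) j x : R :=
  if 0 < sg W l x then partial j (vavg eta (sg W l) (avgZ W l c K Z f)) x else g j x.

End candidate_gradient.

Section smooth_extension.
Context {R : realType} {d : nat}.
Local Notation mu := (lebesgue_rV R d).
Implicit Types (x y z q : 'rV[R]_d).
Variables (eta : 'rV[R]_d -> R).
Hypotheses (d0 : (0 < d)%N) (beta : bump eta) (eta0 : forall x, 0 <= eta x)
  (etapos : exists2 c, 0 < c & forall x, `|x| <= 2^-1 -> c <= eta x).
Variables (W U Z : set 'rV[R]_d) (phi : 'rV[R]_d -> R) (l c E r1 B M S tau rZ : R).
Hypotheses (oW : open W) (W0 : W !=set0) (l0 : 0 < l) (c0 : 0 < c) (E0 : 0 <= E) (mZ : measurable Z)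
  (HI : corkscrews c E W l) (sphi : smooth phi) (oU : open U) (UW : U `<=` W)
  (Ur : forall x, U x -> `|x| <= r1)
  (phiB : forall j x, U x -> `|partial j phi x| <= B) (B0 : 0 <= B)
  (M0 : 0 <= M) (fM : forall p q, W p -> W q -> `|zext phi U q - zext phi U p| <= M * `|q - p|)
  (S0 : 0 <= S) (fS : forall x, `|zext phi U x| <= S)
  (tau0 : 0 < tau) (Ztau : forall z y, ~ Z z -> `|y - z| < tau -> ~ U y)
  (Zr : forall z, Z z -> `|z| <= rZ)
  (foo : (\int[mu]_y (zext phi U y ^+ 2)%:E < +oo)%E).
Local Notation f := (zext phi U).
Local Notation s := (sg W l).
Local Notation A := (avgZ W l c (E + c) Z f).
Local Notation u := (ext eta W l c (E + c) Z f).

Let s0 x : 0 <= s x. Proof. exact/sg_ge0/ltW. Qed.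

Let mf : measurable_fun setT f.
Proof.
apply: measurable_funM; first exact: smooth_measurable.
by apply: measurable_indic; exact: open_measurable_rV.
Qed.

Let M2 := M * (3 / 2 * (E + c) + 2 + E) + S * (E + 2) / tau.

Lemma M2_ge0 : 0 <= M2.
Proof.
apply: addr_ge0; first by apply: mulr_ge0 => //; move: c0 E0; lra.
apply: divr_ge0; last exact: ltW.
by apply: mulr_ge0 => //; move: E0; lra.
Qed.

(** Either [A z] is a mean of values of [f] at points of [W] within
    [(3 / 2 * (E + c) + 2 + E) * s x] of [q], or [A z = 0] by the cut-off. In the latter case, if
    [q] is in [U], then [tau <= (E + 2) * s x], so that the crude bound [S] is itself of order
    [s x]. These are the two terms of [M2]. *)
Lemma avgZ_near x q z : 0 < s x -> W q -> `|q - x| <= E * s x -> ball x (2 * s x) z ->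
  `|A z - f q| <= M2 * s x.
Proof.
move=> sx Wq qx xz; have [h1 h2] := quarter_near (sg_lip W l) xz.
have zx : `|z - x| <= 2 * s x by move: xz; rewrite -ball_normE /= distrC => /ltW.
have sz : 0 < s z by lra.
have t1 : 0 <= M * (3 / 2 * (E + c) + 2 + E) * s x.
  apply: mulr_ge0 => //; apply: mulr_ge0 => //; by move: c0 E0; lra.
have t2 : 0 <= S * (E + 2) / tau * s x.
  apply: mulr_ge0 => //; apply: divr_ge0; last exact: ltW.
  by apply: mulr_ge0 => //; move: E0; lra.
have [Zz|Zz] := pselect (Z z); last first.
  rewrite avgZ_out// sub0r normrN; have [Uq|Uq] := pselect (U q); last first.
    by rewrite zext_out// normr0 mulr_ge0// M2_ge0.
  have : tau <= `|q - z| by rewrite leNgt; apply/negP => h; exact: (Ztau Zz h).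
  have := ler_distD x q z; rewrite [`|x - z|]distrC => h3 h4.
  have h5 : tau <= (E + 2) * s x by rewrite mulrDl; lra.
  apply: le_trans (fS q) _; rewrite /M2 mulrDl.
  have : S * tau <= S * ((E + 2) * s x) by rewrite ler_wpM2l.
  have -> : S * (E + 2) / tau * s x = S * ((E + 2) * s x) / tau by ring.
  by rewrite -ler_pdivlMr// => h6; lra.
have [q1 q1z dq1] := HI sz.
set D := Dset W l c (E + c) z.
have mD : measurable D by exact: measurable_Dset.
have cs : 0 < c * s z by rewrite mulr_gt0.
have Wn0 : ~` W !=set0 by exists z; apply: (sg_notin (ltW l0)).
have D0 : (0 < mu D)%E.
  apply: (@lt_le_trans _ _ (mu (ball q1 (c * s z)))).
    by rewrite [ltRHS](lebesgue_rV_ball q1 cs) lte_fin exprn_gt0// mulr2n addr_gt0.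
  by apply: le_measure; rewrite ?inE//; [exact: measurable_rV_ball|exact: Dset_ball].
have Doo : (mu D < +oo)%E by rewrite ltey; exact: Dset_lt.
have -> : A z = (fine (mu D))^-1 * \int[mu]_(y in D) f y.
  by rewrite /avgZ indicE mem_set// mul1r.
apply: mean_le => //; first by rewrite mulr_ge0// M2_ge0.
move=> y Dy; have Wy : W y by apply: (Dset_deep Dy); exact: ballxx.
apply: le_trans (fM Wq Wy) _; rewrite /M2 mulrDl -mulrA.
apply: (@le_trans _ _ (M * ((3 / 2 * (E + c) + 2 + E) * s x))); last lra.
rewrite ler_wpM2l//; case: Dy => yz _.
have : (E + c) * s z <= (E + c) * (3 / 2 * s x) by rewrite ler_wpM2l//; move: c0 E0; lra.
have h3 := ler_distD z y q; have h4 := ler_distD x z q; rewrite [`|x - q|]distrC in h4.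
lra.
Qed.

Lemma ext_near : exists2 C, 0 <= C & forall x q, 0 < s x -> W q -> `|q - x| <= E * s x ->
  `|u x - f q| <= C * s x /\ forall j, `|partial j (vavg eta s A) x| <= C.
Proof.
have [C C0 HC] := vavg_bound d0 beta eta0 etapos.
exists (C * M2); first by rewrite mulr_ge0 ?M2_ge0// ltW.
move=> x q sx Wq qx.
have [h1 h2] := HC _ s0 (sg_lip W l) _ (f q) _ x (measurable_avgZ W l c (E + c) mZ mf) sx
  (fun z => avgZ_near sx Wq qx).
split; first by rewrite /ext sx -mulrA.
by move=> j; have := h2 j; rewrite mulrA mulfK// gt_eqF.
Qed.

Let ucork x : 0 < s x -> exists2 q, W q & `|q - x| <= E * s x.
Proof.
move=> sx; have [q qx dq] := HI sx; exists q => //; apply: dq; apply: ballxx.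
by apply: mulr_gt0 => //; apply: mulr_gt0.
Qed.

Let uW x : W x -> u x = f x.
Proof. by move=> Wx; rewrite /ext sg_in// ?ltxx// ltW. Qed.

(** If the distance of two points is at most half the scale of one of them, the gradient is bounded
    along the segment. Otherwise each point off [W] is replaced by a point of [W] at a distance
    comparable with that of the pair, and the Lipschitz bound of [f] on [W] is used. *)
Lemma ext_lip_off : exists2 L, 0 <= L & lip_off (bnd W) L u.
Proof.
have [C C0 HC] := ext_near.
exists (d%:R * C + 4 * C + M * (4 * E + 1)).
  by rewrite !addr_ge0// mulr_ge0// addr_ge0// mulr_ge0.
have dC : 0 <= d%:R * C by rewrite mulr_ge0.
have ME : 0 <= M * (4 * E + 1) by rewrite mulr_ge0// addr_ge0// mulr_ge0.
have pos x : ~ bnd W x -> W x \/ 0 < s x.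
  move=> bx; have [sx|sx] := ltP 0 (s x); [by right|left].
  have : s x = 0 by apply/eqP; rewrite eq_le sx s0.
  by move=> /(sg_eq0 oW W0 l0)[].
have near x y : 0 < s x -> `|x - y| <= s x / 2 -> `|u x - u y| <= d%:R * C * `|x - y|.
  move=> sx xy.
  have seg t : 0 <= t <= 1 -> 0 < s (x + t *: (y - x)).
    move=> /andP[t0 t1]; have := sg_lip W l x (x + t *: (y - x)).
    rewrite opprD addNKr normrN normrZ ger0_norm// [`|y - x|]distrC ler_norml => /andP[_ h].
    have : t * `|x - y| <= `|x - y| by rewrite ler_piMl.
    by move: h; set a := s (x + _); set b := t * _; lra.
  have sy : 0 < s y.
    by have := seg 1; rewrite lexx ler01 scale1r [x + _]addrC subrK; apply.
  have -> : u x = vavg eta s A x by rewrite /ext sx.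
  have -> : u y = vavg eta s A (x + (y - x)) by rewrite [x + _]addrC subrK /ext sy.
  rewrite distrC [`|x - y|]distrC; apply: rV_lipschitz_le => [t /seg st|t j /seg st].
    exact: (differentiable_ext d0 beta eta0 etapos l0 c0 E0 mZ HI mf foo).
  by have [q Wq qx] := ucork st; have [_] := HC _ _ st Wq qx.
have far x y : 0 < s x -> s x / 2 < `|x - y| -> W y -> `|u x - u y| <= (2 * C + M * (2 * E + 1)) * `|x - y|.
  move=> sx xy Wy; have [q Wq qx] := ucork sx; have [h1 _] := HC _ _ sx Wq qx.
  rewrite (uW Wy); have h2 := fM Wy Wq; have h3 := ler_distD (f q) (u x) (f y).
  have h4 : C * s x <= C * (2 * `|x - y|) by rewrite ler_wpM2l//; lra.
  have h5 : `|q - y| <= (2 * E + 1) * `|x - y|.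
    have := ler_distD x q y; have : E * s x <= E * (2 * `|x - y|) by rewrite ler_wpM2l//; lra.
    lra.
  have h6 : M * `|q - y| <= M * ((2 * E + 1) * `|x - y|) by rewrite ler_wpM2l.
  lra.
have cmp k x y : 0 <= k -> k <= d%:R * C + 4 * C + M * (4 * E + 1) ->
    `|u x - u y| <= k * `|x - y| -> `|u x - u y| <= (d%:R * C + 4 * C + M * (4 * E + 1)) * `|x - y|.
  by move=> k0 kl h; apply: le_trans h _; rewrite ler_wpM2r.
have kfar : 2 * C + M * (2 * E + 1) <= d%:R * C + 4 * C + M * (4 * E + 1).
  have : M * (2 * E + 1) <= M * (4 * E + 1) by rewrite ler_wpM2l//; move: E0; lra.
  lra.
have kfar0 : 0 <= 2 * C + M * (2 * E + 1) by rewrite addr_ge0 ?mulr_ge0// addr_ge0// mulr_ge0.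
move=> x y /pos[Wx|sx] /pos[Wy|sy].
- rewrite (uW Wx) (uW Wy); apply: le_trans (fM Wy Wx) _; rewrite ler_wpM2r//.
  have : M * 1 <= M * (4 * E + 1) by rewrite ler_wpM2l// lerDr mulr_ge0.
  lra.
- have [h|h] := leP `|y - x| (s y / 2).
    rewrite distrC [`|x - y|]distrC; apply: (cmp (d%:R * C)) => //; [lra|exact: near].
  by rewrite distrC [`|x - y|]distrC; apply: (cmp (2 * C + M * (2 * E + 1))) => //; exact: far.
- have [h|h] := leP `|x - y| (s x / 2).
    apply: (cmp (d%:R * C)) => //; [lra|exact: near].
  by apply: (cmp (2 * C + M * (2 * E + 1))) => //; exact: far.
- have [h|h] := leP `|x - y| (s x / 2).
    apply: (cmp (d%:R * C)) => //; [lra|exact: near].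
  have [h'|h'] := leP `|y - x| (s y / 2).
    rewrite distrC [`|x - y|]distrC; apply: (cmp (d%:R * C)) => //; [lra|exact: near].
  rewrite [`|y - x|]distrC in h'.
  have [q Wq qx] := ucork sx; have [h1 _] := HC _ _ sx Wq qx.
  have [p Wp py] := ucork sy; have [h2 _] := HC _ _ sy Wp py.
  have h3 := ler_distD (f q) (u x) (u y); have h4 := ler_distD (f p) (f q) (u y).
  rewrite [`|f p - u y|]distrC in h4; have h5 := fM Wp Wq.
  have h6 : C * s x <= C * (2 * `|x - y|) by rewrite ler_wpM2l//; lra.
  have h7 : C * s y <= C * (2 * `|x - y|) by rewrite ler_wpM2l//; lra.
  have h8 : `|q - p| <= (4 * E + 1) * `|x - y|.
    have := ler_distD x q p; have := ler_distD y x p; rewrite [`|y - p|]distrC.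
    have : E * s x <= E * (2 * `|x - y|) by rewrite ler_wpM2l//; lra.
    have : E * s y <= E * (2 * `|x - y|) by rewrite ler_wpM2l//; lra.
    lra.
  have h9 : M * `|q - p| <= M * ((4 * E + 1) * `|x - y|) by rewrite ler_wpM2l.
  have : 0 <= d%:R * C * `|x - y| by rewrite mulr_ge0.
  lra.
Qed.

Local Notation Gu := (gext eta W l c (E + c) Z f (fun j => zext (partial j phi) U)).

Let cases x : ~ (bnd W `|` bnd U) x ->
  [\/ 0 < s x, U x | W x /\ exists2 P, open P & P x /\ forall y, P y -> ~ U y].
Proof.
move=> Nx; have Wx : ~ bnd W x by move=> h; apply: Nx; left.
have Ux : ~ bnd U x by move=> h; apply: Nx; right.
have [sx|sx] := ltP 0 (s x); first by constructor 1.
have [xU|xU] := pselect (U x); first by constructor 2.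
have sx0 : s x = 0 by apply/eqP; rewrite eq_le sx s0.
constructor 3; split; first by have [] := sg_eq0 oW W0 l0 sx0.
exists (~` closure U); first by apply: closed_openC; exact: closed_closure.
split; last by move=> y cy Uy; apply: cy; exact: subset_closure.
by move=> cx; apply: Ux; split => //; rewrite (_ : U° = U)//; exact/interior_id.
Qed.

Let nearF x : 0 < s x -> nbhs x [set y | 0 < s y].
Proof. by move=> sx; apply: open_nbhs_nbhs; split => //; exact: open_sg. Qed.

Lemma ext_derivative j x : ~ (bnd W `|` bnd U) x ->
  derivable u x (delta_mx 0 j) /\ 'D_(delta_mx 0 j) u x = Gu j x.
Proof.
move=> /cases[sx|Ux|[Wx [P oP [Px PU]]]].
- have e : \forall y \near x, vavg eta s A y = u y.
    by apply: filterS (nearF sx) => y /= sy; rewrite /ext sy.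
  have dv : derivable (vavg eta s A) x (delta_mx 0 j).
    by apply: diff_derivable; exact: (differentiable_ext d0 beta eta0 etapos l0 c0 E0 mZ HI mf foo).
  split; first exact: near_eq_derivable e dv.
  by rewrite -(near_eq_derive _ e) /gext sx.
- have Wx := UW Ux.
  have e : \forall y \near x, phi y = u y.
    have nU : nbhs x U by exact: open_nbhs_nbhs.
    by apply: filterS nU => y Uy; rewrite uW ?zext_in//; exact: UW.
  have dv : derivable phi x (delta_mx 0 j) by apply: diff_derivable; exact: (sphi [::]).
  split; first exact: near_eq_derivable e dv.
  by rewrite -(near_eq_derive _ e) /gext sg_in ?ltxx ?(ltW l0)// zext_in.
- have e : \forall y \near x, cst 0 y = u y.
    have nP : nbhs x P by exact: open_nbhs_nbhs.
    have nW : nbhs x W by exact: open_nbhs_nbhs.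
    by apply: (@filterS2 _ (nbhs x) _ _ _ _ _ nP nW) => y Py Wy; rewrite uW// zext_out//; exact: PU.
  split; first by apply: near_eq_derivable e _; exact: derivable_cst.
  rewrite -(near_eq_derive _ e) derive_cst /gext sg_in ?ltxx ?(ltW l0)// zext_out//.
  exact: PU.
Qed.

Lemma gext_continuous j x : ~ (bnd W `|` bnd U) x -> {for x, continuous (Gu j)}.
Proof.
have eqc (h k : 'rV[R]_d -> R) : (\forall y \near x, h y = k y) -> {for x, continuous h} -> {for x, continuous k}.
  move=> e ch; have ex := nbhs_singleton e.
  move=> B' /= nB; have hB : nbhs x (h @^-1` B') by apply: ch; rewrite ex.
  by apply: (@filterS2 _ (nbhs x) _ _ _ _ _ e hB) => y /= <-.
move=> /cases[sx|Ux|[Wx [P oP [Px PU]]]].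
- apply: (eqc (partial j (vavg eta s A))).
    by apply: filterS (nearF sx) => y /= sy; rewrite /gext sy.
  exact: (continuous_partial_ext d0 beta eta0 etapos l0 c0 E0 mZ HI mf foo).
- apply: (eqc (partial j phi)); last by apply: smooth_continuous; exact: smooth_partial.
  have nU : nbhs x U by exact: open_nbhs_nbhs.
  apply: filterS nU => y Uy; rewrite /gext sg_in ?ltxx ?(ltW l0) ?zext_in//; exact: UW.
- apply: (eqc (cst 0)); last exact: cst_continuous.
  have nP : nbhs x P by exact: open_nbhs_nbhs.
  have nW : nbhs x W by exact: open_nbhs_nbhs.
  apply: (@filterS2 _ (nbhs x) _ _ _ _ _ nP nW) => y Py Wy.
  by rewrite /gext sg_in ?ltxx ?(ltW l0)// zext_out//; exact: PU.
Qed.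

Lemma ext_bounded : exists L, (forall x, `|u x| <= L) /\ forall j x, `|Gu j x| <= L.
Proof.
have [C C0 HC] := ext_near.
exists (S + C * l + (C + B)).
have Cl : 0 <= C * l by rewrite mulr_ge0// ltW.
split=> [x|j x].
  have [sx|sx] := ltP 0 (s x); last first.
    by rewrite /ext ltNge sx/=; have := fS x; move: B0; lra.
  have [q Wq qx] := ucork sx; have [h1 _] := HC _ _ sx Wq qx.
  have h2 : C * s x <= C * l.
    by rewrite ler_wpM2l//; have := sg_le W l x; move: l0; lra.
  have := ler_normD (u x - f q) (f q); rewrite subrK; have := fS q; move: B0; lra.
rewrite /gext; case: ifPn => [sx|_].
  by have [q Wq qx] := ucork sx; have [_ /(_ j)] := HC _ _ sx Wq qx; move: B0 S0; lra.
have [Ux|Ux] := pselect (U x); last by rewrite zext_out// normr0 !addr_ge0.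
by rewrite zext_in//; have := phiB j Ux; move: S0; lra.
Qed.

Lemma ext_support x : (forall z, `|z - x| < l -> ~ Z z) -> ~ U x -> u x = 0 /\ forall j, Gu j x = 0.
Proof.
move=> Zx Ux; have [sx|sx] := ltP 0 (s x); last first.
  by rewrite /ext /gext ltNge sx/=; split => [|j]; rewrite /gext ?ltNge ?sx zext_out.
have Zx' z : ball x (2 * s x) z -> ~ Z z.
  rewrite -ball_normE /= => xz; apply: Zx; rewrite distrC; apply: lt_le_trans xz _.
  by have := sg_le W l x; move: l0; lra.
have [h1 h2] := ext_off d0 beta eta0 etapos c E l0 mZ mf sx Zx'.
by split => [|j]; rewrite /ext /gext sx.
Qed.

End smooth_extension.

(** * Test functions and limits *)

Section test_functions.
Context {R : realType} {n : nat}.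
Local Notation mu := (lebesgue_rV R n).
Implicit Types (U : set 'rV[R]_n) (f u g psi a b : 'rV[R]_n -> R) (x : 'rV[R]_n) (j : 'I_n).

Lemma test_fun_off U f x j : test_fun U f -> ~ U x -> f x = 0 /\ partial j f x = 0.
Proof.
move=> [_ _ sU] Ux; have nx : ~ closure [set y | f y != 0] x by move=> /sU.
split; first by apply/eqP/negP => /negP fx; apply: nx; exact: subset_closure.
apply: (@near0_partial _ _ _ _ (~` closure [set y | f y != 0])) => //.
  by apply: closed_openC; exact: closed_closure.
by move=> y cy; apply/eqP/negP => /negP fy; apply: cy; exact: subset_closure.
Qed.

Lemma test_fun_bounds U f : test_fun U f -> exists r M : R, [/\ 0 < r, 0 <= M,
  forall x, ~ ball 0 r x -> f x = 0, forall x j, ~ ball 0 r x -> partial j f x = 0 &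
  (forall x, `|f x| <= M) /\ (forall x j, `|partial j f x| <= M)].
Proof.
move=> tf; have [sf cf sU] := tf.
have [r0 [_ Hr]] := compact_bounded cf.
pose r := `|r0| + 2; have r2 : 0 < r by rewrite /r; have := normr_ge0 r0; lra.
have rr : r0 < `|r0| + 1 by have := ler_norm r0; lra.
have supp x : ~ ball 0 r x -> ~ closure [set y | f y != 0] x.
  rewrite -ball_normE /= sub0r normrN => xr cx; apply: xr.
  by apply: le_lt_trans (Hr _ rr x cx) _; rewrite /r; lra.
have tf' : test_fun (ball 0 r) f by split => // x cx; apply: contrapT => /supp.
have [M0 HM0] := continuous_bounded_ball 0 r (smooth_continuous sf).
have /choice[Mj HMj] : forall j, exists M, forall z, `|z - 0| <= r -> `|partial j f z| <= M.
  by move=> j; apply: continuous_bounded_ball; apply: smooth_continuous; exact: smooth_partial.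
exists r, (`|M0| + \sum_j `|Mj j|).
have S0 : 0 <= \sum_j `|Mj j| by apply: sumr_ge0.
have bin x : ball 0 r x -> `|x - 0| <= r by rewrite -ball_normE /= distrC => /ltW.
split => //; first by rewrite addr_ge0.
- by move=> x xr; apply/eqP/negP => /negP fx; apply: (supp x xr); exact: subset_closure.
- by move=> x j /(test_fun_off j tf')[].
split=> [x|x j].
  have [xr|xr] := pselect (ball 0 r x).
    by apply: le_trans (HM0 _ (bin _ xr)) _; have := ler_norm M0; lra.
  have -> : f x = 0 by apply/eqP/negP => /negP fx; apply: (supp x xr); exact: subset_closure.
  by rewrite normr0 addr_ge0.
have [xr|xr] := pselect (ball 0 r x); last first.
  by have [_ ->] := test_fun_off j tf' xr; rewrite normr0 addr_ge0.
apply: le_trans (HMj j _ (bin _ xr)) _; apply: le_trans (ler_norm _) _.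
by rewrite (bigD1 j)//= addrCA lerDl addr_ge0// sumr_ge0.
Qed.

Lemma test_fun_lip U f : test_fun U f -> exists2 M : R, 0 <= M & forall x y, `|f x - f y| <= M * `|x - y|.
Proof.
move=> tf; have [r [M [r0 M0 _ _ [_ fM]]]] := test_fun_bounds tf; have [sf _ _] := tf.
exists (n%:R * M); first by rewrite mulr_ge0.
move=> x y; have -> : f x = f (y + (x - y)) by rewrite [y + _]addrC subrK.
apply: rV_lipschitz_le => [t _|t j _]; last exact: fM.
exact: (sf [::]).
Qed.

Lemma test_fun_parts U V f psi j : test_fun U f -> test_fun V psi ->
  \int[mu]_x (psi x * partial j f x) = - \int[mu]_x (partial j psi x * f x).
Proof.
move=> tf tp; have [sf _ _] := tf; have [sp _ _] := tp.
have [rf [Mf [_ Mf0 _ _ [fM dfM]]]] := test_fun_bounds tf.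
have [rp [Mp [rp0 Mp0 p0 dp0 [pM dpM]]]] := test_fun_bounds tp.
have [Lf Lf0 fL] := test_fun_lip tf; have [Lp Lp0 pL] := test_fun_lip tp.
have m g : smooth g -> measurable_fun setT g by exact: smooth_measurable.
have MM : Mf <= Mf + Lf /\ Lf <= Mf + Lf by split; lra.
apply: (@weak_derivative_lip _ _ psi f (partial j psi) (partial j f) set0 0 rp Lp Mp (Mf + Lf) j) => //.
- exact: m.
- exact: m.
- by apply: m; exact: smooth_partial.
- by apply: m; exact: smooth_partial.
- move=> x _; split => //; apply: diff_derivable; exact: (sp [::]).
- by move=> x; apply: le_trans (fM x) _; lra.
- by move=> x y; apply: le_trans (fL x y) _; rewrite ler_wpM2r//; lra.
- move=> x; split => //; apply: diff_derivable; exact: (sf [::]).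
Qed.

(** Young's inequality [|a b| <= a^2 / e + e b^2] takes the place of Cauchy-Schwarz and gives
    integrability at the same time. *)
Lemma prod_integral_le a b (e c : R) : measurable_fun setT a -> measurable_fun setT b -> 0 < e ->
  (\int[mu]_x (a x ^+ 2)%:E <= (e ^+ 2)%:E)%E -> (\int[mu]_x (b x ^+ 2)%:E <= c%:E)%E ->
  mu.-integrable setT (EFin \o (fun x => a x * b x)) /\ `|\int[mu]_x (a x * b x)| <= e * (1 + c).
Proof.
move=> ma mb e0 ha hb.
have ma2 : measurable_fun setT (fun x => a x ^+ 2) by exact: measurable_funX.
have mb2 : measurable_fun setT (fun x => b x ^+ 2) by exact: measurable_funX.
have mab : measurable_fun setT (fun x => a x * b x) by exact: measurable_funM.
have c0 : 0 <= c by rewrite -lee_fin; apply: le_trans hb; apply: integral_fin_ge0 => x; exact: sqr_ge0.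
have ei0 : 0 <= e^-1 by rewrite invr_ge0 ltW.
have key : (\int[mu]_x `|(a x * b x)%:E| <= (e * (1 + c))%:E)%E.
  apply: (@le_trans _ _ (\int[mu]_x (e^-1 * a x ^+ 2 + e * b x ^+ 2)%:E)%E).
    apply: le_integral_fin => //.
    - exact: measurableT_comp.
    - by apply: measurable_funD; apply: measurable_funM.
    - move=> x _; have h := sqr_ge0 (`|a x| - e * `|b x|).
      have h2 : 2 * (e * (`|a x| * `|b x|)) <= `|a x| ^+ 2 + e ^+ 2 * `|b x| ^+ 2.
        by move: h; rewrite sqrrB exprMn; lra.
      rewrite normrM -[a x ^+ 2]real_normK ?num_real// -[b x ^+ 2]real_normK ?num_real//.
      have ab0 : 0 <= `|a x| * `|b x| by rewrite mulr_ge0.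
      have eq1 : e * (e^-1 * `|a x| ^+ 2) = `|a x| ^+ 2 by rewrite mulrA mulfV ?mul1r// gt_eqF.
      have eq2 : e * (e * `|b x| ^+ 2) = e ^+ 2 * `|b x| ^+ 2 by rewrite mulrA -expr2.
      have p0 : 0 <= e * (`|a x| * `|b x|) by apply: mulr_ge0 => //; exact: ltW.
      rewrite -(ler_pM2l e0) mulrDr eq1 eq2.
      lra.
  rewrite integral_finD//; first last.
  - by move=> x; rewrite mulr_ge0 ?sqr_ge0// ltW.
  - by move=> x; rewrite mulr_ge0 ?sqr_ge0.
  - exact: measurable_funM.
  - exact: measurable_funM.
  rewrite integral_finZ//; last by move=> x; exact: sqr_ge0.
  rewrite integral_finZ ?(ltW e0)//; last by move=> x; exact: sqr_ge0.
  apply: (@le_trans _ _ ((e^-1)%:E * (e ^+ 2)%:E + e%:E * c%:E)%E).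
    by apply: leeD; apply: lee_wpmul2l; rewrite ?lee_fin// ltW.
  rewrite -!EFinM -EFinD lee_fin expr2 mulrA mulVf ?gt_eqF// mul1r mulrDr mulr1//.
have iab : mu.-integrable setT (EFin \o (fun x => a x * b x)).
  by apply/integrableP; split; [exact/measurable_EFinP|apply: le_lt_trans key _; rewrite ltry].
split => //; apply: le_trans (le_normr_Rintegral _ iab) _ => //.
rewrite -lee_fin fineK//; apply: integrable_fin_num => //.
exact: (integrable_norm iab).
Qed.

Lemma test_fun_sqr_integrable U f : test_fun U f -> exists c : R,
  (\int[mu]_x (f x ^+ 2)%:E <= c%:E)%E /\ forall j, (\int[mu]_x (partial j f x ^+ 2)%:E <= c%:E)%E.
Proof.
move=> tf; have [r [M [r0 M0 f0 df0 [fM dfM]]]] := test_fun_bounds tf; have [sf _ _] := tf.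
exists (M ^+ 2 * (r *+ 2) ^+ n).
have aux g : measurable_fun setT g -> (forall x, ~ ball 0 r x -> g x = 0) -> (forall x, `|g x| <= M) ->
    (\int[mu]_x (g x ^+ 2)%:E <= (M ^+ 2 * (r *+ 2) ^+ n)%:E)%E.
  move=> mg g0 gM.
  have := @le_integral_supp R n (fun x => g x ^+ 2) 0 r (M ^+ 2) r0.
  have -> : (\int[mu]_x `|g x ^+ 2|%:E = \int[mu]_x (g x ^+ 2)%:E)%E.
    by apply: eq_integral => x _; rewrite ger0_norm ?sqr_ge0.
  apply=> [|z _|z /g0 ->]; [exact: measurable_funX| |by rewrite expr0n].
  by rewrite normrX lerXn2r ?nnegrE.
split=> [|j]; apply: aux => //.
- exact: smooth_measurable.
- by apply: smooth_measurable; exact: smooth_partial.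
- by move=> x /df0.
Qed.

(** Integration by parts holds for the approximating test functions; the errors are of order [e]
    when the squared L^2 distances are at most [e ^+ 2]. *)
Lemma weak_derivative_limit U V u g f j : test_fun V f -> measurable_fun setT u -> measurable_fun setT g ->
  (forall e : R, 0 < e -> exists psi, [/\ test_fun U psi,
     (\int[mu]_x ((u x - psi x) ^+ 2)%:E <= e%:E)%E &
     (\int[mu]_x ((g x - partial j psi x) ^+ 2)%:E <= e%:E)%E]) ->
  \int[mu]_x (u x * partial j f x) = - \int[mu]_x (g x * f x).
Proof.
move=> tf mu_ mg H; have [c [fc dfc]] := test_fun_sqr_integrable tf; have [sf _ _] := tf.
have mf := smooth_measurable sf; have mdf := smooth_measurable (smooth_partial j sf).
have c0 : 0 <= c by rewrite -lee_fin; apply: le_trans fc; apply: integral_fin_ge0 => x; exact: sqr_ge0.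
suff key (e : R) : 0 < e -> `|\int[mu]_x (u x * partial j f x) + \int[mu]_x (g x * f x)| <= e * (2 * (1 + c)).
  apply/eqP; rewrite -addr_eq0 -normr_eq0 eq_le normr_ge0 andbT.
  have k0 : 0 < 2 * (1 + c) by lra.
  apply/ler_addgt0Pr => e e0; rewrite add0r.
  by have := key (e / (2 * (1 + c))) (divr_gt0 e0 k0); rewrite divfK// gt_eqF.
move=> e0; have [psi [tp hu hg]] := H (e ^+ 2) (exprn_gt0 2 e0).
have [sp _ _] := tp; have mp := smooth_measurable sp; have mdp := smooth_measurable (smooth_partial j sp).
have [i1 b1] := prod_integral_le (measurable_funB mu_ mp) mdf e0 hu (dfc j).
have [i2 b2] := prod_integral_le (measurable_funB mg mdp) mf e0 hg fc.
have parts := test_fun_parts j tf tp.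
have [cp [pc dpc]] := test_fun_sqr_integrable tp.
have cp0 : 0 <= cp by rewrite -lee_fin; apply: le_trans pc; apply: integral_fin_ge0 => x; exact: sqr_ge0.
have cle : cp <= (1 + cp) ^+ 2 by rewrite sqrrD expr1n; have := sqr_ge0 cp; lra.
have cleE : (cp%:E <= ((1 + cp) ^+ 2)%:E)%E by rewrite lee_fin.
have [i3 _] := @prod_integral_le psi (partial j f) (1 + cp) c mp mdf (ltr_wpDr cp0 ltr01)
  (le_trans pc cleE) (dfc j).
have [i4 _] := @prod_integral_le (partial j psi) f (1 + cp) c mdp mf (ltr_wpDr cp0 ltr01)
  (le_trans (dpc j) cleE) fc.
have e1 : \int[mu]_x (u x * partial j f x) =
    \int[mu]_x ((u x - psi x) * partial j f x) + \int[mu]_x (psi x * partial j f x).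
  by rewrite -RintegralD//; apply: eq_Rintegral => x _; rewrite -mulrDl subrK.
have e2 : \int[mu]_x (g x * f x) =
    \int[mu]_x ((g x - partial j psi x) * f x) + \int[mu]_x (partial j psi x * f x).
  by rewrite -RintegralD//; apply: eq_Rintegral => x _; rewrite -mulrDl subrK.
rewrite e1 e2 parts addrACA addNr addr0; apply: le_trans (ler_normD _ _) _.
by move: b1 b2; rewrite /=; lra.
Qed.

End test_functions.

(** * Limits of smooth functions vanishing on the outer part of the boundary *)

Section approximable_pairs.
Context {R : realType} {d : nat}.
Local Notation mu := (lebesgue_rV R d).
Implicit Types (W Om U : set 'rV[R]_d) (f phi psi h : 'rV[R]_d -> R) (G H : 'I_d -> 'rV[R]_d -> R)
  (x y z : 'rV[R]_d) (j : 'I_d).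

Lemma smooth_lin (a : R) f h : smooth f -> smooth h -> smooth (fun x => a * f x + h x).
Proof.
move=> sf sh; apply/Cn_smooth => k; apply: (@CnD _ _ k (fun x => a * f x)).
  by move/Cn_smooth: (smoothZ a sf).
by move/Cn_smooth: sh.
Qed.

Lemma partial_lin (a : R) f h j x : differentiable f x -> differentiable h x ->
  partial j (fun x => a * f x + h x) x = a * partial j f x + partial j h x.
Proof.
move=> sf sh; rewrite /partial.
have df := @diff_derivable _ _ _ _ _ (delta_mx 0 j) sf.
have dh := @diff_derivable _ _ _ _ _ (delta_mx 0 j) sh.
rewrite (_ : (fun _ => _) = (a *: f) + h); last by apply/funext.
by rewrite (deriveD (derivableZ df) dh) deriveZ.
Qed.

Lemma zext_lin (a : R) f h U x : zext (fun x => a * f x + h x) U x = a * zext f U x + zext h U x.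
Proof. by rewrite /zext mulrDl mulrA. Qed.

Lemma measurable_zext f U : smooth f -> open U -> measurable_fun setT (zext f U).
Proof.
move=> sf oU; apply: measurable_funM; first exact: smooth_measurable.
by apply: measurable_indic; exact: open_measurable_rV.
Qed.

Lemma sqr_sub_le (a b : R) : (a + b) ^+ 2 <= 2 * a ^+ 2 + 2 * b ^+ 2.
Proof. by have := sqr_ge0 (a - b); rewrite sqrrB sqrrD; lra. Qed.

Lemma integral_sqr_sub_le f h : measurable_fun setT f -> measurable_fun setT h ->
  (\int[mu]_x (f x ^+ 2)%:E <= 2%:E * \int[mu]_x ((f x - h x) ^+ 2)%:E + 2%:E * \int[mu]_x (h x ^+ 2)%:E)%E.
Proof.
move=> mf mh.
have m1 : measurable_fun setT (fun x => (f x - h x) ^+ 2) by apply: measurable_funX; exact: measurable_funB.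
have m2 : measurable_fun setT (fun x => h x ^+ 2) by exact: measurable_funX.
rewrite -integral_finZ//; last by move=> x; exact: sqr_ge0.
rewrite -integral_finZ//; last by move=> x; exact: sqr_ge0.
rewrite -integral_finD//; first last.
- by move=> x; rewrite mulr_ge0 ?sqr_ge0.
- by move=> x; rewrite mulr_ge0 ?sqr_ge0.
- exact: measurable_funM.
- exact: measurable_funM.
apply: le_integral_fin => //.
- exact: measurable_funX.
- by apply: measurable_funD; apply: measurable_funM.
- by move=> x _; exact: sqr_ge0.
- by move=> x _; have := sqr_sub_le (f x - h x) (h x); rewrite subrK.
Qed.

Variables (W Om : set 'rV[R]_d).
Hypotheses (oW : open W) (oO : open Om).
Local Notation U := (Om `&` W).

Let oU : open U. Proof. exact: openI. Qed.

Lemma bnd_setI : bnd U `<=` bnd Om `|` bnd W.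
Proof.
move=> x bx; have nx := bnd_notin oU bx; case: bx => cx _.
have [cO cW] : closure Om x /\ closure W x.
  by split => A nA; have [y [[Oy Wy] Ay]] := cx A nA; exists y.
have nb A : open A -> closure A x -> ~ A x -> bnd A x.
  by move=> oA cA Ax; split => //; rewrite (_ : A° = A)//; exact/interior_id.
have [Ox|Ox] := pselect (Om x); last by left; exact: nb.
by right; apply: nb => // Wx; exact: nx.
Qed.

(** This is why vanishing on Gamma_eps is the right condition: the part of the boundary of [U] on
    the holes is not in the open set [W], hence is not met by segments inside [W]. *)
Lemma bnd_setI_in x : W x -> bnd U x -> bnd Om x.
Proof. by move=> Wx /bnd_setI[//|/(bnd_notin oW)]. Qed.

Definition admissible phi := smooth phi /\ forall x, bnd U x -> bnd Om x -> phi x = 0.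

Lemma admissible_lin (a : R) f h : admissible f -> admissible h -> admissible (fun x => a * f x + h x).
Proof.
move=> [sf f0] [sh h0]; split; first exact: smooth_lin.
by move=> x bU bO; rewrite f0// h0// mulr0 addr0.
Qed.

(** A component of a field of [H1_vanishing] and its weak gradient, extended by 0 to the whole
    space, where translations and Tonelli's theorem can be used. *)
Definition approximable f G := [/\ measurable_fun setT f, forall j, measurable_fun setT (G j),
  forall x, ~ U x -> f x = 0,
  (\int[mu]_x (f x ^+ 2)%:E < +oo)%E /\ forall j, (\int[mu]_x (G j x ^+ 2)%:E < +oo)%E &
  forall e : R, 0 < e -> exists phi, [/\ admissible phi,
    (\int[mu]_x ((f x - zext phi U x) ^+ 2)%:E <= e%:E)%E &
    forall j, (\int[mu]_x ((G j x - zext (partial j phi) U x) ^+ 2)%:E <= e%:E)%E]].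

Lemma sqr_integrable_sub f h (e : R) : measurable_fun setT f -> measurable_fun setT h ->
  (\int[mu]_x (f x ^+ 2)%:E < +oo)%E -> (\int[mu]_x ((f x - h x) ^+ 2)%:E <= e%:E)%E ->
  (\int[mu]_x (h x ^+ 2)%:E < +oo)%E.
Proof.
move=> mf mh foo he; apply: le_lt_trans (integral_sqr_sub_le mh mf) _.
have -> : (\int[mu]_x ((h x - f x) ^+ 2)%:E = \int[mu]_x ((f x - h x) ^+ 2)%:E)%E.
  by apply: eq_integral => x _; rewrite -sqrrN opprB.
rewrite lte_add_pinfty// lte_mul_pinfty//; apply: le_lt_trans he _; exact: ltry.
Qed.

Lemma approximable_sub f G phi (e : R) : approximable f G -> admissible phi ->
  (\int[mu]_x ((f x - zext phi U x) ^+ 2)%:E <= e%:E)%E ->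
  (forall j, (\int[mu]_x ((G j x - zext (partial j phi) U x) ^+ 2)%:E <= e%:E)%E) ->
  approximable (fun x => f x - zext phi U x) (fun j x => G j x - zext (partial j phi) U x).
Proof.
move=> [mf mG f0 [foo Goo] H] aphi hf hG; have [sphi _] := aphi.
split.
- by apply: measurable_funB => //; exact: measurable_zext.
- by move=> j; apply: measurable_funB => //; apply: measurable_zext => //; exact: smooth_partial.
- by move=> x Ux; rewrite f0// zext_out// subrr.
- by split=> [|j]; [apply: le_lt_trans hf _|apply: le_lt_trans (hG j) _]; exact: ltry.
move=> r r0; have [psi [apsi h1 h2]] := H r r0; have [spsi _] := apsi.
exists (fun x => -1 * phi x + psi x); split; first exact: admissible_lin.
  rewrite (eq_integral (fun x => ((f x - zext psi U x) ^+ 2)%:E))// => x _.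
  by rewrite zext_lin mulN1r opprD opprK addrACA [_ + (_ - _)]addrC; congr (_ ^+ 2)%:E; lra.
move=> j; rewrite (eq_integral (fun x => ((G j x - zext (partial j psi) U x) ^+ 2)%:E))// => x _.
rewrite (_ : partial j (fun x => -1 * phi x + psi x) = fun x => -1 * partial j phi x + partial j psi x); last first.
  by apply/funext => y; apply: partial_lin; [exact: (sphi [::])|exact: (spsi [::])].
by rewrite zext_lin; congr (_ ^+ 2)%:E; lra.
Qed.

Lemma admissible_transl phi : admissible phi -> transl_le W (4 * d%:R) (zext phi U) (zgrad phi U).
Proof.
move=> [sphi phi0]; apply: transl_smooth => // x Wx bx; apply: phi0 => //.
exact: bnd_setI_in.
Qed.

Lemma zgradE phi x : zgrad phi U x = \sum_j zext (partial j phi) U x ^+ 2.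
Proof.
rewrite /zgrad mulr_suml; apply: eq_bigr => j _.
by rewrite /zext exprMn indicE; case: (_ \in _); rewrite ?expr1n ?expr0n.
Qed.

Lemma integral_sum_sqr H : (forall j, measurable_fun setT (H j)) ->
  (\int[mu]_x (\sum_j H j x ^+ 2)%:E = \sum_j \int[mu]_x (H j x ^+ 2)%:E)%E.
Proof.
move=> mH; under eq_integral do rewrite -sumEFin.
rewrite ge0_integral_sum// => [j|j x _]; last by rewrite lee_fin sqr_ge0.
by apply/measurable_EFinP; exact: measurable_funX.
Qed.

(** The inner factor [4 * d] is that of smooth functions, the outer 4 that of the passage to the
    limit, with [h] the squared error of the gradients. *)
Lemma approximable_transl f G : approximable f G ->
  transl_le W (4 * (4 * d%:R)) f (fun x => \sum_j G j x ^+ 2).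
Proof.
move=> [mf mG f0 [foo Goo] H]; apply: transl_limit => //.
- by apply: measurable_sum => j; exact: measurable_funX.
- by move=> x; apply: sumr_ge0 => j _; exact: sqr_ge0.
move=> e e0; have dp : (0 : R) < d.+1%:R by [].
have [phi [aphi h1 h2]] := H (e / d.+1%:R) (divr_gt0 e0 dp); have [sphi _] := aphi.
have mz j : measurable_fun setT (zext (partial j phi) U).
  by apply: measurable_zext => //; exact: smooth_partial.
exists (zext phi U), (zgrad phi U), (fun x => \sum_j (G j x - zext (partial j phi) U x) ^+ 2); split.
- exact: measurable_zext.
- exact: measurable_zgrad.
- by apply: measurable_sum => j; apply: measurable_funX; exact: measurable_funB.
- split; last exact: admissible_transl.
  + by move=> x; exact: zgrad_ge0.
  + by move=> x; apply: sumr_ge0 => j _; exact: sqr_ge0.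
  + move=> x; rewrite zgradE !mulr_sumr -big_split/=; apply: ler_sum => j _.
    have := sqr_sub_le (G j x) (zext (partial j phi) U x - G j x).
    by rewrite [G j x + _]addrC subrK -[in leRHS](sqrrN (_ - G j x)) opprB.
- split; first by apply: le_trans h1 _; rewrite lee_fin ler_pdivrMr// ler_peMr ?(ltW e0)// ler1n.
  rewrite (integral_sum_sqr (fun j => measurable_funB (mG j) (mz j))).
  apply: (@le_trans _ _ (\sum_(j < d) (e / d.+1%:R)%:E)%E); first by apply: lee_sum => j _; exact: h2.
  rewrite sumEFin lee_fin sumr_const card_ord -(mulr_natr (e / d.+1%:R) d) -mulrA ger_pMr//.
  by rewrite mulrC ler_pdivrMr// mul1r ler_nat.
Qed.

End approximable_pairs.

Section extension_approximation.
Context {R : realType} {d : nat}.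
Local Notation mu := (lebesgue_rV R d).
Implicit Types (f phi psi h : 'rV[R]_d -> R) (G H : 'I_d -> 'rV[R]_d -> R) (x y z : 'rV[R]_d) (j : 'I_d).
Variables (eta : 'rV[R]_d -> R).
Hypotheses (d0 : (0 < d)%N) (beta : bump eta) (eta0 : forall x, 0 <= eta x)
  (etapos : exists2 c, 0 < c & forall x, `|x| <= 2^-1 -> c <= eta x).
Variables (W Om Om0 : set 'rV[R]_d) (a r aO rO l t kap c E E' rho r1 : R) (N : nat).
Local Notation U := (Om `&` W).
Local Notation Z := [set z | sdist Om z < t].
Hypotheses (a0 : 0 < a) (a1 : a < 1) (r0 : 0 < r) (cW : cone_domain a r W) (W0 : W !=set0)
  (aO0 : 0 < aO) (rO0 : 0 < rO) (cO : cone_domain aO rO Om) (O0 : Om !=set0)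
  (Or : forall x, Om x -> `|x| <= r1) (l0 : 0 < l) (t0 : 0 < t) (kap0 : 0 < kap)
  (OOm0 : forall x y, Om y -> `|x - y| < l + t + kap -> Om0 x)
  (c0 : 0 < c) (E0 : 0 <= E) (EE : E <= E') (rho0 : 0 < rho) (rhoc : 3 * rho <= c / 2)
  (HI : corkscrews c E W l) (HC : chained c (3 / 2 * (E + c) + 2 + E') rho N W l)
  (HX : outer_corkscrews c E' rho W l Om Z).
Local Notation Ex f := (ext eta W l c (E + c) Z f).
Local Notation Gx f G := (gext eta W l c (E + c) Z f G).
Local Notation approximable := (approximable W Om).
Local Notation admissible := (admissible W Om).

Let oW : open W. Proof. by case: cW. Qed.
Let oO : open Om. Proof. by case: cO. Qed.
Let oU : open U. Proof. exact: openI. Qed.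
Let mZ : measurable Z.
Proof.
have -> : Z = sdist Om @^-1` `]-oo, t[ by apply/seteqP; split=> x /=; rewrite in_itv.
by rewrite -[X in measurable X]setTI; exact: measurable_sdist.
Qed.
Let Ztau z y : ~ Z z -> `|y - z| < t -> ~ U y.
Proof.
move=> /negP; rewrite -leNgt => tz yz [Oy _]; have := sdist_le z Oy.
by rewrite distrC => h; move: (le_trans tz h); rewrite leNgt yz.
Qed.
Let Znear z : Z z -> exists2 y, Om y & `|z - y| < t.
Proof. exact: sdist_lt. Qed.
Let Zr z : Z z -> `|z| <= r1 + t.
Proof.
move=> /Znear[y Oy zy]; rewrite -[z](subrK y); apply: le_trans (ler_normD _ _) _.
by have := Or Oy; move/ltW: zy; lra.
Qed.
Let UW : U `<=` W. Proof. by move=> x []. Qed.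

Let mgt : measurable [set x | 0 < sg W l x].
Proof. exact: measurable_sg_gt0. Qed.

Lemma Ex_off f x : measurable_fun setT f -> (\int[mu]_y (f y ^+ 2)%:E < +oo)%E ->
  (forall x, ~ U x -> f x = 0) -> (forall y, Om y -> l + t <= `|x - y|) -> Ex f x = 0.
Proof.
move=> mf foo f0 far.
have nU : ~ U x by move=> [/far]; rewrite subrr normr0; have := addr_gt0 l0 t0; lra.
rewrite /ext; case: ifPn => s0; last exact: f0.
apply: (ext_off d0 beta eta0 etapos c E l0 mZ mf s0 _).1 => z xz /Znear[y Oy zy].
have := far _ Oy; rewrite leNgt => /negP; apply.
apply: le_lt_trans (ler_distD z _ _) _; rewrite ltrD//.
move: xz; rewrite -ball_normE /= => xz; apply: lt_le_trans xz _.
by have := sg_le W l x; lra.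
Qed.

Lemma measurable_Gx f G j : measurable_fun setT f -> (\int[mu]_y (f y ^+ 2)%:E < +oo)%E ->
  measurable_fun setT (G j) -> measurable_fun setT (Gx f G j).
Proof.
move=> mf foo mG.
pose s x := 0 < sg W l x.
have -> : setT = [set x | s x] `|` ~` [set x | s x] by rewrite setUv.
apply/measurable_funU => //; first exact: measurableC.
split.
  apply: eq_measurable_fun (measurable_partial_ext d0 beta eta0 etapos l0 c0 E0 mZ HI mf foo j).
  by move=> x; rewrite inE /gext => /= ->.
apply: eq_measurable_fun (measurable_funTS mG) => x; rewrite inE /gext /= => /negP/negPf.
by rewrite /s => ->.
Qed.

Lemma Ex_sub f h x : measurable_fun setT f -> measurable_fun setT h ->
  (\int[mu]_y (f y ^+ 2)%:E < +oo)%E -> (\int[mu]_y (h y ^+ 2)%:E < +oo)%E ->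
  Ex (fun y => f y - h y) x = Ex f x - Ex h x.
Proof.
move=> mf mh foo hoo; rewrite [RHS]addrC -mulN1r -(ext_lin d0 beta (-1) x l0 c0 E0 mZ HI)//.
by congr ext; apply/funext => y; rewrite mulN1r addrC.
Qed.

Lemma Gx_sub f h G H j x : measurable_fun setT f -> measurable_fun setT h ->
  (\int[mu]_y (f y ^+ 2)%:E < +oo)%E -> (\int[mu]_y (h y ^+ 2)%:E < +oo)%E ->
  Gx (fun y => f y - h y) (fun j y => G j y - H j y) j x = Gx f G j x - Gx h H j x.
Proof.
move=> mf mh foo hoo; rewrite /gext; case: ifPn => // s0.
have df g := @differentiable_ext _ _ eta d0 beta eta0 etapos W Z l c E g l0 c0 E0 mZ HI.
have := partial_lin (-1) j (df _ mh hoo _ s0) (df _ mf foo _ s0).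
rewrite [RHS]addrC mulN1r => <-; rewrite /partial; apply: near_eq_derive.
have : \forall y \near x, 0 < sg W l y by apply: open_nbhs_nbhs; split => //; exact: open_sg.
apply: filterS => y sy; have := Ex_sub y mf mh foo hoo.
by rewrite /ext sy => ->; rewrite mulN1r addrC.
Qed.

Let Nset := bnd W `|` bnd U.

Let mN : measurable Nset. Proof. by apply: measurableU; exact: measurable_bnd. Qed.

Let N0 : mu Nset = 0%E.
Proof.
have n1 := bnd_null a0 r0 cW; have n2 := bnd_null aO0 rO0 cO.
apply/eqP; rewrite eq_le measure_ge0 andbT.
have mB := measurableU _ _ (measurable_bnd oO) (measurable_bnd oW).
apply: (@le_trans _ _ (mu (bnd Om `|` bnd W))).
  apply: le_measure; rewrite ?inE// => x [bx|bx]; first by right.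
  exact: (bnd_setI oW oO).
by rewrite null_set_setU//; exact: measurable_bnd.
Qed.

Lemma smooth_ext_approx phi (e : R) : admissible phi -> 0 < e ->
  exists psi, [/\ test_fun Om0 psi,
    (\int[mu]_x ((Ex (zext phi U) x - psi x) ^+ 2)%:E <= e%:E)%E &
    forall j, (\int[mu]_x ((Gx (zext phi U) (fun j => zext (partial j phi) U) j x - partial j psi x) ^+ 2)%:E <= e%:E)%E].
Proof.
move=> [sphi phi0] e0.
have U0r x : U x -> `|x| <= r1 by move=> [/Or].
have [Mj HMj] : exists M : R, 0 <= M /\ forall j x, `|x| <= r1 + 1 -> `|partial j phi x| <= M.
  have /choice[Mj HMj] : forall j, exists M, forall z, `|z - 0| <= r1 + 1 -> `|partial j phi z| <= M.
    by move=> j; apply: continuous_bounded_ball; apply: smooth_continuous; exact: smooth_partial.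
  exists (\sum_j `|Mj j|); split; first exact: sumr_ge0.
  move=> j x xr; apply: le_trans (HMj j x _) _; first by rewrite subr0.
  by apply: le_trans (ler_norm _) _; rewrite (bigD1 j)//= lerDl sumr_ge0.
have [B0 phiB] := HMj.
have [S0 HS0] := continuous_bounded_ball 0 r1 (smooth_continuous sphi).
have fS x : `|zext phi U x| <= `|S0|.
  have [Ux|Ux] := pselect (U x); last by rewrite zext_out// normr0.
  by rewrite zext_in//; apply: le_trans (ler_norm _); apply: HS0; rewrite subr0 U0r.
have [M M0 fM] := zext_lipschitz sphi oU U0r phiB a0 a1 r0 cW B0
  (fun x Wx bx => phi0 x bx (bnd_setI_in oW oO Wx bx)).
have mf : measurable_fun setT (zext phi U) by exact: measurable_zext.
have r10 : 0 <= r1 by have [y /Or] := O0; apply: le_trans.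
have foo : (\int[mu]_y (zext phi U y ^+ 2)%:E < +oo)%E.
  have := @le_integral_supp R d (fun x => zext phi U x ^+ 2) 0 (r1 + 1) (`|S0| ^+ 2).
  have -> : (\int[mu]_x `|zext phi U x ^+ 2|%:E = \int[mu]_x (zext phi U x ^+ 2)%:E)%E.
    by apply: eq_integral => x _; rewrite ger0_norm ?sqr_ge0.
  move=> h; apply: le_lt_trans (h _ _ _ _) _.
  - lra.
  - exact: measurable_funX.
  - by move=> z _; rewrite normrX lerXn2r ?nnegrE.
  - move=> z zr; rewrite zext_out ?expr0n// => /U0r zr1; apply: zr.
    by rewrite -ball_normE /= sub0r normrN; lra.
  - exact: ltry.
have phiB' j x : U x -> `|partial j phi x| <= Mj by move=> /U0r xr; apply: phiB; lra.
pose u := Ex (zext phi U); pose Gu := Gx (zext phi U) (fun j => zext (partial j phi) U).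
have [L1 L10 uL] := ext_lip_off d0 beta eta0 etapos oW W0 l0 c0 E0 mZ HI sphi oU M0 fM (normr_ge0 S0) fS t0 Ztau foo.
have [L2 [uB GB]] := ext_bounded d0 beta eta0 etapos l0 c0 E0 mZ HI sphi oU phiB' B0 M0 fM (normr_ge0 S0) fS t0 Ztau.
have dG j x := @ext_derivative _ _ eta d0 beta eta0 etapos W U Z phi l c E oW W0 l0 c0 E0 mZ HI sphi oU UW foo j x.
have cG j x := @gext_continuous _ _ eta d0 beta eta0 etapos W U Z phi l c E oW W0 l0 c0 E0 mZ HI sphi oU UW foo j x.
have sup x := @ext_support _ _ eta d0 beta eta0 etapos W U Z phi l c E l0 mZ sphi oU x.
have mu_ := measurable_ext d0 beta eta0 etapos l0 c0 E0 mZ HI mf foo.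
have mGu j : measurable_fun setT (Gu j).
  by apply: measurable_Gx => //; apply: measurable_zext => //; exact: smooth_partial.
have far x : (forall y, Om y -> l + t <= `|x - y|) -> u x = 0 /\ forall j, Gu j x = 0.
  move=> H; apply: sup => [z zx /Znear[y Oy zy]|[/H]].
    have := H _ Oy; rewrite leNgt => /negP; apply.
    by apply: le_lt_trans (ler_distD z _ _) _; rewrite ltrD// distrC.
  by rewrite subrr normr0; have := addr_gt0 l0 t0; lra.
pose rb := r1 + l + t + 1.
have farb x : ~ ball 0 rb x -> forall y, Om y -> l + t <= `|x - y|.
  rewrite -ball_normE /= sub0r normrN => /negP; rewrite -leNgt => xr y /Or yr.
  have := ler_normD (x - y) y; rewrite subrK; move: xr; rewrite /rb; lra.
have L20 : 0 <= L2 by apply: le_trans (normr_ge0 _) (uB 0).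
have rb0 : 0 < rb by rewrite /rb; move: l0 t0 r10; lra.
have A1 x : ~ ball 0 rb x -> u x = 0 by move=> /farb /far[].
have A2 x : `|u x| <= L1 + L2 by apply: le_trans (uB x) _; lra.
have A3 : lip_off Nset (L1 + L2) u.
  move=> x y nx ny; apply: le_trans (uL x y _ _) _; [by move=> bx; apply: nx; left|by move=> bx; apply: ny; left|].
  by rewrite ler_wpM2r//; lra.
have A5 j x : `|Gu j x| <= L1 + L2 by apply: le_trans (GB j x) _; lra.
have A6 j x : ~ ball 0 rb x -> Gu j x = 0 by move=> /farb /far[_].
(* Mollification enlarges the support by at most [kap / 4] and its closure by another [kap / 4], so
   that it stays within [l + t + kap / 2] of [Om], hence inside [Om0]. *)
have kap4 : 0 < kap / 4 by rewrite divr_gt0.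
have [s [s0 srho h1 h2]] := moll_approx d0 beta eta0 etapos e0 kap4 mN N0 mu_ mGu rb0 A1 A2 A3 dG A5 A6 cG.
exists (moll eta s u); split.
- have supp x : moll eta s u x != 0 -> exists2 y, Om y & `|x - y| < l + t + kap / 4.
    apply: contra_neqP => /forall2NP H; apply: (moll_supp beta s0) => z zx; apply: (far z _).1 => y Oy.
    have [//|/negP] := H y; rewrite -leNgt => h.
    have := ler_distD z x y; rewrite [ `|x - z| ]distrC; lra.
  have csupp x : closure [set x | moll eta s u x != 0] x -> exists2 y, Om y & `|x - y| < l + t + kap / 2.
    move=> /(_ (ball x (kap / 4)))[]; first by apply: nbhsx_ballx; lra.
    move=> z [/= /supp[y Oy zy]]; rewrite -ball_normE /= => xz; exists y => //.
    by have := ler_distD z x y; lra.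
  split.
  + exact: (smooth_moll d0 beta s0 mu_ A2).
  + apply: bounded_closed_compact; last exact: closed_closure.
    exists (r1 + l + t + kap); split; first exact: num_real.
    move=> M' M'r x /csupp[y /Or yr xy] /=.
    have := ler_normD (x - y) y; rewrite subrK; move: kap0; lra.
  + move=> x /csupp[y Oy xy]; apply: OOm0 Oy _; move: kap0 xy; lra.
- rewrite (eq_integral (fun x => ((moll eta s u x - u x) ^+ 2)%:E))// => x _.
  by rewrite -sqrrN opprB.
- move=> j; rewrite (eq_integral (fun x => ((partial j (moll eta s u) x - Gu j x) ^+ 2)%:E))// => x _.
  by rewrite -sqrrN opprB.
Qed.

Lemma Gx_square_integral : exists2 C, 0 < C & forall f G, approximable f G ->
  forall j, (\int[mu]_x (Gx f G j x ^+ 2)%:E <= C%:E * \int[mu]_x (\sum_j G j x ^+ 2)%:E)%E.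
Proof.
have k0 : (0 : R) <= 4 * (4 * d%:R) by rewrite !mulr_ge0.
have [C [K3 [C0 K30 H]]] := ext_grad_integral d0 beta eta0 etapos N k0 c0 E0 EE rho0 rhoc.
exists (C + 1); first by rewrite ltr_pwDr// ltW.
move=> f G ap j; have [mf mG f0 [foo Goo] _] := ap.
have mS : measurable_fun setT (fun x => \sum_j G j x ^+ 2).
  by apply: measurable_sum => i; exact: measurable_funX.
have S0 x : 0 <= \sum_j G j x ^+ 2 by apply: sumr_ge0 => i _; exact: sqr_ge0.
have f0' x : ~ Om x -> f x = 0 by move=> Ox; apply: f0 => -[].
have m1 := @measurable_cst _ _ 'rV[R]_d R setT 1.
have wle : (1 : R) <= 1 * 1 by rewrite mul1r.
have := H W l Om Z f _ (cst 1) (cst 1) 1 l0 mZ HI HC HX mf mS S0 f0' (approximable_transl oW oO ap) foo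
  ler01 m1 m1 (fun=> ler01) (fun=> ler01) (fun _ _ _ _ _ => wle) j.
under eq_integral do rewrite mul1r.
under [in X in (_ <= X)%E]eq_integral do rewrite mul1r.
rewrite mulr1 => HH.
have mg := measurable_Gx mf foo (mG j).
have mg2 : measurable_fun setT (fun x => Gx f G j x ^+ 2) by exact: measurable_funX.
rewrite -[in leLHS](setUv [set x | 0 < sg W l x]) ge0_integral_setU//; first last.
- by apply/disj_setPCl.
- by move=> x _; rewrite lee_fin sqr_ge0.
- by apply/measurable_EFinP; apply: measurable_funTS.
- exact: measurableC.
rewrite EFinD ge0_muleDl ?lee_fin ?(ltW C0)// mul1e; apply: leeD.
  rewrite (eq_integral (fun x => (partial j (vavg eta (sg W l) (avgZ W l c (E + c) Z f)) x ^+ 2)%:E)).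
    exact: HH.
  by move=> x; rewrite inE /gext /= => ->.
apply: le_trans (integral_fin_subset (measurableC mgt) measurableT mS S0 (@subsetT _ _)).
rewrite (eq_integral (fun x => (G j x ^+ 2)%:E)); last first.
  by move=> x; rewrite inE /gext /= => /negP/negPf ->.
apply: le_integral_fin => //; first exact: measurableC.
- exact: measurable_funX.
- by move=> x _; exact: sqr_ge0.
- by move=> x _; rewrite (bigD1 j)//= lerDl sumr_ge0// => i _; exact: sqr_ge0.
Qed.

Lemma ext_approx f G (e : R) : approximable f G -> 0 < e ->
  exists psi, [/\ test_fun Om0 psi, (\int[mu]_x ((Ex f x - psi x) ^+ 2)%:E <= e%:E)%E &
    forall j, (\int[mu]_x ((Gx f G j x - partial j psi x) ^+ 2)%:E <= e%:E)%E].
Proof.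
move=> ap e0; have [mf mG f0 [foo Goo] H] := ap.
have [C1 C10 HE] := ext_value_integral d0 beta eta0 etapos c0 E0.
have [C2 C20 HG] := Gx_square_integral.
(* Linearity and the L^2 bounds turn an error [e'] on [f] and [G] into at most [e / 4] on the
   extension and its gradient; doubling this, and the [e / 4] of [psi], gives [e]. *)
pose e' := e / (4 * (C1 + C2 * d.+1%:R)).
have CC : 0 < C1 + C2 * d.+1%:R by rewrite addr_gt0// mulr_gt0.
have e'0 : 0 < e' by rewrite divr_gt0// mulr_gt0.
have e'E : e' * (C1 + C2 * d.+1%:R) = e / 4.
  by rewrite /e' invfM mulrA -[_ * _^-1 * _ in LHS]mulrA mulVf ?mulr1// gt_eqF.
have [phi [aphi h1 h2]] := H e' e'0; have [sphi _] := aphi.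
have mz : measurable_fun setT (zext phi U) by exact: measurable_zext.
have mzj j : measurable_fun setT (zext (partial j phi) U).
  by apply: measurable_zext => //; exact: smooth_partial.
have zoo := sqr_integrable_sub mf mz foo h1.
have [psi [tpsi p1 p2]] := smooth_ext_approx aphi (divr_gt0 e0 (ltr0Sn R 3)).
have [spsi _ _] := tpsi.
have ap' := approximable_sub oW oO ap aphi h1 h2; have [mf' mG' _ [foo' _] _] := ap'.
exists psi; split => //.
  have mE (g : 'rV[R]_d -> R) : measurable_fun setT g -> (\int[mu]_y (g y ^+ 2)%:E < +oo)%E -> measurable_fun setT (Ex g).
    by move=> mg goo; exact: (measurable_ext d0 beta eta0 etapos l0 c0 E0 mZ HI mg goo).
  have mp := smooth_measurable spsi.
  apply: le_trans (integral_sqr_sub_le (measurable_funB (mE _ mf foo) mp) (measurable_funB (mE _ mz zoo) mp)) _.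
  rewrite (eq_integral (fun x => (Ex (fun y => f y - zext phi U y) x ^+ 2)%:E)); last first.
    by move=> x _; rewrite Ex_sub// opprB addrA subrK.
  apply: (@le_trans _ _ (2%:E * (C1%:E * e'%:E) + 2%:E * (e / 4)%:E)%E).
    apply: leeD; apply: lee_wpmul2l => //; apply: le_trans (HE W l Z _ l0 mZ HI mf' foo') _.
    by apply: lee_wpmul2l => //; rewrite lee_fin ltW.
  rewrite -!EFinM -EFinD lee_fin.
  have : C1 * e' <= e / 4 by rewrite -e'E mulrC ler_wpM2l ?(ltW e'0)// lerDl mulr_ge0// ltW.
  by move: (e / 4) (divfK (lt0r_neq0 (ltr0Sn R 3)) e : e / 4 * 4 = e) => e4 <-; lra.
move=> j; have mp := smooth_measurable (smooth_partial j spsi).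
have mGf := measurable_Gx mf foo (mG j).
have mGz := @measurable_Gx _ (fun j => zext (partial j phi) U) j mz zoo (mzj j).
apply: le_trans (integral_sqr_sub_le (measurable_funB mGf mp) (measurable_funB mGz mp)) _.
rewrite (eq_integral (fun x => (Gx (fun y => f y - zext phi U y)
   (fun j y => G j y - zext (partial j phi) U y) j x ^+ 2)%:E)); last first.
  by move=> x _; rewrite Gx_sub// opprB addrA subrK.
apply: (@le_trans _ _ (2%:E * (C2%:E * (d%:R * e')%:E) + 2%:E * (e / 4)%:E)%E).
  apply: leeD; apply: lee_wpmul2l => //; last exact: p2.
  apply: le_trans (HG _ _ ap' j) _.
  apply: lee_wpmul2l; first by rewrite lee_fin ltW.
  rewrite (integral_sum_sqr mG').
  apply: (@le_trans _ _ (\sum_(j < d) e'%:E)%E); first by apply: lee_sum => i _; exact: h2.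
  by rewrite sumEFin lee_fin sumr_const card_ord -(mulr_natl e' d).
rewrite -!EFinM -EFinD lee_fin.
have : C2 * (d%:R * e') <= e / 4.
  rewrite -e'E mulrA mulrC ler_wpM2l ?(ltW e'0)//.
  apply: (@le_trans _ _ (C2 * d.+1%:R)); last by rewrite lerDr ltW.
  by rewrite ler_wpM2l ?(ltW C20)// ler_nat.
by move: (e / 4) (divfK (lt0r_neq0 (ltr0Sn R 3)) e : e / 4 * 4 = e) => e4 <-; lra.
Qed.

End extension_approximation.

(** * Weighted estimates *)

Section weighted_extension.
Context {R : realType} {d : nat}.
Local Notation mu := (lebesgue_rV R d).
Implicit Types (f q : 'rV[R]_d -> R) (G : 'I_d -> 'rV[R]_d -> R) (x y z : 'rV[R]_d) (j : 'I_d).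
Variables (eta : 'rV[R]_d -> R).
Hypotheses (d0 : (0 < d)%N) (beta : bump eta) (eta0 : forall x, 0 <= eta x)
  (etapos : exists2 c, 0 < c & forall x, `|x| <= 2^-1 -> c <= eta x).

Lemma measurable_near (Om : set 'rV[R]_d) (t : R) : measurable [set z | sdist Om z < t].
Proof.
have -> : [set z | sdist Om z < t] = sdist Om @^-1` `]-oo, t[.
  by apply/seteqP; split=> x /=; rewrite in_itv.
by rewrite -[X in measurable X]setTI; exact: measurable_sdist.
Qed.

(** Outside [P] the extension vanishes off [W], so that there [q] may be replaced by its restriction
    to [P]; the weights need be comparable only between a point of [P] and a point of [Om]. The 1 in
    the constant stands for the closure of [W], where the gradient is unchanged. *)
Lemma Gx_weighted (c E E' rho : R) N : 0 < c -> 0 <= E -> E <= E' -> 0 < rho -> 3 * rho <= c / 2 ->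
  exists C K3, [/\ 0 < C, 0 < K3 & forall W Om P (l t kap : R) f G q,
  open W -> open Om -> 0 < l -> 0 < t -> Om !=set0 -> corkscrews c E W l ->
  chained c (3 / 2 * (E + c) + 2 + E') rho N W l ->
  outer_corkscrews c E' rho W l Om [set z | sdist Om z < t] ->
  approximable W Om f G -> (forall j x, ~ Om x -> G j x = 0) ->
  measurable P -> measurable_fun setT q -> (forall x, 0 <= q x) -> 0 <= kap ->
  (forall x y, ~ P x -> Om y -> l + t <= `|x - y|) ->
  (forall x y, P x -> Om y -> `|y - x| < K3 * l -> q x <= kap * q y) ->
  forall j, (\int[mu]_x (q x * gext eta W l c (E + c) [set z | sdist Om z < t] f G j x ^+ 2)%:E <=
    (C * kap + 1)%:E * \int[mu]_x (q x * \sum_j G j x ^+ 2)%:E)%E].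
Proof.
move=> c0 E0 EE rho0 rhoc.
have k0 : (0 : R) <= 4 * (4 * d%:R) by rewrite !mulr_ge0.
have [C [K3 [C0 K30 H]]] := ext_grad_integral d0 beta eta0 etapos N k0 c0 E0 EE rho0 rhoc.
exists C, K3; split => // W Om P l t kap f G q oW oO l0 t0 O0 HI HC HX ap G0 mP mq q0 kap0 far cmp j.
set Z := [set z | sdist Om z < t].
have mZ : measurable Z by exact: measurable_near.
have [mf mG f0 [foo Goo] _] := ap.
have mS : measurable_fun setT (fun x => \sum_j G j x ^+ 2).
  by apply: measurable_sum => i; exact: measurable_funX.
have S0 x : 0 <= \sum_j G j x ^+ 2 by apply: sumr_ge0 => i _; exact: sqr_ge0.
have f0' x : ~ Om x -> f x = 0 by move=> Ox; apply: f0 => -[].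
pose p x := q x * \1_P x.
have mp : measurable_fun setT p by apply: measurable_funM => //; exact: measurable_indic.
have p0 x : 0 <= p x by apply: mulr_ge0.
have pq x y : 0 < sg W l x -> `|y - x| < K3 * sg W l x -> 0 < \sum_j G j y ^+ 2 -> p x <= kap * q y.
  move=> sx yx Gy; have [Px|Px] := pselect (P x); last first.
    by rewrite /p indicE memNset// mulr0 mulr_ge0.
  rewrite /p indicE mem_set// mulr1; apply: cmp => //.
    apply: contrapT => Oy; move: Gy; rewrite big1 ?ltxx// => i _.
    by rewrite G0// expr0n.
  apply: lt_le_trans yx _; rewrite ler_pM2l//.
  by apply: le_trans (sg_le W l x) _; clear -G q l0; lra.
have HH := H W l Om Z f _ p q kap l0 mZ HI HC HX mf mS S0 f0' (approximable_transl oW oO ap) foo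
  kap0 mp mq p0 q0 pq j.
have mgt := measurable_sg_gt0 W l.
have mg : measurable_fun setT (gext eta W l c (E + c) Z f G j).
  by apply: measurable_Gx.
have mqg : measurable_fun setT (fun x => q x * gext eta W l c (E + c) Z f G j x ^+ 2).
  by apply: measurable_funM => //; exact: measurable_funX.
have mqS : measurable_fun setT (fun x => q x * \sum_j G j x ^+ 2) by exact: measurable_funM.
have qS0 x : 0 <= q x * \sum_j G j x ^+ 2 by exact: mulr_ge0.
rewrite -[in leLHS](setUv [set x | 0 < sg W l x]) ge0_integral_setU//; first last.
- by apply/disj_setPCl.
- by move=> x _; rewrite lee_fin mulr_ge0 ?sqr_ge0.
- by apply/measurable_EFinP; apply: measurable_funTS.
- exact: measurableC.
have Ck0 : 0 <= C * kap by rewrite mulr_ge0// ltW.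
rewrite EFinD ge0_muleDl ?lee_fin// mul1e; apply: leeD.
  rewrite (eq_integral (fun x => (p x * partial j (vavg eta (sg W l) (avgZ W l c (E + c) Z f)) x ^+ 2)%:E)).
    exact: HH.
  move=> x; rewrite inE /gext /= => sx; rewrite sx /p indicE.
  have [Px|Px] := pselect (P x); first by rewrite mem_set// mulr1.
  rewrite memNset// mulr0 mul0r; congr (_%:E).
  suff off z : ball x (2 * sg W l x) z -> ~ Z z.
    by have [_ ->] := ext_off d0 beta eta0 etapos c E l0 mZ mf sx off; rewrite expr0n mulr0.
  move=> xz /(sdist_lt O0)[y Oy zy]; have := far _ _ Px Oy; rewrite leNgt => /negP; apply.
  apply: le_lt_trans (ler_distD z _ _) _; rewrite ltrD//.
  move: xz; rewrite -ball_normE /= => xz; apply: lt_le_trans xz _.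
  by have := sg_le W l x; clear -sx; lra.
apply: le_trans (integral_fin_subset (measurableC mgt) measurableT mqS qS0 (@subsetT _ _)).
rewrite (eq_integral (fun x => (q x * G j x ^+ 2)%:E)); last first.
  by move=> x; rewrite inE /gext /= => /negP/negPf ->.
apply: le_integral_fin => //; first exact: measurableC.
- by apply: measurable_funM => //; exact: measurable_funX.
- by move=> x _; rewrite mulr_ge0 ?sqr_ge0.
- by move=> x _; rewrite ler_wpM2l// (bigD1 j)//= lerDl sumr_ge0// => i _; exact: sqr_ge0.
Qed.

End weighted_extension.

(** * The outer domain and the weight *)

Section outer_domain.
Context {R : realType} {d : nat}.
Implicit Types (A B Om : set 'rV[R]_d) (x y b : 'rV[R]_d) (r s : R).

Lemma pt_dist_le A x y : A y -> pt_dist x A <= enorm (x - y).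
Proof.
move=> Ay; apply: ge_inf; last by exists y.
by exists 0 => _ [z _ <-]; exact: sqrtr_ge0.
Qed.

Lemma pt_dist_ge A x r : A !=set0 -> (forall y, A y -> r <= enorm (x - y)) -> r <= pt_dist x A.
Proof.
by move=> [y0 Ay0] H; apply: lb_le_inf; [exists (enorm (x - y0)), y0|move=> _ [y Ay <-]; exact: H].
Qed.

Lemma pt_dist_lt A x r : A !=set0 -> pt_dist x A < r -> exists2 y, A y & enorm (x - y) < r.
Proof.
move=> A0 dr; apply: contrapT => /forall2NP H; move: dr; apply/negP; rewrite -leNgt.
by apply: pt_dist_ge => // y Ay; case: (H y) => // /negP; rewrite -leNgt.
Qed.

Lemma sdist_le_pt_dist A x : A !=set0 -> sdist A x <= pt_dist x A.
Proof.
move=> A0; apply: pt_dist_ge => // y Ay; apply: le_trans (sdist_le x Ay) _; exact: norm_le_enorm.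
Qed.

Lemma pt_dist_le_sdist A x : (0 < d)%N -> A !=set0 -> pt_dist x A <= d%:R * sdist A x.
Proof.
move=> d0 A0; have dp : (0 : R) < d%:R by rewrite ltr0n.
rewrite -ler_pdivrMl//; apply: sdist_ge => // y Ay; rewrite ler_pdivrMl//.
apply: le_trans (pt_dist_le x Ay) _; exact: enorm_le_norm.
Qed.

Lemma continuous_enorm : continuous (@enorm R d).
Proof.
move=> x; apply: continuous_comp; last exact: sqrt_continuous.
have -> : @sqn R 1 d = fun M => \sum_i M 0 i * M 0 i.
  by apply/funext => M; rewrite /sqn big_ord1.
apply: (@continuous_big _ _ +%R 0) => [|i _]; first exact: add_continuous.
have cc : continuous (fun M : 'rV[R]_d => M 0 i) by exact: coord_continuous.
by move=> y; exact: (cvgM (cc y) (cc y)).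
Qed.

(* An infimum of continuous functions is upper semicontinuous. *)
Lemma measurable_pt_dist A : A !=set0 -> measurable_fun setT (fun x => pt_dist x A).
Proof.
move=> A0 mD; apply: (measurability _ (RGenInftyO.measurableE R)) => //= _ [_ [r ->] <-].
rewrite setTI (_ : _ @^-1` _ = \bigcup_(y in A) [set x | enorm (x - y) < r]).
  apply: open_measurable_rV; apply: bigcup_open => y _.
  have -> : [set x | enorm (x - y) < r] = (fun x => enorm (x - y)) @^-1` `]-oo, r[.
    by apply/seteqP; split=> x /=; rewrite in_itv.
  apply: open_comp => // x _; apply: continuous_comp; last exact: continuous_enorm.
  exact: (cvgB cvg_id (cvg_cst _)).
apply/seteqP; split=> x /=; rewrite in_itv/=; first by move=> /(pt_dist_lt A0)[y Ay xy]; exists y.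
by move=> [y Ay /= xy]; apply: le_lt_trans xy; exact: pt_dist_le.
Qed.

(** As [|s| < 1] and [k >= 1], the power of [k] is at most [k] itself, which makes the constant
    uniform in the exponent. For negative [s] the roles of [a] and [b] are exchanged. *)
Lemma powR_comparable (a b k s : R) : 0 < a -> 0 < b -> 1 <= k -> a <= k * b -> b <= k * a ->
  -1 < s < 1 -> a `^ s <= k * b `^ s.
Proof.
move=> a0 b0 k1 ab ba /andP[s1 s2]; have k0 : 0 < k by apply: lt_le_trans k1.
have [s0|s0] := leP 0 s.
  apply: (@le_trans _ _ ((k * b) `^ s)).
    by apply: ge0_ler_powR => //; rewrite nnegrE ltW// mulr_gt0.
  rewrite powRM ?(ltW k0) ?(ltW b0)// ler_wpM2r ?powR_ge0//.
  by apply: le_trans (ler_powR k1 (ltW s2)) _; rewrite powRr1// ltW.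
have -> : s = - (- s) by rewrite opprK.
rewrite (powRN a) (powRN b) -ler_pdivrMl// -invfM lef_pV2 ?posrE ?mulr_gt0 ?powR_gt0//.
apply: (@le_trans _ _ ((k * a) `^ (- s))).
  by apply: ge0_ler_powR; rewrite ?nnegrE ?oppr_ge0 ?(ltW s0) ?(ltW b0)// mulr_ge0// ltW.
rewrite powRM ?(ltW k0) ?(ltW a0)// ler_wpM2r ?powR_ge0//.
apply: le_trans (ler_powR k1 (_ : - s <= 1)) _; first lra.
by rewrite powRr1// ltW.
Qed.

Hypothesis d0 : (0 < d)%N.
Let dp : (0 : R) < d%:R. Proof. by rewrite ltr0n. Qed.

(** Without it the distance to the boundary would be an infimum over the empty set, which is 0 by
    convention. *)
Lemma bnd_nonempty A : open A -> bounded_set A -> A !=set0 -> bnd A !=set0.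
Proof.
move=> oA [M [_ HM]] [x Ax]; pose v : 'rV[R]_d := const_mx (`|M| + 1 + `|x| + 1).
have nv : `|x + v| > `|M| + 1.
  have := ler_normB (x + v) x; rewrite addrAC subrr add0r.
  have : `|v| >= `|M| + 1 + `|x| + 1.
    apply: le_trans (coord_le_norm v (Ordinal d0)); rewrite mxE; exact: ler_norm.
  lra.
have [|t [_ _ bt]] := @first_exit _ _ A x v oA Ax; last by exists (x + t *: v).
move=> Axv; have MM : M < `|M| + 1 by have := ler_norm M; lra.
by have := HM _ MM _ Axv; rewrite /= leNgt nv.
Qed.

Variables (Om Om0 : set 'rV[R]_d) (h : R).
Hypotheses (h0 : 0 < h) (oO0 : open Om0) (bO0 : bounded_set Om0) (OO : Om `<=` Om0) (O0 : Om !=set0)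
  (far : forall x, bnd Om0 x -> h <= pt_dist x Om).
Local Notation delta x := (pt_dist x (bnd Om0)).

Lemma bnd_outer : bnd Om0 !=set0.
Proof. by apply: bnd_nonempty => //; have [x /OO] := O0; exists x. Qed.

Lemma bnd_outer_far x y : bnd Om0 x -> Om y -> h / d%:R <= `|x - y|.
Proof.
move=> bx Oy; rewrite ler_pdivrMr// mulrC; apply: le_trans (enorm_le_norm _).
by apply: le_trans (far bx) _; exact: pt_dist_le.
Qed.

Lemma near_inner_in x y : Om y -> `|x - y| < h / d%:R -> Om0 x.
Proof.
move=> Oy xy; apply: contrapT => nx.
have [|t [/andP[t0 t1] _ bt]] := @first_exit _ _ Om0 y (x - y) oO0 (OO Oy); first by rewrite addrC subrK.
have := bnd_outer_far bt Oy; rewrite addrAC subrr add0r leNgt => /negP; apply.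
apply: le_lt_trans xy; rewrite normrZ ger0_norm ?(ltW t0)//.
by rewrite ler_piMl.
Qed.

Lemma delta_inner y : Om y -> h <= delta y.
Proof.
move=> Oy; apply: pt_dist_ge; first exact: bnd_outer.
move=> b bb; have -> : enorm (y - b) = enorm (b - y).
  by rewrite /enorm /sqn; congr Num.sqrt; apply: eq_bigr => i _; apply: eq_bigr => j _; rewrite !mxE -sqrrN opprB.
by apply: le_trans (far bb) _; exact: pt_dist_le.
Qed.

(** Where [delta] is small one is beyond the reach of the extension, so that weights are never
    compared near the outer boundary. *)
Lemma delta_small x y : Om y -> delta x < h / (2 * d%:R) -> h / (2 * d%:R) <= `|x - y|.
Proof.
move=> Oy /(pt_dist_lt bnd_outer)[b bb xb].
have := bnd_outer_far bb Oy; have := ler_distD x b y; have := norm_le_enorm (x - b).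
have -> : h / d%:R = h / (2 * d%:R) + h / (2 * d%:R) by rewrite invfM -mulrDr -mulrDl; congr (_ * _); lra.
by rewrite [ `|b - x| ]distrC; move: xb; set u := h / _; lra.
Qed.

(** The outer factor [d] of [k] is the price for passing between the two norms. As [delta] is at
    least [h / (2 * d)] at both points, the displacement [e * h] is at most [2 * d * e] times either
    value. *)
Lemma delta_comparable x y (e k : R) : Om y -> `|y - x| <= e * h -> h / (2 * d%:R) <= delta x -> 0 <= e ->
  k = d%:R * (1 + 2 * d%:R * e) ->
  [/\ 0 < delta x, 0 < delta y, delta x <= k * delta y & delta y <= k * delta x].
Proof.
move=> Oy yx dx e0 ->; have hy := delta_inner Oy.
have dx0 : 0 < delta x by apply: lt_le_trans dx; rewrite divr_gt0// mulr_gt0.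
have d1 : (1 : R) <= d%:R by rewrite ler1n.
split => //; first exact: lt_le_trans hy.
  apply: le_trans (pt_dist_le_sdist x d0 bnd_outer) _; rewrite -mulrA ler_pM2l//.
  have := sdist_lip (bnd Om0) x y; have := sdist_le_pt_dist y bnd_outer.
  rewrite ler_norml distrC => s1 /andP[_ s2].
  have : e * h <= 2 * d%:R * e * delta y.
    have : e * h <= e * delta y by rewrite ler_wpM2l.
    have : e * delta y <= d%:R * (e * delta y) by rewrite ler_peMl// mulr_ge0// (le_trans (ltW h0)).
    have : 0 <= e * delta y by rewrite mulr_ge0// (le_trans (ltW h0)).
    rewrite -!mulrA; lra.
  by move: s1 s2 yx; rewrite mulrDl mul1r; lra.
apply: le_trans (pt_dist_le_sdist y d0 bnd_outer) _; rewrite -mulrA ler_pM2l//.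
have := sdist_lip (bnd Om0) y x; have := sdist_le_pt_dist x bnd_outer.
rewrite ler_norml => s1 /andP[_ s2].
have : e * h <= 2 * d%:R * e * delta x.
  have : h <= 2 * d%:R * delta x by rewrite mulrC -ler_pdivrMr// mulr_gt0.
  by move=> hx; rewrite [2 * _ * e]mulrC -mulrA ler_wpM2l.
by move: s1 s2 yx; rewrite mulrDl mul1r; lra.
Qed.

End outer_domain.

(** * Vector fields *)

Section vector_fields.
Context {R : realType} {d : nat}.
Local Notation mu := (lebesgue_rV R d).
Implicit Types (U : set 'rV[R]_d) (w : 'rV[R]_d -> 'rV[R]_d) (q h : 'rV[R]_d -> R) (x y z : 'rV[R]_d).

Definition cut U h : 'rV[R]_d -> R := fun x => h x * \1_U x.

Lemma cut_in U h x : U x -> cut U h x = h x.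
Proof. by move=> Ux; rewrite /cut indicE mem_set// mulr1. Qed.

Lemma cut_out U h x : ~ U x -> cut U h x = 0.
Proof. by move=> Ux; rewrite /cut indicE memNset// mulr0. Qed.

Lemma measurable_cut U h : measurable U -> measurable_fun U h -> measurable_fun setT (cut U h).
Proof.
move=> mU mh; rewrite (_ : cut U h = h \_ U); first by apply/(measurable_restrictT h mU).
apply/funext => x; rewrite patchE; case: ifPn => [/set_mem Ux|/negP Ux].
  by rewrite cut_in.
by rewrite cut_out// => /mem_set.
Qed.

Lemma integral_cut U h (F : R -> R) : F 0 = 0 ->
  (\int[mu]_x (F (cut U h x))%:E = \int[mu]_(x in U) (F (h x))%:E)%E.
Proof.
move=> F0; rewrite [RHS]integral_mkcond; apply: eq_integral => x _; rewrite patchE.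
case: ifPn => [/set_mem Ux|/negP Ux]; first by rewrite cut_in.
by rewrite cut_out ?F0// => /mem_set.
Qed.

Lemma sqn_ge0 m n (M : 'M[R]_(m, n)) : 0 <= sqn M.
Proof. by apply: sumr_ge0 => i _; apply: sumr_ge0 => j _; exact: sqr_ge0. Qed.

Lemma sqr_le_sqn m n (M : 'M[R]_(m, n)) i j : M i j ^+ 2 <= sqn M.
Proof.
rewrite /sqn (bigD1 i)//= (bigD1 j)//= -addrA lerDl addr_ge0//.
  by apply: sumr_ge0 => k _; exact: sqr_ge0.
by apply: sumr_ge0 => k _; apply: sumr_ge0 => k' _; exact: sqr_ge0.
Qed.

Lemma measurable_sqn U m n (F : 'rV[R]_d -> 'M[R]_(m, n)) :
  (forall i j, measurable_fun U (fun x => F x i j)) -> measurable_fun U (fun x => sqn (F x)).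
Proof. by move=> mF; apply: measurable_sum => i; apply: measurable_sum => j; exact: measurable_funX. Qed.

Lemma integral_sqn U m n (F : 'rV[R]_d -> 'M[R]_(m, n)) q : measurable U ->
  (forall i j, measurable_fun U (fun x => F x i j)) -> measurable_fun setT q -> (forall x, 0 <= q x) ->
  (\int[mu]_(x in U) (sqn (F x) * q x)%:E =
   \sum_i \sum_j \int[mu]_x (q x * cut U (fun x => F x i j) x ^+ 2)%:E)%E.
Proof.
move=> mU mF mq q0.
have mc i j : measurable_fun setT (fun x => q x * cut U (fun x => F x i j) x ^+ 2).
  by apply: measurable_funM => //; apply: measurable_funX; exact: measurable_cut.
have c0 i j x : 0 <= q x * cut U (fun x => F x i j) x ^+ 2 by rewrite mulr_ge0 ?sqr_ge0.
have -> : (\int[mu]_(x in U) (sqn (F x) * q x)%:E =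
    \int[mu]_x (\sum_i \sum_j q x * cut U (fun x => F x i j) x ^+ 2)%:E)%E.
  rewrite integral_mkcond; apply: eq_integral => x _; rewrite patchE.
  case: ifPn => [/set_mem Ux|/negP Ux]; last first.
    by rewrite big1// => i _; rewrite big1// => j _; rewrite cut_out ?expr0n ?mulr0// => /mem_set.
  congr (_%:E); rewrite /sqn mulrC mulr_sumr; apply: eq_bigr => i _; rewrite mulr_sumr.
  by apply: eq_bigr => j _; rewrite cut_in.
under eq_integral do rewrite -sumEFin.
rewrite ge0_integral_sum//; first last.
- by move=> i x _; rewrite lee_fin sumr_ge0.
- by move=> i; apply/measurable_EFinP; apply: measurable_sum => j.
apply: eq_bigr => i _; under eq_integral do rewrite -sumEFin.
rewrite ge0_integral_sum// => j; last by move=> x _; rewrite lee_fin.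
exact/measurable_EFinP.
Qed.

Lemma integral_cut_le U m n (F : 'rV[R]_d -> 'M[R]_(m, n)) i j : measurable U ->
  (forall i j, measurable_fun U (fun x => F x i j)) ->
  (\int[mu]_x (cut U (fun x => F x i j) x ^+ 2)%:E <= \int[mu]_(x in U) (sqn (F x))%:E)%E.
Proof.
move=> mU mF; rewrite (integral_cut U _ (F := fun r => r ^+ 2)) ?expr0n//.
apply: ge0_le_integral => //.
- by move=> x _; rewrite lee_fin sqr_ge0.
- by apply/measurable_EFinP; exact: measurable_funX.
- by apply/measurable_EFinP; exact: measurable_sqn.
- by move=> x _; rewrite lee_fin sqr_le_sqn.
Qed.

Lemma bounded_sub_ball U : bounded_set U -> exists2 r : R, 0 < r & U `<=` ball 0 r.
Proof.
move=> [M [_ HM]]; exists (`|M| + 2); first by have := normr_ge0 M; lra.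
move=> x Ux; rewrite -ball_normE /= sub0r normrN.
have MM : M < `|M| + 1 by have := ler_norm M; lra.
by have := HM _ MM x Ux; rewrite /=; lra.
Qed.

Lemma L2_integrable U m n (F : 'rV[R]_d -> 'M[R]_(m, n)) i j : open U -> bounded_set U -> L2 U F ->
  mu.-integrable U (EFin \o (fun x => F x i j)).
Proof.
move=> oU bU [mF Foo]; have mU := open_measurable_rV oU.
have [r r0 Ur] := bounded_sub_ball bU.
have U_fin : (mu U < +oo)%E.
  apply: (@le_lt_trans _ _ (mu (ball 0 r))).
    by apply: le_measure; rewrite ?inE//; exact: measurable_rV_ball.
  by rewrite lebesgue_rV_ball// ltry.
apply/integrableP; split; first exact/measurable_EFinP.
apply: (@le_lt_trans _ _ (\int[mu]_(x in U) (1 + (sqn (F x))%:E))%E).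
  apply: ge0_le_integral => //.
  - by apply: measurableT_comp => //; exact/measurable_EFinP.
  - by apply: emeasurable_funD => //; apply/measurable_EFinP; exact: measurable_sqn.
  - move=> x _; rewrite /= -EFinD lee_fin; have := sqr_le_sqn (F x) i j.
    have := sqr_ge0 (`|F x i j| - 1); rewrite sqrrB real_normK ?num_real//.
    have := normr_ge0 (F x i j); lra.
rewrite ge0_integralD//; first last.
- by apply/measurable_EFinP; exact: measurable_sqn.
- by move=> x _; rewrite lee_fin sqn_ge0.
by rewrite lte_add_pinfty// integral_cst// mul1e.
Qed.

(** Needed because the final estimate is stated for arbitrary weak gradients, whereas it is proved
    for particular ones; boundedness makes L^2 functions integrable. *)
Lemma weak_grad_unique U w (D1 D2 : 'rV[R]_d -> 'M[R]_d) i j : (0 < d)%N -> open U -> bounded_set U ->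
  H1 U w D1 -> H1 U w D2 -> {ae mu, forall x, U x -> D1 x i j = D2 x i j}.
Proof.
move=> d0 oU bU [_ L1 W1] [_ L2_ W2]; have mU := open_measurable_rV oU.
have i1 := L2_integrable i j oU bU L1; have i2 := L2_integrable i j oU bU L2_.
suff : {ae mu, forall x, U x -> D1 x i j - D2 x i j = 0}.
  by apply: filterS => x H /H /eqP; rewrite subr_eq0 => /eqP.
apply: (test_fun_ae_eq0 d0 oU (h := fun x => D1 x i j - D2 x i j)).
  exact: (integrableB mU i1 i2).
move=> f tf; have [r [M [_ M0 _ _ [fM _]]]] := test_fun_bounds tf; have [sf _ _] := tf.
have mf : measurable_fun U f by apply: measurable_funTS; exact: smooth_measurable.
have imul h : mu.-integrable U (EFin \o h) -> mu.-integrable U (EFin \o (fun x => h x * f x)).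
  move=> ih; have mh : measurable_fun U h by apply/measurable_EFinP; exact: (measurable_int _ ih).
  apply: (le_integrable mU _ _ (integrableZl mU M ih)).
    by apply/measurable_EFinP; exact: measurable_funM.
  by move=> x _; rewrite /= lee_fin !normrM mulrC (ger0_norm M0) ler_wpM2r.
have -> : \int[mu]_(x in U) ((D1 x i j - D2 x i j) * f x) =
    \int[mu]_(x in U) (D1 x i j * f x) - \int[mu]_(x in U) (D2 x i j * f x).
  by rewrite -RintegralB//; [|exact: imul|exact: imul]; apply: eq_Rintegral => x _; rewrite mulrBl.
by apply/eqP; rewrite -[X in X - _]opprK -(W1 f tf i j) -[X in _ - X]opprK -(W2 f tf i j) subrr.
Qed.

Lemma measurable_grad_test U (phi : 'rV[R]_d -> 'rV[R]_d) i j : smooth_vec phi ->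
  measurable_fun U (fun x => grad phi x i j).
Proof.
move=> sphi; apply: measurable_funTS.
rewrite (_ : (fun _ => _) = partial j (fun y => phi y 0 i)).
  by apply: smooth_measurable; exact: smooth_partial.
by apply/funext => x; rewrite mxE.
Qed.

Lemma integral_test U (g : 'rV[R]_d -> R) : (forall x, ~ U x -> g x = 0) ->
  \int[mu]_(x in U) g x = \int[mu]_x g x.
Proof.
move=> g0; rewrite Rintegral_mkcond; apply: eq_Rintegral => x _; rewrite patchE.
by case: ifPn => // /negP Ux; rewrite g0// => /mem_set.
Qed.

Lemma H1_intro U w (Dw : 'rV[R]_d -> 'M[R]_d) : measurable U ->
  (forall i, measurable_fun setT (fun x => w x 0 i)) ->
  (forall i j, measurable_fun setT (fun x => Dw x i j)) ->
  (forall i, (\int[mu]_x (w x 0 i ^+ 2)%:E < +oo)%E) ->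
  (forall i j, (\int[mu]_x (Dw x i j ^+ 2)%:E < +oo)%E) ->
  (forall f i j, test_fun U f ->
     \int[mu]_x (w x 0 i * partial j f x) = - \int[mu]_x (Dw x i j * f x)) -> H1 U w Dw.
Proof.
move=> mU mw mD woo Doo H.
have aux m n (F : 'rV[R]_d -> 'M[R]_(m, n)) : (forall i j, measurable_fun setT (fun x => F x i j)) ->
    (forall i j, (\int[mu]_x (F x i j ^+ 2)%:E < +oo)%E) -> L2 U F.
  move=> mF Foo; split; first by move=> i j; exact: measurable_funTS.
  have mF' i j : measurable_fun U (fun x => F x i j) by exact: measurable_funTS.
  have := integral_sqn mU mF' (@measurable_cst _ _ _ R setT 1) (fun=> ler01).
  under eq_integral do rewrite mulr1.
  move=> ->; apply: lte_sum_pinfty => i _; apply: lte_sum_pinfty => j _.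
  under eq_integral do rewrite mul1r.
  rewrite (integral_cut U _ (F := fun r => r ^+ 2)) ?expr0n//; apply: le_lt_trans (Foo i j).
  apply: integral_fin_subset => //; first exact: measurable_funX.
  by move=> x; exact: sqr_ge0.
split.
- by apply: aux => i j; rewrite ord1.
- exact: aux.
move=> f tf i j.
have e1 x : ~ U x -> w x 0 i * partial j f x = 0 by move=> /(test_fun_off j tf)[_ ->]; rewrite mulr0.
have e2 x : ~ U x -> Dw x i j * f x = 0 by move=> /(test_fun_off j tf)[-> _]; rewrite mulr0.
by rewrite (integral_test e1) (integral_test e2); exact: H.
Qed.

Lemma test_vec_H1 U (phi : 'rV[R]_d -> 'rV[R]_d) : measurable U ->
  (forall i, test_fun U (fun x => phi x 0 i)) -> H1 U phi (grad phi).
Proof.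
move=> mU tphi.
have gE x i j : grad phi x i j = partial j (fun y => phi y 0 i) x by rewrite mxE.
have sphi i : smooth (fun x => phi x 0 i) by have [] := tphi i.
apply: H1_intro => //.
- by move=> i; exact: smooth_measurable.
- by move=> i j; exact: measurable_grad_test.
- by move=> i; have [c [h _]] := test_fun_sqr_integrable (tphi i); apply: le_lt_trans h _; exact: ltry.
- move=> i j; have [c [_ h]] := test_fun_sqr_integrable (tphi i).
  by under eq_integral do rewrite gE; apply: le_lt_trans (h j) _; exact: ltry.
- move=> f i j tf; rewrite (test_fun_parts j tf (tphi i)); congr (- _).
  by apply: eq_Rintegral => x _; rewrite gE.
Qed.

End vector_fields.

Section vanishing_fields.
Context {R : realType} {d : nat}.
Local Notation mu := (lebesgue_rV R d).
Implicit Types (w : 'rV[R]_d -> 'rV[R]_d) (x y z : 'rV[R]_d).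
Variables (W Om : set 'rV[R]_d).
Hypotheses (oW : open W) (oO : open Om).
Local Notation U := (Om `&` W).

Let oU : open U. Proof. exact: openI. Qed.
Let mU : measurable U. Proof. exact: open_measurable_rV. Qed.

Lemma vanishing_approximable w : H1_vanishing U (bnd U `&` bnd Om) w -> exists2 Dw, H1 U w Dw &
  forall i, approximable W Om (cut U (fun x => w x 0 i)) (fun j => cut U (fun x => Dw x i j)).
Proof.
move=> [Dw HD HP]; exists Dw => // i; have [[mw woo] [mD Doo] _] := HD.
have mwi k j : measurable_fun U (fun x => w x k j) by exact: mw.
split.
- exact: measurable_cut.
- by move=> j; exact: measurable_cut.
- by move=> x Ux; rewrite cut_out.
- split=> [|j]; first exact: le_lt_trans (integral_cut_le 0 i mU mw) woo.
  exact: le_lt_trans (integral_cut_le i j mU mD) Doo.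
move=> e e0; have [phi [[sphi phi0] [[mp _] _ _] he]] := HP e e0.
exists (fun x => phi x 0 i); split.
- by split => // x bU bO; rewrite phi0 ?mxE.
- have mpw k j : measurable_fun U (fun x => (phi x - w x) k j).
    rewrite (_ : (fun _ => _) = (fun x => phi x k j) \- (fun x => w x k j)).
      exact: measurable_funB.
    by apply/funext => x; rewrite !mxE.
  apply: (@le_trans _ _ (\int[mu]_(x in U) (sqn (phi x - w x))%:E)%E); last first.
    by apply: le_trans he; rewrite leeDl// integral_ge0// => x _; rewrite lee_fin sqn_ge0.
  apply: le_trans (integral_cut_le 0 i mU mpw).
  rewrite (eq_integral (fun x => (cut U (fun x => (phi x - w x) 0 i) x ^+ 2)%:E))// => x _.
  by rewrite /cut /zext !mxE mulrBl -sqrrN opprB.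
- move=> j; have mpD k j' : measurable_fun U (fun x => (grad phi x - Dw x) k j').
    rewrite (_ : (fun _ => _) = (fun x => grad phi x k j') \- (fun x => Dw x k j')).
      by apply: measurable_funB => //; exact: measurable_grad_test.
    by apply/funext => x; rewrite mxE [X in _ + X]mxE.
  apply: (@le_trans _ _ (\int[mu]_(x in U) (sqn (grad phi x - Dw x))%:E)%E); last first.
    by apply: le_trans he; rewrite leeDr// integral_ge0// => x _; rewrite lee_fin sqn_ge0.
  apply: le_trans (integral_cut_le i j mU mpD).
  rewrite (eq_integral (fun x => (cut U (fun x => (grad phi x - Dw x) i j) x ^+ 2)%:E))// => x _.
  by rewrite /cut /zext !mxE mulrBl -sqrrN opprB.
Qed.

End vanishing_fields.

Section extension_operator.
Context {R : realType} {d : nat}.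
Local Notation mu := (lebesgue_rV R d).
Implicit Types (w : 'rV[R]_d -> 'rV[R]_d) (x y z : 'rV[R]_d).

Definition extv (eta : 'rV[R]_d -> R) W Om l c K Z w x : 'rV[R]_d :=
  \row_i ext eta W l c K Z (cut (Om `&` W) (fun y => w y 0 i)) x.

Definition gextv (eta : 'rV[R]_d -> R) W Om l c K Z w (Dw : 'rV[R]_d -> 'M[R]_d) x : 'M[R]_d :=
  \matrix_(i, j) gext eta W l c K Z (cut (Om `&` W) (fun y => w y 0 i))
    (fun j => cut (Om `&` W) (fun y => Dw y i j)) j x.

Variables (eta : 'rV[R]_d -> R).
Hypotheses (d0 : (0 < d)%N) (beta : bump eta) (eta0 : forall x, 0 <= eta x)
  (etapos : exists2 c, 0 < c & forall x, `|x| <= 2^-1 -> c <= eta x).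
Variables (W Om Om0 : set 'rV[R]_d) (a r aO rO l t kap c E E' rho r1 : R) (N : nat).
Local Notation U := (Om `&` W).
Local Notation Z := [set z | sdist Om z < t].
Hypotheses (a0 : 0 < a) (a1 : a < 1) (r0 : 0 < r) (cW : cone_domain a r W) (W0 : W !=set0)
  (aO0 : 0 < aO) (rO0 : 0 < rO) (cO : cone_domain aO rO Om) (O0 : Om !=set0)
  (Or : forall x, Om x -> `|x| <= r1) (l0 : 0 < l) (t0 : 0 < t) (kap0 : 0 < kap)
  (oO0 : open Om0)
  (OOm0 : forall x y, Om y -> `|x - y| < l + t + kap -> Om0 x)
  (c0 : 0 < c) (E0 : 0 <= E) (EE : E <= E') (rho0 : 0 < rho) (rhoc : 3 * rho <= c / 2)
  (HI : corkscrews c E W l) (HC : chained c (3 / 2 * (E + c) + 2 + E') rho N W l)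
  (HX : outer_corkscrews c E' rho W l Om Z).
Local Notation Lam := (extv eta W Om l c (E + c) Z).
Local Notation DLam := (gextv eta W Om l c (E + c) Z).
Local Notation X := (H1_vanishing U (bnd U `&` bnd Om)).

Let oW : open W. Proof. by case: cW. Qed.
Let oO : open Om. Proof. by case: cO. Qed.
Let oU : open U. Proof. exact: openI. Qed.
Let mU : measurable U. Proof. exact: open_measurable_rV. Qed.
Let mZ : measurable Z. Proof. exact: measurable_near. Qed.
Let mO0 : measurable Om0. Proof. exact: open_measurable_rV. Qed.

Lemma extv_in w x : U x -> Lam w x = w x.
Proof.
move=> [Ox Wx]; apply/rowP => i; rewrite mxE /ext sg_in ?(ltW l0)// ltxx.
exact: cut_in.
Qed.

Lemma vanishing_sqr w i : X w -> measurable_fun setT (cut U (fun x => w x 0 i)) /\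
  (\int[mu]_x (cut U (fun x => w x 0 i) x ^+ 2)%:E < +oo)%E.
Proof. by move=> /(vanishing_approximable oW oO)[Dw _ /(_ i)[mw _ _ []]]. Qed.

Lemma extv_off w x : X w -> (forall y, Om y -> l + t <= `|x - y|) -> Lam w x = 0.
Proof.
move=> Xw far; apply/rowP => i; rewrite !mxE.
have [mw woo] := vanishing_sqr i Xw.
by apply: (Ex_off d0 beta eta0 etapos c E O0 l0 t0 mw woo _ far) => y; exact: cut_out.
Qed.

Lemma extv_lin k w w' x : X w -> X w' -> Lam (fun x => k *: w x + w' x) x = k *: Lam w x + Lam w' x.
Proof.
move=> Xw Xw'; apply/rowP => i; rewrite !mxE.
have [mw woo] := vanishing_sqr i Xw; have [mw' woo'] := vanishing_sqr i Xw'.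
rewrite -(ext_lin d0 beta k x l0 c0 E0 mZ HI)//; congr ext; apply/funext => y.
by rewrite /cut !mxE mulrDl mulrA.
Qed.

Lemma extv_ae w w' : X w -> X w' -> ae_eq_on U w w' -> ae_eq_on Om0 (Lam w) (Lam w').
Proof.
move=> Xw Xw' H.
have Hi i : {ae mu, forall x, ext eta W l c (E + c) Z (cut U (fun x => w x 0 i)) x =
    ext eta W l c (E + c) Z (cut U (fun x => w' x 0 i)) x}.
  have [mw _] := vanishing_sqr i Xw; have [mw' _] := vanishing_sqr i Xw'.
  apply: ext_ae => //; apply: filterS H => x H; have [Ux|Ux] := pselect (U x).
    by rewrite !cut_in// H.
  by rewrite !cut_out.
have := @filter_forall _ _ _ _ (ae_filter_ringOfSetsType mu) Hi.
by apply: filterS => x H' _; apply/rowP => i; rewrite !mxE.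
Qed.

Let mono_sum (F : 'I_d -> \bar R) (e : R) : (forall i, (F i <= e%:E)%E) -> (\sum_i F i <= (d%:R * e)%:E)%E.
Proof.
move=> H; apply: (@le_trans _ _ (\sum_(i < d) e%:E)%E); first by apply: lee_sum => i _; exact: H.
by rewrite sumEFin lee_fin sumr_const card_ord -(mulr_natl e d).
Qed.

Lemma extv_H1_0 w Dw : H1 U w Dw ->
  (forall i, approximable W Om (cut U (fun x => w x 0 i)) (fun j => cut U (fun x => Dw x i j))) ->
  H1 Om0 (Lam w) (DLam w Dw) /\ H1_0 Om0 (Lam w).
Proof.
move=> HD ap.
have [C1 C10 HE] := ext_value_integral d0 beta eta0 etapos c0 E0.
have [C2 C20 HG] := Gx_square_integral d0 beta eta0 etapos cW cO l0 c0 E0 EE rho0 rhoc HI HC HX.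
have apx i (e : R) (e0 : 0 < e) := ext_approx d0 beta eta0 etapos a0 a1 r0 cW W0 aO0 rO0 cO O0 Or l0 t0 kap0 OOm0 c0 E0 EE rho0 rhoc HI HC HX (ap i) e0.
have LE x i : Lam w x 0 i = ext eta W l c (E + c) Z (cut U (fun y => w y 0 i)) x by rewrite mxE.
have GE x i j : DLam w Dw x i j = gext eta W l c (E + c) Z (cut U (fun y => w y 0 i))
    (fun j => cut U (fun y => Dw y i j)) j x by rewrite mxE.
have mL i : measurable_fun setT (fun x => Lam w x 0 i).
  rewrite (_ : (fun _ => _) = ext eta W l c (E + c) Z (cut U (fun y => w y 0 i))); last by apply/funext.
  by have [mw _ _ [woo _] _] := ap i; exact: (measurable_ext d0 beta eta0 etapos l0 c0 E0 mZ HI mw woo).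
have mG i j : measurable_fun setT (fun x => DLam w Dw x i j).
  rewrite (_ : (fun _ => _) = gext eta W l c (E + c) Z (cut U (fun y => w y 0 i))
    (fun j => cut U (fun y => Dw y i j)) j); last by apply/funext.
  by have [mw mD _ [woo _] _] := ap i; apply: measurable_Gx.
have H1L : H1 Om0 (Lam w) (DLam w Dw).
  apply: H1_intro => //.
  - move=> i; have [mw mD _ [woo _] _] := ap i.
    under eq_integral do rewrite LE.
    by apply: le_lt_trans (HE W l Z _ l0 mZ HI mw woo) _; rewrite lte_mul_pinfty// lee_fin ltW.
  - move=> i j; have [mw mD _ [_ Doo] _] := ap i.
    under eq_integral do rewrite GE.
    apply: le_lt_trans (HG _ _ (ap i) j) _; rewrite lte_mul_pinfty// ?lee_fin ?(ltW C20)//.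
    by rewrite (integral_sum_sqr mD); apply: lte_sum_pinfty => k _; exact: Doo.
  - move=> f i j tf; apply: (@weak_derivative_limit _ _ Om0 _ _ _ _ j tf) => // e e0.
    have [psi [tp h1 h2]] := apx i e e0; exists psi; split => //.
      by under eq_integral do rewrite LE.
    by under eq_integral do rewrite GE; exact: h2.
split => //; exists (DLam w Dw) => // e e0.
(* There are [d] errors on the components and [d ^+ 2] on the partial derivatives, and their number
   is at most [2 * d.+1 ^+ 2]. *)
have dd : (0 : R) < 2 * d.+1%:R ^+ 2 by rewrite mulr_gt0// exprn_gt0// ltr0n.
pose e' := e / (2 * d.+1%:R ^+ 2).
have e'0 : 0 < e' by rewrite divr_gt0.
have /choice[psi Hpsi] i := apx i e' e'0.
pose phi x : 'rV[R]_d := \row_i psi i x.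
have phiE i : (fun x => phi x 0 i) = psi i by apply/funext => x; rewrite mxE.
have tphi i : test_fun Om0 (fun x => phi x 0 i) by rewrite phiE; have [] := Hpsi i.
have mphi i : measurable_fun setT (fun x => phi x 0 i).
  by apply: smooth_measurable; have [] := tphi i.
exists phi; split => //; first exact: test_vec_H1.
have q1 : measurable_fun setT (cst 1 : 'rV[R]_d -> R) by exact: measurable_cst.
have aux m n (F : 'rV[R]_d -> 'M[R]_(m, n)) : (forall i j, measurable_fun setT (fun x => F x i j)) ->
    (\int[mu]_(x in Om0) (sqn (F x))%:E <= \sum_i \sum_j \int[mu]_x (F x i j ^+ 2)%:E)%E.
  move=> mF; have mF' i j : measurable_fun Om0 (fun x => F x i j) by exact: measurable_funTS.
  have := integral_sqn mO0 mF' q1 (fun=> ler01); under eq_integral do rewrite mulr1.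
  move=> ->; apply: lee_sum => i _; apply: lee_sum => j _; under eq_integral do rewrite mul1r.
  rewrite (integral_cut Om0 _ (F := fun r => r ^+ 2)) ?expr0n//.
  by apply: integral_fin_subset => //; [exact: measurable_funX|move=> x; exact: sqr_ge0].
have s1 : (\int[mu]_(x in Om0) (sqn (phi x - Lam w x))%:E <= (d%:R * e')%:E)%E.
  apply: le_trans (aux _ _ (fun x => phi x - Lam w x) _) _.
    move=> i j; rewrite ord1 (_ : (fun _ => _) = (fun x => phi x 0 j) \- (fun x => Lam w x 0 j)).
      exact: measurable_funB.
    by apply/funext => x; rewrite mxE [X in _ + X]mxE.
  rewrite big_ord1; apply: mono_sum => i; have [_ h _] := Hpsi i.
  rewrite (eq_integral (fun x => ((ext eta W l c (E + c) Z (cut U (fun y => w y 0 i)) x - psi i x) ^+ 2)%:E))//.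
  by move=> x _; rewrite !mxE -sqrrN opprB.
have s2 : (\int[mu]_(x in Om0) (sqn (grad phi x - DLam w Dw x))%:E <= (d%:R * (d%:R * e'))%:E)%E.
  apply: le_trans (aux _ _ (fun x => grad phi x - DLam w Dw x) _) _.
    move=> i j; rewrite (_ : (fun _ => _) = (fun x => grad phi x i j) \- (fun x => DLam w Dw x i j)).
      apply: measurable_funB => //; apply: measurable_grad_test => k; by have [] := tphi k.
    by apply/funext => x; rewrite mxE [X in _ + X]mxE.
  apply: mono_sum => i; apply: mono_sum => j; have [_ _ h] := Hpsi i.
  rewrite (eq_integral (fun x => ((gext eta W l c (E + c) Z (cut U (fun y => w y 0 i))
    (fun j => cut U (fun y => Dw y i j)) j x - partial j (psi i) x) ^+ 2)%:E)); first exact: h.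
  by move=> x _; rewrite !mxE phiE -sqrrN opprB.
apply: le_trans (leeD s1 s2) _; rewrite -EFinD lee_fin.
have eE : e = 2 * d.+1%:R ^+ 2 * e' by rewrite /e' mulrC divfK// gt_eqF.
clearbody e'; rewrite eE.
rewrite !mulrA -mulrDl ler_wpM2r ?(ltW e'0)// -(natr1 d).
have : (0 : R) <= d%:R by [].
by move: (d%:R : R) => D D0; have := sqr_ge0 D; rewrite !expr2; lra.
Qed.

End extension_operator.

(** * Zero traces and weighted gradient integrals *)

Section traces_and_weights.
Context {R : realType} {d : nat}.
Local Notation mu := (lebesgue_rV R d).
Implicit Types (w : 'rV[R]_d -> 'rV[R]_d) (x y z : 'rV[R]_d).

(** Even the empty set has to be covered by infinitely many balls of positive radius. With geometric
    radii at most 1, the powers of exponent [d.-1 >= 1] are bounded by the radii, whose sum is at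
    most [e]. *)
Lemma surface_negligible0 : (2 <= d)%N -> surface_negligible (set0 : set 'rV[R]_d).
Proof.
move=> d2 e e0; pose m := Num.min 1 e.
have m0 : 0 < m by rewrite lt_min ltr01.
have m1 : m <= 1 by rewrite ge_min lexx.
have me : m <= e by rewrite ge_min lexx orbT.
pose r k := m / (2 ^ k.+1)%:R.
have r0 k : 0 < r k by rewrite divr_gt0// ltr0n expn_gt0.
exists (fun=> 0), r; split => //.
apply: (@le_trans _ _ (\sum_(0 <= k <oo) (r k)%:E)%E).
  apply: lee_nneseries => [k _ _|k _]; first by rewrite lee_fin exprn_ge0// ltW.
  have r1 : r k <= 1.
    rewrite ler_pdivrMr ?ltr0n ?expn_gt0// mul1r; apply: le_trans m1 _.
    by rewrite ler1n expn_gt0.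
  rewrite lee_fin; case: d d2 => [//|[//|n]] _ /=.
  move: (ltW (r0 k)) r1; move: (r k) => s s0 s1.
  by rewrite exprS ler_piMr// exprn_ile1.
apply: le_trans (epsilon_trick0 _ (ltW m0)) _.
by rewrite lee_fin.
Qed.

(** When [w] vanishes near the boundary the means are exactly 0 for small radii, and the exceptional
    set is empty. *)
Lemma has_trace0 U w : (2 <= d)%N ->
  (forall x, bnd U x -> exists2 s : R, 0 < s & forall y, `|x - y| < s -> w y = 0) ->
  has_trace U w (fun=> 0).
Proof.
move=> d2 H; exists set0; first exact: surface_negligible0.
move=> x bx _; have [s s0 w0] := H x bx.
apply: (cvg_near_cst (0 : R)); near=> r.
have rs : r < s by near: r; exact: nbhs_right_lt.
rewrite (_ : \int[mu]_(y in _) _ = 0) ?mul0r//.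
rewrite /Rintegral integral0_eq// => y [_ xy]; congr (_%:E).
rewrite w0 ?subrr.
  rewrite /enorm /sqn big1 ?sqrtr0// => i _; rewrite big1// => j _.
  by rewrite mxE expr0n.
rewrite distrC; apply: le_lt_trans (norm_le_enorm _) _; exact: lt_trans xy rs.
Unshelve. all: by end_near. Qed.

Lemma gextv_weighted (eta : 'rV[R]_d -> R) (W Om Om0 : set 'rV[R]_d) (l c K : R) Z w (Dw : 'rV[R]_d -> 'M[R]_d) (q : 'rV[R]_d -> R) (M : R) :
  measurable Om0 -> measurable (Om `&` W) -> measurable_fun setT q -> (forall x, 0 <= q x) -> 0 <= M ->
  (forall i j, measurable_fun (Om `&` W) (fun x => Dw x i j)) ->
  (forall i j, measurable_fun setT (fun x => gextv eta W Om l c K Z w Dw x i j)) ->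
  (forall i j, (\int[mu]_x (q x * gext eta W l c K Z (cut (Om `&` W) (fun y => w y 0 i))
      (fun j => cut (Om `&` W) (fun y => Dw y i j)) j x ^+ 2)%:E <=
    M%:E * \int[mu]_x (q x * \sum_j cut (Om `&` W) (fun y => Dw y i j) x ^+ 2)%:E)%E) ->
  (\int[mu]_(x in Om0) (sqn (gextv eta W Om l c K Z w Dw x) * q x)%:E <=
    (d%:R * M)%:E * \int[mu]_(x in Om `&` W) (sqn (Dw x) * q x)%:E)%E.
Proof.
move=> mO mU mq q0 M0 mD mG H.
rewrite (integral_sqn mO _ mq q0); last by move=> i j; exact: measurable_funTS.
rewrite (integral_sqn mU mD mq q0).
have mc i j : measurable_fun setT (fun x => q x * cut (Om `&` W) (fun y => Dw y i j) x ^+ 2).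
  by apply: measurable_funM => //; apply: measurable_funX; exact: measurable_cut.
have c0 i j x : 0 <= q x * cut (Om `&` W) (fun y => Dw y i j) x ^+ 2 by rewrite mulr_ge0 ?sqr_ge0.
have I0 i j : (0 <= \int[mu]_x (q x * cut (Om `&` W) (fun y => Dw y i j) x ^+ 2)%:E)%E.
  exact: integral_fin_ge0.
have HI i : (\int[mu]_x (q x * \sum_j cut (Om `&` W) (fun y => Dw y i j) x ^+ 2)%:E =
    \sum_j \int[mu]_x (q x * cut (Om `&` W) (fun y => Dw y i j) x ^+ 2)%:E)%E.
  under eq_integral do rewrite mulr_sumr -sumEFin.
  rewrite ge0_integral_sum// => j; last by move=> x _; rewrite lee_fin.
  exact/measurable_EFinP.
rewrite ge0_sume_distrr; last by move=> i _; exact: sume_ge0.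
apply: lee_sum => i _; rewrite -HI.
apply: (@le_trans _ _ (\sum_(j < d) (M%:E * \int[mu]_x (q x * \sum_j cut (Om `&` W) (fun y => Dw y i j) x ^+ 2)%:E))%E).
  apply: lee_sum => j _; apply: le_trans (H i j).
  apply: le_integral_fin => //.
  - by apply: measurable_funM => //; apply: measurable_funX; apply: measurable_cut => //; exact: measurable_funTS.
  - rewrite (_ : gext _ _ _ _ _ _ _ _ j = fun x => gextv eta W Om l c K Z w Dw x i j).
      by apply: measurable_funM => //; exact: measurable_funX.
    by apply/funext => x; rewrite mxE.
  - by move=> x _; rewrite mulr_ge0 ?sqr_ge0.
  - move=> x _; rewrite ler_wpM2l//; have [Ox|Ox] := pselect (Om0 x); first by rewrite cut_in// mxE.
    by rewrite cut_out// expr0n sqr_ge0.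
rewrite HI; set S := (\sum_j _)%E; have S0 : (0 <= S)%E by exact: sume_ge0.
rewrite sumr_const card_ord EFinM -muleA.
have M0' : (0 <= M%:E * S)%E by rewrite mule_ge0.
elim: (d : nat) => [|n IH]; first by rewrite mulr0n mul0e.
by rewrite mulrS -natr1 EFinD ge0_muleDl ?lee_fin// mul1e [leRHS]addeC leeD.
Qed.

Lemma weighted_grad_unique U w (F G : 'rV[R]_d -> 'M[R]_d) (q : 'rV[R]_d -> R) : (0 < d)%N ->
  open U -> bounded_set U -> H1 U w F -> H1 U w G -> measurable_fun setT q ->
  (\int[mu]_(x in U) (sqn (F x) * q x)%:E = \int[mu]_(x in U) (sqn (G x) * q x)%:E)%E.
Proof.
move=> d0 oU bU HF HG mq; have [_ [mF _] _] := HF; have [_ [mG _] _] := HG.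
have mm (H : 'rV[R]_d -> 'M[R]_d) : (forall i j, measurable_fun U (fun x => H x i j)) ->
    measurable_fun U (fun x => (sqn (H x) * q x)%:E).
  by move=> mH; apply/measurable_EFinP; apply: measurable_funM; [exact: measurable_sqn|exact: measurable_funTS].
apply: ae_eq_integral; [exact: open_measurable_rV|exact: mm|exact: mm|].
have Hij i j := weak_grad_unique i j d0 oU bU HF HG.
have Hi i := @filter_forall _ _ _ _ (ae_filter_ringOfSetsType mu) (Hij i).
have := @filter_forall _ _ _ _ (ae_filter_ringOfSetsType mu) Hi.
apply: filterS => x Hx Ux; congr (sqn _ * _)%:E.
by apply/matrixP => i j; exact: Hx.
Qed.

End traces_and_weights.

Lemma bounded_lipschitz_cone (R : realType) (d : nat) (U : set 'rV[R]_d) (L a : R) :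
  (forall r : R, 0 < r -> exists2 r', 0 < r' & forall (U : set 'rV[R]_d) b, lipschitz_graph_at r L U b -> cone_at a r' U b) ->
  bounded_lipschitz_domain L U ->
  [/\ bounded_set U, open U, U !=set0 & exists2 r, 0 < r & cone_domain a r U].
Proof.
move=> H [bU [r r0 [oU _ U0 gU]]]; split => //; have [r' r'0 H'] := H r r0.
by exists r' => //; split => // b /gU /H'.
Qed.

Theorem theorem1p3 (R : realType) (d : nat) (g rw Lw L c1 c2 : R)
    (hd : (2 <= d)%N) (hg : 0 < g) (hrw : 0 < rw) (hc1 : 0 < c1)
    (hc2 : 0 < c2) :
  exists2 C : R, 0 < C &
  forall omega Omega : set 'rV[R]_d,
    perforated_structure rw Lw g omega ->
    bounded_lipschitz_domain L Omega ->
  exists2 eps0 : R, 0 < eps0 < 1 &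
  forall (eps : R) (Omega0 : set 'rV[R]_d), 0 < eps <= eps0 ->
    (exists L0 : R, bounded_lipschitz_domain L0 Omega0) ->
    closure Omega `<=` Omega0 ->
    (forall x, bnd Omega0 x ->
       c1 * (10 * eps) <= pt_dist x Omega <= c2 * (10 * eps)) ->
  let Omega_eps := Omega `&` scale_set eps omega in
  let Gamma_eps := bnd Omega_eps `&` bnd Omega in
  let delta x := pt_dist x (bnd Omega0) in
  let H1_Gamma := H1_vanishing Omega_eps Gamma_eps in
  exists Lam : ('rV[R]_d -> 'rV[R]_d) -> ('rV[R]_d -> 'rV[R]_d),
  [/\ linear_operator Omega_eps H1_Gamma Omega0 (H1_0 Omega0) Lam,
      forall w, H1_Gamma w ->
        ae_eq_on Omega_eps (Lam w) w /\ has_trace Omega0 (Lam w) (fun=> 0)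
    & forall (beta : R) w Dw DLw, -1 < beta < 1 -> H1_Gamma w ->
        H1 Omega_eps w Dw -> H1 Omega0 (Lam w) DLw ->
        (\int[lebesgue_rV R d]_(x in Omega0)
            (sqn (DLw x) * delta x `^ beta)%:E
         <= C%:E * \int[lebesgue_rV R d]_(x in Omega_eps)
            (sqn (Dw x) * delta x `^ beta)%:E)%E].
Proof.
have d0 : (0 < d)%N by apply: ltn_trans hd.
have dp : (0 : R) < d%:R by rewrite ltr0n.
have d1 : (1 : R) <= d%:R by rewrite ler1n.
have [a [a0 a1 coneW]] := lipschitz_cone Lw d0.
have [aO [aO0 aO1 coneO]] := lipschitz_cone L d0.
(* For omega the radius of the cones is known in advance; for Omega only the aperture [aO] is, and
   its radius will enter only the choice of [eps0]. *)
have [rW rW0 HW] := coneW rw hrw.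
have c1d : 0 < c1 / d%:R by rewrite divr_gt0.
(* The first bound is that of the geometric lemmas; the second makes the cap [l = lam * eps] at most
   the cut-off distance [t = c1 / d * eps]. *)
pose lam := Num.min (Num.min 1 (rW / 2)) (c1 / d%:R).
have lam0 : 0 < lam by rewrite !lt_min ltr01 divr_gt0.
have lam1 : lam <= Num.min 1 (rW / 2) by rewrite /lam ge_min lexx.
have lam2 : lam <= c1 / d%:R by rewrite /lam ge_min lexx orbT.
have [c [E [E' [rho [N [[c0 E0 EE rho0 rhoc] geom]]]]]] := @perforation_geometry R d _ _ _ _ _ a0 a1 rW0 lam0 lam1 c1d aO0.
clearbody lam.
have [eta [seta eta0 eta1 etapos _]] := @bump_exists R d.
have beta : bump eta by split => // x x1; apply: eta1; exact: ltW.
have [C [K3 [C0 K30 HGx]]] := Gx_weighted d0 beta eta0 etapos N c0 E0 EE rho0 rhoc.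
(* Chosen so that [e * h = K3 * l], the largest displacement between the points whose weights are
   compared; [eps] cancels. *)
pose e := K3 * lam / (10 * c1).
have e0 : 0 <= e by rewrite ltW// divr_gt0 ?mulr_gt0.
pose k := d%:R * (1 + 2 * d%:R * e).
have de0 : 0 <= 2 * d%:R * e by apply: mulr_ge0 => //; apply: mulr_ge0.
have k1 : 1 <= k by rewrite /k; apply: le_trans d1 _; rewrite ler_pMr// lerDl.
have k0 : 0 <= k by apply: le_trans k1.
have Ck : 0 < C * k + 1 by rewrite ltr_wpDl// mulr_ge0// ltW.
exists (d%:R * (C * k + 1)); first exact: mulr_gt0.
move=> omega Omega [[oom com om0 gom] _ pom _ _] hOm.
have [bO oO O0 [rO rO0 cO]] := bounded_lipschitz_cone coneO hOm.
have cW : cone_domain a rW omega by split => // b /gom /HW.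
have [r1 r10 Or1] := bounded_sub_ball bO.
have Or x : Omega x -> `|x| <= r1.
  by move=> /Or1; rewrite -ball_normE /= sub0r normrN => /ltW.
pose A := 3 / aO + 3; have A0 : 0 < A by rewrite addr_gt0// divr_gt0.
(* The exterior cones of Omega must contain the detour of size [A * eps] made by the outer
   corkscrews. *)
pose eps0 := Num.min 2^-1 (rO / (2 * A)).
exists eps0.
  by rewrite lt_min invr_gt0 ltr0n divr_gt0 ?mulr_gt0//= gt_min invf_lt1 ?ltr1n.
move=> eps Omega0 /andP[ep0 ep1] [L0 [bO0 [rL0 rL00 [oO0 _ _ _]]]] clO far.
move=> Omega_eps Gamma_eps delta H1_Gamma.
have epA : A * eps < rO.
  apply: (@le_lt_trans _ _ (A * (rO / (2 * A)))).
    by rewrite ler_pM2l//; apply: le_trans ep1 _; rewrite /eps0 ge_min lexx orbT.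
  have -> : A * (rO / (2 * A)) = rO / 2 by field; rewrite gt_eqF.
  by rewrite gtr_pMr// invf_lt1// ltr1n.
have [HI HC HX] := geom omega Omega rO eps cW com om0 pom ep0 cO O0 epA.
set W := scale_set eps omega in HI HC HX *.
set l := lam * eps in HI HC HX *; set t := c1 / d%:R * eps in HX *.
pose h := c1 * (10 * eps).
have h0 : 0 < h by rewrite /h !mulr_gt0.
have l0 : 0 < l by rewrite mulr_gt0.
have t0 : 0 < t by rewrite mulr_gt0.
have lt : l <= t by rewrite ler_pM2r.
(* In the sup norm the outer boundary is at least [10 * t] away from Omega, whereas the extension
   reaches only [l + t <= 2 * t]. *)
have hd10 : h / d%:R = 10 * t by rewrite /h /t; field; rewrite gt_eqF.
have hd5 : h / (2 * d%:R) = 5 * t by rewrite /h /t; field; rewrite gt_eqF.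
have eh : e * h = K3 * l by rewrite /e /h /l; field; rewrite gt_eqF.
have cWe := cone_domain_scale ep0 cW.
have W0 : W !=set0.
  by have [x ox] := om0; exists (eps *: x); rewrite /W /scale_set /= scalerA mulVf ?scale1r// gt_eqF.
have oW : open W by exact: open_scale.
have OO : Omega `<=` Omega0 by move=> x /subset_closure /clO.
have far' x : bnd Omega0 x -> h <= pt_dist x Omega by move=> /far /andP[].
have OOm0 x y : Omega y -> `|x - y| < l + t + t -> Omega0 x.
  move=> Oy xy; apply: (near_inner_in d0 oO0 OO far' Oy); rewrite hd10; move: xy lt t0; clear; lra.
have mU : measurable Omega_eps by apply: open_measurable_rV; exact: openI.
have mO0 : measurable Omega0 by exact: open_measurable_rV.
have bU : bounded_set Omega_eps by have [M [rM HM]] := bO; exists M; split => // M' /HM H x [/H].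
have X0 w : H1_Gamma w -> H1_vanishing Omega_eps (bnd Omega_eps `&` bnd Omega) w by [].
have rWe0 : 0 < eps * rW by exact: mulr_gt0.
have H10 := extv_H1_0 d0 beta eta0 etapos a0 a1 rWe0 cWe W0 aO0 rO0 cO O0 Or l0 t0 t0 oO0 OOm0 c0 E0 EE rho0 rhoc HI HC HX.
have approx := vanishing_approximable oW oO.
have off w x := @extv_off _ _ eta d0 beta eta0 etapos W Omega a _ aO rO l t c E cWe cO O0 l0 t0 w x.
exists (extv eta W Omega l c (E + c) [set z | sdist Omega z < t]); split.
- split.
  + by move=> w /approx[Dw HD ap]; have [] := H10 w Dw HD ap.
  + by move=> w w' Xw Xw'; exact: (extv_ae eta Omega0 l t c E cWe cO Xw Xw').
  + move=> s w w' Xw Xw'; apply: aeW => x _.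
    exact: (extv_lin d0 beta t cWe cO l0 c0 E0 HI s x Xw Xw').
- move=> w Xw; split; first by apply: aeW => x Ux; exact: extv_in.
  (* A point within [5 * t] of the outer boundary is still at least [5 * t] away from Omega, where
     the extension vanishes. *)
  apply: has_trace0 => // b bb; exists (5 * t); first by rewrite mulr_gt0.
  move=> y yb; apply: off => // z Oz.
  have := bnd_outer_far d0 far' bb Oz; rewrite hd10.
  have := ler_distD y b z; move: yb lt t0; clear; lra.
move=> be w Dw DLw hbe Xw HDw HDLw.
have [D HD ap] := approx w Xw.
have [HL _] := H10 w D HD ap.
have [_ [mD _] _] := HD.
have bn := bnd_outer d0 oO0 bO0 OO O0.
have mdelta : measurable_fun setT delta by exact: measurable_pt_dist.
have mq : measurable_fun setT (fun x => delta x `^ be).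
  exact: (measurableT_comp (measurable_powR be) mdelta).
have q0 x : 0 <= delta x `^ be by exact: powR_ge0.
(* The given gradients are replaced by [gextv] and by the one along which [w] is approximated. *)
rewrite (weighted_grad_unique d0 oO0 bO0 HDLw HL mq) (weighted_grad_unique d0 (openI oO oW) bU HDw HD mq).
apply: gextv_weighted => //; first exact: ltW.
- move=> i j; rewrite (_ : (fun _ => _) = gext eta W l c (E + c) [set z | sdist Omega z < t] (cut Omega_eps (fun y => w y 0 i))
    (fun j => cut Omega_eps (fun y => D y i j)) j); last by apply/funext => x; rewrite mxE.
  by have [mw mD' _ [woo _] _] := ap i; apply: measurable_Gx.
(* Off this set [delta x < 5 * t], so that [x] is beyond the reach of the extension; on it [delta]
   is of order at least [eps]. *)
- move=> i j; apply: (HGx W Omega [set x | h / (2 * d%:R) <= delta x]) => //.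
  + by move=> j' x Ox; apply: cut_out => -[].
  + rewrite (_ : [set x | _] = delta @^-1` `[h / (2 * d%:R), +oo[).
      by rewrite -[X in measurable X]setTI; exact: mdelta.
    by apply/seteqP; split=> x /=; rewrite in_itv/= andbT.
  + move=> x y /negP; rewrite -ltNge => dx Oy.
    apply: le_trans (delta_small d0 oO0 bO0 OO O0 far' Oy dx); rewrite hd5; move: lt t0; clear; lra.
  + move=> x y Px Oy yx; have yx' : `|y - x| <= e * h by rewrite eh ltW.
    have [dx dy h1 h2] := delta_comparable d0 h0 oO0 bO0 OO O0 far' Oy yx' Px e0 (erefl k).
    exact: powR_comparable.
Qed.
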